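(* Let $f\in\mathcal{C}^{\infty,0}_{\mathbf{pol}}(\mathbb{R},\mathbb{R}_+)$ and suppose that $f$ is uniformly continuous on $\mathbb{R}\times[0,M]$ for every $M>0$. Let $u(t,x,y)=\mathbb{E}[f(X^{t,x,y}_T,Y^{t,y}_T)]$, $(t,x,y)\in[0,T]\times\mathbb{R}\times\mathbb{R}_+$, and, for $y\in\mathbb{R}_+$, let $u^h_0(\cdot,y)$ be the discrete solution produced by the backward hybrid procedure starting from $f$ (with time step $h=T/N$ and space step $\Delta x$). Then $$u^h_0(\cdot,y)\longrightarrow u(0,\cdot,y)\quad\text{in }\ell^\infty\text{ as }(h,\Delta x)\to0,$$ that is, $|u(0,\cdot,y)-u^h_0(\cdot,y)|_{\ell^\infty(\mathcal{X})}\to0$ as $(h,\Delta x)\to 0$.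
   Context: Notation: $\mathbb{R}_+=[0,\infty)$. Parameters: $T>0$, $r\in\mathbb{R}$, $\delta\ge0$, $a,b,\sigma>0$, $\rho\in(-1,1)$, $\bar\rho=\sqrt{1-\rho^2}$. Put $\mu_X(y)=r-\delta-\frac{\rho}{\sigma}a+\big(\frac{\rho}{\sigma}b-\frac12\big)y$ and $\mu_Y(y)=a-by$. The process $(X^{t,x,y},Y^{t,y})$ is the solution started at $(x,y)$ at time $t$ of $$dX_s=\mu_X(Y_s)ds+\bar\rho\sqrt{Y_s}\,dB_s,\qquad dY_s=\mu_Y(Y_s)ds+\sigma\sqrt{Y_s}\,dW_s,$$ with $(W,B)$ a standard two-dimensional Brownian motion. $\mathcal{C}^{\infty,0}_{\mathbf{pol}}(\mathbb{R},\mathbb{R}_+)$ is the set of continuous $g:\mathbb{R}\times\mathbb{R}_+\to\mathbb{R}$ for which there are $C,L,c>0$ with $|g(x,y)|\le C(1+|x|^L+y^L)$ and $\sup_{x\in\mathbb{R}}|g(x,y)|\le C(1+y^c)$ for all $(x,y)$. Hybrid procedure. Let $N\in\mathbb{N}^*$, $h=T/N$, $\Delta x>0$, $X_0\in\mathbb{R}$ fixed, $\mathcal{X}=\{X_0+i\Delta x: i\in\mathbb{Z}\}$, and let $\ell^\infty(\mathcal{X})$ be the bounded functions on $\mathcal{X}$ with norm $|g|_{\ell^\infty}=\sup_{x\in\mathcal{X}}|g(x)|$. (Finite differences in $x$.) For $y\in\mathbb{R}_+$ let $\alpha(y)=\frac{h}{\Delta x}\mu_X(y)$, $\beta(y)=\frac{h}{2\Delta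 x^2}\bar\rho^2y$, and let $A^h_{\Delta x}(y)$ be the tridiagonal linear operator on $\ell^\infty(\mathcal{X})$ (functions indexed by $i\in\mathbb{Z}$) with entries $$A_{ij}=\begin{cases}-\beta(y)-|\alpha(y)|\mathbf{1}_{\alpha(y)<0}&i=j+1,\\1+2\beta(y)+|\alpha(y)|&i=j,\\-\beta(y)-|\alpha(y)|\mathbf{1}_{\alpha(y)>0}&i=j-1,\\0&|i-j|>1.\end{cases}$$ Set $\Pi^h_{\Delta x}(y)=(A^h_{\Delta x}(y))^{-1}$. (Tree for $Y$.) Given the initial value $y\in\mathbb{R}_+$, for $n=0,\dots,N$ let $\mathcal{Y}^h_n=\{y^n_k\}_{k=0,\dots,n}$ with $$y^n_k=\Big(\sqrt y+\tfrac\sigma2(2k-n)\sqrt h\Big)^2\mathbf{1}_{\{\sqrt y+\frac\sigma2(2k-n)\sqrt h>0\}}.$$ For $0\le n\le N-1$ and $0\le k\le n$ let $$k_u(n,k)=\min\{k^*:k+1\le k^*\le n+1,\ y^n_k+\mu_Y(y^n_k)h\le y^{n+1}_{k^*}\},$$ $$k_d(n,k)=\max\{k^*:0\le k^*\le k,\ y^n_k+\mu_Y(y^n_k)h\ge y^{n+1}_{k^*}\},$$ with $k_u(n,k)=n+1$ (resp. $k_d(n,k)=0$) if the corresponding set is empty. The Markov chain $(\hat Y^h_n)_{n=0,\dots,N}$ starts at $\hat Y^h_0=y$ and from node $(n,k)$ jumps to $y^{n+1}_{k_u(n,k)}$ with probability $$p_u(n,k)=0\vee\frac{\mu_Y(y^n_k)h+y^n_k-y^{n+1}_{k_d(n,k)}}{y^{n+1}_{k_u(n,k)}-y^{n+1}_{k_d(n,k)}}\wedge1$$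 and to $y^{n+1}_{k_d(n,k)}$ with probability $p_d(n,k)=1-p_u(n,k)$. (Backward recursion.) $u^h_N(x,\eta)=f(x,\eta)$ for $(x,\eta)\in\mathcal{X}\times\mathcal{Y}^h_N$ and, for $n=N-1,\dots,0$, $$u^h_n(x,\eta)=\mathbb{E}\big[\Pi^h_{\Delta x}(\eta)u^h_{n+1}(\cdot,\hat Y^h_{n+1})(x)\,\big|\,\hat Y^h_n=\eta\big],\qquad(x,\eta)\in\mathcal{X}\times\mathcal{Y}^h_n,$$ i.e. for $\eta=y^n_k$ the right-hand side is $p_u(n,k)\,\Pi^h_{\Delta x}(\eta)u^h_{n+1}(\cdot,y^{n+1}_{k_u(n,k)})(x)+p_d(n,k)\,\Pi^h_{\Delta x}(\eta)u^h_{n+1}(\cdot,y^{n+1}_{k_d(n,k)})(x)$. Since $\mathcal{Y}^h_0=\{y\}$, this produces $u^h_0(\cdot,y)$ on $\mathcal{X}$. *)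

(* Defs.v *)
From HB Require Import structures.
From mathcomp Require Import all_boot all_order all_algebra.
From mathcomp Require Import all_classical all_reals all_analysis.

Set Implicit Arguments.
Unset Strict Implicit.
Unset Printing Implicit Defensive.

Import Order.TTheory GRing.Theory Num.Theory.
Import numFieldNormedType.Exports.

Local Open Scope classical_set_scope.
Local Open Scope ring_scope.

Record heston (R : realType) := Heston {
  rate : R;
  dividend : R;
  drift0 : R;     (* a *)
  reversion : R;  (* b *)
  volvol : R;     (* sigma *)
  corr : R        (* rho *)
}.

Definition heston_admissible (R : realType) (m : heston R) : Prop :=
  [/\ 0 <= dividend m, 0 < drift0 m, 0 < reversion m, 0 < volvol m
    & -1 < corr m < 1].

Section Model.
Context {R : realType} (m : heston R).

Definition rho_bar : R := Num.sqrt (1 - corr m ^+ 2).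

Definition mu_X (y : R) : R :=
  rate m - dividend m - corr m / volvol m * drift0 m
  + (corr m / volvol m * reversion m - 2^-1) * y.

Definition mu_Y (y : R) : R := drift0 m - reversion m * y.

End Model.

(* Functions on R x R_+ are represented by total functions on R * R; only
   their values on the half-plane [0 <= p.2] are ever used. *)
Section PayoffClass.
Context {R : realType}.
Implicit Type g : R * R -> R.

Definition C_inf0_pol g : Prop :=
  {within [set p : R * R | 0 <= p.2], continuous g} /\
  exists C L c : R, [/\ 0 < C, 0 < L, 0 < c,
    forall x y : R, 0 <= y ->
      `|g (x, y)| <= C * (1 + `|x| `^ L + y `^ L)
    & forall y : R, 0 <= y ->
      (ereal_sup [set `|g (x, y)|%:E | x in [set: R]]
        <= (C * (1 + y `^ c))%:E)%E].

Definition unif_continuous_on g (A : set (R * R)) : Prop :=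
  forall e : R, 0 < e -> exists2 d : R, 0 < d &
    forall p q : R * R, A p -> A q ->
      `|p.1 - q.1| < d -> `|p.2 - q.2| < d -> `|g p - g q| < e.

End PayoffClass.

Section StochasticCalculus.
Context {R : realType} {d : measure_display} {Omega : measurableType d}
        (P : probability Omega R).

Definition is_filtration (F : R -> set (set Omega)) : Prop :=
  [/\ forall s, 0 <= s -> sigma_algebra [set: Omega] (F s),
      forall s, 0 <= s -> F s `<=` measurable
    & forall s t, 0 <= s -> s <= t -> F s `<=` F t].

Definition measurable_wrt (G : set (set Omega)) (Z : Omega -> R) : Prop :=
  forall B : set R, measurable B -> G (Z @^-1` B).

Definition cvg_in_probability (Z : nat -> Omega -> R) (Zlim : Omega -> R) :
    Prop :=
  forall e : R, 0 < e ->
    P [set w | e < `|Z n w - Zlim w|] @[n --> \oo] --> 0%E.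

(* (W, B) is a standard two-dimensional Brownian motion relative to F: given
   F_s, the increment over ]s, t] has law N(0, (t - s) I_2). The second
   parameter of [normal_prob] is the standard deviation. *)
Definition brownian2 (F : R -> set (set Omega)) (W B : R -> Omega -> R) :
    Prop :=
  [/\ forall s, 0 <= s -> measurable_wrt (F s) (W s) /\
                          measurable_wrt (F s) (B s),
      forall w, {within `[0, +oo[, continuous (W ^~ w)} /\
                {within `[0, +oo[, continuous (B ^~ w)},
      {ae P, forall w, W 0 w = 0 /\ B 0 w = 0}
    & forall (s t : R) (A : set Omega) (U V : set R),
        0 <= s -> s < t -> F s A -> measurable U -> measurable V ->
        P (A `&` (fun w => W t w - W s w) @^-1` U
             `&` (fun w => B t w - B s w) @^-1` V)
        = (P A * normal_prob 0 (Num.sqrt (t - s)) U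
               * normal_prob 0 (Num.sqrt (t - s)) V)%E].

(* The step process equal to [sp_val i] on ]sp_time i, sp_time i.+1] for
   i < sp_size, and to 0 elsewhere. *)
Record step_process := StepProcess {
  sp_size : nat;
  sp_time : nat -> R;
  sp_val : nat -> Omega -> R
}.

Definition is_simple (F : R -> set (set Omega)) (t T : R) (H : step_process) :
    Prop :=
  [/\ sp_time H 0%N = t, sp_time H (sp_size H) = T,
      forall i, (i < sp_size H)%N -> sp_time H i <= sp_time H i.+1,
      forall i, (i < sp_size H)%N ->
        measurable_wrt (F (sp_time H i)) (sp_val H i)
    & forall i, (i < sp_size H)%N ->
        exists K : R, forall w, `|sp_val H i w| <= K].

Definition step_eval (H : step_process) (s : R) (w : Omega) : R :=
  \sum_(i < sp_size H) sp_val H i w * \1_`]sp_time H i, sp_time H i.+1] s.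

Definition step_integral (W : R -> Omega -> R) (H : step_process)
    (s : R) (w : Omega) : R :=
  \sum_(i < sp_size H) sp_val H i w *
    (W (Num.min (sp_time H i.+1) s) w - W (Num.min (sp_time H i) s) w).

(* I_s is (a version of) the Ito integral of H against W over [t, s], for
   s in [t, T]: the limit in probability of the integrals of simple processes
   approximating H in L^2([t, T]) in probability. *)
Definition ito_integral (F : R -> set (set Omega)) (W : R -> Omega -> R)
    (t T : R) (H I : R -> Omega -> R) : Prop :=
  exists Hn : nat -> step_process,
  [/\ forall n, is_simple F t T (Hn n),
      cvg_in_probability
        (fun n w => \int[lebesgue_measure]_(s in `[t, T])
                      (step_eval (Hn n) s w - H s w) ^+ 2)
        (fun=> 0)
    & forall s, t <= s <= T ->
        measurable_fun [set: Omega] (I s) /\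
        cvg_in_probability (fun n => step_integral W (Hn n) s) (I s)].

Definition adapted_continuous (F : R -> set (set Omega)) (t T : R)
    (Z : R -> Omega -> R) : Prop :=
  (forall s, t <= s <= T -> measurable_wrt (F s) (Z s)) /\
  (forall w, {within `[t, T], continuous (Z ^~ w)}).

(* (X, Y) solves the SDE on [t, T], started at (x, y) at time t. *)
Definition heston_solution (m : heston R) (F : R -> set (set Omega))
    (W B : R -> Omega -> R) (T t x y : R) (X Y : R -> Omega -> R) : Prop :=
  [/\ adapted_continuous F t T X, adapted_continuous F t T Y,
      forall s w, t <= s <= T -> 0 <= Y s w
    & exists IB IW : R -> Omega -> R,
      [/\ ito_integral F B t T
            (fun s w => rho_bar m * Num.sqrt (Y s w)) IB,
          ito_integral F W t T
            (fun s w => volvol m * Num.sqrt (Y s w)) IW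
        & forall s, t <= s <= T ->
            {ae P, forall w,
              X s w = x + (\int[lebesgue_measure]_(v in `[t, s]) mu_X m (Y v w))
                      + IB s w /\
              Y s w = y + (\int[lebesgue_measure]_(v in `[t, s]) mu_Y m (Y v w))
                      + IW s w}]].

End StochasticCalculus.

Section HybridProcedure.
Context {R : realType} (m : heston R).
(* h : time step; dx : space step. A function on the grid X_0 + dx Z is
   represented by the function i |-> g (X_0 + i dx) of type int -> R. *)
Variables (h dx : R).

Definition linf : set (int -> R) :=
  [set g | exists K : R, forall i, `|g i| <= K].

Definition fd_alpha (y : R) : R := h / dx * mu_X m y.

Definition fd_beta (y : R) : R := h / (2 * dx ^+ 2) * rho_bar m ^+ 2 * y.

Definition fd_entry (y : R) (i j : int) : R :=
  if i == j + 1 then - fd_beta y - `|fd_alpha y| * (fd_alpha y < 0)%R%:R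
  else if i == j then 1 + 2 * fd_beta y + `|fd_alpha y|
  else if i == j - 1 then - fd_beta y - `|fd_alpha y| * (0 < fd_alpha y)%R%:R
  else 0.

(* Row i of the matrix is supported by {i - 1, i, i + 1}. *)
Definition fd_op (y : R) (g : int -> R) : int -> R :=
  fun i => \sum_(j <- [:: i - 1; i; i + 1]) fd_entry y i j * g j.

(* The inverse of [fd_op y] as an operator on l^infty. *)
Definition fd_inv (y : R) : (int -> R) -> (int -> R) :=
  'pinv_(fun=> 0) linf (fd_op y).

(* Y_0 : initial value of the tree. *)
Variable Y_0 : R.

Definition node (n k : nat) : R :=
  let z := Num.sqrt Y_0 + volvol m / 2 * (2 * k%:R - n%:R) * Num.sqrt h in
  z ^+ 2 * (0 < z)%R%:R.

Definition node_drifted (n k : nat) : R := node n k + mu_Y m (node n k) * h.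

(* The defaults n.+1 and 0 of the iterated minimum and maximum are bounds of
   their ranges, hence are only attained when they should be. *)
Definition k_up (n k : nat) : nat :=
  \big[minn/n.+1]_(k.+1 <= j < n.+2 | (node_drifted n k <= node n.+1 j)%R) j.

Definition k_down (n k : nat) : nat :=
  (\max_(0 <= j < k.+1 | (node n.+1 j <= node_drifted n k)%R) j)%N.

Definition p_up (n k : nat) : R :=
  Num.max 0 (Num.min
    ((mu_Y m (node n k) * h + node n k - node n.+1 (k_down n k))
     / (node n.+1 (k_up n k) - node n.+1 (k_down n k))) 1).

Definition p_down (n k : nat) : R := 1 - p_up n k.

Variables (X_0 : R) (f : R * R -> R).

(* [hybrid l n k] is the discrete solution at time level n and node (n, k),
   when l steps remain before maturity, i.e. l + n = N. Distinct indices k may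
   share the node value 0; they then lead to the same successor values. *)
Fixpoint hybrid (l n k : nat) : int -> R :=
  if l is l'.+1 then fun i =>
    p_up n k * fd_inv (node n k) (hybrid l' n.+1 (k_up n k)) i
    + p_down n k * fd_inv (node n k) (hybrid l' n.+1 (k_down n k)) i
  else fun i => f (X_0 + i%:~R * dx, node n k).

End HybridProcedure.

(* u^h_0 (X_0 + i dx, y) for h = T / N *)
Definition hybrid0 {R : realType} (m : heston R) (T X_0 : R)
    (f : R * R -> R) (N : nat) (dx y : R) : int -> R :=
  hybrid m (T / N%:R) dx y X_0 f N 0 0.

(* Main.v *)
(** Uniformly in the starting point [x0], and up to an error
[eps + C * bump ((x - x0) / A) + eps * expR (lam * y)], the payoff is a finite
combination of waves [expR (- v y) cos (u x + th)] with [v > 0], whose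
coefficients may depend on [x0]. For a wave, both the expectation and the hybrid
scheme are compared with the exponential-affine function given by an explicit
Euler scheme for the Riccati system on the time grid.

For the expectation, the increments of the stochastic integrals are replaced by
those of step processes, along which the complex exponential martingale is
computed by conditioning, one Gaussian increment at a time; neither the Ito
formula nor the regularity of [u] is needed. For the hybrid scheme, the
operators [fd_op] satisfy a maximum principle, so that the exponential-affine
function plus its accumulated consistency error is a supersolution. The two
remaining error terms are dominated by a Lyapunov supersolution in [y] and by a
tail supersolution in [x], and, for the expectation, by an exponential moment of
[Y] and by writing a Gaussian in [X - x0] as a mixture of waves. *)

(* Three constraints shape the class of waves. With v > 0 the real part p of the Riccati solution
   stays in an interval [c, C] with c > 0: for p >= 0 the cubic term in the growth of p^2 + q^2 has
   the good sign, so nothing explodes, and expR (- c y) absorbs the powers of y in the consistency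
   error. A translation of x is a phase shift of a wave, so estimates uniform in the phase are
   uniform in the starting point; the laws of X started at different points are compared in this
   way, without a pathwise relation between them. Finally, f need not decay in x and has in general
   no global approximation by waves, whence the localisation at x0.

   The coefficient sqrt Y is neither bounded nor Lipschitz, and stochastic integrals are known only
   as limits in probability. So the comparison with the martingale is made path by path outside
   events of small probability, with cells switched off once Y exceeds a level at a mesh time.
   Truncating the integrands by their quadratic variation bounds the second moment of the martingale
   independently of the mesh, which controls those events. *)
Require Import Defs.
From HB Require Import structures.
From mathcomp Require Import all_boot all_order all_algebra.
From mathcomp Require Import all_classical all_reals all_analysis.
From mathcomp Require Import measurable_realfun ring lra zify.
Set Implicit Arguments.
Unset Strict Implicit.
Unset Printing Implicit Defensive.
Import Order.TTheory GRing.Theory Num.Theory.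
Import numFieldNormedType.Exports.
Local Open Scope classical_set_scope.
Local Open Scope ring_scope.

(* Bounds the cost of [lra] and [nra] in large contexts. *)
Ltac keep_goal := repeat match goal with
  H : ?A |- _ => lazymatch type of A with Prop => clear H end end.
Ltac goal_lra := keep_goal; lra.
Ltac goal_nra := keep_goal; nra.

(** * Taylor bounds *)

Section ElementaryTaylor.
Context {R : realType}.
Implicit Types (a b c t x : R) (f g : R -> R).

(** Each use of the mean value theorem gains one power of [t]. Starting from a bound on the highest
    derivative and going down gives the Taylor remainders below, with the factorials given up. *)
Lemma mvt_power_bound f g (M : R) (n : nat) :
  (forall t, is_derive t (1 : R) f (g t)) -> f 0 = 0 ->
  (forall t, 0 <= t <= 1 -> `|g t| <= M * t ^+ n) ->
  forall t, 0 <= t <= 1 -> `|f t| <= M * t ^+ n.+1.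
Proof.
move=> df f0 gM t /andP[t0 t1].
have cf : {within `[0, t], continuous f}.
  apply: continuous_subspaceT => x.
  by apply: differentiable_continuous; apply/derivable1_diffP; case: (df x).
have [c] := MVT_segment t0 (fun x _ => df x) cf.
rewrite in_itv/= f0 !subr0 => /andP[c0 ct] ->.
have c1 : 0 <= c <= 1 by rewrite c0 (le_trans ct).
have M0 : 0 <= M by have := gM 1; rewrite expr1n mulr1 ler01 lexx => /(_ isT); exact: le_trans.
rewrite normrM (ger0_norm t0) exprSr mulrA ler_wpM2r//.
by rewrite (le_trans (gM _ c1))// ler_wpM2l// lerXn2r.
Qed.

Let ec a b c t := expR (t * a) * cos (c + t * b).
Let es a b c t := expR (t * a) * sin (c + t * b).

Let dec a b c t : is_derive t (1 : R) (ec a b c) (a * ec a b c t - b * es a b c t).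
Proof. by apply: is_derive_eq; rewrite /ec /es /GRing.scale/=; ring. Qed.

Let des a b c t : is_derive t (1 : R) (es a b c) (a * es a b c t + b * ec a b c t).
Proof. by apply: is_derive_eq; rewrite /ec /es /GRing.scale/=; ring. Qed.

Let ec_bound a b c t : 0 <= t <= 1 -> `|ec a b c t| <= expR `|a|.
Proof.
move=> /andP[t0 t1]; rewrite normrM ger0_norm ?expR_ge0// -[leRHS]mulr1.
apply: ler_pM => //; last exact: cos_max.
rewrite ler_expR (le_trans (ler_norm _))// normrM ger0_norm//.
by rewrite ler_piMl.
Qed.

Let es_bound a b c t : 0 <= t <= 1 -> `|es a b c t| <= expR `|a|.
Proof.
move=> /andP[t0 t1]; rewrite normrM ger0_norm ?expR_ge0// -[leRHS]mulr1.
apply: ler_pM => //; last exact: sin_max.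
rewrite ler_expR (le_trans (ler_norm _))// normrM ger0_norm//.
by rewrite ler_piMl.
Qed.

(* The coefficients of [E^(k)] over [ec], [es], with E t = e^(ta) cos(c + tb). *)
Let lin_bound a b c (u v : R) t : 0 <= t <= 1 ->
  `|u * ec a b c t + v * es a b c t| <= (`|u| + `|v|) * expR `|a|.
Proof.
move=> t01; rewrite (le_trans (ler_normD _ _))// 2!(normrM _ (_ t)) mulrDl.
by apply: lerD; apply: ler_wpM2l => //; [exact: ec_bound|exact: es_bound].
Qed.

Lemma expcos_taylor0 a b c :
  `|expR a * cos (c + b) - cos c| <= (`|a| + `|b|) * expR `|a|.
Proof.
have H : forall t, 0 <= t <= 1 -> `|ec a b c t - ec a b c 0| <=
    ((`|a| + `|b|) * expR `|a|) * t ^+ 1.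
  apply: (mvt_power_bound (g := fun t => a * ec a b c t - b * es a b c t)).
  - by move=> t; apply: is_derive_eq; rewrite /GRing.scale/= /ec /es; ring.
  - by rewrite subrr.
  - move=> t t01; rewrite expr0 mulr1 -mulNr -[`|b|]normrN; exact: lin_bound.
have := H 1; rewrite lexx ler01 => /(_ isT).
by rewrite /ec !mul1r !mul0r expR0 mul1r addr0 expr1 mulr1.
Qed.

Lemma expcos_taylor1 a b c :
  `|expR a * cos (c + b) - cos c - (a * cos c - b * sin c)|
    <= (`|a| + `|b|) ^+ 2 * expR `|a|.
Proof.
pose M := (`|a| + `|b|) ^+ 2 * expR `|a|.
pose g t := a * ec a b c t - b * es a b c t.
have dg t : is_derive t (1 : R) g
    ((a ^+ 2 - b ^+ 2) * ec a b c t + (- (2 * a * b)) * es a b c t).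
  by apply: is_derive_eq; rewrite /GRing.scale/= /ec /es; ring.
have H1 : forall t, 0 <= t <= 1 -> `|g t - g 0| <= M * t ^+ 1.
  apply: (mvt_power_bound (g := fun t => (a ^+ 2 - b ^+ 2) * ec a b c t + (- (2 * a * b)) * es a b c t)).
  - by move=> t; apply: is_derive_eq; rewrite /GRing.scale/= /ec /es; ring.
  - by rewrite subrr.
  - move=> t t01; rewrite expr0 mulr1 (le_trans (lin_bound _ _ _ _ _ t01))//.
    rewrite ler_wpM2r ?expR_ge0// normrN !normrM (ger0_norm (_ : 0 <= 2))//.
    rewrite (le_trans (lerD (ler_normB _ _) (lexx _)))// !normrX.
    have -> : (`|a| + `|b|) ^+ 2 = `|a| ^+ 2 + `|b| ^+ 2 + 2 * `|a| * `|b| by ring.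
    by [].
have H2 : forall t, 0 <= t <= 1 ->
    `|ec a b c t - ec a b c 0 - t * g 0| <= M * t ^+ 2.
  apply: (@mvt_power_bound (fun t => ec a b c t - ec a b c 0 - t * g 0)
    (fun t => g t - g 0) M 1); last exact: H1.
  - by move=> t; apply: is_derive_eq; rewrite /g /GRing.scale/= /ec /es; ring.
  - by rewrite mul0r subr0 subrr.
have := H2 1; rewrite lexx ler01 => /(_ isT).
by rewrite /g /ec /es !mul1r !mul0r expR0 !mul1r !addr0 expr1n mulr1.
Qed.

Lemma expcos_taylor2 a b c :
  `|expR a * cos (c + b) - cos c - (a * cos c - b * sin c)
     - ((a ^+ 2 - b ^+ 2) * cos c - 2 * a * b * sin c) / 2|
    <= (`|a| + `|b|) ^+ 3 * expR `|a|.
Proof.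
pose M := (`|a| + `|b|) ^+ 3 * expR `|a|.
pose g t := a * ec a b c t - b * es a b c t.
pose h t := (a ^+ 2 - b ^+ 2) * ec a b c t - 2 * a * b * es a b c t.
have dg t : is_derive t (1 : R) g (h t).
  by apply: is_derive_eq; rewrite /h /GRing.scale/= /ec /es; ring.
have dh t : is_derive t (1 : R) h
    ((a ^+ 3 - 3 * a * b ^+ 2) * ec a b c t + (b ^+ 3 - 3 * a ^+ 2 * b) * es a b c t).
  by apply: is_derive_eq; rewrite /GRing.scale/= /ec /es; ring.
have H0 : forall t, 0 <= t <= 1 -> `|h t - h 0| <= M * t ^+ 1.
  apply: (mvt_power_bound (g := fun t => (a ^+ 3 - 3 * a * b ^+ 2) * ec a b c t + (b ^+ 3 - 3 * a ^+ 2 * b) * es a b c t)).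
  - by move=> t; apply: is_derive_eq; rewrite /GRing.scale/= /ec /es; ring.
  - by rewrite subrr.
  - move=> t t01; rewrite expr0 mulr1 (le_trans (lin_bound _ _ _ _ _ t01))//.
    rewrite ler_wpM2r ?expR_ge0//.
    rewrite (le_trans (lerD (ler_normB _ _) (ler_normB _ _)))//.
    rewrite [`|3 * a * b ^+ 2|]normrM [`|3 * a|]normrM [`|3 * a ^+ 2 * b|]normrM.
    rewrite [`|3 * a ^+ 2|]normrM !normrX (ger0_norm (_ : 0 <= 3))//.
    have -> : (`|a| + `|b|) ^+ 3 = `|a| ^+ 3 + 3 * `|a| * `|b| ^+ 2 + (`|b| ^+ 3 + 3 * `|a| ^+ 2 * `|b|) by ring.
    by [].
have H1 : forall t, 0 <= t <= 1 -> `|g t - g 0 - t * h 0| <= M * t ^+ 2.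
  apply: (@mvt_power_bound (fun t => g t - g 0 - t * h 0)
    (fun t => h t - h 0) M 1); last exact: H0.
  - by move=> t; apply: is_derive_eq; rewrite /h /GRing.scale/=; ring.
  - by rewrite mul0r subr0 subrr.
have H2 : forall t, 0 <= t <= 1 ->
    `|ec a b c t - ec a b c 0 - t * g 0 - t ^+ 2 / 2 * h 0| <= M * t ^+ 3.
  apply: (@mvt_power_bound (fun t => ec a b c t - ec a b c 0 - t * g 0 - t ^+ 2 / 2 * h 0)
    (fun t => g t - g 0 - t * h 0) M 2); last exact: H1.
  - by move=> t; apply: is_derive_eq; rewrite /g /h /GRing.scale/= /GRing.scale/= /ec /es; field.
  - by rewrite expr0n/= !mul0r !subr0 subrr.
have := H2 1; rewrite lexx ler01 => /(_ isT).
rewrite /g /h /ec /es !mul1r !mul0r expR0 !mul1r !addr0 !expr1n mulr1.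
by rewrite mul1r (mulrC 2^-1).
Qed.

Lemma expR_taylor0 a : `|expR a - 1| <= `|a| * expR `|a|.
Proof. by have := expcos_taylor0 a 0 0; rewrite addr0 cos0 mulr1 normr0 addr0. Qed.

Lemma expR_taylor1 a : `|expR a - 1 - a| <= `|a| ^+ 2 * expR `|a|.
Proof.
by have := expcos_taylor1 a 0 0; rewrite addr0 cos0 !mulr1 normr0 addr0 mul0r subr0.
Qed.

Lemma cos_taylor0 b c : `|cos (c + b) - cos c| <= `|b|.
Proof. by have := expcos_taylor0 0 b c; rewrite normr0 expR0 mul1r add0r mulr1. Qed.

Lemma cos_taylor1 b c : `|cos (c + b) - cos c + b * sin c| <= `|b| ^+ 2.
Proof.
have := expcos_taylor1 0 b c.
by rewrite normr0 expR0 mul1r add0r mulr1 mul0r sub0r opprK.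
Qed.

Lemma cos_taylor2 b c :
  `|cos (c + b) - cos c + b * sin c + b ^+ 2 * cos c / 2| <= `|b| ^+ 3.
Proof.
have := expcos_taylor2 0 b c.
rewrite normr0 expR0 mul1r add0r mulr1 mul0r sub0r opprK expr0n/= sub0r.
by rewrite mulr0 !mul0r subr0 !mulNr opprK.
Qed.

End ElementaryTaylor.

(** * Gaussian increments of Brownian motion *)

Section Density.
Context {R : realType} {d : measure_display} {T : measurableType d}.
Variables (mu nu : {measure set T -> \bar R}) (g : T -> R).
Hypotheses (mg : measurable_fun setT g) (g0 : forall x, 0 <= g x).
Hypothesis nuE : forall A, measurable A -> nu A = (\int[mu]_(x in A) (g x)%:E)%E.

Import HBNNSimple.

Let integral_density_indic E : measurable E ->
  (\int[nu]_x (\1_E x)%:E = \int[mu]_x ((\1_E x)%:E * (g x)%:E))%E.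
Proof.
move=> mE; rewrite integral_indic//= setIT nuE// integral_mkcond/=.
apply: eq_integral => x _; rewrite patchE indicE.
by case: ifPn => xE; rewrite ?mul1e ?mul0e.
Qed.

Let integral_density_nnsfun (f : {nnsfun T >-> R}) :
  (\int[nu]_x (f x)%:E = \int[mu]_x ((f x)%:E * (g x)%:E))%E.
Proof.
under [LHS]eq_integral do rewrite fimfunE -fsumEFin//.
rewrite [LHS]ge0_integral_fsum//; last 2 first.
  - by move=> r; exact/measurable_EFinP/measurableT_comp.
  - by move=> n x _; rewrite EFinM nnfun_muleindic_ge0.
under [RHS]eq_integral.
  move=> x xD; rewrite fimfunE -fsumEFin// muleC ge0_mule_fsumr; last first.
    by move=> r; rewrite EFinM nnfun_muleindic_ge0.
  over.
rewrite [RHS]ge0_integral_fsum//; last 2 first.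
  - move=> r; apply: emeasurable_funM; first exact/measurable_EFinP.
    by apply/measurable_EFinP; exact/measurableT_comp.
  - move=> n x _; rewrite mule_ge0// ?lee_fin ?g0//.
    by rewrite -lee_fin EFinM nnfun_muleindic_ge0.
apply: eq_fsbigr => r _.
have [r0|r0] := ltP r 0.
  have E0 : (f @^-1` [set r]) = set0.
    by apply/seteqP; split=> x //= fxr; move: r0; rewrite -fxr ltNge fun_ge0.
  rewrite !integral0_eq// => x _; rewrite E0 indic0/= mulr0//.
  by rewrite mule0.
under eq_integral do rewrite EFinM.
rewrite ge0_integralZl//; last exact/measurable_EFinP/measurable_indic.
rewrite integral_density_indic//.
rewrite -ge0_integralZl//; last 2 first.
  - apply: emeasurable_funM; first exact/measurable_EFinP/measurable_indic.
    exact/measurable_EFinP.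
  - by move=> x _; rewrite mule_ge0// lee_fin.
by apply: eq_integral => x _; rewrite EFinM [RHS]muleC muleA.
Qed.

Lemma ge0_integral_density (f : T -> \bar R) :
  measurable_fun setT f -> (forall x, 0 <= f x)%E ->
  (\int[nu]_x f x = \int[mu]_x (f x * (g x)%:E))%E.
Proof.
move=> mf f0.
pose f_ := nnsfun_approx measurableT mf.
transitivity (lim (\int[nu]_x (f_ n x)%:E @[n --> \oo])%E).
  rewrite -monotone_convergence//=.
  - apply: eq_integral => ? /[!inE] xD; apply/esym/cvg_lim => //=.
    exact: cvg_nnsfun_approx.
  - by move=> n; exact/measurable_EFinP/measurable_funTS.
  - by move=> n ? _; rewrite lee_fin.
  - by move=> ? _ ? ? mn; rewrite lee_fin; exact/lefP/nd_nnsfun_approx.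
rewrite (_ : (fun n => _) = fun n => \int[mu]_x ((f_ n x)%:E * (g x)%:E))%E; last first.
  by apply/funext => n; exact: integral_density_nnsfun.
rewrite -monotone_convergence//=.
- apply: eq_integral => x _; apply: cvg_lim => //.
  under eq_fun do rewrite muleC.
  rewrite muleC; apply: cvgeZl => //.
  exact: cvg_nnsfun_approx.
- move=> n; apply: emeasurable_funM; last exact/measurable_EFinP.
  exact/measurable_EFinP/measurable_funTS.
- by move=> n ? _; rewrite mule_ge0// lee_fin.
- move=> x _ n k nk; rewrite lee_wpmul2r ?lee_fin//; exact/lefP/nd_nnsfun_approx.
Qed.
End Density.

Section IntegrableEFin.
Context {R : realType} {d : measure_display} {T : measurableType d}.
Variable m : {measure set T -> \bar R}.

Lemma integrable_EFinD (f g : T -> R) : m.-integrable setT (EFin \o f) ->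
  m.-integrable setT (EFin \o g) ->
  m.-integrable setT (EFin \o (fun x => f x + g x)).
Proof. by move=> fi gi; exact: (integrableD measurableT fi gi). Qed.

Lemma integrable_EFinB (f g : T -> R) : m.-integrable setT (EFin \o f) ->
  m.-integrable setT (EFin \o g) ->
  m.-integrable setT (EFin \o (fun x => f x - g x)).
Proof. by move=> fi gi; exact: (integrableB measurableT fi gi). Qed.

Lemma integrable_EFinZl (k : R) (f : T -> R) : m.-integrable setT (EFin \o f) ->
  m.-integrable setT (EFin \o (fun x => k * f x)).
Proof. by move=> fi; exact: (integrableZl measurableT k fi). Qed.

End IntegrableEFin.

Section Gaussian.
Context {R : realType} (sigma : R).
Hypothesis sigma_gt0 : 0 < sigma.
Local Notation gamma := (normal_prob 0 sigma).
Local Notation mu := (@lebesgue_measure R).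
Implicit Types (s q th c x : R).

Lemma ge0_integral_normal_prob (f : R -> \bar R) :
  measurable_fun setT f -> (forall x, 0 <= f x)%E ->
  (\int[gamma]_x f x = \int[mu]_x (f x * (normal_pdf 0 sigma x)%:E))%E.
Proof.
move=> mf f0.
by apply: (@ge0_integral_density _ _ _ mu gamma) => //;
  [exact: measurable_normal_pdf|move=> x; exact: normal_pdf_ge0].
Qed.

Lemma integral_translation (G : R -> R) c :
  continuous G -> (forall x, 0 <= G x) ->
  (\int[mu]_x (G x)%:E = \int[mu]_x (G (x + c))%:E)%E.
Proof.
move=> cG G0.
have dF x : is_derive x (1 : R) (fun y : R => y + c) (1 : R).
  by apply: is_derive_eq; rewrite addr0.
have F'E : (fun y : R => y + c)^`()%classic = cst 1.
  by apply/funext => x; rewrite derive1E; apply: derive_val.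
rewrite (increasing_ge0_integration_by_substitutionT (F := fun y => y + c))//.
- by rewrite F'E; apply: eq_integral => x _ /=; rewrite !fctE mulr1.
- by move=> x y xy; rewrite ltrD2r.
- by rewrite F'E => ?; exact: cvg_cst.
- by rewrite F'E; exact: is_cvg_cst.
- by rewrite F'E; exact: is_cvg_cst.
- exact: cvg_addrr_Ny.
- exact: cvg_addrr.
Qed.

(** Completing the square: [expR (s x)] times the centred Gaussian density is
    [expR (s^2 sigma^2 / 2)] times the density with mean [s sigma^2], and a translation recentres
    it. *)
Lemma gauss_tilt (G : R -> R) s : continuous G -> (forall x, 0 <= G x) ->
  (\int[gamma]_x (expR (s * x) * G x)%:E
   = (expR (s ^+ 2 * sigma ^+ 2 / 2))%:E * \int[gamma]_x (G (x + s * sigma ^+ 2))%:E)%E.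
Proof.
move=> cG G0.
have mG : measurable_fun setT G by exact: continuous_measurable_fun.
have mE : measurable_fun setT (fun x : R => expR (s * x)).
  by apply: measurableT_comp => //; exact: measurable_funM.
rewrite ge0_integral_normal_prob; last 2 first.
- by apply/measurable_EFinP; exact: measurable_funM.
- by move=> x; rewrite lee_fin mulr_ge0 ?expR_ge0.
rewrite [X in (_ * X)%E]ge0_integral_normal_prob; last 2 first.
- apply/measurable_EFinP; apply: measurableT_comp => //; exact: measurable_funD.
- by move=> x; rewrite lee_fin.
rewrite -ge0_integralZl//; last 2 first.
- apply: emeasurable_funM.
    by apply/measurable_EFinP; apply: measurableT_comp => //; exact: measurable_funD.
  by apply/measurable_EFinP; exact: measurable_normal_pdf.
- by move=> x _; rewrite mule_ge0// lee_fin// normal_pdf_ge0.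
pose H x := expR (s * x) * G x * normal_pdf 0 sigma x.
under eq_integral do rewrite -EFinM -/(H _).
rewrite (integral_translation (s * sigma ^+ 2)); last 2 first.
- move=> x; apply: cvgM; last by apply: continuous_normal_pdf; rewrite gt_eqF.
  apply: cvgM; last exact: cG.
  by apply: continuous_comp; [exact: mulrl_continuous|exact: continuous_expR].
- by move=> x; rewrite mulr_ge0 ?normal_pdf_ge0// mulr_ge0// expR_ge0.
apply: eq_integral => x _; rewrite /H; congr (_%:E).
rewrite !normal_pdfE ?gt_eqF//= /normal_fun !subr0.
set e := G _; set pk := normal_peak _.
rewrite [LHS](_ : _ = e * pk * (expR (s * (x + s * sigma ^+ 2)) * expR (- (x + s * sigma ^+ 2) ^+ 2 / (sigma ^+ 2 *+ 2)))); last by ring.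
rewrite [RHS](_ : _ = e * pk * (expR (s ^+ 2 * sigma ^+ 2 / 2) * expR (- x ^+ 2 / (sigma ^+ 2 *+ 2)))); last by ring.
rewrite -!expRD; congr (_ * expR _).
by field; rewrite gt_eqF.
Qed.

Lemma gauss_exp s :
  (\int[gamma]_x (expR (s * x))%:E = (expR (s ^+ 2 * sigma ^+ 2 / 2))%:E)%E.
Proof.
have c1 : continuous (cst 1 : R -> R) by move=> x; exact: cvg_cst.
have := @gauss_tilt (cst 1) s c1 (fun=> ler01).
under eq_integral do rewrite mulr1.
have g1 : (\int[gamma]_x 1%:E = 1)%E by rewrite integral_cst// mul1e [LHS]probability_setT.
by move=> ->; rewrite [X in (_ * X)%E]g1 mule1.
Qed.

Lemma gauss_integrable (f : R -> R) c : measurable_fun setT f ->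
  (forall x, `|f x| <= c * (expR (2 * x) + expR (- 2 * x))) ->
  gamma.-integrable setT (EFin \o f).
Proof.
move=> mf fc.
have iE s : gamma.-integrable setT (EFin \o (fun x => expR (s * x))).
  apply/integrableP; split.
    by apply/measurable_EFinP; apply: measurableT_comp => //; exact: measurable_funM.
  by under eq_integral do rewrite /= ger0_norm ?expR_ge0//; rewrite gauss_exp ltry.
have iC : gamma.-integrable setT
    (fun x => c%:E * ((expR (2 * x))%:E + (expR (- 2 * x))%:E))%E.
  by apply: integrableZl => //; apply: integrableD => //; exact: iE.
apply: le_integrable iC => //; first exact/measurable_EFinP.
by move=> x _ /=; rewrite lee_fin (le_trans (fc x))//; exact: ler_norm.
Qed.

Let gauss_env th q c x : `|c * cos (q * x + th)| <= `|c| * (expR (2 * x) + expR (- 2 * x)).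
Proof.
rewrite normrM ler_wpM2l// (le_trans (cos_max _))//.
have [x0|/ltW x0] := leP 0 x.
  by rewrite ler_wpDr ?expR_ge0// -expR0 ler_expR mulr_ge0.
by rewrite ler_wpDl ?expR_ge0// -expR0 ler_expR mulr_le0.
Qed.

Definition gauss_cos q th : R := \int[gamma]_x cos (q * x + th).

Let mcos q th : measurable_fun setT (fun x : R => cos (q * x + th)).
Proof.
apply: continuous_measurable_fun => x; apply: continuous_comp; last exact: continuous_cos.
by apply: cvgD; [exact: mulrl_continuous|exact: cvg_cst].
Qed.

Let icos q th : gamma.-integrable setT (EFin \o (fun x : R => cos (q * x + th))).
Proof.
apply: (gauss_integrable (c := 1)) => // x.
by have := gauss_env th q 1 x; rewrite mul1r normr1.
Qed.

Let EFin_gauss_cos q th :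
  (\int[gamma]_x (cos (q * x + th))%:E)%E = (gauss_cos q th)%:E.
Proof. by rewrite /gauss_cos /Rintegral fineK//; apply: integrable_fin_num => //; exact: icos. Qed.

Let int1cos q th :
  (\int[gamma]_x (1 + cos (q * x + th))%:E = (1 + gauss_cos q th)%:E)%E.
Proof.
under eq_integral do rewrite EFinD.
rewrite integralD_EFin//; last exact: finite_measure_integrable_cst.
by rewrite integral_cst// mul1e [X in (X + _)%E]probability_setT EFin_gauss_cos.
Qed.

Lemma ge0_integral_exp_cos q th s :
  (\int[gamma]_x (expR (s * x) * (1 + cos (q * x + th)))%:E
   = (expR (s ^+ 2 * sigma ^+ 2 / 2) *
      (1 + gauss_cos q (th + q * s * sigma ^+ 2)))%:E)%E.
Proof.
rewrite gauss_tilt; last 2 first.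
- move=> x; apply: cvgD; first exact: cvg_cst.
  apply: continuous_comp; last exact: continuous_cos.
  by apply: cvgD; [exact: mulrl_continuous|exact: cvg_cst].
- by move=> x; rewrite -lerBlDl sub0r cos_geN1.
rewrite EFinM -int1cos; congr (_ * _)%E; apply: eq_integral => x _.
by congr (1 + cos _)%:E; ring.
Qed.

Let iexp s : gamma.-integrable setT (EFin \o (fun x : R => expR (s * x))).
Proof.
apply/integrableP; split.
  by apply/measurable_EFinP; apply: measurableT_comp => //; exact: measurable_funM.
by under eq_integral do rewrite /= ger0_norm ?expR_ge0//; rewrite gauss_exp ltry.
Qed.

Let iexpcos s q th :
  gamma.-integrable setT (EFin \o (fun x : R => expR (s * x) * cos (q * x + th))).
Proof.
apply: le_integrable (iexp s) => //.
  apply/measurable_EFinP; apply: measurable_funM; last exact: mcos.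
  by apply: measurableT_comp => //; exact: measurable_funM.
move=> x _ /=; rewrite lee_fin normrM ler_piMr//; exact: cos_max.
Qed.

Lemma Rintegral_exp_cos q th s :
  \int[gamma]_x (expR (s * x) * cos (q * x + th)) =
  expR (s ^+ 2 * sigma ^+ 2 / 2) * gauss_cos q (th + q * s * sigma ^+ 2).
Proof.
have E : (\int[gamma]_x (expR (s * x) * (1 + cos (q * x + th)))%:E =
   (expR (s ^+ 2 * sigma ^+ 2 / 2))%:E +
     \int[gamma]_x (expR (s * x) * cos (q * x + th))%:E)%E.
  rewrite -gauss_exp -integralD_EFin//.
  by apply: eq_integral => x _; rewrite mulrDr mulr1 EFinD.
apply: (@addrI _ (expR (s ^+ 2 * sigma ^+ 2 / 2))).
apply: EFin_inj; rewrite [LHS]EFinD /Rintegral fineK; last first.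
  by apply: integrable_fin_num => //; exact: iexpcos.
by rewrite -E ge0_integral_exp_cos mulrDr mulr1.
Qed.

Let bound2 (f : R -> R) c : measurable_fun setT f ->
  (forall x, `|f x| <= c * (expR (2 * x) + expR (- 2 * x))) ->
  `|\int[gamma]_x f x| <= c * (2 * expR (2 * sigma ^+ 2)).
Proof.
move=> mf fc.
have i2 s : \int[gamma]_x expR (s * x) = expR (s ^+ 2 * sigma ^+ 2 / 2).
  by rewrite /Rintegral gauss_exp.
have if_ := gauss_integrable mf fc.
rewrite (le_trans (le_normr_Rintegral _ if_))//.
have <- : \int[gamma]_x (c * (expR (2 * x) + expR (- 2 * x))) = c * (2 * expR (2 * sigma ^+ 2)).
  rewrite RintegralZl//; last first.
    by apply: integrable_EFinD; exact: iexp.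
  rewrite RintegralD//; try exact: iexp.
  rewrite !i2 sqrrN (_ : 2 ^+ 2 * sigma ^+ 2 / 2 = 2 * sigma ^+ 2); last by field.
  by ring.
apply: le_Rintegral => //.
  exact: integrable_norm.
by apply/integrable_EFinZl/integrable_EFinD; exact: iexp.
Qed.

(** The derivative of [gauss_cos] in [q] is minus the integral of [x sin (q x + th)]. Instead of
    integrating by parts, [e x] is replaced by [expR (e x) - 1], whose integral against the sine is
    known from the exponential tilt; the sine is written as a cosine with phase shifted by
    [pi / 2]. *)
Let pointwise q th e x : `|e| <= 1 ->
  `|cos ((q + e) * x + th) - cos (q * x + th)
     + expR (e * x) * cos (q * x + (th - pi / 2)) - cos (q * x + (th - pi / 2))|
  <= 4 * e ^+ 2 * (expR (2 * x) + expR (- 2 * x)).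
Proof.
move=> e1.
have -> : cos (q * x + (th - pi / 2)) = sin (q * x + th) by rewrite addrA cosBpihalf.
have -> : (q + e) * x + th = (q * x + th) + e * x by ring.
set b := q * x + th; set t := e * x.
have H1 := cos_taylor1 t b.
have H2 := expR_taylor1 t.
have tx : `|t| <= `|x| by rewrite normrM ler_piMl.
have t2 : `|t| ^+ 2 = e ^+ 2 * x ^+ 2 by rewrite real_normK ?num_real// exprMn.
have x2 : x ^+ 2 <= 2 * expR `|x|.
  have := @expR_ge1Dxn R `|x| 1 (normr_ge0 x).
  rewrite real_normK ?num_real// (_ : 2`! = 2%N)// => h.
  by have := expR_ge0 `|x|; lra.
have e2 : expR `|x| * expR `|x| <= expR (2 * x) + expR (- 2 * x).
  rewrite -expRD; have [x0|/ltW x0] := leP 0 x.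
    by rewrite ger0_norm// ler_wpDr ?expR_ge0// ler_expR; lra.
  by rewrite ler0_norm// ler_wpDl ?expR_ge0// ler_expR; lra.
have et : expR `|t| <= expR `|x| by rewrite ler_expR.
have ex1 : 1 <= expR `|x| by rewrite -expR0 ler_expR.
have -> : cos (b + t) - cos b + expR t * sin b - sin b =
  (cos (b + t) - cos b + t * sin b) + (expR t - 1 - t) * sin b by ring.
rewrite (le_trans (ler_normD _ _))// normrM.
have H3 : `|expR t - 1 - t| * `|sin b| <= `|t| ^+ 2 * expR `|t|.
  by rewrite (le_trans _ H2)// ler_piMr// sin_max.
rewrite (le_trans (lerD H1 H3))// t2 -mulrA.
apply: (@le_trans _ _ (e ^+ 2 * (4 * (expR `|x| * expR `|x|)))); last first.
  by rewrite [leRHS]mulrCA ler_wpM2l ?sqr_ge0// ler_wpM2l.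
rewrite -[X in X + _]mulr1 -mulrDr -mulrA ler_wpM2l ?sqr_ge0//.
have -> : 4 * (expR `|x| * expR `|x|) = (2 * expR `|x|) * (2 * expR `|x|) by ring.
by apply: ler_pM; rewrite ?sqr_ge0 ?addr_ge0 ?expR_ge0//; lra.
Qed.

(** Expansion of the tilted integrand in [e]: the factor [expR (e^2 sigma^2 / 2)] is of second
    order, and the phase shift [q e sigma^2] produces the right-hand side of the differential
    equation for [gauss_cos]. *)
Let pointwise2 q th e x : `|e| <= 1 ->
  `|expR (e ^+ 2 * sigma ^+ 2 / 2) * cos (q * x + (th - pi / 2 + q * e * sigma ^+ 2))
    - cos (q * x + (th - pi / 2)) - (q * e * sigma ^+ 2) * cos (q * x + th)|
  <= e ^+ 2 * (sigma ^+ 2 / 2 + (sigma ^+ 2 / 2 + `|q| * sigma ^+ 2) ^+ 2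
       * expR (sigma ^+ 2 / 2)).
Proof.
move=> e1.
set a := e ^+ 2 * sigma ^+ 2 / 2; set r := q * e * sigma ^+ 2.
set b := q * x + (th - pi / 2).
have -> : q * x + (th - pi / 2 + r) = b + r by rewrite /b; ring.
have -> : cos (q * x + th) = - sin b.
  by rewrite /b addrA sinBpihalf opprK.
have s0 : 0 <= sigma ^+ 2 by exact: sqr_ge0.
have a0 : 0 <= a by rewrite /a; have := sqr_ge0 e; nra.
have e21 : e ^+ 2 <= `|e| by rewrite -real_normK ?num_real// expr2 ler_piMl.
have aE : a <= `|e| * (sigma ^+ 2 / 2).
  by rewrite /a -mulrA ler_wpM2r// divr_ge0.
have rE : `|r| = `|e| * (`|q| * sigma ^+ 2).
  by rewrite /r normrM (ger0_norm s0) normrM; ring.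
have ee : expR a <= expR (sigma ^+ 2 / 2).
  by rewrite ler_expR (le_trans aE)// ler_piMl// divr_ge0.
have H := expcos_taylor1 a r b.
have -> : expR a * cos (b + r) - cos b - r * - sin b =
   (expR a * cos (b + r) - cos b - (a * cos b - r * sin b)) + a * cos b by ring.
rewrite (le_trans (ler_normD _ _))// addrC mulrDr lerD//.
  by rewrite normrM (ger0_norm a0) mulrA ler_piMr// cos_max.
rewrite (le_trans H)// (ger0_norm a0) mulrA ler_pM ?expR_ge0//.
  by rewrite exprn_ge0// addr_ge0.
rewrite -(@real_normK _ e) ?num_real// -exprMn lerXn2r// ?nnegrE.
- by rewrite addr_ge0.
- by rewrite mulr_ge0// addr_ge0// ?divr_ge0// mulr_ge0.
- by rewrite rE mulrDr lerD.
Qed.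

Let gauss_cos_quad q th e : `|e| <= 1 ->
  `|gauss_cos (q + e) th - gauss_cos q th + (q * sigma ^+ 2) * gauss_cos q th * e|
  <= e ^+ 2 * (4 * (2 * expR (2 * sigma ^+ 2)) +
      (sigma ^+ 2 / 2 + (sigma ^+ 2 / 2 + `|q| * sigma ^+ 2) ^+ 2
       * expR (sigma ^+ 2 / 2)) * (2 * expR (2 * sigma ^+ 2))).
Proof.
move=> e1.
pose f1 x := cos ((q + e) * x + th) - cos (q * x + th)
     + expR (e * x) * cos (q * x + (th - pi / 2)) - cos (q * x + (th - pi / 2)).
pose c2 := expR (e ^+ 2 * sigma ^+ 2 / 2).
pose f2 x := c2 * cos (q * x + (th - pi / 2 + q * e * sigma ^+ 2))
    - cos (q * x + (th - pi / 2)) - (q * e * sigma ^+ 2) * cos (q * x + th).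
have E1 : \int[gamma]_x f1 x = gauss_cos (q + e) th - gauss_cos q th
    + c2 * gauss_cos q (th - pi / 2 + q * e * sigma ^+ 2) - gauss_cos q (th - pi / 2).
  rewrite -Rintegral_exp_cos /f1 RintegralB//=; last first.
    apply: integrable_EFinD; last exact: iexpcos.
    by apply: integrable_EFinB; exact: icos.
  rewrite RintegralD//=; last by apply: integrable_EFinB; exact: icos.
  by rewrite RintegralB.
have E2 : \int[gamma]_x f2 x =
    c2 * gauss_cos q (th - pi / 2 + q * e * sigma ^+ 2) - gauss_cos q (th - pi / 2)
    - (q * e * sigma ^+ 2) * gauss_cos q th.
  rewrite /f2 RintegralB//=; last 2 first.
  - apply: integrable_EFinB; last exact: icos.
    by apply: integrable_EFinZl; exact: icos.
  - by apply: integrable_EFinZl; exact: icos.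
  rewrite RintegralB//=; last by apply: integrable_EFinZl; exact: icos.
  by rewrite !RintegralZl.
have -> : gauss_cos (q + e) th - gauss_cos q th + (q * sigma ^+ 2) * gauss_cos q th * e
   = \int[gamma]_x f1 x - \int[gamma]_x f2 x by rewrite E1 E2; ring.
rewrite (le_trans (ler_normB _ _))// mulrDr lerD//.
  rewrite [leRHS](_ : _ = 4 * e ^+ 2 * (2 * expR (2 * sigma ^+ 2))); last by ring.
  apply: bound2; last by move=> x; exact: pointwise.
  apply: measurable_funB; last exact: mcos.
  apply: measurable_funD; first by apply: measurable_funB; exact: mcos.
  apply: measurable_funM; last exact: mcos.
  by apply: measurableT_comp => //; exact: measurable_funM.
rewrite mulrA; apply: bound2.
  apply: measurable_funB; last by apply: measurable_funM => //; exact: mcos.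
  by apply: measurable_funB; [apply: measurable_funM => //; exact: mcos|exact: mcos].
move=> x; rewrite (le_trans (pointwise2 _ _ _ e1))// ler_peMr//.
  rewrite mulr_ge0 ?sqr_ge0// addr_ge0 ?divr_ge0 ?sqr_ge0// mulr_ge0 ?expR_ge0//.
  by rewrite sqr_ge0.
have [x0|/ltW x0] := leP 0 x.
  by rewrite ler_wpDr ?expR_ge0// -expR0 ler_expR mulr_ge0.
by rewrite ler_wpDl ?expR_ge0// -expR0 ler_expR mulr_le0.
Qed.

Lemma is_derive_quad (f : R -> R) (x l C : R) :
  (forall e, `|e| <= 1 -> `|f (x + e) - f x - l * e| <= e ^+ 2 * C) ->
  is_derive x (1 : R) f l.
Proof.
move=> fC.
have C0 : 0 <= C by have := fC 1; rewrite normr1 lexx expr1n mul1r => /(_ isT); exact: le_trans.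
have cvgl : h^-1 *: (f (h *: (1 : R) + x) - f x) @[h --> 0^'] --> l.
  apply/cvgrPdist_le => e e0; near=> h.
  have h0 : h != 0 by near: h; exact: nbhs_dnbhs_neq.
  have -> : l - h^-1 *: (f (h *: (1 : R) + x) - f x) =
      - (h^-1 * (f (x + h) - f x - l * h)).
    by rewrite /GRing.scale/= mulr1 (addrC h); field.
  rewrite normrN normrM normfV ler_pdivrMl ?normr_gt0//.
  have h1 : `|h| <= 1.
    by near: h; apply: dnbhs0_le.
  rewrite (le_trans (fC _ h1))// -real_normK ?num_real// expr2 -mulrA ler_wpM2l//.
  have hC : `|h| <= e / (C + 1).
    by near: h; apply: dnbhs0_le; rewrite divr_gt0// ltr_wpDl.
  rewrite (le_trans (ler_wpM2r C0 hC))// -mulrA ler_piMr ?ltW//.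
  by rewrite ltr_pdivrMl ?ltr_wpDl// mulr1 ltrDl.
by split; [apply/cvg_ex; exists l|apply: cvg_lim].
Unshelve. all: by end_near. Qed.

(** As a function of [q], [gauss_cos] solves [g' = - q sigma^2 g], so its product with
    [expR (q^2 sigma^2 / 2)] is constant. *)
Lemma gauss_cosE q th : gauss_cos q th = expR (- q ^+ 2 * sigma ^+ 2 / 2) * cos th.
Proof.
pose F (q : R) := expR (q ^+ 2 * sigma ^+ 2 / 2) * gauss_cos q th.
have dg (x : R) : is_derive x (1 : R) (gauss_cos ^~ th) (- (x * sigma ^+ 2) * gauss_cos x th).
  apply: is_derive_quad => e e1; rewrite !mulNr opprK; exact: gauss_cos_quad.
have dF (x : R) : is_derive x (1 : R) F 0.
  by apply: is_derive_eq; rewrite /GRing.scale/=; field.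
have F0 : F q = F 0 := is_derive_0_is_cst q 0 dF.
have FE : F 0 = cos th.
  rewrite /F expr0n/= !mul0r expR0 mul1r /gauss_cos.
  under eq_Rintegral do rewrite mul0r add0r.
  by rewrite Rintegral_cst// [X in fine X]probability_setT mulr1.
by rewrite -FE -F0 /F mulrA -expRD !mulNr addNr expR0 mul1r.
Qed.

(* The factor [1 + cos] keeps the integrand nonnegative. *)
Lemma gauss_exp_cos_ge0 s q c th :
  (\int[gamma]_x (expR (s * x + c) * (1 + cos (q * x + th)))%:E
   = (expR (c + s ^+ 2 * sigma ^+ 2 / 2) +
      expR (c + (s ^+ 2 - q ^+ 2) * sigma ^+ 2 / 2) * cos (th + q * s * sigma ^+ 2))%:E)%E.
Proof.
under eq_integral do rewrite addrC expRD -mulrA EFinM.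
rewrite ge0_integralZl//; last first.
  apply/measurable_EFinP/measurable_funM.
    by apply: measurableT_comp => //; exact: measurable_funM.
  by apply: measurable_funD => //; exact: mcos.
rewrite ge0_integral_exp_cos gauss_cosE -EFinM; congr (_%:E).
rewrite mulrDr mulr1 mulrDr -expRD !mulrA -!expRD; congr (_ + expR _ * _).
by field.
Qed.

End Gaussian.

(** * Independence and integration with respect to product laws *)

Section Independence.
Context {R : realType} {d d0 d1 d2 : measure_display}.
Context {Omega : measurableType d} {T0 : measurableType d0}.
Context {T1 : measurableType d1} {T2 : measurableType d2}.
Variables (P : probability Omega R) (zeta : Omega -> T0).
Hypothesis mzeta : measurable_fun setT zeta.

Let Z : {mfun Omega >-> T0} := HB.pack zeta (isMeasurableFun.Build _ _ _ _ _ mzeta).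

Lemma measurable_preimage e1 e2 (S1 : measurableType e1) (S2 : measurableType e2)
  (f : S1 -> S2) A : measurable_fun setT f -> measurable A ->
  measurable (f @^-1` A).
Proof. by move=> mf mA; rewrite -[X in measurable X]setTI; exact: mf. Qed.

(** Independence on rectangles identifies the law of [(zeta, D)] with a product measure; the rest is
    Tonelli. *)
Lemma ge0_integral_indep (D : Omega -> T1) (mu : probability T1 R)
    (f : T0 * T1 -> \bar R) : measurable_fun setT D ->
  (forall A U, measurable A -> measurable U ->
    P (zeta @^-1` A `&` D @^-1` U) = (P (zeta @^-1` A) * mu U)%E) ->
  measurable_fun setT f -> (forall x, 0 <= f x)%E ->
  (\int[P]_w f (zeta w, D w) = \int[P]_w \int[mu]_u f (zeta w, u))%E.
Proof.
move=> mD indep mf f0.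
have mZD : measurable_fun setT (fun w => (zeta w, D w)) by exact: measurable_fun_pair.
rewrite -[LHS](@ge0_integral_pushforward _ _ _ _ _ _ mZD P setT f)//.
rewrite (eq_measure_integral (distribution P Z \x mu)%E); last first.
  by move=> A mA _; apply/esym; apply: product_measure_unique.
rewrite fubini_tonelli1//.
rewrite (@ge0_integral_pushforward _ _ _ _ _ _ mzeta P setT)//.
- exact: measurable_fun_fubini_tonelli_F.
- by move=> x _; apply: integral_ge0.
Qed.

(** For fixed [V] both sides are finite measures in [A]. By uniqueness of product measures, each is
    the product of [mu1] with the law of [zeta] scaled by [mu2 V]. *)
Lemma indep_pair (D1 : Omega -> T1) (D2 : Omega -> T2)
    (mu1 : probability T1 R) (mu2 : probability T2 R) :
  measurable_fun setT D1 -> measurable_fun setT D2 ->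
  (forall A U V, measurable A -> measurable U -> measurable V ->
    P (zeta @^-1` A `&` D1 @^-1` U `&` D2 @^-1` V)
    = (P (zeta @^-1` A) * mu1 U * mu2 V)%E) ->
  forall A V, measurable A -> measurable V ->
  P ((fun w => (zeta w, D1 w)) @^-1` A `&` D2 @^-1` V)
  = (P ((fun w => (zeta w, D1 w)) @^-1` A) * mu2 V)%E.
Proof.
move=> mD1 mD2 indep A V mA mV.
have mZD : measurable_fun setT (fun w => (zeta w, D1 w)) by exact: measurable_fun_pair.
have mDV : measurable (D2 @^-1` V) by exact: measurable_preimage.
have c0 : 0 <= fine (mu2 V) by exact: fine_ge0.
have cE : ((fine (mu2 V))%:E = mu2 V)%E by rewrite fineK// fin_num_measure.
pose c := NngNum c0.
pose m1 : {measure set _ -> \bar R} := mscale c (distribution P Z).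
have indep1 B U : measurable B -> measurable U ->
    P (zeta @^-1` B `&` D1 @^-1` U) = (P (zeta @^-1` B) * mu1 U)%E.
  by move=> mB mU; have := indep B U setT mB mU measurableT;
    rewrite preimage_setT setIT probability_setT mule1.
pose XY : {mfun Omega >-> (T0 * T1)%type} :=
  HB.pack (fun w => (zeta w, D1 w)) (isMeasurableFun.Build _ _ _ _ _ mZD).
have E1 : ((mscale c (distribution P Z)) \x mu1)%E A =
    measure_function_pushforward__canonical__measure_function_Measure
      (measure_function_mrestr__canonical__measure_function_Measure P mDV) mZD A.
  apply: product_measure_unique => // B U mB mU.
  rewrite /= /pushforward /mrestr /= /mscale/= cE /distribution /pushforward.
  rewrite (_ : _ @^-1` (B `*` U) = zeta @^-1` B `&` D1 @^-1` U)//.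
  by rewrite indep// muleC muleA [X in (X * _)%E]muleC.
have E2 : ((mscale c (distribution P Z)) \x mu1)%E A =
    mscale c (distribution P XY) A.
  apply: product_measure_unique => // B U mB mU.
  rewrite /= /mscale/= cE /distribution /pushforward/=.
  rewrite (_ : _ @^-1` (B `*` U) = zeta @^-1` B `&` D1 @^-1` U)//.
  by rewrite indep1// muleA.
have := etrans (esym E1) E2.
by rewrite /= /mscale/= cE /pushforward /mrestr /distribution /pushforward/= muleC.
Qed.

End Independence.

Section Independence2.
Context {R : realType} {d d0 d1 d2 : measure_display}.
Context {Omega : measurableType d} {T0 : measurableType d0}.
Context {T1 : measurableType d1} {T2 : measurableType d2}.
Variables (P : probability Omega R) (zeta : Omega -> T0).
Hypothesis mzeta : measurable_fun setT zeta.

Lemma ge0_integral_indep2 (D1 : Omega -> T1) (D2 : Omega -> T2)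
    (mu1 : probability T1 R) (mu2 : probability T2 R)
    (f : T0 * T1 * T2 -> \bar R) :
  measurable_fun setT D1 -> measurable_fun setT D2 ->
  (forall A U V, measurable A -> measurable U -> measurable V ->
    P (zeta @^-1` A `&` D1 @^-1` U `&` D2 @^-1` V)
    = (P (zeta @^-1` A) * mu1 U * mu2 V)%E) ->
  measurable_fun setT f -> (forall x, 0 <= f x)%E ->
  (\int[P]_w f (zeta w, D1 w, D2 w)
   = \int[P]_w \int[mu1]_u \int[mu2]_v f (zeta w, u, v))%E.
Proof.
move=> mD1 mD2 indep mf f0.
have mZD : measurable_fun setT (fun w => (zeta w, D1 w)) by exact: measurable_fun_pair.
have indep1 B U : measurable B -> measurable U ->
    P (zeta @^-1` B `&` D1 @^-1` U) = (P (zeta @^-1` B) * mu1 U)%E.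
  by move=> mB mU; have := indep B U setT mB mU measurableT;
    rewrite preimage_setT setIT probability_setT mule1.
rewrite (ge0_integral_indep mZD mD2 (mu := mu2))//; last exact: indep_pair indep.
pose g (x : T0 * T1) := (\int[mu2]_v f (x, v))%E.
rewrite (ge0_integral_indep mzeta mD1 (mu := mu1) (f := g))//.
- exact: measurable_fun_fubini_tonelli_F.
- by move=> x; apply: integral_ge0.
Qed.

End Independence2.

Section BrownianStep.
Context {R : realType} {d : measure_display} {Omega : measurableType d}.
Variables (P : probability Omega R) (F : R -> set (set Omega)) (W B : R -> Omega -> R).
Hypotheses (hF : is_filtration F) (hWB : brownian2 P F W B).
Implicit Types (s t : R) (r x y a th : Omega -> R).

Lemma measurable_wrt_fun s r : 0 <= s -> measurable_wrt (F s) r ->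
  measurable_fun setT r.
Proof.
move=> s0 mr _ A mA; rewrite setTI.
by have [_ FM _] := hF; apply: (FM s s0); exact: mr.
Qed.

Lemma measurable_wrt_gen s r : measurable_wrt (F s) r ->
  measurable_fun [set: g_sigma_algebraType (F s)] (r : g_sigma_algebraType (F s) -> R).
Proof.
move=> mr _ A mA; rewrite setTI.
by apply: sub_sigma_algebra; exact: mr.
Qed.

Lemma measurable_W t : 0 <= t -> measurable_fun setT (W t).
Proof. by move=> t0; have [/(_ t t0)[mW _] _ _ _] := hWB; exact: measurable_wrt_fun mW. Qed.

Lemma measurable_B t : 0 <= t -> measurable_fun setT (B t).
Proof. by move=> t0; have [/(_ t t0)[_ mB] _ _ _] := hWB; exact: measurable_wrt_fun mB. Qed.

Let id_meas s : 0 <= s ->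
  measurable_fun setT (id : Omega -> g_sigma_algebraType (F s)).
Proof.
move=> s0 _ A mA; rewrite setTI preimage_id.
have [FS FM _] := hF; apply: (FM s s0).
by rewrite -(sigma_algebra_id (FS s s0)).
Qed.

(** Conditioning on [F s] without conditional expectations: [zeta] is the identity of [Omega], its
    target carrying the sigma-algebra [F s]. The integrand may thus depend on the past through any
    [F s]-measurable coefficients. *)
Lemma ge0_integral_increments s t (f : g_sigma_algebraType (F s) * measurableTypeR R * measurableTypeR R -> \bar R) :
  0 <= s -> s < t -> measurable_fun setT f -> (forall z, 0 <= f z)%E ->
  (\int[P]_w f (w, (W t w - W s w)%R, (B t w - B s w)%R)
   = \int[P]_w \int[normal_prob 0 (Num.sqrt (t - s)%R)]_u
       \int[normal_prob 0 (Num.sqrt (t - s)%R)]_v f (w, u, v))%E.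
Proof.
move=> s0 st mf f0.
have t0 : 0 <= t := le_trans s0 (ltW st).
pose g : probability (measurableTypeR R) R := normal_prob 0 (Num.sqrt (t - s)).
pose D1 : Omega -> measurableTypeR R := fun w => W t w - W s w.
pose D2 : Omega -> measurableTypeR R := fun w => B t w - B s w.
have mD1 : measurable_fun setT D1 by apply: measurable_funB; exact: measurable_W.
have mD2 : measurable_fun setT D2 by apply: measurable_funB; exact: measurable_B.
have := ge0_integral_indep2 (P := P) (id_meas s0) (mu1 := g) (mu2 := g) mD1 mD2.
move=> /(_ f); apply => //.
move=> A U V mA mU mV; rewrite preimage_id.
have [FS _ _] := hF; have [_ _ _ h] := hWB.
by apply: h => //; rewrite -(sigma_algebra_id (FS s s0)).
Qed.

Let mlift s r : measurable_wrt (F s) r ->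
  measurable_fun setT (fun z : g_sigma_algebraType (F s) * measurableTypeR R * measurableTypeR R => r z.1.1).
Proof.
move=> mr; apply: (measurableT_comp (measurable_wrt_gen mr)).
by apply: (measurableT_comp measurable_fst); exact: measurable_fst.
Qed.

Let mu1 s : measurable_fun setT (fun z : g_sigma_algebraType (F s) * measurableTypeR R * measurableTypeR R => z.1.2).
Proof. by apply: (measurableT_comp measurable_snd); exact: measurable_fst. Qed.

Let mcosR : measurable_fun setT (@cos R).
Proof. by apply: continuous_measurable_fun; exact: continuous_cos. Qed.

Let gauss_exp_affine (sg x c : R) : 0 < sg ->
  (\int[normal_prob 0 sg]_u (expR (x * u + c))%:E
   = (expR (c + x ^+ 2 * sg ^+ 2 / 2))%:E)%E.
Proof.
move=> sg0; under eq_integral do rewrite addrC expRD EFinM.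
rewrite ge0_integralZl//.
  by rewrite gauss_exp// -EFinM -expRD.
by apply/measurable_EFinP/measurableT_comp => //; exact: measurable_funM.
Qed.

Lemma ge0_integral_exp_increment s t r x : 0 <= s -> s <= t ->
  measurable_wrt (F s) r -> measurable_wrt (F s) x ->
  (\int[P]_w (expR (r w + x w * (W t w - W s w)))%:E
   = \int[P]_w (expR (r w + x w ^+ 2 * (t - s) / 2))%:E)%E.
Proof.
move=> s0; rewrite le_eqVlt => /predU1P[<-|st] mr mx.
  by apply: eq_integral => w _; rewrite !subrr !mulr0 mul0r.
have sg0 : 0 < Num.sqrt (t - s) by rewrite sqrtr_gt0 subr_gt0.
pose f (z : g_sigma_algebraType (F s) * measurableTypeR R * measurableTypeR R) := (expR (r z.1.1 + x z.1.1 * z.1.2))%:E.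
rewrite (ge0_integral_increments (f := f))//.
- apply: eq_integral => w _ /=; rewrite /f/=.
  under eq_integral do rewrite integral_cst// [X in (_ * X)%E]probability_setT mule1.
  under eq_integral do rewrite addrC.
  by rewrite gauss_exp_affine// sqr_sqrtr// subr_ge0 ltW.
- apply/measurable_EFinP/measurableT_comp => //.
  apply: measurable_funD; first exact: mlift.
  by apply: measurable_funM; [exact: mlift|exact: mu1].
- by move=> z; rewrite lee_fin expR_ge0.
Qed.

Lemma ge0_integral_expcos_increment s t r x y a th : 0 <= s -> s <= t ->
  measurable_wrt (F s) r -> measurable_wrt (F s) x -> measurable_wrt (F s) y ->
  measurable_wrt (F s) a -> measurable_wrt (F s) th ->
  (\int[P]_w (expR (r w + x w * (W t w - W s w)) *
      (1 + cos (th w + a w * (B t w - B s w) + y w * (W t w - W s w))))%:E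
   = \int[P]_w (expR (r w + x w ^+ 2 * (t - s) / 2)
      + expR (r w + (x w ^+ 2 - y w ^+ 2 - a w ^+ 2) * (t - s) / 2)
        * cos (th w + x w * y w * (t - s)))%:E)%E.
Proof.
move=> s0; rewrite le_eqVlt => /predU1P[<-|st] mr mx my ma mth.
  apply: eq_integral => w _; congr (_%:E).
  by rewrite !subrr !mulr0 !mul0r !addr0 mulrDr mulr1.
have sg0 : 0 < Num.sqrt (t - s) by rewrite sqrtr_gt0 subr_gt0.
have sg2 : Num.sqrt (t - s) ^+ 2 = t - s by rewrite sqr_sqrtr// subr_ge0 ltW.
pose f (z : g_sigma_algebraType (F s) * measurableTypeR R * measurableTypeR R) :=
  (expR (r z.1.1 + x z.1.1 * z.1.2) *
    (1 + cos (th z.1.1 + a z.1.1 * z.2 + y z.1.1 * z.1.2)))%:E.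
rewrite (ge0_integral_increments (f := f))//; last 2 first.
- apply/measurable_EFinP/measurable_funM.
    apply: measurableT_comp => //.
    apply: measurable_funD; first exact: mlift.
    by apply: measurable_funM; [exact: mlift|exact: mu1].
  apply: measurable_funD => //; apply: measurableT_comp => //.
  apply: measurable_funD.
    apply: measurable_funD; first exact: mlift.
    by apply: measurable_funM; [exact: mlift|exact: measurable_snd].
  by apply: measurable_funM; [exact: mlift|exact: mu1].
- by move=> z; rewrite lee_fin mulr_ge0 ?expR_ge0// -lerBlDl sub0r cos_geN1.
apply: eq_integral => w _; rewrite /f/=.
set rw := r w; set xw := x w; set yw := y w; set aw := a w; set tw := th w.
(* Integrating out the increment of [B] damps only the cosine, by [k <= 1]. The result is split as
   [(1 - k) e + k e (1 + cos)], a sum of nonnegative terms to which the Gaussian formulas for [W]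
   apply. *)
set k := expR (- aw ^+ 2 * (t - s) / 2).
have k1 : k <= 1.
  rewrite -expR0 ler_expR mulNr mulNr oppr_le0 divr_ge0// mulr_ge0 ?sqr_ge0//.
  by rewrite subr_ge0 ltW.
have inner u : (\int[normal_prob 0 (Num.sqrt (t - s))]_v
    (expR (rw + xw * u) * (1 + cos (tw + aw * v + yw * u)))%:E
    = ((1 - k) * expR (xw * u + rw))%:E
      + (k * (expR (xw * u + rw) * (1 + cos (yw * u + tw))))%:E)%E.
  have := gauss_exp_cos_ge0 sg0 0 aw (rw + xw * u) (tw + yw * u).
  rewrite sg2 expr0n/= !mul0r !addr0 sub0r mulr0 mul0r addr0 -/k => E.
  transitivity (expR (rw + xw * u) + expR (rw + xw * u + - aw ^+ 2 * (t - s) / 2)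
    * cos (tw + yw * u))%:E.
    rewrite -E; apply: eq_integral => v _; congr (_%:E).
    by rewrite mul0r add0r; congr (_ * (1 + cos _)); ring.
  rewrite -EFinD; congr (_%:E); rewrite [in X in _ + X * _]expRD -/k.
  by rewrite (addrC rw) (addrC tw); ring.
under eq_integral do rewrite inner.
have mE : measurable_fun setT (fun u : R => expR (xw * u + rw)).
  by apply: measurableT_comp => //; apply: measurable_funD => //; exact: measurable_funM.
have mC : measurable_fun setT (fun u : R => expR (xw * u + rw) * (1 + cos (yw * u + tw))).
  apply: measurable_funM => //; apply: measurable_funD => //.
  by apply: measurableT_comp => //; apply: measurable_funD => //; exact: measurable_funM.
have C0 u : 0 <= expR (xw * u + rw) * (1 + cos (yw * u + tw)).
  by rewrite mulr_ge0 ?expR_ge0// -lerBlDl sub0r cos_geN1.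
rewrite ge0_integralD//; last 4 first.
- by move=> u _; rewrite lee_fin mulr_ge0 ?expR_ge0// subr_ge0.
- by apply/measurable_EFinP; exact: measurable_funM.
- by move=> u _; rewrite lee_fin mulr_ge0 ?expR_ge0.
- by apply/measurable_EFinP; exact: measurable_funM.
under eq_integral do rewrite EFinM.
under [X in (_ + X)%E]eq_integral do rewrite EFinM.
rewrite !ge0_integralZl//; try exact/measurable_EFinP; last 2 first.
- by rewrite lee_fin expR_ge0.
- by rewrite lee_fin subr_ge0.
rewrite gauss_exp_cos_ge0// gauss_exp_affine// sg2.
rewrite -!EFinM -EFinD; congr (_%:E).
have -> : rw + (xw ^+ 2 - yw ^+ 2 - aw ^+ 2) * (t - s) / 2 =
  - aw ^+ 2 * (t - s) / 2 + (rw + (xw ^+ 2 - yw ^+ 2) * (t - s) / 2) by field.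
by rewrite (expRD (- aw ^+ 2 * (t - s) / 2)) -/k (mulrC yw); ring.
Qed.

End BrownianStep.

Section MeasurableWrt.
Context {R : realType} {d : measure_display} {Omega : measurableType d}.
Variables (F : R -> set (set Omega)).
Hypothesis hF : is_filtration F.

Lemma measurable_wrtP s (r : Omega -> R) : 0 <= s -> measurable_wrt (F s) r <->
  measurable_fun [set: g_sigma_algebraType (F s)] (r : g_sigma_algebraType (F s) -> R).
Proof.
move=> s0; split; first exact: measurable_wrt_gen.
move=> mr A mA; have [FS _ _] := hF.
rewrite -(sigma_algebra_id (FS s s0)).
by have := mr measurableT A mA; rewrite setTI.
Qed.

Lemma measurable_wrt_le s t (r : Omega -> R) : 0 <= s -> s <= t ->
  measurable_wrt (F s) r -> measurable_wrt (F t) r.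
Proof. by move=> s0 st mr A mA; have [_ _ FM] := hF; apply: (FM s t) => //; exact: mr. Qed.

End MeasurableWrt.

(** * Exponential martingales *)

Section ExponentialMartingale.
Context {R : realType} {d : measure_display} {Omega : measurableType d}.
Variables (P : probability Omega R) (F : R -> set (set Omega)) (W B : R -> Omega -> R).
Hypotheses (hF : is_filtration F) (hWB : brownian2 P F W B).
Variables (tau : nat -> R) (a x y : nat -> Omega -> R).
Hypotheses (tau0 : 0 <= tau 0) (tauS : forall k, tau k <= tau k.+1).
Hypotheses (ma : forall k, measurable_wrt (F (tau k)) (a k))
  (mx : forall k, measurable_wrt (F (tau k)) (x k))
  (my : forall k, measurable_wrt (F (tau k)) (y k)).

(* [expo_re k] and [expo_im k] are the real and imaginary parts of M - <M>/2
   for the complex martingale with increments (x + iy) dW + i a dB. *)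
Definition expo_re k w : R := \sum_(i < k)
  (x i w * (W (tau i.+1) w - W (tau i) w)
   - (x i w ^+ 2 - y i w ^+ 2 - a i w ^+ 2) * (tau i.+1 - tau i) / 2).

Definition expo_im k w : R := \sum_(i < k)
  (a i w * (B (tau i.+1) w - B (tau i) w) + y i w * (W (tau i.+1) w - W (tau i) w)
   - x i w * y i w * (tau i.+1 - tau i)).

(** Sum of the brackets of the real and imaginary martingales: exactly what must be subtracted from
    [2 * expo_re] to leave the exponent of a real exponential martingale. *)
Definition expo_qv k w : R := \sum_(i < k)
  (a i w ^+ 2 + x i w ^+ 2 + y i w ^+ 2) * (tau i.+1 - tau i).

Lemma tau_ge0 k : 0 <= tau k.
Proof. by elim: k => // k; move/le_trans; apply. Qed.

Lemma tau_le i k : (i <= k)%N -> tau i <= tau k.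
Proof.
elim: k => [|k IH]; first by rewrite leqn0 => /eqP ->.
by rewrite leq_eqVlt => /predU1P[->//|]; rewrite ltnS => /IH /le_trans; apply.
Qed.

Let T k := g_sigma_algebraType (F (tau k)).

Let lift i k (r : Omega -> R) : (i <= k)%N -> measurable_wrt (F (tau i)) r ->
  measurable_fun [set: T k] (r : T k -> R).
Proof.
move=> ik mr; apply/(measurable_wrtP hF) => //; first exact: tau_ge0.
by apply: (measurable_wrt_le hF) mr; [exact: tau_ge0|exact: tau_le].
Qed.

Let mW i k : (i <= k)%N -> measurable_fun [set: T k] (W (tau i) : T k -> R).
Proof.
by move=> ik; apply: lift ik _; have [h _ _ _] := hWB; have [] := h _ (tau_ge0 i).
Qed.

Let mB i k : (i <= k)%N -> measurable_fun [set: T k] (B (tau i) : T k -> R).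
Proof.
by move=> ik; apply: lift ik _; have [h _ _ _] := hWB; have [] := h _ (tau_ge0 i).
Qed.

Lemma measurable_expo_re k : measurable_fun [set: T k] (expo_re k : T k -> R).
Proof.
apply: measurable_sum => i; have ik := ltnW (ltn_ord i).
apply: measurable_funB.
  apply: measurable_funM; first exact: lift (mx i).
  by apply: measurable_funB; exact: mW.
apply: measurable_funM => //; apply: measurable_funM => //.
apply: measurable_funB; last by apply: measurable_funX; exact: lift (ma i).
by apply: measurable_funB; apply: measurable_funX; [exact: lift (mx i)|exact: lift (my i)].
Qed.

Lemma measurable_expo_im k : measurable_fun [set: T k] (expo_im k : T k -> R).
Proof.
apply: measurable_sum => i; have ik := ltnW (ltn_ord i).
apply: measurable_funB.
  apply: measurable_funD; apply: measurable_funM.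
  - exact: lift (ma i).
  - by apply: measurable_funB; exact: mB.
  - exact: lift (my i).
  - by apply: measurable_funB; exact: mW.
apply: measurable_funM => //.
by apply: measurable_funM; [exact: lift (mx i)|exact: lift (my i)].
Qed.

(** The bracket is predictable: its value at [k.+1] is already known at time [tau k]. The truncation
    further down relies on this shift of index. *)
Lemma measurable_expo_qvS k : measurable_fun [set: T k] (expo_qv k.+1 : T k -> R).
Proof.
apply: measurable_sum => i; have ik : (i <= k)%N by rewrite -ltnS.
apply: measurable_funM => //; apply: measurable_funD.
  by apply: measurable_funD; apply: measurable_funX; [exact: lift (ma i)|exact: lift (mx i)].
by apply: measurable_funX; exact: lift (my i).
Qed.

Let wrt k (r : Omega -> R) : measurable_fun [set: T k] (r : T k -> R) ->
  measurable_wrt (F (tau k)) r.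
Proof. by move=> mr; apply/(measurable_wrtP hF) => //; exact: tau_ge0. Qed.

Let la k : measurable_fun [set: T k] (a k : T k -> R). Proof. exact: lift (ma k). Qed.
Let lx k : measurable_fun [set: T k] (x k : T k -> R). Proof. exact: lift (mx k). Qed.
Let ly k : measurable_fun [set: T k] (y k : T k -> R). Proof. exact: lift (my k). Qed.

Lemma expo_second_moment k :
  (\int[P]_w (expR (2 * expo_re k w - expo_qv k w))%:E = 1)%E.
Proof.
elim: k => [|k IH].
  under eq_integral do rewrite /expo_re /expo_qv !big_ord0 mulr0 subrr expR0.
  by rewrite integral_cst// mul1e [LHS]probability_setT.
pose r w := 2 * expo_re k w
  - (x k w ^+ 2 - y k w ^+ 2 - a k w ^+ 2) * (tau k.+1 - tau k) - expo_qv k.+1 w.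
transitivity (\int[P]_w (expR (r w + 2 * x k w * (W (tau k.+1) w - W (tau k) w)))%:E)%E.
  apply: eq_integral => w _; congr (expR _)%:E.
  by rewrite /r /expo_re big_ord_recr/=; field.
rewrite (ge0_integral_exp_increment hF hWB (x := fun w => 2 * x k w))//.
- rewrite -IH; apply: eq_integral => w _; congr (expR _)%:E.
  by rewrite /r /expo_qv big_ord_recr/=; field.
- exact: tau_ge0.
- apply: wrt; apply: measurable_funB; last exact: measurable_expo_qvS.
  apply: measurable_funB; first by apply: measurable_funM => //; exact: measurable_expo_re.
  apply: measurable_funM => //; apply: measurable_funB; last exact: measurable_funX.
  by apply: measurable_funB; exact: measurable_funX.
- by apply: wrt; exact: measurable_funM.
Qed.

Variable (K : R).
Hypothesis qvK : forall k w, expo_qv k w <= K.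

Let measT k (r : Omega -> R) : measurable_fun [set: T k] (r : T k -> R) ->
  measurable_fun setT r.
Proof. by move/wrt; apply: measurable_wrt_fun => //; exact: tau_ge0. Qed.

Lemma measurableT_expo_re k : measurable_fun setT (expo_re k).
Proof. by apply: (@measT k); exact: measurable_expo_re. Qed.

Lemma measurableT_expo_im k : measurable_fun setT (expo_im k).
Proof. by apply: (@measT k); exact: measurable_expo_im. Qed.

Lemma expo_second_moment_le k :
  (\int[P]_w (expR (2 * expo_re k w))%:E <= (expR K)%:E)%E.
Proof.
have mqv : measurable_fun setT (expo_qv k).
  case: k => [|k]; last by apply: (@measT k); exact: measurable_expo_qvS.
  by rewrite (_ : expo_qv 0 = cst 0)//; apply/funext => w; rewrite /expo_qv big_ord0.
have mre := measurableT_expo_re k.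
apply: (@le_trans _ _ (\int[P]_w ((expR K)%:E * (expR (2 * expo_re k w - expo_qv k w))%:E))%E).
  apply: ge0_le_integral => //.
  - by apply/measurable_EFinP/measurableT_comp => //; exact: measurable_funM.
  - apply/measurable_EFinP; apply: measurable_funM => //; apply: measurableT_comp => //.
    by apply: measurable_funB => //; exact: measurable_funM.
  - move=> w _; rewrite -EFinM lee_fin -expRD ler_expR.
    by have := qvK k w; lra.
rewrite ge0_integralZl//.
- by rewrite expo_second_moment mule1.
- apply/measurable_EFinP; apply: measurableT_comp => //.
  by apply: measurable_funB => //; exact: measurable_funM.
Qed.

Lemma expo_integrable k : P.-integrable setT (EFin \o (fun w => expR (expo_re k w))).
Proof.
have mre := measurableT_expo_re k.
have i2 : P.-integrable setT (EFin \o (fun w => expR (2 * expo_re k w))).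
  apply/integrableP; split.
    by apply/measurable_EFinP/measurableT_comp => //; exact: measurable_funM.
  under eq_integral do rewrite /= ger0_norm ?expR_ge0//.
  by rewrite (le_lt_trans (expo_second_moment_le k))// ltry.
have i3 : P.-integrable setT (EFin \o (fun w => 1 + expR (2 * expo_re k w))).
  by apply: integrable_EFinD => //; exact: finite_measure_integrable_cst.
apply: le_integrable i3 => //.
  by apply/measurable_EFinP/measurableT_comp.
move=> w _ /=; rewrite lee_fin !ger0_norm ?addr_ge0 ?expR_ge0//.
rewrite (_ : 2 * expo_re k w = expo_re k w + expo_re k w); last by ring.
by rewrite expRD; have := sqr_ge0 (expR (expo_re k w) - 1); nra.
Qed.

Lemma expo_cos_integrable k th :
  P.-integrable setT (EFin \o (fun w => expR (expo_re k w) * cos (th + expo_im k w))).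
Proof.
have mre := measurableT_expo_re k; have mim := measurableT_expo_im k.
apply: le_integrable (expo_integrable k) => //.
  apply/measurable_EFinP; apply: measurable_funM; first exact: measurableT_comp.
  apply: measurableT_comp; last exact: measurable_funD.
  by apply: continuous_measurable_fun; exact: continuous_cos.
by move=> w _ /=; rewrite lee_fin normrM ler_piMr//; exact: cos_max.
Qed.

(** The conditioning formulas are for nonnegative integrands, so one step is taken with [1 + cos].
    The integral of the pure exponential, equal to that of [expR (e w)], is then cancelled on both
    sides; the bound on [expo_qv] makes it finite. *)
Lemma expo_martingale k th :
  (\int[P]_w (expR (expo_re k w) * cos (th + expo_im k w))%:E = (cos th)%:E)%E.
Proof.
elim: k => [|k IH].
  under eq_integral do rewrite /expo_re /expo_im !big_ord0 addr0 expR0 mul1r.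
  by rewrite integral_cst// [X in (_ * X)%E]probability_setT mule1.
rewrite -IH.
have mre := @measurable_expo_re k; have mim := @measurable_expo_im k.
pose r w := expo_re k w - (x k w ^+ 2 - y k w ^+ 2 - a k w ^+ 2) * (tau k.+1 - tau k) / 2.
pose t w := th + expo_im k w - x k w * y k w * (tau k.+1 - tau k).
have mr : measurable_wrt (F (tau k)) r.
  apply: wrt; apply: measurable_funB => //; apply: measurable_funM => //.
  apply: measurable_funM => //; apply: measurable_funB; last exact: measurable_funX.
  by apply: measurable_funB; exact: measurable_funX.
have mt : measurable_wrt (F (tau k)) t.
  apply: wrt; apply: measurable_funB; first exact: measurable_funD.
  by apply: measurable_funM => //; exact: measurable_funM.
pose e w := expo_re k w + (y k w ^+ 2 + a k w ^+ 2) * (tau k.+1 - tau k) / 2.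
have E1 : (\int[P]_w (expR (expo_re k.+1 w))%:E = \int[P]_w (expR (e w))%:E)%E.
  transitivity (\int[P]_w (expR (r w + x k w * (W (tau k.+1) w - W (tau k) w)))%:E)%E.
    apply: eq_integral => w _; congr (expR _)%:E.
    by rewrite /r /expo_re big_ord_recr/=; field.
  rewrite (ge0_integral_exp_increment hF hWB (r := r) (x := x k) (tau_ge0 k))//.
  by apply: eq_integral => w _; congr (expR _)%:E; rewrite /r /e; field.
have E2 : (\int[P]_w (expR (expo_re k.+1 w) * (1 + cos (th + expo_im k.+1 w)))%:E
    = \int[P]_w (expR (e w) + expR (expo_re k w) * cos (th + expo_im k w))%:E)%E.
  transitivity (\int[P]_w (expR (r w + x k w * (W (tau k.+1) w - W (tau k) w)) *
      (1 + cos (t w + a k w * (B (tau k.+1) w - B (tau k) w)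
        + y k w * (W (tau k.+1) w - W (tau k) w))))%:E)%E.
    apply: eq_integral => w _; congr (_%:E).
    by congr (expR _ * (1 + cos _)); rewrite /r /t /expo_re /expo_im big_ord_recr/=; field.
  rewrite (ge0_integral_expcos_increment hF hWB)//; last exact: tau_ge0.
  apply: eq_integral => w _; congr (_%:E).
  by congr (expR _ + expR _ * cos _); rewrite /r /e /t; field.
have i1 := expo_integrable k.+1; have i2 := expo_cos_integrable k.+1 th.
have i3 := expo_cos_integrable k th.
have i4 : P.-integrable setT (EFin \o (fun w => expR (e w))).
  have me : measurable_fun setT e.
    apply: (@measT k); apply: measurable_funD => //; apply: measurable_funM => //.
    by apply: measurable_funM => //; apply: measurable_funD; exact: measurable_funX.
  apply/integrableP; split; first by apply/measurable_EFinP/measurableT_comp.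
  under eq_integral do rewrite /= ger0_norm ?expR_ge0//.
  rewrite -E1; case/integrableP : i1 => _.
  by under eq_integral do rewrite /= ger0_norm ?expR_ge0//.
move: E2; under eq_integral do rewrite mulrDr mulr1 EFinD.
rewrite integralD_EFin// integralD_EFin// E1.
have fe := integrable_fin_num measurableT i4.
have f2 := integrable_fin_num measurableT i2.
have f3 := integrable_fin_num measurableT i3.
set A := (\int[P]_w (expR (e w))%:E)%E in fe *.
set X := (\int[P]_w _)%E; set Y := (\int[P]_w _)%E.
move=> AXY; have {}AXY : (A + X = A + Y)%E by exact: AXY.
move: AXY => /(congr1 (fun z => z - A)%E).
by rewrite (addeC A X) (addeC A Y) (addeK _ fe) (addeK _ fe).
Qed.

End ExponentialMartingale.

(** * Time grids *)

Section Grid.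
Context {R : realType}.
Variables (tau : nat -> R).
Hypothesis tauS : forall k, tau k <= tau k.+1.
Implicit Types (a b s : R) (g : R -> R).
Local Notation mu := (@lebesgue_measure R).

(** No open cell of the grid contains [a]. This form avoids naming an index for [a] and tolerates
    repeated grid values. *)
Definition grid_point a := forall k, a <= tau k \/ tau k.+1 <= a.

Lemma grid_point_min a b : grid_point a -> grid_point b -> grid_point (Num.min a b).
Proof.
move=> ha hb k; rewrite minEle; case: ifP => ab; [exact: ha|exact: hb].
Qed.

Lemma grid_tau_le i k : (i <= k)%N -> tau i <= tau k.
Proof.
elim: k => [|k IH]; first by rewrite leqn0 => /eqP ->.
by rewrite leq_eqVlt => /predU1P[->//|]; rewrite ltnS => /IH /le_trans; apply.
Qed.

Lemma grid_lt a k : grid_point a -> a < tau k.+1 -> a <= tau k.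
Proof. by move=> /(_ k)[//|h]; rewrite ltNge h. Qed.

(** Clipping every [tau k] to [[a, b]] gives a telescoping sum; as [a] and [b] are grid points, the
    clipping either keeps a cell whole or collapses it. *)
Lemma grid_telescope a b g L : grid_point a -> grid_point b -> a <= b ->
  tau 0 <= a -> b <= tau L ->
  \sum_(k < L) (a < tau k.+1 <= b)%R%:R * (g (tau k.+1) - g (tau k)) = g b - g a.
Proof.
move=> ga gb ab t0a bL.
pose clip t := Num.min (Num.max t a) b.
have clip_telescope n : \sum_(k < n) (g (clip (tau k.+1)) - g (clip (tau k))) =
    g (clip (tau n)) - g (clip (tau 0)).
  elim: n => [|n IH]; first by rewrite big_ord0 subrr.
  by rewrite big_ord_recr/= IH; ring.
rewrite (_ : g b - g a = g (clip (tau L)) - g (clip (tau 0))); last first.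
  rewrite /clip (max_idPl (le_trans ab bL)) (min_idPr bL) (max_idPr t0a).
  by rewrite (min_idPl ab).
rewrite -clip_telescope; apply: eq_bigr => k _; rewrite /clip.
have [ka|ka] := leP (tau k.+1) a.
  have ka' := le_trans (tauS k) ka.
  by rewrite mul0r (max_idPr ka') subrr.
have ak := grid_lt ga ka.
rewrite (max_idPl ak).
have [kb|kb] := leP (tau k.+1) b.
  by rewrite mul1r (min_idPl (le_trans (tauS k) kb)).
by rewrite mul0r (min_idPr (grid_lt gb kb)) subrr.
Qed.

Lemma grid_step_telescope a b s g L : grid_point a -> grid_point b -> grid_point s ->
  a <= b -> tau 0 <= a -> tau 0 <= s -> b <= tau L ->
  g (Num.min b s) - g (Num.min a s) =
  \sum_(k < L) (a < tau k.+1 <= b)%R%:R * (tau k.+1 <= s)%R%:R * (g (tau k.+1) - g (tau k)).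
Proof.
move=> ga gb gs ab t0a t0s bL.
rewrite -(@grid_telescope _ _ g L); last 5 first.
- exact: grid_point_min.
- exact: grid_point_min.
- by rewrite le_min ge_min ab/= ge_min lexx orbT.
- by rewrite le_min t0a t0s.
- by rewrite ge_min bL.
apply: eq_bigr => k _; congr (_ * _); rewrite -natrM mulnb.
congr (_%:R); congr nat_of_bool; rewrite gt_min le_min.
have [sk|sk] := leP (tau k.+1) s; rewrite ?andbF ?andbT//= ?orbF.
by have [] := ltP s (tau k.+1) => //; rewrite ltNge sk.
Qed.

Definition cell_constant (phi : R -> R) :=
  forall k s, tau k < s -> s <= tau k.+1 -> phi s = phi (tau k.+1).

Lemma cell_constant_lt_le a b : grid_point a -> grid_point b ->
  cell_constant (fun s => \1_`]a, b] s).
Proof.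
move=> ga gb k s ks sk; rewrite !indicE !mem_setE !in_itv/=; congr (_%:R).
congr (nat_of_bool (_ && _)).
  apply/idP/idP => [as_|ak]; first exact: lt_le_trans sk.
  by apply: le_lt_trans ks; exact: grid_lt.
apply/idP/idP => [sb|]; last exact: le_trans.
by rewrite leNgt; apply/negP => /(grid_lt gb) bk; move: sb; rewrite leNgt (le_lt_trans bk).
Qed.

Lemma integrable_cst_set (A : set R) r : measurable A -> (mu A < +oo)%E ->
  mu.-integrable A (EFin \o cst r).
Proof.
move=> mA A_fin; apply: measurable_bounded_integrable => //.
by exists `|r|; split; [exact: num_real|move=> M /ltW rM s _].
Qed.

Lemma measure_itv_fin (b1 b2 : bool) (a b : R) :
  (mu [set` Interval (BSide b1 a) (BSide b2 b)] < +oo)%E.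
Proof. by rewrite lebesgue_measure_itv/=; case: ifP; rewrite ?ltry// -EFinB ltry. Qed.

Lemma cell_constant_integral phi L : cell_constant phi ->
  mu.-integrable `[tau 0, tau L] (EFin \o phi) /\
  \int[mu]_(s in `[tau 0, tau L]) phi s =
  \sum_(k < L) phi (tau k.+1) * (tau k.+1 - tau k).
Proof.
move=> phic; elim: L => [|L [IH1 IH2]].
  rewrite big_ord0 set_itv1; split; last by rewrite Rintegral_set1.
  apply: null_set_integrable => //; last exact: lebesgue_measure_set1.
  by apply/measurable_EFinP; exact: measurable_fun_set1.
have tL := tauS L.
have t0L : tau 0 <= tau L by exact: grid_tau_le.
have itvE : `[tau 0, tau L.+1]%classic = `[tau 0, tau L]%classic `|` `]tau L, tau L.+1]%classic.
  by rewrite -itv_bndbnd_setU// bnd_simp.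
have i2 : mu.-integrable `]tau L, tau L.+1] (EFin \o phi).
  apply: (@eq_integrable _ _ _ mu _ _ (EFin \o cst (phi (tau L.+1)))) => //.
    by move=> s; rewrite inE/= in_itv/= => /andP[s1 s2]; rewrite (phic L s).
  by apply: integrable_cst_set => //; exact: measure_itv_fin.
have dis : [disjoint `[tau 0, tau L]%classic & `]tau L, tau L.+1]%classic].
  apply/disj_setPS => s []/=; rewrite !in_itv/= => /andP[_ s1] /andP[s2 _].
  by move: s2; rewrite ltNge s1.
have i12 : mu.-integrable (`[tau 0, tau L] `|` `]tau L, tau L.+1]) (EFin \o phi).
  have [m1 f1] := integrableP _ _ _ IH1; have [m2 f2] := integrableP _ _ _ i2.
  apply/integrableP; split; first exact/measurable_funU.
  rewrite ge0_integral_setU//; first exact: lte_add_pinfty.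
  by apply: measurableT_comp => //; exact/measurable_funU.
rewrite itvE; split => //.
rewrite Rintegral_setU//.
rewrite IH2 big_ord_recr/=; congr (_ + _).
rewrite (@eq_Rintegral _ _ _ mu _ (cst (phi (tau L.+1)))); last first.
  by move=> s; rewrite inE/= in_itv/= => /andP[s1 s2]; rewrite (phic L s).
transitivity (phi (tau L.+1) * fine (mu `]tau L, tau L.+1])); first exact: Rintegral_cst.
rewrite lebesgue_measure_itv/= lte_fin.
case: ltP => [_|h]; first by rewrite -EFinB.
by rewrite (le_anti (_ : tau L <= tau L.+1 <= tau L)) ?tL// subrr.
Qed.

End Grid.

Section GridOfSeq.
Context {R : realType}.

Lemma grid_of_seq (l : seq R) (T : R) : 0 <= T -> (forall t, t \in l -> 0 <= t <= T) ->
  exists (tau : nat -> R) (L : nat), [/\ forall k, tau k <= tau k.+1,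
    tau 0 = 0, tau L = T, forall k, (L <= k)%N -> tau k = T &
    forall t, t \in l -> grid_point tau t].
Proof.
move=> T0 lT.
pose s := sort <=%R (0 :: l).
have sT t : t \in s -> 0 <= t <= T.
  by rewrite mem_sort inE => /predU1P[->|/lT//]; rewrite lexx T0.
have ss : sorted <=%R s by apply: sort_sorted; exact: le_total.
have s_gt0 : (0 < size s)%N by rewrite size_sort.
(* The default value [T] continues the sorted list, so [tau] is nondecreasing on all of [nat] and
   equals [T] from index [size s] on. *)
pose tau k := nth T s k.
have tau_def k : (size s <= k)%N -> tau k = T by move=> h; rewrite /tau nth_default.
have tauS k : tau k <= tau k.+1.
  have [h|h] := leqP (size s) k.+1.
    rewrite (tau_def _ h); have [k1|k1] := leqP (size s) k; first by rewrite tau_def.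
    by have /andP[] := sT _ (mem_nth T k1).
  by rewrite /tau; apply: (sorted_leq_nth le_trans le_refl) => //; rewrite inE// ltnW.
exists tau, (size s); split => //.
- have /(nthP T)[i ilt iE] : 0 \in s by rewrite mem_sort inE eqxx.
  apply/eqP; rewrite eq_le -[X in _ <= X]iE grid_tau_le//=.
  by have /andP[] := sT _ (mem_nth T s_gt0).
- by rewrite tau_def.
- move=> t tl k.
  have /(nthP T)[i ilt iE] : t \in s by rewrite mem_sort inE tl orbT.
  rewrite -iE -/(tau i); have [ik|ik] := leqP i k; first by left; exact: grid_tau_le.
  by right; exact: grid_tau_le.
Qed.

End GridOfSeq.

Section StepOnGrid.
Context {R : realType} {d : measure_display} {Omega : measurableType d}.
Variables (tau : nat -> R) (L : nat) (T : R).
Hypotheses (tauS : forall k, tau k <= tau k.+1) (tau0 : tau 0 = 0) (tauL : tau L = T).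
Variable H : step_process (R := R) (Omega := Omega).
Hypothesis Hmono : forall i, (i < sp_size H)%N -> sp_time H i <= sp_time H i.+1.
Hypothesis H0T : forall i, (i <= sp_size H)%N -> 0 <= sp_time H i <= T.
Hypothesis Hgrid : forall i, (i <= sp_size H)%N -> grid_point tau (sp_time H i).
Implicit Types (s t : R) (w : Omega).

Lemma step_eval_indic s w : step_eval H s w =
  \sum_(i < sp_size H) sp_val H i w * (sp_time H i < s <= sp_time H i.+1)%R%:R.
Proof.
by apply: eq_bigr => i _; rewrite indicE mem_setE in_itv.
Qed.

Lemma step_eval_cell_constant w : cell_constant tau (step_eval H ^~ w).
Proof.
move=> k s ks sk; apply: eq_bigr => i _; congr (_ * _).
by apply: (cell_constant_lt_le (tau := tau)) ks sk; apply: Hgrid => //; exact: ltnW.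
Qed.

Lemma step_integralE (W : R -> Omega -> R) s w : grid_point tau s -> 0 <= s ->
  step_integral W H s w = \sum_(k < L) step_eval H (tau k.+1) w *
    (tau k.+1 <= s)%R%:R * (W (tau k.+1) w - W (tau k) w).
Proof.
move=> gs s0; rewrite /step_integral.
transitivity (\sum_(i < sp_size H) \sum_(k < L) sp_val H i w *
    ((sp_time H i < tau k.+1 <= sp_time H i.+1)%R%:R * (tau k.+1 <= s)%R%:R
     * (W (tau k.+1) w - W (tau k) w))).
  apply: eq_bigr => i _; rewrite -mulr_sumr; congr (_ * _).
  have il := ltn_ord i.
  apply: (grid_step_telescope tauS (W ^~ w)) => //.
  - exact: Hgrid (ltnW il).
  - exact: Hgrid.
  - exact: Hmono.
  - by rewrite tau0; have /andP[] := H0T (ltnW il).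
  - by rewrite tau0.
  - by rewrite tauL; have /andP[] := H0T il.
rewrite exchange_big/=; apply: eq_bigr => k _.
rewrite step_eval_indic 2!mulr_suml; apply: eq_bigr => i _.
by rewrite !mulrA.
Qed.

(** Step times are grid points, so [sp_time H i < tau k.+1] implies [sp_time H i <= tau k]: the
    value on a cell is known at its left end. *)
Lemma measurable_wrt_step_eval (F : R -> set (set Omega)) k : is_filtration F ->
  (forall i, (i < sp_size H)%N -> measurable_wrt (F (sp_time H i)) (sp_val H i)) ->
  measurable_wrt (F (tau k)) (step_eval H (tau k.+1)).
Proof.
move=> hF mH.
have tk0 : 0 <= tau k by rewrite -tau0 grid_tau_le.
apply/(measurable_wrtP hF) => //.
rewrite (_ : step_eval H (tau k.+1) = fun w => \sum_(i < sp_size H)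
   sp_val H i w * (sp_time H i < tau k.+1 <= sp_time H i.+1)%R%:R); last first.
  by apply/funext => w; rewrite step_eval_indic.
apply: measurable_sum => i; have il := ltn_ord i.
have [it|it] := ltP (sp_time H i) (tau k.+1); last first.
  by under eq_fun do rewrite mulr0; exact: measurable_cst.
apply: measurable_funM => //.
apply/(measurable_wrtP hF) => //.
have /andP[t0 _] := H0T (ltnW il).
apply: (measurable_wrt_le hF t0) (mH _ il).
by apply: grid_lt it; exact: Hgrid (ltnW il).
Qed.

End StepOnGrid.

Section RintegralSum.
Context {R : realType} {d : measure_display} {T : measurableType d}.
Variables (mu : {measure set T -> \bar R}) (D : set T).
Hypothesis mD : measurable D.

Lemma Rintegral_sum (n : nat) (f : nat -> T -> R) :
  (forall j, (j < n)%N -> mu.-integrable D (EFin \o f j)) ->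
  mu.-integrable D (EFin \o (fun s => \sum_(j < n) f j s)) /\
  \int[mu]_(s in D) (\sum_(j < n) f j s) = \sum_(j < n) \int[mu]_(s in D) f j s.
Proof.
elim: n => [|n IH] fi.
  rewrite big_ord0; split.
    rewrite (_ : EFin \o _ = cst 0%E); first exact: integrable0.
    by apply/funext => s /=; rewrite big_ord0.
  under eq_Rintegral do rewrite big_ord0.
  by rewrite Rintegral_cst// mul0r.
have [IH1 IH2] := IH (fun j jn => fi j (ltnW jn)).
have fn := fi n (ltnSn n).
have -> : (fun s => \sum_(j < n.+1) f j s) = (fun s => \sum_(j < n) f j s + f n s).
  by apply/funext => s; rewrite big_ord_recr.
by split; [exact: (integrableD mD IH1 fn)|rewrite RintegralD// IH2 big_ord_recr].
Qed.

End RintegralSum.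

(** * The coarse mesh of step T / m, which carries the Riccati coefficients *)

Section Coarse.
Context {R : realType}.
Local Notation mu := (@lebesgue_measure R).
Variables (T : R) (m : nat).
Hypotheses (T0 : 0 < T) (m0 : (0 < m)%N).
Implicit Types (v : nat -> R) (s : R).

Definition mesh (j : nat) : R := j%:R * (T / m%:R).

Definition coarse_fun v s : R := \sum_(j < m) v j * (mesh j < s <= mesh j.+1)%R%:R.

Local Notation coarse := coarse_fun.

Let h0 : 0 < T / m%:R. Proof. by rewrite divr_gt0// ltr0n. Qed.

Lemma mesh0 : mesh 0 = 0. Proof. by rewrite /mesh mul0r. Qed.

Lemma meshm : mesh m = T.
Proof. by rewrite /mesh mulrC divfK// pnatr_eq0 -lt0n. Qed.

Lemma mesh_le i j : (i <= j)%N -> mesh i <= mesh j.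
Proof. by move=> ij; rewrite /mesh ler_wpM2r ?(ltW h0)// ler_nat. Qed.

Lemma mesh_ge0 j : 0 <= mesh j.
Proof. by rewrite /mesh mulr_ge0// ltW. Qed.

Lemma mesh_leT j : (j <= m)%N -> mesh j <= T.
Proof. by move=> jm; rewrite -meshm; exact: mesh_le. Qed.

Lemma meshS j : mesh j.+1 - mesh j = T / m%:R.
Proof. by rewrite /mesh -natr1; ring. Qed.

Lemma coarse_cell s : 0 < s -> s <= T ->
  exists2 j, (j < m)%N & mesh j < s <= mesh j.+1 /\ forall v, coarse v s = v j.
Proof.
move=> s0 sT.
have ex : exists j, s <= mesh j.+1 by exists m.-1; rewrite prednK// meshm.
case: (ex_minnP ex) => j sj jmin.
have jm : (j < m)%N.
  by have := jmin m.-1; rewrite prednK// meshm => /(_ sT) h; rewrite -(prednK m0) ltnS.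
have js : mesh j < s.
  case: j sj jmin jm => [|j] sj jmin _; first by rewrite mesh0.
  by rewrite ltNge; apply/negP => /jmin; rewrite ltnn.
exists j => //; split; first by rewrite js sj.
move=> v; rewrite /coarse_fun (bigD1 (Ordinal jm))//= js sj mulr1 big1 ?addr0// => i.
rewrite -val_eqE/= => ij; have [ilj|jli] := ltnP i j.
  by rewrite [s <= _]leNgt (le_lt_trans (mesh_le ilj) js) andbF mulr0.
have {}jli : (j < i)%N by rewrite ltn_neqAle eq_sym ij.
by rewrite [_ < s]ltNge (le_trans sj (mesh_le jli)) mulr0.
Qed.

(** A sum over the fine grid with a coarse weight becomes a sum over mesh cells of increments of
    partial sums; for step integrals these are the increments between mesh times. *)
Lemma sum_coarse (n : nat) (tau : nat -> R) (f : nat -> R) v :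
  \sum_(k < n) coarse v (tau k.+1) * f k =
  \sum_(j < m) v j * (\sum_(k < n) (tau k.+1 <= mesh j.+1)%R%:R * f k
                      - \sum_(k < n) (tau k.+1 <= mesh j)%R%:R * f k).
Proof.
under eq_bigr do rewrite /coarse_fun mulr_suml.
rewrite exchange_big/=; apply: eq_bigr => j _.
rewrite -sumrB mulr_sumr; apply: eq_bigr => k _.
rewrite -mulrBl mulrA; congr (_ * _ * _).
have jj := mesh_le (leqnSn j).
have [h|h] := leP (tau k.+1) (mesh j); first by rewrite (le_trans h jj) subrr.
by rewrite subr0.
Qed.

Lemma coarse_cell_constant tau v :
  (forall j, (j <= m)%N -> grid_point tau (mesh j)) -> cell_constant tau (coarse v).
Proof.
move=> gm k s ks sk; apply: eq_bigr => j _; congr (_ * _).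
have := cell_constant_lt_le (gm j (ltnW (ltn_ord j))) (gm j.+1 (ltn_ord j)) ks sk.
by rewrite !indicE !mem_setE !in_itv.
Qed.

Lemma measurable_coarse v (D : set R) : measurable_fun D (coarse v).
Proof.
apply: measurable_sum => j; apply: measurable_funM => //.
rewrite (_ : (fun _ => _) = \1_(`]mesh j, mesh j.+1]%classic : set R)); first exact: measurable_indic.
by apply/funext => s; rewrite indicE mem_setE in_itv.
Qed.

Lemma Rintegral_coarse (G : R -> R) v : mu.-integrable `[0, T] (EFin \o G) ->
  mu.-integrable `[0, T] (EFin \o (fun s => coarse v s * G s)) /\
  \int[mu]_(s in `[0, T]) (coarse v s * G s) =
  \sum_(j < m) v j * (\int[mu]_(s in `[0, mesh j.+1]) G s - \int[mu]_(s in `[0, mesh j]) G s).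
Proof.
move=> Gi.
pose f j s := v j * ((mesh j < s <= mesh j.+1)%R%:R * G s).
have mind j (D : set R) : measurable_fun D (fun s => ((mesh j < s <= mesh j.+1)%R%:R : R)).
  rewrite (_ : (fun _ => _) = \1_(`]mesh j, mesh j.+1]%classic : set R)); first exact: measurable_indic.
  by apply/funext => s; rewrite indicE mem_setE in_itv.
have mG : measurable_fun `[0, T] G by apply/measurable_EFinP; exact: measurable_int Gi.
have f1 j : mu.-integrable `[0, T] (EFin \o (fun s => (mesh j < s <= mesh j.+1)%R%:R * G s)).
  apply: le_integrable Gi => //.
    by apply/measurable_EFinP; apply: measurable_funM => //; exact: mind.
  move=> s _ /=; rewrite lee_fin normrM ler_piMl//.
  by case: (_ < _ <= _); rewrite ?normr1 ?normr0.
have fi j : (j < m)%N -> mu.-integrable `[0, T] (EFin \o f j).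
  by move=> _; exact: (integrableZl _ (v j) (f1 j)).
have [S1 S2] := Rintegral_sum (mu := mu) (D := `[0, T]%classic) (measurable_itv _) fi.
have fE : (fun s => coarse v s * G s) = (fun s => \sum_(j < m) f j s).
  apply/funext => s; rewrite /coarse_fun mulr_suml; apply: eq_bigr => j _.
  by rewrite /f mulrA.
rewrite fE; split => //; rewrite S2; apply: eq_bigr => j _.
rewrite /f RintegralZl//; congr (_ * _).
have jm := ltn_ord j.
have sub : (`[0, mesh j.+1]%classic : set R) `<=` `[0, T]%classic.
  by apply: subset_itvl; rewrite bnd_simp mesh_leT.
rewrite Rintegral_itvB//; last 3 first.
- by apply: integrableS Gi.
- by rewrite bnd_simp mesh_ge0.
- by rewrite bnd_simp mesh_le.
have -> : `]mesh j, mesh j.+1]%classic = `[0, T]%classic `&` `]mesh j, mesh j.+1]%classic :> set R.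
  apply/esym/setIidPr => s /=; rewrite !in_itv/= => /andP[s1 s2].
  by rewrite (le_trans s2 (mesh_leT jm)) (le_trans (mesh_ge0 j) (ltW s1)).
rewrite Rintegral_mkcondr; apply: eq_Rintegral => s _.
rewrite patchE mem_setE in_itv/=.
by case: ifP => _; rewrite ?mul1r ?mul0r.
Qed.

End Coarse.

(** Young's inequality with weight [e]. With [a] a step integrand and [b] a multiple of [sqrt Y], it
    turns closeness in mean square into closeness of the integrals of the squares where [Y] is
    bounded. *)
Lemma sqr_diff_bound {R : realType} (a b e : R) : 0 < e ->
  `|a ^+ 2 - b ^+ 2| <= (1 + e^-1) * (a - b) ^+ 2 + e * b ^+ 2.
Proof.
move=> e0; set x := (a - b) / e.
have ab : a - b = e * x by rewrite /x; field; rewrite gt_eqF.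
have -> : a ^+ 2 - b ^+ 2 = (a - b) ^+ 2 + e * (2 * b * x) by rewrite mulrCA -ab; ring.
have -> : (1 + e^-1) * (a - b) ^+ 2 + e * b ^+ 2 = (a - b) ^+ 2 + e * (x ^+ 2 + b ^+ 2).
  by rewrite ab; field; rewrite gt_eqF.
rewrite (le_trans (ler_normD _ _))// ger0_norm ?sqr_ge0// lerD2l//.
rewrite normrM (gtr0_norm e0); apply: ler_wpM2l; first exact: ltW.
rewrite ler_norml.
by have := sqr_ge0 (x - b); have := sqr_ge0 (x + b); nra.
Qed.

(** * Comparison, along one path, of the martingale exponent with the affine exponent *)

Section PathComparison.
Context {R : realType}.
Local Notation mu := (@lebesgue_measure R).
Variables (T : R) (m : nat).
Hypotheses (T0 : 0 < T) (m0 : (0 < m)%N).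
Variables (tau : nat -> R) (L : nat).
Hypotheses (tauS : forall k, tau k <= tau k.+1) (tau0 : tau 0 = 0) (tauL : tau L = T).
Hypothesis gmesh : forall j, (j <= m)%N -> grid_point tau (mesh T m j).
Variables (sg rb : R) (yp HB HW : R -> R).
Hypotheses (yp0 : forall s, 0 <= s <= T -> 0 <= yp s)
  (ypc : {within `[0, T], continuous yp})
  (cHB : cell_constant tau HB) (cHW : cell_constant tau HW).
Variables (act : nat -> bool) (K del C e : R).
Hypotheses (e0 : 0 < e) (C0 : 0 <= C) (K0 : 0 <= K) (del0 : 0 <= del).
Hypothesis actK : forall j s, (j < m)%N -> act j -> mesh T m j < s <= mesh T m j.+1 -> yp s <= K.
Hypothesis osc : forall j s, (j < m)%N -> mesh T m j < s <= mesh T m j.+1 ->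
  `|yp s - yp (mesh T m j)| <= del.

Local Notation coarse := (coarse_fun T m).
Local Notation mesh := (mesh T m).

Lemma cell_constant_integrable phi : cell_constant tau phi ->
  mu.-integrable `[0, T] (EFin \o phi).
Proof. by move=> c; have [] := cell_constant_integral tauS L c; rewrite tau0 tauL. Qed.

Lemma path_integrable : mu.-integrable `[0, T] (EFin \o yp).
Proof. by apply: continuous_compact_integrable => //; exact: segment_compact. Qed.

Lemma cell_constantX phi n : cell_constant tau phi -> cell_constant tau (fun s => phi s ^+ n).
Proof. by move=> c k s ks sk; rewrite (c k s). Qed.

Lemma integrable_sqr_dist H c : cell_constant tau H ->
  mu.-integrable `[0, T] (EFin \o (fun s => (H s - c * Num.sqrt (yp s)) ^+ 2)).
Proof.
move=> cH.
have iH2 := cell_constant_integrable (cell_constantX 2 cH).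
have mH : measurable_fun `[0, T] H.
  by apply/measurable_EFinP; exact: measurable_int (cell_constant_integrable cH).
have my : measurable_fun `[0, T] yp.
  by apply/measurable_EFinP; exact: measurable_int path_integrable.
have msq : measurable_fun `[0, T] (fun s => Num.sqrt (yp s)).
  have ms : measurable_fun setT (@Num.sqrt R).
    by apply: continuous_measurable_fun; exact: sqrt_continuous.
  exact: (measurableT_comp ms my).
have iS : mu.-integrable `[0, T] (EFin \o (fun s => 2 * H s ^+ 2 + 2 * c ^+ 2 * yp s)).
  apply: (integrableD _ (integrableZl _ 2 iH2) (integrableZl _ (2 * c ^+ 2) path_integrable)) => //.
apply: le_integrable iS => //.
  apply/measurable_EFinP; apply: measurable_funX; apply: measurable_funB => //.
  exact: measurable_funM.
move=> s; rewrite /= in_itv/= => s01; rewrite lee_fin.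
have y0 := yp0 s01.
rewrite ger0_norm ?sqr_ge0// ger0_norm; last first.
  by have := sqr_ge0 (H s); have := mulr_ge0 (sqr_ge0 c) y0; nra.
rewrite -[X in _ <= _ + _ * X](sqr_sqrtr y0).
by have := sqr_ge0 (H s + c * Num.sqrt (yp s)); nra.
Qed.

(** The integrand collects two replacements made in the drift: squares of step integrands against
    multiples of [yp], and [yp] against its value at the left end of the cell. It vanishes on
    inactive cells. On active ones [yp <= K], so the first costs the mean square distances plus a
    multiple of [e K], the second the oscillation [del]. *)
Lemma coarse_bound_integral (c1 c2 c3 : nat -> R) :
  (forall j, (j < m)%N -> `|c1 j| <= C) -> (forall j, (j < m)%N -> `|c2 j| <= C) ->
  (forall j, (j < m)%N -> `|c3 j| <= C) ->
  `|\int[mu]_(s in `[0, T]) (coarse (fun j => (act j)%:R * c1 j) s * (HW s ^+ 2 - sg ^+ 2 * yp s)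
   + coarse (fun j => (act j)%:R * c2 j) s * (HB s ^+ 2 - rb ^+ 2 * yp s)
   + (coarse (fun j => (act j)%:R * c3 j) s * yp s
      - coarse (fun j => (act j)%:R * c3 j * yp (mesh j)) s))|
  <= C * (1 + e^-1) * (\int[mu]_(s in `[0, T]) (HW s - sg * Num.sqrt (yp s)) ^+ 2
       + \int[mu]_(s in `[0, T]) (HB s - rb * Num.sqrt (yp s)) ^+ 2)
     + C * (e * (sg ^+ 2 + rb ^+ 2) * K + del) * T.
Proof.
move=> hc1 hc2 hc3.
set f := (X in `|\int[mu]_(s in _) X s|).
have iW := integrable_sqr_dist sg cHW; have iB := integrable_sqr_dist rb cHB.
set DW := (fun s => (HW s - sg * Num.sqrt (yp s)) ^+ 2) in iW *.
set DB := (fun s => (HB s - rb * Num.sqrt (yp s)) ^+ 2) in iB *.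
pose M2 := C * (e * (sg ^+ 2 + rb ^+ 2) * K + del).
pose g s := C * (1 + e^-1) * (DW s + DB s) + M2.
have i1 : mu.-integrable `[0, T] (EFin \o (cst M2 : R -> R)).
  by apply: integrable_cst_set => //; exact: measure_itv_fin.
have iWB : mu.-integrable `[0, T] (EFin \o (fun s => DW s + DB s)).
  exact: (integrableD _ iW iB).
have ig : mu.-integrable `[0, T] (EFin \o g).
  exact: (integrableD _ (integrableZl _ (C * (1 + e^-1)) iWB) i1).
have iy := path_integrable.
have mHW : measurable_fun `[0, T] HW.
  by apply/measurable_EFinP; exact: measurable_int (cell_constant_integrable cHW).
have mHB : measurable_fun `[0, T] HB.
  by apply/measurable_EFinP; exact: measurable_int (cell_constant_integrable cHB).
have my : measurable_fun `[0, T] yp by apply/measurable_EFinP; exact: measurable_int iy.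
have mf : measurable_fun `[0, T] f.
  apply: measurable_funD.
    apply: measurable_funD; apply: measurable_funM; try exact: measurable_coarse.
      by apply: measurable_funB; [exact: measurable_funX|exact: measurable_funM].
    by apply: measurable_funB; [exact: measurable_funX|exact: measurable_funM].
  apply: measurable_funB; last exact: measurable_coarse.
  by apply: measurable_funM => //; exact: measurable_coarse.
have g_ge0 s : 0 <= g s.
  rewrite /g addr_ge0//.
    rewrite mulr_ge0//; last by rewrite addr_ge0// /DW /DB sqr_ge0.
    by rewrite mulr_ge0// addr_ge0// invr_ge0 ltW.
  by rewrite /M2 mulr_ge0// addr_ge0// mulr_ge0// mulr_ge0 ?addr_ge0 ?sqr_ge0// ltW.
have fg s : 0 <= s <= T -> `|f s| <= g s.
  move=> /andP[]; rewrite le_eqVlt => /predU1P[<-|s0] sT.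
    have c00 v : coarse v 0 = 0.
      by rewrite /coarse_fun big1// => j _; rewrite ltNge mesh_ge0// mulr0.
    by rewrite /f !c00 !mul0r subrr !addr0 normr0.
  have [j jm [jj cE]] := coarse_cell T0 m0 s0 sT.
  rewrite /f !cE; have [aj|] := boolP (act j); last first.
    by rewrite !mul0r subrr !addr0 normr0.
  rewrite !mul1r -mulrBr.
  have ys : 0 <= yp s by rewrite yp0// ltW.
  have yK := actK jm aj jj.
  have hW : `|HW s ^+ 2 - sg ^+ 2 * yp s| <= (1 + e^-1) * DW s + e * (sg ^+ 2 * K).
    have := sqr_diff_bound (HW s) (sg * Num.sqrt (yp s)) e0.
    rewrite exprMn sqr_sqrtr// => /le_trans; apply.
    rewrite lerD2l; apply: ler_wpM2l; first exact: ltW.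
    by apply: ler_wpM2l => //; exact: sqr_ge0.
  have hB : `|HB s ^+ 2 - rb ^+ 2 * yp s| <= (1 + e^-1) * DB s + e * (rb ^+ 2 * K).
    have := sqr_diff_bound (HB s) (rb * Num.sqrt (yp s)) e0.
    rewrite exprMn sqr_sqrtr// => /le_trans; apply.
    rewrite lerD2l; apply: ler_wpM2l; first exact: ltW.
    by apply: ler_wpM2l => //; exact: sqr_ge0.
  have hy := osc jm jj.
  rewrite (le_trans (ler_normD _ _))//.
  rewrite (le_trans (lerD (ler_normD _ _) (lexx _)))// !normrM.
  apply: (@le_trans _ _ (C * ((1 + e^-1) * DW s + e * (sg ^+ 2 * K))
     + C * ((1 + e^-1) * DB s + e * (rb ^+ 2 * K)) + C * del)).
    by apply: lerD; [apply: lerD|]; apply: ler_pM => //; [exact: hc1|exact: hc2|exact: hc3].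
  by rewrite /g /M2 le_eqVlt; apply/orP; left; apply/eqP; ring.
have if_ : mu.-integrable `[0, T] (EFin \o f).
  apply: le_integrable ig => //; first exact/measurable_EFinP.
  move=> s; rewrite /= in_itv/= => /fg h; rewrite lee_fin (le_trans h)//.
  exact: ler_norm.
rewrite (le_trans (le_normr_Rintegral _ if_))//.
rewrite (@le_trans _ _ (\int[mu]_(s in `[0, T]) g s))//.
  by apply: le_Rintegral => //; exact: integrable_norm.
rewrite /g RintegralD//=; last first.
  exact: (integrableZl _ (C * (1 + e^-1)) iWB).
rewrite RintegralZl// RintegralD// Rintegral_cst//.
have muT : fine (mu `[0, T]) = T.
  by rewrite lebesgue_measure_itv/= lte_fin T0 -EFinB subr0.
by rewrite -[X in _ <= _ + _ * X]muT.
Qed.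

Let h := T / m%:R.
Let J t := \int[mu]_(s in `[0, t]) yp s.

Lemma coarse_act_mul (f g : nat -> R) s : s <= T ->
  coarse (fun j => (act j)%:R * f j) s * coarse (fun j => (act j)%:R * g j) s
  = coarse (fun j => (act j)%:R * (f j * g j)) s.
Proof.
move=> sT; have [s0|s0] := ltP 0 s.
  have [j jm [jj cE]] := coarse_cell T0 m0 s0 sT.
  by rewrite !cE; case: (act j); rewrite ?mul1r ?mul0r.
have c00 v : coarse v s = 0.
  rewrite /coarse_fun big1// => j _.
  by rewrite ltNge (le_trans s0 (mesh_ge0 T0 m0 j)) mulr0.
by rewrite !c00 mulr0.
Qed.

Let mesh_gridc (f : nat -> R) : cell_constant tau (coarse f).
Proof. by apply: coarse_cell_constant => //; exact: ltnW. Qed.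

Lemma coarse_E_integral (c1 c2 c3 : nat -> R) :
  \int[mu]_(s in `[0, T]) (coarse (fun j => (act j)%:R * c1 j) s * (HW s ^+ 2 - sg ^+ 2 * yp s)
   + coarse (fun j => (act j)%:R * c2 j) s * (HB s ^+ 2 - rb ^+ 2 * yp s)
   + (coarse (fun j => (act j)%:R * c3 j) s * yp s
      - coarse (fun j => (act j)%:R * c3 j * yp (mesh j)) s))
  = \sum_(k < L) (coarse (fun j => (act j)%:R * c1 j) (tau k.+1) * HW (tau k.+1) ^+ 2
     + coarse (fun j => (act j)%:R * c2 j) (tau k.+1) * HB (tau k.+1) ^+ 2) * (tau k.+1 - tau k)
   + \sum_(j < m) (act j)%:R * ((c3 j - sg ^+ 2 * c1 j - rb ^+ 2 * c2 j) * (J (mesh j.+1) - J (mesh j))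
       - c3 j * yp (mesh j) * h).
Proof.
set v1 := fun j => (act j)%:R * c1 j; set v2 := fun j => (act j)%:R * c2 j.
set v3 := fun j => (act j)%:R * c3 j; set v4 := fun j => (act j)%:R * c3 j * yp (mesh j).
pose v5 j := v3 j - sg ^+ 2 * v1 j - rb ^+ 2 * v2 j.
pose f1 s := coarse v1 s * HW s ^+ 2 + coarse v2 s * HB s ^+ 2.
have cf1 : cell_constant tau f1.
  by move=> k s ks sk; rewrite /f1 (mesh_gridc v1 ks sk) (mesh_gridc v2 ks sk) (cHW ks sk) (cHB ks sk).
have cone : mu.-integrable `[0, T] (EFin \o (cst 1 : R -> R)).
  by apply: integrable_cst_set => //; exact: measure_itv_fin.
have [if1 f1E] := cell_constant_integral tauS L cf1.
rewrite tau0 tauL in if1 f1E.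
have [i5 E5] := Rintegral_coarse T0 m0 v5 path_integrable.
have [i4 E4] := Rintegral_coarse T0 m0 v4 cone.
transitivity (\int[mu]_(s in `[0, T]) (f1 s + coarse v5 s * yp s - coarse v4 s * cst 1 s)).
  apply: eq_Rintegral => s _; rewrite /f1 /cst mulr1.
  have -> : coarse v5 s = coarse v3 s - sg ^+ 2 * coarse v1 s - rb ^+ 2 * coarse v2 s.
    rewrite /coarse_fun !mulr_sumr -!sumrB; apply: eq_bigr => j _.
    by rewrite /v5; ring.
  by ring.
rewrite RintegralB//=; last exact: (integrableD _ if1 i5).
rewrite RintegralD// f1E E5 E4 -addrA; congr (_ + _).
rewrite -sumrB; apply: eq_bigr => j _.
have Rc (t : R) : 0 <= t -> \int[mu]_(s in `[0, t]) cst 1 s = t.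
  move=> t0; transitivity (1 * fine (mu `[0, t])); first exact: Rintegral_cst.
  rewrite lebesgue_measure_itv/= lte_fin mul1r.
  case: ltP => [_|t0']; first by rewrite -EFinB subr0.
  by apply/eqP; rewrite eq_le/= t0 t0'.
rewrite !Rc ?mesh_ge0// meshS /v5 /v4 /v3 /v1 /v2 -/(J _) -/(J _) /h.
by ring.
Qed.

Variables (Wp Bp IW IB Xp : R -> R) (p q A Bq : nat -> R).
Variables (a0 b0 c0 k0 u x0 y0 e1 : R).
Hypothesis SDE_Y : forall j, (j <= m)%N ->
  yp (mesh j) = y0 + (a0 * mesh j - b0 * J (mesh j)) + IW (mesh j).
Hypothesis SDE_X : forall j, (j <= m)%N ->
  Xp (mesh j) = x0 + (c0 * mesh j + k0 * J (mesh j)) + IB (mesh j).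
Let SI (H V : R -> R) (s : R) := \sum_(k < L) H (tau k.+1) * (tau k.+1 <= s)%R%:R *
  (V (tau k.+1) - V (tau k)).
Hypothesis SI_W : forall j, (j <= m)%N -> `|SI HW Wp (mesh j) - IW (mesh j)| <= e1.
Hypothesis SI_B : forall j, (j <= m)%N -> `|SI HB Bp (mesh j) - IB (mesh j)| <= e1.
Hypothesis recp : forall j, (j < m)%N -> p j = p j.+1 -
  h * (b0 * p j.+1 - rb ^+ 2 * u ^+ 2 / 2 + sg ^+ 2 / 2 * (p j.+1 ^+ 2 - q j.+1 ^+ 2)).
Hypothesis recq : forall j, (j < m)%N -> q j = q j.+1 -
  h * (u * k0 + b0 * q j.+1 + sg ^+ 2 * p j.+1 * q j.+1).
Hypothesis recA : forall j, (j < m)%N -> A j = A j.+1 - h * (a0 * p j.+1).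
Hypothesis recB : forall j, (j < m)%N -> Bq j = Bq j.+1 + h * (u * c0 - a0 * q j.+1).
Variable Cp : R.
Hypothesis Cp0 : 0 <= Cp.
Hypothesis pC : forall j, (j <= m)%N -> `|p j| <= Cp.
Hypothesis qC : forall j, (j <= m)%N -> `|q j| <= Cp.
Hypothesis CE : Cp ^+ 2 + u ^+ 2 + rb ^+ 2 * u ^+ 2 + sg ^+ 2 * Cp ^+ 2
  + `|u * k0| + `|b0| * Cp <= C.

(** The complex exponent [A - p Y + i (u X + b - q Y)] has coefficient [- (p + i q) sg sqrt Y] on
    [dW] and [i u rb sqrt Y] on [dB]. These three functions are the corresponding real and imaginary
    parts, with step integrands in place of the square roots and 0 on inactive cells. *)
Definition path_x k := - (coarse (fun j => (act j)%:R * p j.+1) (tau k.+1) * HW (tau k.+1)).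
Definition path_y k := - (coarse (fun j => (act j)%:R * q j.+1) (tau k.+1) * HW (tau k.+1)).
Definition path_a k := coarse (fun j => (act j)%:R * u) (tau k.+1) * HB (tau k.+1).

Let err := C * (1 + e^-1) * (\int[mu]_(s in `[0, T]) (HW s - sg * Num.sqrt (yp s)) ^+ 2
       + \int[mu]_(s in `[0, T]) (HB s - rb * Num.sqrt (yp s)) ^+ 2)
     + C * (e * (sg ^+ 2 + rb ^+ 2) * K + del) * T.

Let tau_leT k : (k < L)%N -> tau k.+1 <= T.
Proof. by move=> kL; rewrite -tauL; exact: grid_tau_le. Qed.

Let SIdiff H V (v : nat -> R) :
  \sum_(k < L) coarse v (tau k.+1) * (H (tau k.+1) * (V (tau k.+1) - V (tau k)))
  = \sum_(j < m) v j * (SI H V (mesh j.+1) - SI H V (mesh j)).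
Proof.
rewrite (sum_coarse T0 m0 L tau (fun k => H (tau k.+1) * (V (tau k.+1) - V (tau k)))).
by apply: eq_bigr => j _; congr (_ * (_ - _)); apply: eq_bigr => k _; ring.
Qed.

Let act_sum_bound (v : nat -> R) (M : R) : (forall j, (j < m)%N -> `|v j| <= M) ->
  `|\sum_(j < m) (act j)%:R * v j| <= m%:R * M.
Proof.
move=> vM; rewrite (le_trans (ler_norm_sum _ _ _))//.
apply: (@le_trans _ _ (\sum_(j < m) M)); last by rewrite sumr_const card_ord mulr_natl.
apply: ler_sum => j _; rewrite normrM.
have := vM j (ltn_ord j); case: (act j); rewrite ?normr1 ?mul1r// normr0 mul0r => h0.
by rewrite (le_trans _ h0).
Qed.

(** On an active cell the stochastic integrals cancel up to [e1] at each end, and the Riccati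
    recursion cancels the drift up to the integral of [coarse_bound_integral]. *)
Lemma path_re_close :
  `|\sum_(k < L) (path_x k * (Wp (tau k.+1) - Wp (tau k))
     - (path_x k ^+ 2 - path_y k ^+ 2 - path_a k ^+ 2) * (tau k.+1 - tau k) / 2)
   - \sum_(j < m) (act j)%:R * ((A j.+1 - p j.+1 * yp (mesh j.+1)) - (A j - p j * yp (mesh j)))|
  <= m%:R * (2 * Cp * e1) + err.
Proof.
(* [c1] and [c2] are the coefficients of [HW ^+ 2] and [HB ^+ 2] in the compensator, and [c3 j] is
   the slope [(p j - p j.+1) / h]. Hence [c3 j - sg ^+ 2 * c1 j - rb ^+ 2 * c2 j = - b0 * p j.+1],
   which matches the mean reversion of [Y]. *)
pose c1 j := - (p j.+1 ^+ 2 - q j.+1 ^+ 2) / 2.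
pose c2 (j : nat) := u ^+ 2 / 2.
pose c3 j := - (b0 * p j.+1 - rb ^+ 2 * u ^+ 2 / 2 + sg ^+ 2 / 2 * (p j.+1 ^+ 2 - q j.+1 ^+ 2)).
have sq (x y : R) : `|x| <= y -> x ^+ 2 <= y ^+ 2.
  by move=> xy; rewrite -real_normK ?num_real// lerXn2r// nnegrE// (le_trans _ xy).
have terms := (sqr_ge0 Cp, sqr_ge0 u, mulr_ge0 (sqr_ge0 rb) (sqr_ge0 u),
   mulr_ge0 (sqr_ge0 sg) (sqr_ge0 Cp), normr_ge0 (u * k0), mulr_ge0 (normr_ge0 b0) Cp0).
have pq2 j : (j < m)%N -> `|p j.+1 ^+ 2 - q j.+1 ^+ 2| <= Cp ^+ 2.
  move=> jm; rewrite ler_norml.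
  have := sq _ _ (pC jm); have := sq _ _ (qC jm).
  by have := sqr_ge0 (p j.+1); have := sqr_ge0 (q j.+1); lra.
have c1C j : (j < m)%N -> `|c1 j| <= C.
  move=> jm; rewrite /c1 mulNr normrN normrM (ger0_norm (_ : 0 <= 2^-1))//.
  by have := pq2 j jm; have := CE; move: terms => [[[[[]]]]]; lra.
have c2C (j : nat) : (j < m)%N -> `|c2 j| <= C.
  move=> _; rewrite /c2 ger0_norm ?divr_ge0 ?sqr_ge0//.
  by have := CE; move: terms => [[[[[]]]]]; lra.
have c3C (j : nat) : (j < m)%N -> `|c3 j| <= C.
  move=> jm; rewrite /c3 normrN.
  have h1 : `|b0 * p j.+1| <= `|b0| * Cp by rewrite normrM ler_wpM2l// pC.
  have h2 : `|sg ^+ 2 / 2 * (p j.+1 ^+ 2 - q j.+1 ^+ 2)| <= sg ^+ 2 * Cp ^+ 2.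
    rewrite normrM (ger0_norm (_ : 0 <= sg ^+ 2 / 2)) ?divr_ge0 ?sqr_ge0//.
    apply: ler_pM => //; rewrite ?divr_ge0 ?sqr_ge0 ?pq2//.
    by rewrite ler_pdivrMr// ler_peMr ?sqr_ge0// ler1n.
  move: h1 h2 CE terms; set X := b0 * _; set Y := _ / 2 * _ => h1 h2 CE'.
  case=> [[[[[]]]]] *; rewrite ler_norml; move: h1 h2; rewrite !ler_norml => /andP[? ?] /andP[? ?].
  by apply/andP; split; lra.
have hE := coarse_E_integral c1 c2 c3.
have hbound := @coarse_bound_integral c1 c2 c3.
set I := (\int[mu]_(s in _) _) in hE; rewrite -/I in hbound.
have tau2 k : (k < L)%N -> - ((path_x k ^+ 2 - path_y k ^+ 2 - path_a k ^+ 2) / 2) =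
    coarse (fun j => (act j)%:R * c1 j) (tau k.+1) * HW (tau k.+1) ^+ 2
     + coarse (fun j => (act j)%:R * c2 j) (tau k.+1) * HB (tau k.+1) ^+ 2.
  move=> kL; rewrite /path_x /path_y /path_a !sqrrN !exprMn.
  rewrite [coarse _ _ ^+ 2]expr2 [in X in _ - X * _ - _]expr2 [in X in _ - _ - X * _]expr2.
  rewrite !coarse_act_mul ?tau_leT//.
  have -> : coarse (fun j => (act j)%:R * c1 j) (tau k.+1) =
     - (coarse (fun j => (act j)%:R * (p j.+1 * p j.+1)) (tau k.+1)
       - coarse (fun j => (act j)%:R * (q j.+1 * q j.+1)) (tau k.+1)) / 2.
    rewrite /coarse_fun -sumrB -sumrN mulr_suml; apply: eq_bigr => j _.
    by rewrite /c1; field.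
  have -> : coarse (fun j => (act j)%:R * c2 j) (tau k.+1) =
     coarse (fun j => (act j)%:R * (u * u)) (tau k.+1) / 2.
    rewrite /coarse_fun mulr_suml; apply: eq_bigr => j _.
    by rewrite /c2; field.
  by field.
rewrite (_ : _ - _ = \sum_(j < m) (act j)%:R * (- p j.+1 *
   ((SI HW Wp (mesh j.+1) - IW (mesh j.+1)) - (SI HW Wp (mesh j) - IW (mesh j)))) + I).
  rewrite (le_trans (ler_normD _ _))// lerD//.
    apply: (@act_sum_bound (fun j => - p j.+1 * ((SI HW Wp (mesh j.+1) - IW (mesh j.+1))
      - (SI HW Wp (mesh j) - IW (mesh j)))) _) => j jm.
    rewrite normrM normrN -mulrA (mulrCA 2).
    apply: ler_pM => //; first exact: pC.
    rewrite (le_trans (ler_normB _ _))// mulr_natl mulr2n lerD//; apply: SI_W => //.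
    exact: ltnW.
  by apply: hbound => j jm; [exact: c1C|exact: c2C|exact: c3C].
rewrite hE addrA.
have -> : \sum_(k < L) (path_x k * (Wp (tau k.+1) - Wp (tau k))
     - (path_x k ^+ 2 - path_y k ^+ 2 - path_a k ^+ 2) * (tau k.+1 - tau k) / 2)
  = - (\sum_(j < m) (act j)%:R * p j.+1 * (SI HW Wp (mesh j.+1) - SI HW Wp (mesh j)))
   + \sum_(k < L) (coarse (fun j => (act j)%:R * c1 j) (tau k.+1) * HW (tau k.+1) ^+ 2
     + coarse (fun j => (act j)%:R * c2 j) (tau k.+1) * HB (tau k.+1) ^+ 2) * (tau k.+1 - tau k).
  rewrite -(SIdiff HW Wp (fun j => (act j)%:R * p j.+1)) -sumrN -big_split/=; apply: eq_bigr => k _.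
  by rewrite -tau2// /path_x; ring.
match goal with |- - ?a + ?s - ?c = ?d + ?s2 + ?e =>
  suff E : - a - c = d + e by rewrite [RHS]addrAC -E addrAC end.
rewrite -!sumrN -!big_split/=; apply: eq_bigr => j _.
have jm := ltn_ord j; have jm' := ltnW jm.
rewrite (recA jm) (recp jm) /c1 /c2 /c3.
have Y1 := SDE_Y jm; have Y2 := SDE_Y jm'.
have mS := meshS T m j; rewrite -/h in mS.
have -> : IW (mesh j.+1) = yp (mesh j.+1) - y0 - (a0 * mesh j.+1 - b0 * J (mesh j.+1)).
  by rewrite Y1; ring.
have -> : IW (mesh j) = yp (mesh j) - y0 - (a0 * mesh j - b0 * J (mesh j)).
  by rewrite [in RHS]Y2; ring.
have -> : mesh j.+1 = mesh j + h by rewrite -mS; ring.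
by field.
Qed.

Lemma path_im_close :
  `|\sum_(k < L) (path_a k * (Bp (tau k.+1) - Bp (tau k))
     + path_y k * (Wp (tau k.+1) - Wp (tau k))
     - path_x k * path_y k * (tau k.+1 - tau k))
   - \sum_(j < m) (act j)%:R * ((u * Xp (mesh j.+1) + Bq j.+1 - q j.+1 * yp (mesh j.+1))
       - (u * Xp (mesh j) + Bq j - q j * yp (mesh j)))|
  <= m%:R * (2 * (Cp + `|u|) * e1) + err.
Proof.
pose c1 j := - (p j.+1 * q j.+1).
(* The coefficient of [dB] is purely imaginary, so [HB ^+ 2] does not enter the imaginary part of
   the compensator. Now [c3 j] is [(q j - q j.+1) / h]. *)
pose c2 (j : nat) := 0 : R.
pose c3 j := - (u * k0 + b0 * q j.+1 + sg ^+ 2 * p j.+1 * q j.+1).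
have terms := (sqr_ge0 Cp, sqr_ge0 u, mulr_ge0 (sqr_ge0 rb) (sqr_ge0 u),
   mulr_ge0 (sqr_ge0 sg) (sqr_ge0 Cp), normr_ge0 (u * k0), mulr_ge0 (normr_ge0 b0) Cp0).
have pqC j : (j < m)%N -> `|p j.+1 * q j.+1| <= Cp ^+ 2.
  by move=> jm; rewrite normrM expr2; apply: ler_pM => //; [exact: pC|exact: qC].
have c1C j : (j < m)%N -> `|c1 j| <= C.
  move=> jm; rewrite /c1 normrN.
  by have := pqC j jm; have := CE; move: terms => [[[[[]]]]]; lra.
have c2C (j : nat) : (j < m)%N -> `|c2 j| <= C by rewrite normr0.
have c3C (j : nat) : (j < m)%N -> `|c3 j| <= C.
  move=> jm; rewrite /c3 normrN.
  have h1 : `|b0 * q j.+1| <= `|b0| * Cp by rewrite normrM ler_wpM2l// qC.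
  have h2 : `|sg ^+ 2 * p j.+1 * q j.+1| <= sg ^+ 2 * Cp ^+ 2.
    rewrite -mulrA normrM (ger0_norm (_ : 0 <= sg ^+ 2)) ?sqr_ge0//.
    by rewrite ler_wpM2l ?sqr_ge0// pqC.
  rewrite (le_trans (ler_normD _ _))// (le_trans (lerD (ler_normD _ _) (lexx _)))//.
  by have := CE; move: terms h1 h2 => [[[[[]]]]]; lra.
have hE := coarse_E_integral c1 c2 c3.
have hbound := @coarse_bound_integral c1 c2 c3.
set I := (\int[mu]_(s in _) _) in hE; rewrite -/I in hbound.
have tau2 k : (k < L)%N -> - (path_x k * path_y k) =
    coarse (fun j => (act j)%:R * c1 j) (tau k.+1) * HW (tau k.+1) ^+ 2
     + coarse (fun j => (act j)%:R * c2 j) (tau k.+1) * HB (tau k.+1) ^+ 2.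
  move=> kL; rewrite /path_x /path_y mulrNN mulrACA coarse_act_mul ?tau_leT//.
  have -> : coarse (fun j => (act j)%:R * c1 j) (tau k.+1) =
     - coarse (fun j => (act j)%:R * (p j.+1 * q j.+1)) (tau k.+1).
    rewrite /coarse_fun -sumrN; apply: eq_bigr => j _.
    by rewrite /c1; ring.
  have -> : coarse (fun j => (act j)%:R * c2 j) (tau k.+1) = 0.
    by rewrite /coarse_fun big1// => j _; rewrite /c2 mulr0 mul0r.
  by ring.
rewrite (_ : _ - _ = \sum_(j < m) (act j)%:R * (
   u * ((SI HB Bp (mesh j.+1) - IB (mesh j.+1)) - (SI HB Bp (mesh j) - IB (mesh j)))
   - q j.+1 * ((SI HW Wp (mesh j.+1) - IW (mesh j.+1)) - (SI HW Wp (mesh j) - IW (mesh j)))) + I).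
  rewrite (le_trans (ler_normD _ _))// lerD//.
    apply: (@act_sum_bound (fun j =>
      u * ((SI HB Bp (mesh j.+1) - IB (mesh j.+1)) - (SI HB Bp (mesh j) - IB (mesh j)))
      - q j.+1 * ((SI HW Wp (mesh j.+1) - IW (mesh j.+1)) - (SI HW Wp (mesh j) - IW (mesh j)))) _) => j jm.
    have e2 (H V I' : R -> R) : (forall j, (j <= m)%N -> `|SI H V (mesh j) - I' (mesh j)| <= e1) ->
       `|(SI H V (mesh j.+1) - I' (mesh j.+1)) - (SI H V (mesh j) - I' (mesh j))| <= 2 * e1.
      move=> hI; rewrite (le_trans (ler_normB _ _))// mulr_natl mulr2n lerD//; apply: hI => //.
      exact: ltnW.
    rewrite (le_trans (ler_normB _ _))// !normrM -mulrA mulrCA mulrDl addrC lerD//.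
      by apply: ler_pM => //; [exact: qC|exact: e2].
    by rewrite ler_wpM2l// e2.
  by apply: hbound => j jm; [exact: c1C|exact: c2C|exact: c3C].
rewrite hE addrA.
have -> : \sum_(k < L) (path_a k * (Bp (tau k.+1) - Bp (tau k))
     + path_y k * (Wp (tau k.+1) - Wp (tau k))
     - path_x k * path_y k * (tau k.+1 - tau k))
  = (\sum_(j < m) (act j)%:R * u * (SI HB Bp (mesh j.+1) - SI HB Bp (mesh j))
     - \sum_(j < m) (act j)%:R * q j.+1 * (SI HW Wp (mesh j.+1) - SI HW Wp (mesh j)))
   + \sum_(k < L) (coarse (fun j => (act j)%:R * c1 j) (tau k.+1) * HW (tau k.+1) ^+ 2
     + coarse (fun j => (act j)%:R * c2 j) (tau k.+1) * HB (tau k.+1) ^+ 2) * (tau k.+1 - tau k).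
  rewrite -(SIdiff HB Bp (fun j => (act j)%:R * u)) -(SIdiff HW Wp (fun j => (act j)%:R * q j.+1)) -sumrB -big_split/=; apply: eq_bigr => k _.
  by rewrite -tau2// /path_a /path_y; ring.
match goal with |- ?a - ?b + ?s - ?c = ?d + ?s2 + ?e =>
  suff E : a - b - c = d + e by rewrite [RHS]addrAC -E addrAC end.
rewrite -!sumrN -!big_split/=; apply: eq_bigr => j _.
have jm := ltn_ord j; have jm' := ltnW jm.
rewrite (recB jm) (recq jm) /c1 /c2 /c3.
have Y1 := SDE_Y jm; have Y2 := SDE_Y jm'; have X1 := SDE_X jm; have X2 := SDE_X jm'.
have mS := meshS T m j; rewrite -/h in mS.
have -> : IW (mesh j.+1) = yp (mesh j.+1) - y0 - (a0 * mesh j.+1 - b0 * J (mesh j.+1)).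
  by rewrite Y1; ring.
have -> : IW (mesh j) = yp (mesh j) - y0 - (a0 * mesh j - b0 * J (mesh j)).
  by rewrite [in RHS]Y2; ring.
have -> : IB (mesh j.+1) = Xp (mesh j.+1) - x0 - (c0 * mesh j.+1 + k0 * J (mesh j.+1)).
  by rewrite X1; ring.
have -> : IB (mesh j) = Xp (mesh j) - x0 - (c0 * mesh j + k0 * J (mesh j)).
  by rewrite [in RHS]X2; ring.
have -> : mesh j.+1 = mesh j + h by rewrite -mS; ring.
by field.
Qed.

End PathComparison.

Lemma within_itv_distP {R : realType} (I : interval R) (f : R -> R) :
  {within [set` I], continuous f} -> forall x e : R, x \in I -> 0 < e ->
  exists2 del : R, 0 < del & forall y, y \in I -> `|x - y| < del -> `|f x - f y| < e.
Proof.
move=> /subspace_continuousP fc x e xI e0.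
have /cvgrPdist_lt/(_ e e0) := fc x xI.
rewrite near_withinE => /nbhs_ballP[del /= del0 h].
by exists del => // y yI xy; exact: h.
Qed.

Lemma segment_unif_continuous {R : realType} (f : R -> R) (a b : R) :
  {within `[a, b], continuous f} -> forall e : R, 0 < e -> exists2 del : R, 0 < del &
    forall s t, s \in `[a, b] -> t \in `[a, b] -> `|s - t| < del -> `|f s - f t| < e.
Proof.
move=> /within_itv_distP fc e e0.
have /compact_near_coveringP cov := @segment_compact R a b.
pose Q (del s : R) := s \in `[a, b] -> forall t, t \in `[a, b] -> `|s - t| < del -> `|f s - f t| < e.
have loc : forall x, `[a, b]%classic x -> \forall x' \near x & z \near (0^'+ : set_system R), Q z x'.
  move=> x xab; have e2 : 0 < e / 2 by rewrite divr_gt0.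
  have [r r0 hr] := fc x _ xab e2.
  exists (ball x (r / 2), [set z | 0 < z < r / 2]) => /=.
    split; first by apply: nbhsx_ballx; rewrite divr_gt0.
    near=> z; apply/andP; split; near: z; first exact: nbhs_right_gt.
    by apply: nbhs_right_lt; rewrite divr_gt0.
  move=> [s z]/= [xs /andP[z0 zr]] sab t tab st.
  rewrite /ball/= in xs.
  have h1 : `|f x - f s| < e / 2 by apply: hr => //; lra.
  have h2 : `|f x - f t| < e / 2.
    by apply: hr => //; rewrite (le_lt_trans (ler_distD s _ _))//; lra.
  rewrite (le_lt_trans (ler_distD (f x) _ _))// distrC; lra.
have := cov _ _ Q _ loc => /(_ _)/nbhs_ballP[r /= r0 hr].
exists (r / 2) => [|s t sab tab st]; first by rewrite divr_gt0.
apply: (hr (r / 2) _ _ s sab sab t tab st) => //=.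
  by rewrite /ball/= sub0r normrN gtr0_norm ?divr_gt0//; lra.
by rewrite divr_gt0.
Unshelve. all: by end_near.
Qed.

(** * Exceptional events *)

Section Vanishing.
Context {R : realType} {d : measure_display} {Omega : measurableType d}.
Variable P : probability Omega R.
Implicit Types E G : nat -> set Omega.

(** Stable under finite unions, so that exceptional events can be gathered before a single index is
    chosen. *)
Definition vanishing E := (forall n, measurable (E n)) /\
  forall e : R, 0 < e -> exists n0, forall n, (n0 <= n)%N -> (P (E n) <= e%:E)%E.

Lemma vanishingU E G : vanishing E -> vanishing G -> vanishing (fun n => E n `|` G n).
Proof.
move=> [mE vE] [mG vG]; split => [n|e e0]; first exact: measurableU.
have e2 : 0 < e / 2 by rewrite divr_gt0.
have [n1 h1] := vE _ e2; have [n2 h2] := vG _ e2.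
exists (maxn n1 n2) => n; rewrite geq_max => /andP[/h1 {}h1 /h2 {}h2].
rewrite (le_trans (measureU2 _ (mE n) (mG n)))// (le_trans (leeD h1 h2))//.
by rewrite -EFinD lee_fin -splitr.
Qed.

Lemma vanishing_null (N : set Omega) : measurable N -> P N = 0%E -> vanishing (fun=> N).
Proof. by move=> mN PN; split => // e e0; exists 0%N => n _; rewrite PN lee_fin ltW. Qed.

Lemma vanishing_bigcup (E : nat -> nat -> set Omega) k :
  (forall j, (j < k)%N -> vanishing (E j)) ->
  vanishing (fun n => \bigcup_(j in `I_k) E j n).
Proof.
elim: k => [_|k IH vE].
  rewrite (_ : (fun _ => _) = fun=> set0); last by apply/funext => n; rewrite II0 bigcup_set0.
  by apply: vanishing_null.
rewrite (_ : (fun _ => _) = fun n => (\bigcup_(j in `I_k) E j n) `|` E k n).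
  by apply: vanishingU; [apply: IH => j jk; apply: vE; exact: ltnW|exact: vE].
apply/funext => n; apply/seteqP; split => w.
  move=> [j /= jk Ew]; move: jk; rewrite ltnS leq_eqVlt => /predU1P[jk|jk].
    by right; rewrite -jk.
  by left; exists j.
by case=> [[j /= jk Ew]|Ew]; [exists j => //=; exact: ltnW|exists k => /=].
Qed.

(** The tail unions decrease to the empty set and [P] is continuous from above: statements on each
    path become statements in probability. *)
Lemma vanishing_pointwise E : (forall n, measurable (E n)) ->
  (forall w, exists k, forall n, (k <= n)%N -> ~ E n w) -> vanishing E.
Proof.
move=> mE hE; split => // e e0.
pose G k := \bigcup_(n in [set n | (k <= n)%N]) E n.
have mG k : measurable (G k) by apply: bigcup_measurable => n _; exact: mE.
have G0 : \bigcap_k G k = set0.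
  apply/seteqP; split => // w hw; have [k hk] := hE w.
  by have [n kn /hk] := hw k I; exact.
have : P \o G @ \oo --> P (\bigcap_n G n).
  apply: nonincreasing_cvg_mu => //.
  - by rewrite (le_lt_trans (probability_le1 P (mG _)))// ltry.
  - exact: bigcap_measurable.
  - apply/nonincreasing_seqP => k; apply/subsetPset => w [n /= kn Enw].
    by exists n => //=; exact: ltnW.
rewrite G0 measure0 => /fine_cvgP[fG].
move=> /cvgrPdist_le/(_ e e0)[k _ hk].
case: fG => k' _ hk'.
exists (maxn k k') => n; rewrite geq_max => /andP[kn kn'].
have := hk _ kn; rewrite /= sub0r normrN ger0_norm ?fine_ge0// => h.
rewrite (le_trans (_ : _ <= P (G n))%E)//.
  by apply: le_measure; rewrite ?inE//; move=> w Ew; exists n => //=.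
by have /= := hk' _ kn' => /fineK <-; rewrite lee_fin.
Qed.

Lemma measurable_lt_set (f g : Omega -> R) : measurable_fun setT f -> measurable_fun setT g ->
  measurable [set w | f w < g w].
Proof.
move=> mf mg.
rewrite (_ : [set _ | _] = (fun w => g w - f w) @^-1` `]0, +oo[%classic).
  by apply: measurable_preimage => //; exact: measurable_funB.
by apply/seteqP; split => w /=; rewrite in_itv/= andbT subr_gt0.
Qed.

Lemma measurable_le_set (f g : Omega -> R) : measurable_fun setT f -> measurable_fun setT g ->
  measurable [set w | f w <= g w].
Proof.
move=> mf mg; rewrite (_ : [set _ | _] = ~` [set w | g w < f w]).
  by apply: measurableC; exact: measurable_lt_set.
by apply/seteqP; split => w /=; rewrite leNgt => /negP.
Qed.

Lemma vanishing_cvg_in_probability (Z : nat -> Omega -> R) (Z0 : Omega -> R) (e : R) :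
  (forall n, measurable_fun setT (Z n)) -> measurable_fun setT Z0 -> 0 < e ->
  cvg_in_probability P Z Z0 -> vanishing (fun n => [set w | e < `|Z n w - Z0 w|]).
Proof.
move=> mZ mZ0 e0 cZ.
have mE n : measurable [set w | e < `|Z n w - Z0 w|].
  apply: measurable_lt_set => //; apply: measurableT_comp => //.
  exact: measurable_funB.
split => // e' e'0; have /fine_cvgP[[k' _ hk']] := cZ e e0.
move=> /cvgrPdist_le/(_ e' e'0)[k _ hk].
exists (maxn k k') => n; rewrite geq_max => /andP[kn kn'].
have := hk _ kn; rewrite /= sub0r normrN ger0_norm ?fine_ge0// => h.
by have /= := hk' _ kn' => /fineK <-; rewrite lee_fin.
Qed.

End Vanishing.

Section PathEvents.
Context {R : realType} {d : measure_display} {Omega : measurableType d}.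
Variables (P : probability Omega R) (T : R) (Y : R -> Omega -> R).
Hypothesis T0 : 0 < T.
Hypothesis mY : forall s, 0 <= s <= T -> measurable_fun setT (Y s).
Hypothesis cY : forall w, {within `[0, T], continuous (Y ^~ w)}.

Let meshT m j : (0 < m)%N -> (j <= m)%N -> 0 <= mesh T m j <= T.
Proof. by move=> m0 jm; rewrite mesh_ge0// mesh_leT. Qed.

(** The union runs over all meshes rather than one, so that the level [K] can be chosen before the
    mesh; it is countable, hence measurable. *)
Definition exceed_set (K : R) : set Omega :=
  \bigcup_n \bigcup_(i in `I_n.+2) [set w | K < Y (mesh T n.+1 i) w].

Lemma exceed_setP K m i w : (0 < m)%N -> (i <= m)%N -> ~ exceed_set K w -> Y (mesh T m i) w <= K.
Proof.
move=> m0 im; apply: contra_notP => /negP; rewrite -ltNge => h.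
by exists m.-1 => //; exists i; rewrite /= ?prednK.
Qed.

Lemma measurable_exceed_set K : measurable (exceed_set K).
Proof.
apply: bigcup_measurable => n _; apply: bigcup_measurable => i /= ilt.
by apply: measurable_lt_set => //; apply: mY; exact: meshT.
Qed.

Lemma exceed_vanishing : vanishing P (fun k => exceed_set k%:R).
Proof.
apply: vanishing_pointwise => [n|w]; first exact: measurable_exceed_set.
have [c cI hc] := EVT_max (ltW T0) (cY (w := w)).
exists (Num.truncn (Y c w)).+1 => n hn [k _ [i /= ik]].
apply/negP; rewrite -leNgt; apply: (@le_trans _ _ (Y c w)).
  by apply: hc; rewrite in_itv/=; exact: meshT.
by rewrite ltW// (lt_le_trans (truncnS_gt _))// ler_nat.
Qed.

(** A fine enough refinement of the mesh has a point just to the right of [s] and in the same cell,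
    because [mesh T m j.+1] belongs to every refinement; continuity then transfers the bound to
    [s]. *)
Lemma dense_mesh (f : R -> R) m j s (r : R) : (0 < m)%N -> (j < m)%N ->
  (forall x e : R, x \in `[0, T] -> 0 < e ->
    exists2 del : R, 0 < del & forall y, y \in `[0, T] -> `|x - y| < del -> `|f x - f y| < e) ->
  mesh T m j < s <= mesh T m j.+1 ->
  (forall n i, (0 < n)%N -> (i <= n)%N -> mesh T m j < mesh T n i <= mesh T m j.+1 ->
     f (mesh T n i) <= r) -> f s <= r.
Proof.
move=> m0 jm fc /andP[js sj] hr.
rewrite leNgt; apply/negP => rs.
have s0 : 0 < s by rewrite (le_lt_trans _ js)// mesh_ge0.
have sT : s <= T by rewrite (le_trans sj)// mesh_leT.
have sI : s \in `[0, T] by rewrite in_itv/= (ltW s0).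
have fr : 0 < f s - r by rewrite subr_gt0.
have [del del0 hd] := fc s _ sI fr.
have [k kd] : exists k : nat, T / del < k%:R.
  by exists (Num.truncn (T / del)).+1; rewrite truncnS_gt.
have k0 : (0 < k)%N by rewrite -(ltr0n R) (le_lt_trans _ kd)// divr_ge0 ?ltW.
have mk0 : (0 < m * k)%N by rewrite muln_gt0 m0.
have [i imk [/andP[is_ si] _]] := coarse_cell T0 mk0 s0 sT.
have meshM a : mesh T m a = mesh T (m * k) (a * k).
  rewrite /mesh !natrM; field.
  by rewrite !pnatr_eq0 -!lt0n m0 k0.
have ij : (i < j.+1 * k)%N.
  rewrite ltnNge; apply/negP => h.
  by have := lt_le_trans is_ sj; rewrite meshM ltNge (mesh_le T0 mk0 h).
have h1 : f (mesh T (m * k) i.+1) <= r.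
  apply: hr => //; rewrite (lt_le_trans js si)/= meshM.
  exact: (mesh_le T0 mk0).
have := hd (mesh T (m * k) i.+1) _ _.
rewrite in_itv/= mesh_ge0// mesh_leT// => /(_ isT).
rewrite ler0_norm ?subr_le0// opprB.
have hlt : mesh T (m * k) i.+1 - s < del.
  apply: (@lt_le_trans _ _ (mesh T (m * k) i.+1 - mesh T (m * k) i)); first by lra.
  rewrite meshS natrM ler_pdivrMr ?mulr_gt0 ?ltr0n//.
  move: kd; rewrite ltr_pdivrMr// => kd; rewrite mulrCA (le_trans (ltW kd))// mulrC.
  by rewrite ler_peMl ?ler1n// mulr_ge0// ltW.
move=> /(_ hlt); move: h1; set z := f (mesh _ _ _) => h1.
by rewrite ltr_norml => /andP[_]; lra.
Qed.

(** Only mesh times are tested, which keeps the event a countable union; continuity of the paths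
    extends the bound to all times of a cell. *)
Definition osc_set (del : R) (m : nat) : set Omega :=
  \bigcup_(j in `I_m) \bigcup_n \bigcup_(i in [set i | (i <= n.+1)%N /\ mesh T m j < mesh T n.+1 i <= mesh T m j.+1])
    [set w | del < `|Y (mesh T n.+1 i) w - Y (mesh T m j) w|].

Lemma osc_setP del m j s w : (0 < m)%N -> (j < m)%N -> ~ osc_set del m w ->
  mesh T m j < s <= mesh T m j.+1 -> `|Y s w - Y (mesh T m j) w| <= del.
Proof.
move=> m0 jm nO sj.
have base n i : (0 < n)%N -> (i <= n)%N -> mesh T m j < mesh T n i <= mesh T m j.+1 ->
    `|Y (mesh T n i) w - Y (mesh T m j) w| <= del.
  move=> n0 im ij; apply: contra_notP nO => /negP; rewrite -ltNge => h.
  by exists j => //; exists n.-1 => //; exists i; rewrite /= ?prednK.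
apply: (@dense_mesh (fun z => `|Y z w - Y (mesh T m j) w|) _ _ _ _ m0 jm) sj _ => // x e xI e0.
have [r r0 hr] := within_itv_distP (cY (w := w)) xI e0.
exists r => // z zI xz; apply: le_lt_trans (hr z zI xz).
by rewrite (le_trans (ler_dist_dist _ _))// opprB addrA subrK.
Qed.

Lemma measurable_osc_set del m : (0 < m)%N -> measurable (osc_set del m).
Proof.
move=> m0; apply: bigcup_measurable => j /= jm; apply: bigcup_measurable => n _.
apply: bigcup_measurable => i /= [ilt _].
apply: measurable_lt_set => //; apply: measurableT_comp => //.
by apply: measurable_funB; apply: mY; apply: meshT => //; exact: ltnW.
Qed.

Lemma osc_vanishing del : 0 < del -> vanishing P (fun m => osc_set del m.+1).
Proof.
move=> del0; apply: vanishing_pointwise => [n|w]; first exact: measurable_osc_set.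
have [r r0 hr] := segment_unif_continuous (cY (w := w)) del0.
exists (Num.truncn (T / r)).+1 => m hm [j /= jm [n _ [i /= [ilt /andP[ji ij]]]]].
apply/negP; rewrite -leNgt; apply/ltW/hr.
- by rewrite in_itv/=; exact: meshT.
- by rewrite in_itv/=; apply: meshT => //; exact: ltnW.
have mr : T / m.+1%:R < r.
  rewrite ltr_pdivrMr ?ltr0n// mulrC -ltr_pdivrMr//.
  by rewrite (lt_le_trans (truncnS_gt _))// ler_nat ltnW.
have := meshS T m.+1 j.
by move: mr; set q := T / _ => mr hq; rewrite gtr0_norm ?subr_gt0//; lra.
Qed.

End PathEvents.

Section SquareDistance.
Context {R : realType} {d : measure_display} {Omega : measurableType d}.
Variables (T : R) (Y : R -> Omega -> R) (H : step_process (R := R) (Omega := Omega)) (c : R).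
Local Notation mu := (@lebesgue_measure R).
Hypothesis T0 : 0 < T.
Hypothesis mY : forall s, 0 <= s <= T -> measurable_fun setT (Y s).
Hypothesis cY : forall w, {within `[0, T], continuous (Y ^~ w)}.
Hypothesis mH : forall i, (i < sp_size H)%N -> measurable_fun setT (sp_val H i).

Let O2 : measurableType _ := (Omega * measurableTypeR R)%type.

Let mind (a b : R) : measurable_fun [set: O2] (fun z : O2 => ((a < z.2 <= b)%R%:R : R)).
Proof.
rewrite (_ : (fun _ => _) = (\1_(`]a, b]%classic : set R)) \o snd); last first.
  by apply/funext => z /=; rewrite indicE mem_setE in_itv.
apply: measurableT_comp => //; exact: measurable_indic.
Qed.

Let fst_meas (f : Omega -> R) : measurable_fun setT f -> measurable_fun [set: O2] (fun z : O2 => f z.1).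
Proof. by move=> mf; exact: measurableT_comp. Qed.

Let msqrt : measurable_fun setT (@Num.sqrt R).
Proof. by apply: continuous_measurable_fun; exact: sqrt_continuous. Qed.

Lemma coarse_cvg (f : R -> R) s : {within `[0, T], continuous f} -> 0 < s <= T ->
  (fun m => coarse_fun T m.+1 (fun j => f (mesh T m.+1 j.+1)) s) @ \oo --> f s.
Proof.
move=> /within_itv_distP fc /andP[s0 sT]; apply/cvgrPdist_lt => e e0.
have sI : s \in `[0, T] by rewrite in_itv/= ltW.
have [r r0 hr] := fc s e sI e0.
exists (Num.truncn (T / r)).+1 => //= m hm.
have [j jm [/andP[js sj] ->]] := coarse_cell T0 (ltn0Sn m) s0 sT.
apply: hr; first by rewrite in_itv/= mesh_ge0// mesh_leT.
have mr : T / m.+1%:R < r.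
  rewrite ltr_pdivrMr ?ltr0n// mulrC -ltr_pdivrMr//.
  by rewrite (lt_le_trans (truncnS_gt _))// ler_nat ltnW.
have := meshS T m.+1 j.
by move: mr; set q := T / _ => mr hq; rewrite ler0_norm ?subr_le0// opprB; lra.
Qed.

(** Joint measurability of [Y] comes from its approximation by values at right ends of mesh cells;
    Tonelli then gives measurability in [w]. Coarse functions vanish at time 0, so the integrand is
    cut to [0 < s <= T], which leaves the integral unchanged. *)
Lemma measurable_sqr_dist : measurable_fun setT
  (fun w => \int[mu]_(s in `[0, T]) (step_eval H s w - c * Num.sqrt (Y s w)) ^+ 2).
Proof.
pose G m (z : O2) := (step_eval H z.2 z.1
   - c * Num.sqrt (coarse_fun T m.+1 (fun j => Y (mesh T m.+1 j.+1) z.1) z.2)) ^+ 2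
   * (0 < z.2 <= T)%R%:R.
pose g (z : O2) := (step_eval H z.2 z.1 - c * Num.sqrt (Y z.2 z.1)) ^+ 2 * (0 < z.2 <= T)%R%:R.
have mstep : measurable_fun [set: O2] (fun z : O2 => step_eval H z.2 z.1).
  under eq_fun do rewrite step_eval_indic.
  by apply: measurable_sum => i; apply: measurable_funM => //; apply: fst_meas; exact: mH.
have mG m : measurable_fun [set: O2] (G m).
  apply: measurable_funM => //; apply: measurable_funX; apply: measurable_funB => //.
  apply: measurable_funM => //; apply: measurableT_comp => //.
  apply: measurable_sum => i; apply: measurable_funM => //; apply: fst_meas.
  by apply: mY; rewrite mesh_ge0// mesh_leT.
have mg : measurable_fun [set: O2] g.
  apply: (measurable_fun_cvg mG) => -[w s] _; rewrite /G/g/=.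
  have [sT|] := boolP (0 < s <= T); last first.
    rewrite mulr0 => _; apply: cvg_near_cst.
    by apply: nearW => m; rewrite mulr0.
  have h := coarse_cvg (cY (w := w)) sT.
  have hs := continuous_cvg _ (@sqrt_continuous R (Y s w)) h.
  have hd : (fun m => step_eval H s w - c * Num.sqrt (coarse_fun T m.+1 (fun j => Y (mesh T m.+1 j.+1) w) s))
      @ \oo --> step_eval H s w - c * Num.sqrt (Y s w).
    by apply: cvgB; first exact: cvg_cst; apply: cvgMr; exact: hs.
  by apply: cvgM; [rewrite expr2; exact: (cvgM hd hd)|exact: cvg_cst].
rewrite (_ : (fun _ => _) = fine \o (fubini_F mu (EFin \o g))).
  apply: measurableT_comp => //.
  apply: measurable_fun_fubini_tonelli_F; first exact/measurable_EFinP.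
  by move=> z; rewrite lee_fin mulr_ge0// sqr_ge0.
apply/funext => w; rewrite /fubini_F /= /Rintegral; congr fine.
have mgw : measurable_fun setT (fun s => g (w, s)).
  by apply: (measurableT_comp mg); exact: measurable_pair1.
have gE s : 0 < s <= T -> g (w, s) = (step_eval H s w - c * Num.sqrt (Y s w)) ^+ 2.
  by move=> sT; rewrite /g/= sT mulr1.
rewrite -integral_itv_obnd_cbnd; last first.
  apply: (eq_measurable_fun (EFin \o (fun s => g (w, s)))).
    by move=> s; rewrite inE/= in_itv/= => /gE ->.
  by apply/measurable_EFinP; exact: measurable_funS mgw.
rewrite integral_mkcond; apply: eq_integral => s _.
rewrite patchE mem_setE in_itv/=; case: ifPn => [/gE -> //|/negbTE sT].
by rewrite /g/= sT mulr0.
Qed.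

End SquareDistance.

(** * Truncation of the integrands by their quadratic variation *)

Section Truncation.
Context {R : realType} {d : measure_display} {Omega : measurableType d}.
Variables (F : R -> set (set Omega)) (W B : R -> Omega -> R).
Hypotheses (hF : is_filtration F).
Variables (tau : nat -> R) (a x y : nat -> Omega -> R).
Hypotheses (tau0 : 0 <= tau 0) (tauS : forall k, tau k <= tau k.+1).
Hypotheses (ma : forall k, measurable_wrt (F (tau k)) (a k))
  (mx : forall k, measurable_wrt (F (tau k)) (x k))
  (my : forall k, measurable_wrt (F (tau k)) (y k)).
Variable K : R.
Hypothesis K0 : 0 <= K.

(** The test uses the bracket at [k.+1], known at time [tau k]: the integrand is switched off just
    before the bracket would pass [K], so the truncated bracket never does. *)
Definition expo_trunc k w : R := (expo_qv tau a x y k.+1 w <= K)%R%:R.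
Local Notation tr f := (fun k w => expo_trunc k w * f k w).

Lemma measurable_expo_trunc (f : nat -> Omega -> R) k :
  measurable_wrt (F (tau k)) (f k) -> measurable_wrt (F (tau k)) (tr f k).
Proof.
have tk := tau_ge0 tau0 tauS k.
move=> /(measurable_wrtP hF _ tk) mf; apply/(measurable_wrtP hF) => //.
apply: measurable_funM => //.
have mq := measurable_expo_qvS hF tau0 tauS ma mx my (k := k).
rewrite (_ : expo_trunc k = \1_[set w | expo_qv tau a x y k.+1 w <= K]).
  apply: measurable_indic.
  by apply: (@measurable_le_set _ _ (g_sigma_algebraType (F (tau k)))).
by apply/funext => w; rewrite indicE mem_setE.
Qed.

Lemma expo_qv_trunc_le k w : expo_qv tau (tr a) (tr x) (tr y) k w <= K.
Proof.
suff [] : expo_qv tau (tr a) (tr x) (tr y) k w <= K /\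
  expo_qv tau (tr a) (tr x) (tr y) k w <= expo_qv tau a x y k w by [].
elim: k => [|k [IH1 IH2]]; first by rewrite /expo_qv !big_ord0.
set S := expo_qv tau a x y k w in IH2 *; set S' := expo_qv _ _ _ _ _ _ in IH1 IH2 *.
have qE : expo_qv tau a x y k.+1 w = S + (a k w ^+ 2 + x k w ^+ 2 + y k w ^+ 2) * (tau k.+1 - tau k).
  by rewrite /expo_qv big_ord_recr.
have q0 : 0 <= (a k w ^+ 2 + x k w ^+ 2 + y k w ^+ 2) * (tau k.+1 - tau k).
  by rewrite mulr_ge0 ?subr_ge0// !addr_ge0 ?sqr_ge0.
have q'E : expo_qv tau (tr a) (tr x) (tr y) k.+1 w =
    S' + ((tr a) k w ^+ 2 + (tr x) k w ^+ 2 + (tr y) k w ^+ 2) * (tau k.+1 - tau k).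
  by rewrite /expo_qv big_ord_recr.
rewrite q'E qE /expo_trunc qE; set q := (_ * (tau k.+1 - _)) in q0 *.
have [h|h] := leP (S + q) K.
  by rewrite !mul1r -/q; split; lra.
by rewrite !mul0r expr0n/= !addr0 mul0r addr0; split => //; lra.
Qed.

Lemma expo_qv_le k l w : (k <= l)%N -> expo_qv tau a x y k w <= expo_qv tau a x y l w.
Proof.
elim: l => [|l IH]; first by rewrite leqn0 => /eqP ->.
rewrite leq_eqVlt => /predU1P[->//|]; rewrite ltnS => /IH /le_trans; apply.
rewrite [X in _ <= X]/expo_qv big_ord_recr/= lerDl.
by rewrite mulr_ge0 ?subr_ge0// !addr_ge0 ?sqr_ge0.
Qed.

Lemma expo_truncE L w : expo_qv tau a x y L w <= K ->
  expo_re W tau (tr a) (tr x) (tr y) L w = expo_re W tau a x y L w /\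
  expo_im W B tau (tr a) (tr x) (tr y) L w = expo_im W B tau a x y L w.
Proof.
move=> SK; have tr1 k : (k < L)%N -> expo_trunc k w = 1.
  by move=> kL; rewrite /expo_trunc (le_trans (expo_qv_le _ kL)).
split; apply: eq_bigr => k _; rewrite !tr1// !mul1r//.
Qed.

End Truncation.

(** * Approximation by exponential martingales *)

Section HestonPath.
Context {R : realType} {d : measure_display} {Omega : measurableType d}.
Variables (P : probability Omega R) (mdl : heston R) (F : R -> set (set Omega)).
Variables (W B : R -> Omega -> R) (T x y : R) (X Y : R -> Omega -> R).
Hypotheses (hF : is_filtration F) (hWB : brownian2 P F W B) (T0 : 0 < T).
Hypothesis hsol : heston_solution P mdl F W B T 0 x y X Y.
Local Notation mu := (@lebesgue_measure R).

Let a0 := drift0 mdl.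
Let b0 := reversion mdl.
Let sg := volvol mdl.
Let rb := rho_bar mdl.

Definition slope_X : R := corr mdl / volvol mdl * reversion mdl - 2^-1.
Definition const_X : R := rate mdl - dividend mdl - corr mdl / volvol mdl * drift0 mdl.

(** One explicit Euler step, backwards in time, for the exponent [A + i b + i u x - (p + i q) y].
    With [z = p + i q] it reads [z' = z - h (b0 z + sg^2 z^2 / 2 + i u slope_X - rb^2 u^2 / 2)],
    split into real and imaginary parts; [A + i b] gains [h (i u const_X - a0 z)]. *)
Definition riccati (h u p q A b p' q' A' b' : R) :=
  [/\ p' = p - h * (b0 * p - rb ^+ 2 * u ^+ 2 / 2 + sg ^+ 2 / 2 * (p ^+ 2 - q ^+ 2)),
      q' = q - h * (u * slope_X + b0 * q + sg ^+ 2 * p * q),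
      A' = A - h * (a0 * p)
    & b' = b + h * (u * const_X - a0 * q)].

Let Y_ge0 s w : 0 <= s <= T -> 0 <= Y s w.
Proof. by case: hsol => _ _ h _; exact: h. Qed.

Let cY w : {within `[0, T], continuous (Y ^~ w)}.
Proof. by case: hsol => _ [_ h]. Qed.

Let mYF s : 0 <= s <= T -> measurable_wrt (F s) (Y s).
Proof. by case: hsol => _ [h _] _ _; exact: h. Qed.

Let mXF s : 0 <= s <= T -> measurable_wrt (F s) (X s).
Proof. by case: hsol => [[h _]] _ _ _; exact: h. Qed.

Lemma measurable_sol_Y s : 0 <= s <= T -> measurable_fun setT (Y s).
Proof. by move=> sT; apply: (measurable_wrt_fun hF) (mYF sT); case/andP: sT. Qed.

Lemma measurable_sol_X s : 0 <= s <= T -> measurable_fun setT (X s).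
Proof. by move=> sT; apply: (measurable_wrt_fun hF) (mXF sT); case/andP: sT. Qed.

(** Stopping is tested at mesh times only, so the activity of a cell is known at its left end;
    inside the cell [Y] is controlled by the oscillation event. *)
Definition active (m : nat) (K : R) (w : Omega) (j : nat) : bool :=
  [forall i : 'I_j.+1, Y (mesh T m i) w <= K].

Lemma activeS m K w j : active m K w j.+1 -> active m K w j.
Proof.
move=> /forallP h; apply/forallP => i.
by have := h (widen_ord (leqnSn _) i).
Qed.

Lemma measurable_active m K j : (0 < m)%N -> (j <= m)%N ->
  measurable_wrt (F (mesh T m j)) (fun w => (active m K w j)%:R : R).
Proof.
move=> m0 jm; have j0 := mesh_ge0 T0 m0 j.
apply/(measurable_wrtP hF) => //.
rewrite (_ : (fun _ => _) = \1_(\bigcap_(i in `I_j.+1) [set w | Y (mesh T m i) w <= K])).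
  apply: measurable_indic; apply: bigcap_measurableType => i /= ij.
  apply: (@measurable_le_set _ _ (g_sigma_algebraType (F (mesh T m j)))) => //.
  apply/(measurable_wrtP hF) => //.
  apply: (measurable_wrt_le hF) (mYF _); [exact: mesh_ge0|exact: mesh_le|].
  by rewrite mesh_ge0// mesh_leT// (leq_trans _ jm).
apply/funext => w; rewrite indicE; congr (nat_of_bool _)%:R.
apply/idP/idP => [/forallP h|].
  by rewrite inE => i /= ij; exact: (h (Ordinal ij)).
by rewrite inE => h; apply/forallP => i; apply: h => /=; exact: ltn_ord.
Qed.

Section OnGrid.
Variables (m : nat) (K Cp C u : R) (HB HW : step_process (R := R) (Omega := Omega)).
Hypotheses (m0 : (0 < m)%N) (sHB : is_simple F 0 T HB) (sHW : is_simple F 0 T HW).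
Variables (p q : nat -> R).
Variables (tau : nat -> R) (L : nat).
Hypotheses (tauS : forall k, tau k <= tau k.+1) (tau0 : tau 0 = 0) (tauL : tau L = T)
  (tauT : forall k, (L <= k)%N -> tau k = T).
Hypothesis gmesh : forall j, (j <= m)%N -> grid_point tau (mesh T m j).
Hypothesis gHB : forall i, (i <= sp_size HB)%N -> grid_point tau (sp_time HB i).
Hypothesis gHW : forall i, (i <= sp_size HW)%N -> grid_point tau (sp_time HW i).

Lemma simple_time_itv H i : is_simple F 0 T H -> (i <= sp_size H)%N -> 0 <= sp_time H i <= T.
Proof.
case=> s0 sT mono _ _; move=> il.
have up j k : (j <= k)%N -> (k <= sp_size H)%N -> sp_time H j <= sp_time H k.
  elim: k => [|k IH]; first by rewrite leqn0 => /eqP ->.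
  rewrite leq_eqVlt => /predU1P[->//|]; rewrite ltnS => jk kl.
  by rewrite (le_trans (IH jk (ltnW kl)))// mono.
by rewrite -[X in X <= _]s0 up//= -[X in _ <= X]sT up.
Qed.

Definition proc_x k w := path_x T m tau (step_eval HW ^~ w) (active m K w) p k.
Definition proc_y k w := path_y T m tau (step_eval HW ^~ w) (active m K w) q k.
Definition proc_a k w := path_a T m tau (step_eval HB ^~ w) (active m K w) u k.

Let mstep H k : is_simple F 0 T H -> (forall i, (i <= sp_size H)%N -> grid_point tau (sp_time H i)) ->
  measurable_wrt (F (tau k)) (step_eval H (tau k.+1)).
Proof.
move=> sH gH; have [_ _ mono mH _] := sH.
have hT i : (i <= sp_size H)%N -> 0 <= sp_time H i <= T by exact: simple_time_itv.
exact: (measurable_wrt_step_eval tauS tau0 hT gH k hF mH).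
Qed.

Let mcoarse k (v : nat -> R) :
  measurable_wrt (F (tau k)) (fun w => coarse_fun T m (fun j => (active m K w j)%:R * v j) (tau k.+1)).
Proof.
have tk : 0 <= tau k by apply: tau_ge0 => //; rewrite tau0.
apply/(measurable_wrtP hF) => //; apply: measurable_sum => j.
have jm := ltn_ord j.
have [jk|] := boolP (mesh T m j < tau k.+1 <= mesh T m j.+1); last first.
  by move=> _; under eq_fun do rewrite mulr0; exact: measurable_cst.
apply: measurable_funM => //; apply: measurable_funM => //.
apply/(measurable_wrtP hF) => //.
apply: (measurable_wrt_le hF) (measurable_active _ m0 (ltnW jm)); first exact: mesh_ge0.
by case/andP: jk => jk _; apply: grid_lt jk; apply: gmesh; exact: ltnW.
Qed.

Let wrtM k (f g : Omega -> R) : measurable_wrt (F (tau k)) f -> measurable_wrt (F (tau k)) g ->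
  measurable_wrt (F (tau k)) (fun w => f w * g w).
Proof.
have tk : 0 <= tau k by apply: tau_ge0 => //; rewrite tau0.
move=> /(measurable_wrtP hF _ tk) mf /(measurable_wrtP hF _ tk) mg.
by apply/(measurable_wrtP hF) => //; exact: measurable_funM.
Qed.

Let wrtN k (f : Omega -> R) : measurable_wrt (F (tau k)) f ->
  measurable_wrt (F (tau k)) (fun w => - f w).
Proof.
have tk : 0 <= tau k by apply: tau_ge0 => //; rewrite tau0.
move=> /(measurable_wrtP hF _ tk) mf.
by apply/(measurable_wrtP hF) => //; exact: measurable_funN.
Qed.

Lemma measurable_proc_x k : measurable_wrt (F (tau k)) (proc_x k).
Proof. by apply: wrtN; apply: wrtM; [exact: mcoarse|exact: mstep]. Qed.

Lemma measurable_proc_y k : measurable_wrt (F (tau k)) (proc_y k).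
Proof. by apply: wrtN; apply: wrtM; [exact: mcoarse|exact: mstep]. Qed.

Lemma measurable_proc_a k : measurable_wrt (F (tau k)) (proc_a k).
Proof. by apply: wrtM; [exact: mcoarse|exact: mstep]. Qed.

Section QV.
Variables (w : Omega) (del : R).
Hypotheses (K0 : 0 <= K) (Cp0 : 0 <= Cp).
Hypothesis pC : forall j, (j <= m)%N -> `|p j| <= Cp.
Hypothesis qC : forall j, (j <= m)%N -> `|q j| <= Cp.
Hypothesis osc : forall j s, (j < m)%N -> mesh T m j < s <= mesh T m j.+1 ->
  `|Y s w - Y (mesh T m j) w| <= 1.

Let dist (H : step_process) c :=
  \int[mu]_(s in `[0, T]) (step_eval H s w - c * Num.sqrt (Y s w)) ^+ 2.

Let cc H : (forall i, (i <= sp_size H)%N -> grid_point tau (sp_time H i)) ->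
  cell_constant tau (step_eval H ^~ w).
Proof. by move=> gH; exact: step_eval_cell_constant. Qed.

Lemma activeK j s : (j < m)%N -> active m K w j -> mesh T m j < s <= mesh T m j.+1 -> Y s w <= K + 1.
Proof.
move=> jm /forallP/(_ ord_max)/= h /(osc jm).
by rewrite ler_norml => /andP[_]; lra.
Qed.

(** Each squared step value is at most twice its squared distance to [c sqrt Y] plus [2 c^2 Y], and
    [Y <= K + 1] on active cells, the 1 allowing for oscillation. Outside the exceptional events the
    truncation therefore has no effect. *)
Lemma expo_qv_bound : expo_qv tau proc_a proc_x proc_y L w <=
  (u ^+ 2 + 2 * Cp ^+ 2) * (2 * (dist HW sg + dist HB rb)
     + 2 * (sg ^+ 2 + rb ^+ 2) * (K + 1) * T).
Proof.
pose phi s := (coarse_fun T m (fun j => (active m K w j)%:R * u) s * step_eval HB s w) ^+ 2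
  + (coarse_fun T m (fun j => (active m K w j)%:R * p j.+1) s * step_eval HW s w) ^+ 2
  + (coarse_fun T m (fun j => (active m K w j)%:R * q j.+1) s * step_eval HW s w) ^+ 2.
have ccoarse v : cell_constant tau (coarse_fun T m v).
  by apply: coarse_cell_constant => //; exact: ltnW.
have cphi : cell_constant tau phi.
  move=> k s ks sk; rewrite /phi !(ccoarse _ _ _ ks sk).
  by rewrite (cc gHB ks sk) (cc gHW ks sk).
have [iphi phiE] := cell_constant_integral tauS L cphi.
rewrite tau0 tauL in iphi phiE.
have -> : expo_qv tau proc_a proc_x proc_y L w = \int[mu]_(s in `[0, T]) phi s.
  by rewrite phiE; apply: eq_bigr => k _; rewrite /proc_a /proc_x /proc_y /path_a /path_x /path_y !sqrrN.
have yp0 s : 0 <= s <= T -> 0 <= Y s w by exact: Y_ge0.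
have iW := integrable_sqr_dist tauS tau0 tauL yp0 (cY (w := w)) sg (cc gHW).
have iB := integrable_sqr_dist tauS tau0 tauL yp0 (cY (w := w)) rb (cc gHB).
set DW := (fun s => (step_eval HW s w - sg * _) ^+ 2) in iW *.
set DB := (fun s => (step_eval HB s w - rb * _) ^+ 2) in iB *.
pose M1 := u ^+ 2 + 2 * Cp ^+ 2; pose M2 := M1 * (2 * (sg ^+ 2 + rb ^+ 2) * (K + 1)).
have M1_ge0 : 0 <= M1 by rewrite /M1; have := sqr_ge0 u; have := sqr_ge0 Cp; lra.
have M2_ge0 : 0 <= M2.
  rewrite /M2; apply: mulr_ge0 => //; apply: mulr_ge0; last by rewrite addr_ge0.
  by apply: mulr_ge0 => //; rewrite addr_ge0 ?sqr_ge0.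
pose g s := M1 * 2 * (DW s + DB s) + M2.
have i1 : mu.-integrable `[0, T] (EFin \o (cst M2 : R -> R)).
  by apply: integrable_cst_set => //; exact: measure_itv_fin.
have iWB : mu.-integrable `[0, T] (EFin \o (fun s => DW s + DB s)).
  exact: (integrableD _ iW iB).
have ig : mu.-integrable `[0, T] (EFin \o g).
  exact: (integrableD _ (integrableZl _ (M1 * 2) iWB) i1).
have sq (r z : R) : `|r| <= z -> r ^+ 2 <= z ^+ 2.
  by move=> rz; rewrite -real_normK ?num_real// lerXn2r// nnegrE// (le_trans _ rz).
apply: (@le_trans _ _ (\int[mu]_(s in `[0, T]) g s)).
  apply: le_Rintegral => // s; rewrite /= in_itv/= => /andP[].
  rewrite le_eqVlt => /predU1P[<-|s0] sT.
    have c00 v : coarse_fun T m v 0 = 0.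
      by rewrite /coarse_fun big1// => j _; rewrite ltNge mesh_ge0// mulr0.
    rewrite /phi !c00 !mul0r expr0n/= !addr0 /g addr_ge0//.
    by apply: mulr_ge0; [lra|rewrite addr_ge0// sqr_ge0].
  have [j jm [jj cE]] := coarse_cell T0 m0 s0 sT.
  rewrite /phi !cE.
  have gs : 0 <= g s.
    by rewrite /g addr_ge0//; apply: mulr_ge0; [lra|rewrite addr_ge0// sqr_ge0].
  have [aj|] := boolP (active m K w j); last by rewrite !mul0r expr0n/= !addr0.
  rewrite !mul1r !exprMn.
  have ys : 0 <= Y s w by rewrite yp0// ltW.
  have yK := activeK jm aj jj.
  have hH (z c : R) : z ^+ 2 <= 2 * (z - c * Num.sqrt (Y s w)) ^+ 2 + 2 * c ^+ 2 * (K + 1).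
    rewrite (@le_trans _ _ (2 * (z - c * Num.sqrt (Y s w)) ^+ 2 + 2 * (c ^+ 2 * Y s w)))//.
      rewrite -[X in c ^+ 2 * X](sqr_sqrtr ys) -exprMn.
      set v := c * _; have := sqr_ge0 (z - 2 * v); nra.
    by rewrite lerD2l -mulrA ler_pM2l// ler_wpM2l ?sqr_ge0.
  have hW := hH (step_eval HW s w) sg; have hB := hH (step_eval HB s w) rb.
  have p2 := sq _ _ (pC jm); have q2 := sq _ _ (qC jm).
  rewrite -/(DW s) in hW; rewrite -/(DB s) in hB.
  have DW0 : 0 <= DW s by exact: sqr_ge0.
  have DB0 : 0 <= DB s by exact: sqr_ge0.
  set EW := 2 * DW s + _ in hW; set EB := 2 * DB s + _ in hB.
  have EW0 : 0 <= EW by rewrite (le_trans _ hW)// sqr_ge0.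
  have EB0 : 0 <= EB by rewrite (le_trans _ hB)// sqr_ge0.
  have e1 : u ^+ 2 * step_eval HB s w ^+ 2 <= u ^+ 2 * EB by rewrite ler_wpM2l ?sqr_ge0.
  have e2 : p j.+1 ^+ 2 * step_eval HW s w ^+ 2 <= Cp ^+ 2 * EW.
    by apply: ler_pM => //; exact: sqr_ge0.
  have e3 : q j.+1 ^+ 2 * step_eval HW s w ^+ 2 <= Cp ^+ 2 * EW.
    by apply: ler_pM => //; exact: sqr_ge0.
  have -> : g s = M1 * (EW + EB) by rewrite /g /M2 /EW /EB; ring.
  rewrite /M1 mulrDl.
  have := mulr_ge0 (sqr_ge0 u) EW0; have := mulr_ge0 (sqr_ge0 Cp) EB0.
  by clearbody EW EB; rewrite !mulrDr; lra.
rewrite /g RintegralD//=; last exact: (integrableZl _ (M1 * 2) iWB).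
rewrite RintegralZl// RintegralD//.
have -> : \int[mu]_(s in `[0, T]) M2 = M2 * T.
  transitivity (M2 * fine (mu `[0, T])); first exact: Rintegral_cst.
  by rewrite lebesgue_measure_itv/= lte_fin T0 -EFinB subr0.
by rewrite /M2 /M1 le_eqVlt; apply/orP; left; apply/eqP; rewrite /DW /DB /dist; ring.
Qed.

End QV.
End OnGrid.

End HestonPath.

Section HestonMartingale.
Context {R : realType} {d : measure_display} {Omega : measurableType d}.
Variables (P : probability Omega R) (mdl : heston R) (F : R -> set (set Omega)).
Variables (W B : R -> Omega -> R) (T x y : R) (X Y : R -> Omega -> R).
Hypotheses (hF : is_filtration F) (hWB : brownian2 P F W B) (T0 : 0 < T).
Hypothesis hsol : heston_solution P mdl F W B T 0 x y X Y.
Local Notation mu := (@lebesgue_measure R).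

Let a0 := drift0 mdl.
Let b0 := reversion mdl.
Let sg := volvol mdl.
Let rb := rho_bar mdl.
Let J t w := \int[mu]_(s in `[0, t]) Y s w.

Let Y_ge0 s w : 0 <= s <= T -> 0 <= Y s w.
Proof. by case: hsol => _ _ h _; exact: h. Qed.

Let cY w : {within `[0, T], continuous (Y ^~ w)}.
Proof. by case: hsol => _ [_ h]. Qed.

Lemma Rintegral_affine w (c k s : R) : 0 <= s <= T ->
  \int[mu]_(v in `[0, s]) (c + k * Y v w) = c * s + k * J s w.
Proof.
move=> /andP[s0 sT].
have iY : mu.-integrable `[0, s] (EFin \o (Y ^~ w)).
  apply: (@integrableS _ _ _ mu `[0, T]%classic) => //.
    by apply: subset_itvl; rewrite bnd_simp.
  exact: path_integrable (cY (w := w)).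
rewrite RintegralD//=; last 2 first.
- by apply: integrable_cst_set => //; exact: measure_itv_fin.
- exact: (integrableZl _ k iY).
rewrite RintegralZl// -/(J s w); congr (_ + _).
transitivity (c * fine (mu `[0, s])); first exact: Rintegral_cst.
rewrite lebesgue_measure_itv/= lte_fin.
case: ltP => [_|t0']; first by rewrite -EFinB subr0.
by congr (_ * _); apply/eqP; rewrite eq_le/= s0 t0'.
Qed.

(** [ito_integral] determines [I] at each time only as a limit in probability. The step integrals
    vanish identically at time 0, which forces the limit to vanish off a null set; the initial
    values of [X] and [Y] follow. *)
Lemma ito_integral_start V H I : ito_integral P F V 0 T H I ->
  exists2 N : set Omega, measurable N /\ P N = 0%E & forall w, ~ N w -> I 0 w = 0.
Proof.
move=> [Hn [sH _ iH]].
have T00 : (0 : R) <= 0 <= T by rewrite lexx ltW.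
have [mI cI] := iH 0 T00.
have SI0 n w : step_integral V (Hn n) 0 w = 0.
  rewrite /step_integral big1// => i _; have il := ltn_ord i.
  have /andP[t1 _] := simple_time_itv (sH n) (ltnW il).
  have /andP[t2 _] := simple_time_itv (sH n) il.
  by rewrite !min_r// subrr mulr0.
have SIE : (fun n => step_integral V (Hn n) 0) = (fun n => cst (0 : R)).
  by apply/funext => n; apply/funext => w; rewrite SI0.
rewrite SIE in cI.
pose N := \bigcup_k [set w | k.+1%:R^-1 < `|(0 : R) - I 0 w|].
have mN : measurable N.
  apply: bigcup_measurable => k _; apply: measurable_lt_set => //.
  by apply: measurableT_comp => //; exact: measurable_funB.
exists N.
  split => //; apply: measure_negligible => //; apply: negligible_bigcup => k.
  have e0 : (0 : R) < k.+1%:R^-1 by rewrite invr_gt0.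
  have [mE vE] := vanishing_cvg_in_probability (fun n => measurable_cst (0 : R)) mI e0 cI.
  apply/negligibleP; first exact: (mE 0%N).
  apply/eqP; rewrite eq_le measure_ge0 andbT; apply/lee_addgt0Pr => e e_0.
  by rewrite add0e; have [n0 /(_ n0 (leqnn _))] := vE e e_0.
move=> w; apply: contra_notP => /eqP Iw; exists (Num.truncn (`|I 0 w|^-1)) => //=.
rewrite sub0r normrN invf_plt ?posrE ?normr_gt0//.
by rewrite truncnS_gt.
Qed.

(** Only finitely many mesh times occur, so a single null set and two vanishing sequences of events
    carry all that [heston_solution] asserts almost surely or in probability. *)
Lemma solution_mesh m : (0 < m)%N -> exists HBn HWn : nat -> step_process (R := R) (Omega := Omega),
  exists IB IW : R -> Omega -> R, exists N : set Omega,
  [/\ forall n, is_simple F 0 T (HBn n) /\ is_simple F 0 T (HWn n),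
      measurable N /\ P N = 0%E,
      forall w j, ~ N w -> (j <= m)%N ->
        Y (mesh T m j) w = y + (a0 * mesh T m j - b0 * J (mesh T m j) w) + IW (mesh T m j) w /\
        X (mesh T m j) w = x + (const_X mdl * mesh T m j + slope_X mdl * J (mesh T m j) w) + IB (mesh T m j) w /\
        Y 0 w = y /\ X 0 w = x,
      forall e, 0 < e -> vanishing P (fun n => [set w | e <
          `|\int[mu]_(s in `[0, T]) (step_eval (HWn n) s w - sg * Num.sqrt (Y s w)) ^+ 2|]
        `|` [set w | e < `|\int[mu]_(s in `[0, T]) (step_eval (HBn n) s w - rb * Num.sqrt (Y s w)) ^+ 2|])
    & forall e, 0 < e -> vanishing P (fun n => \bigcup_(j in `I_m.+1)
        ([set w | e < `|step_integral W (HWn n) (mesh T m j) w - IW (mesh T m j) w|]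
        `|` [set w | e < `|step_integral B (HBn n) (mesh T m j) w - IB (mesh T m j) w|]))].
Proof.
move=> m0.
have [_ _ _ [IB [IW [itoB itoW sde]]]] := hsol.
have [NB [mNB PNB] B0] := ito_integral_start itoB.
have [NW [mNW PNW] W0] := ito_integral_start itoW.
move: itoB itoW => [HBn [sB dB iB]] [HWn [sW dW iW]].
have mT j : (j <= m)%N -> 0 <= mesh T m j <= T by move=> jm; rewrite mesh_ge0// mesh_leT.
have mval H : is_simple F 0 T H -> forall i, (i < sp_size H)%N -> measurable_fun setT (sp_val H i).
  move=> sH i il; have [_ _ _ mH _] := sH.
  apply: (measurable_wrt_fun hF) (mH _ il).
  by have /andP[] := simple_time_itv sH (ltnW il).
have mSI (V : R -> Omega -> R) H s : (forall s, 0 <= s -> measurable_fun setT (V s)) ->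
    is_simple F 0 T H -> 0 <= s -> measurable_fun setT (step_integral V H s).
  move=> mV sH s0; apply: measurable_sum => i; have il := ltn_ord i.
  apply: measurable_funM; first exact: mval.
  have t1 : 0 <= sp_time H i by have /andP[] := simple_time_itv sH (ltnW il).
  have t2 : 0 <= sp_time H i.+1 by have /andP[] := simple_time_itv sH il.
  by apply: measurable_funB; apply: mV; rewrite le_min s0 ?t1 ?t2.
have mW s : 0 <= s -> measurable_fun setT (W s) by move=> s0; exact: (measurable_W hF hWB).
have mB s : 0 <= s -> measurable_fun setT (B s) by move=> s0; exact: (measurable_B hF hWB).
have mD H c : is_simple F 0 T H -> measurable_fun setT
    (fun w => \int[mu]_(s in `[0, T]) (step_eval H s w - c * Num.sqrt (Y s w)) ^+ 2).
  move=> sH; apply: measurable_sqr_dist => //; last exact: mval.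
  by move=> s sT; exact: (measurable_sol_Y hF hsol).
have /choice[Nf hN] : forall j, exists N : set Omega, (j <= m)%N ->
    [/\ measurable N, P N = 0%E & forall w, ~ N w ->
        Y (mesh T m j) w = y + (a0 * mesh T m j - b0 * J (mesh T m j) w) + IW (mesh T m j) w /\
        X (mesh T m j) w = x + (const_X mdl * mesh T m j + slope_X mdl * J (mesh T m j) w) + IB (mesh T m j) w].
  move=> j; have [jm|] := boolP (j <= m)%N; last by exists set0.
  have [N [mN PN sub]] := sde _ (mT j jm).
  exists N => _; split => // w nNw.
  have [->] : X (mesh T m j) w = x + (\int[mu]_(v in `[0, mesh T m j]) mu_X mdl (Y v w)) + IB (mesh T m j) w /\
              Y (mesh T m j) w = y + (\int[mu]_(v in `[0, mesh T m j]) mu_Y mdl (Y v w)) + IW (mesh T m j) w.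
    by apply: contrapT => h; apply: nNw; exact: sub.
  move=> ->; split; congr (_ + _ + _).
    transitivity (\int[mu]_(v in `[0, mesh T m j]) (a0 + - b0 * Y v w)).
      by apply: eq_Rintegral => v _; rewrite /mu_Y mulNr.
    by rewrite Rintegral_affine ?mT// mulNr.
  exact: Rintegral_affine (mT j jm).
exists HBn, HWn, IB, IW, ((\bigcup_(j in `I_m.+1) Nf j) `|` (NB `|` NW)); split.
- by move=> n; split.
- have mNf : measurable (\bigcup_(j in `I_m.+1) Nf j).
    by apply: bigcup_measurable => j /= jm; have [] := hN j jm.
  split; first by apply: measurableU => //; exact: measurableU.
  have PBW : P (NB `|` NW) = 0%E by rewrite measureU0.
  rewrite (measureU0 mNf (measurableU _ _ mNB mNW) PBW).
  have [|mE vE] := @vanishing_bigcup _ _ _ P (fun j _ => Nf j) m.+1.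
    by move=> j jm; have [mN PN _] := hN j jm; exact: vanishing_null.
  apply/eqP; rewrite eq_le measure_ge0 andbT; apply/lee_addgt0Pr => e e0.
  by rewrite add0e; have [n0 /(_ n0 (leqnn _))] := vE e e0.
- move=> w j nN jm; have [_ _ h] := hN j jm.
  have [|h1 h2] := h w; first by move=> Nw; apply: nN; left; exists j.
  split=> //; split=> //.
  have [_ _ /(_ w)] := hN 0%N isT; rewrite mesh0.
  have J0 : J 0 w = 0 by rewrite /J set_itv1 Rintegral_set1.
  rewrite J0 !mulr0 subrr !addr0 B0 ?W0 ?addr0; last 2 first.
  + by move=> Nw; apply: nN; right; right.
  + by move=> Nw; apply: nN; right; left.
  by apply=> Nw; apply: nN; left; exists 0%N.
- move=> e e0.
  have vd (Hn : nat -> step_process) c : (forall n, is_simple F 0 T (Hn n)) ->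
      cvg_in_probability P (fun n w => \int[mu]_(s in `[0, T]) (step_eval (Hn n) s w - c * Num.sqrt (Y s w)) ^+ 2) (fun=> 0) ->
      vanishing P (fun n => [set w | e < `|\int[mu]_(s in `[0, T]) (step_eval (Hn n) s w - c * Num.sqrt (Y s w)) ^+ 2|]).
    move=> sH cH; have := vanishing_cvg_in_probability (fun n => mD (Hn n) c (sH n)) (measurable_cst (0 : R)) e0 cH.
    by under eq_fun do under eq_set do rewrite subr0.
  by apply: vanishingU; apply: vd.
- move=> e e0; apply: (@vanishing_bigcup _ _ _ P (fun j n =>
    [set w | e < `|step_integral W (HWn n) (mesh T m j) w - IW (mesh T m j) w|]
    `|` [set w | e < `|step_integral B (HBn n) (mesh T m j) w - IB (mesh T m j) w|])) => j jm.
  have [mIW cW] := iW _ (mT j jm); have [mIB cB] := iB _ (mT j jm).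
  apply: vanishingU; apply: vanishing_cvg_in_probability => // n; apply: mSI => //; exact: mesh_ge0.
Qed.

Lemma small_factor (c del : R) : 0 <= c -> 0 < del ->
  exists2 e : R, 0 < e & c * e <= del.
Proof.
(* The denominator [c + 1] covers [c = 0]. *)
move=> c0 del0; exists (del / (c + 1)); first by rewrite divr_gt0// ltr_wpDl.
rewrite mulrCA ler_piMr ?(ltW del0)// ler_pdivrMr ?mul1r; last by rewrite ltr_wpDl.
by rewrite lerDl.
Qed.

Lemma grid_of_simple m H H' : (0 < m)%N -> is_simple F 0 T H -> is_simple F 0 T H' ->
  exists (tau : nat -> R) (L : nat), [/\ forall k, tau k <= tau k.+1, tau 0 = 0, tau L = T,
    forall j, (j <= m)%N -> grid_point tau (mesh T m j) &
    (forall i, (i <= sp_size H)%N -> grid_point tau (sp_time H i)) /\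
    (forall i, (i <= sp_size H')%N -> grid_point tau (sp_time H' i))].
Proof.
move=> m0 sH sH'.
pose l := map (mesh T m) (iota 0 m.+1) ++ map (sp_time H) (iota 0 (sp_size H).+1)
  ++ map (sp_time H') (iota 0 (sp_size H').+1).
have lP t : t \in l -> 0 <= t <= T.
  rewrite !mem_cat => /or3P[] /mapP[i]; rewrite mem_iota/= ltnS => il ->.
  - by rewrite mesh_ge0// mesh_leT.
  - exact: simple_time_itv sH il.
  - exact: simple_time_itv sH' il.
have [tau [L [tauS tau0 tauL _ gl]]] := grid_of_seq (ltW T0) lP.
exists tau, L; split => //; [|split] => i il; apply: gl; rewrite !mem_cat; apply/or3P.
- by apply: Or31; apply: map_f; rewrite mem_iota.
- by apply: Or32; apply: map_f; rewrite mem_iota.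
- by apply: Or33; apply: map_f; rewrite mem_iota.
Qed.

(** Outside [Bad], the exponent [rho + i theta] of the martingale follows the increment of the
    affine exponent up to the stopping cell. The order of the quantifiers matters: the second moment
    bound [D] precedes [del], [eps] and the mesh, so that the contribution of [Bad] can be made
    small afterwards. *)
Lemma martingale_approx (K Cp u : R) : 0 <= K -> 0 <= Cp -> exists D : R,
  forall del eps : R, 0 < del -> 0 < eps -> exists m1 : nat, forall m, (m1 <= m)%N -> (0 < m)%N ->
  forall p q A b : nat -> R,
  (forall j, (j < m)%N -> riccati mdl (T / m%:R) u (p j.+1) (q j.+1) (A j.+1) (b j.+1)
     (p j) (q j) (A j) (b j)) ->
  (forall j, (j <= m)%N -> `|p j| <= Cp) -> (forall j, (j <= m)%N -> `|q j| <= Cp) ->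
  exists (rho theta : Omega -> R) (Bad : set Omega),
  [/\ measurable_fun setT rho /\ measurable_fun setT theta,
      forall th, P.-integrable setT (EFin \o (fun w => expR (rho w) * cos (th + theta w))) /\
        (\int[P]_w (expR (rho w) * cos (th + theta w))%:E = (cos th)%:E)%E,
      (\int[P]_w (expR (2 * rho w))%:E <= D%:E)%E /\
        (u = 0 -> (forall j, q j = 0) -> forall w, theta w = 0),
      measurable Bad /\ (P Bad <= eps%:E)%E
    & forall w, ~ Bad w -> [/\
      `|rho w - \sum_(j < m) (active T Y m K w j)%:R *
         ((A j.+1 - p j.+1 * Y (mesh T m j.+1) w) - (A j - p j * Y (mesh T m j) w))| <= del,
      `|theta w - \sum_(j < m) (active T Y m K w j)%:R *
         ((u * X (mesh T m j.+1) w + b j.+1 - q j.+1 * Y (mesh T m j.+1) w)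
          - (u * X (mesh T m j) w + b j - q j * Y (mesh T m j) w))| <= del,
      Y 0 w = y & X 0 w = x]].
Proof.
move=> K0 Cp0.
pose C := Cp ^+ 2 + u ^+ 2 + rb ^+ 2 * u ^+ 2 + sg ^+ 2 * Cp ^+ 2
  + `|u * slope_X mdl| + `|b0| * Cp.
have C0 : 0 <= C.
  by rewrite /C; repeat (exact: sqr_ge0 || exact: normr_ge0 || exact: Cp0 || apply: addr_ge0 || apply: mulr_ge0).
pose s2 := sg ^+ 2 + rb ^+ 2.
have s20 : 0 <= s2 by rewrite addr_ge0 ?sqr_ge0.
have K1 : 0 <= K + 1 by rewrite addr_ge0.
pose M1 := u ^+ 2 + 2 * Cp ^+ 2.
have M10 : 0 <= M1 by rewrite /M1; have := sqr_ge0 u; have := sqr_ge0 Cp; lra.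
(* The sum [1 + 1] bounds the two mean square distances; for this reason [e'] is taken at most 1. *)
pose Kq := M1 * (2 * (1 + 1) + 2 * s2 * (K + 1) * T).
have Kq0 : 0 <= Kq.
  apply: mulr_ge0 => //; apply: addr_ge0 => //; apply: mulr_ge0; last exact: ltW.
  by apply: mulr_ge0 => //; exact: mulr_ge0.
exists (expR Kq) => del eps del0 eps0.
(* The quarters of [del] pay for the weight [e] of Young's inequality, the oscillation [del1], the
   mean square distances and the errors [e1] of the stochastic integrals. [e1] is chosen after [m],
   since the number of cells multiplies it. *)
have d4 : 0 < del / 4 by rewrite divr_gt0.
have e2 : 0 < eps / 2 by rewrite divr_gt0.
have [e e0 he] := small_factor (mulr_ge0 (mulr_ge0 (mulr_ge0 C0 s20) K1) (ltW T0)) d4.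
have [r r0 hr] := small_factor (mulr_ge0 C0 (ltW T0)) d4.
pose del1 := Num.min 1 r.
have del1_gt0 : 0 < del1 by rewrite lt_min ltr01.
have mY s : 0 <= s <= T -> measurable_fun setT (Y s) by exact: (measurable_sol_Y hF hsol).
have [mO vO] := osc_vanishing P T0 mY cY del1_gt0.
have [m1 hm1] := vO _ e2.
exists m1.+1 => m m1m m0 p q A b rec pC qC.
have [HBn [HWn [IB [IW [N [sHn [mN PN] sde vd vS]]]]]] := solution_mesh m0.
have ei : 0 <= 1 + e^-1 by rewrite addr_ge0// invr_ge0 ltW.
have [r' r'0 hr'] := small_factor (mulr_ge0 (mulr_ge0 C0 ei) (ler0n R 2)) d4.
pose e' := Num.min 1 r'.
have e'_gt0 : 0 < e' by rewrite lt_min ltr01.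
have mC0 : 0 <= m%:R * (2 * (Cp + `|u|)) by rewrite mulr_ge0// mulr_ge0// addr_ge0.
have [e1 e1_gt0 he1] := small_factor mC0 d4.
have [mV vV] := vanishingU (vd _ e'_gt0) (vS _ e1_gt0).
have [n /(_ n (leqnn n)) PV] := vV _ e2.
move: (mV n) PV; set V := (X in measurable X) => mVn PV.
have [sHB sHW] := sHn n.
have [tau [L [tauS tau0 tauL gmesh [gHB gHW]]]] := grid_of_simple m0 sHB sHW.
pose pa := proc_a T Y m K u (HBn n) tau.
pose px := proc_x T Y m K (HWn n) p tau.
pose py := proc_y T Y m K (HWn n) q tau.
have mpa k : measurable_wrt (F (tau k)) (pa k) by exact: (measurable_proc_a hF T0 hsol).
have mpx k : measurable_wrt (F (tau k)) (px k) by exact: (measurable_proc_x hF T0 hsol).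
have mpy k : measurable_wrt (F (tau k)) (py k) by exact: (measurable_proc_y hF T0 hsol).
pose tr (f : nat -> Omega -> R) k w := expo_trunc tau pa px py Kq k w * f k w.
have tau00 : 0 <= tau 0 by rewrite tau0.
have mta k : measurable_wrt (F (tau k)) (tr pa k) by exact: (measurable_expo_trunc hF tau00 tauS mpa mpx mpy).
have mtx k : measurable_wrt (F (tau k)) (tr px k) by exact: (measurable_expo_trunc hF tau00 tauS mpa mpx mpy).
have mty k : measurable_wrt (F (tau k)) (tr py k) by exact: (measurable_expo_trunc hF tau00 tauS mpa mpx mpy).
have qvK k w : expo_qv tau (tr pa) (tr px) (tr py) k w <= Kq by exact: expo_qv_trunc_le.
exists (expo_re W tau (tr pa) (tr px) (tr py) L), (expo_im W B tau (tr pa) (tr px) (tr py) L).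
have Om : measurable (osc_set T Y del1 m) by exact: measurable_osc_set.
exists ((osc_set T Y del1 m `|` V) `|` N); split.
- split; first exact: (measurableT_expo_re hF hWB tau00 tauS mta mtx mty).
  exact: (measurableT_expo_im hF hWB tau00 tauS mta mtx mty).
- move=> th; split; first exact: (expo_cos_integrable hF hWB tau00 tauS mta mtx mty qvK).
  exact: (expo_martingale hF hWB tau00 tauS mta mtx mty qvK).
- split; first exact: (expo_second_moment_le hF hWB tau00 tauS mta mtx mty qvK).
  move=> u0 q0 w; rewrite /expo_im big1// => i _.
  have -> : tr pa i w = 0.
    rewrite /tr /pa /proc_a /path_a /coarse_fun big1 ?mul0r ?mulr0// => j _.
    by rewrite u0 mulr0 mul0r.
  have -> : tr py i w = 0.
    rewrite /tr /py /proc_y /path_y /coarse_fun big1 ?mul0r ?oppr0 ?mulr0// => j _.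
    by rewrite q0 mulr0 mul0r.
  by rewrite !mul0r mulr0 mul0r !addr0 subr0.
- split; first by apply: measurableU => //; exact: measurableU.
  have -> : P (osc_set T Y del1 m `|` V `|` N) = P (osc_set T Y del1 m `|` V).
    by rewrite measureU0//; exact: measurableU.
  rewrite (le_trans (measureU2 _ Om mVn))//.
  rewrite [X in (_ <= X%:E)%E](splitr eps) EFinD leeD//.
  have := hm1 m.-1; rewrite prednK//; apply.
  by rewrite -ltnS prednK.
move=> w nBad.
have nO : ~ osc_set T Y del1 m w by move=> h; apply: nBad; left; left.
have nV : ~ V w by move=> h; apply: nBad; left; right.
have nN : ~ N w by move=> h; apply: nBad; right.
have osc j s : (j < m)%N -> mesh T m j < s <= mesh T m j.+1 -> `|Y s w - Y (mesh T m j) w| <= del1.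
  by move=> jm; exact: (osc_setP T0 cY m0 jm nO).
have osc1 j s : (j < m)%N -> mesh T m j < s <= mesh T m j.+1 -> `|Y s w - Y (mesh T m j) w| <= 1.
  by move=> jm /(osc _ _ jm)/le_trans; apply; rewrite ge_min lexx.
have dW : \int[mu]_(s in `[0, T]) (step_eval (HWn n) s w - sg * Num.sqrt (Y s w)) ^+ 2 <= e'.
  apply: contra_notP nV => /negP; rewrite -ltNge => h; left; left => /=.
  by rewrite (lt_le_trans h)// ler_norm.
have dB : \int[mu]_(s in `[0, T]) (step_eval (HBn n) s w - rb * Num.sqrt (Y s w)) ^+ 2 <= e'.
  apply: contra_notP nV => /negP; rewrite -ltNge => h; left; right => /=.
  by rewrite (lt_le_trans h)// ler_norm.
have siW j : (j <= m)%N -> `|step_integral W (HWn n) (mesh T m j) w - IW (mesh T m j) w| <= e1.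
  move=> jm; apply: contra_notP nV => /negP; rewrite -ltNge => h; right.
  by exists j => //; left.
have siB j : (j <= m)%N -> `|step_integral B (HBn n) (mesh T m j) w - IB (mesh T m j) w| <= e1.
  move=> jm; apply: contra_notP nV => /negP; rewrite -ltNge => h; right.
  by exists j => //; right.
have [_ [_ [Y0w X0w]]] := sde w 0%N nN isT.
have qvw : expo_qv tau pa px py L w <= Kq.
  rewrite (le_trans (expo_qv_bound T0 hsol u m0 tauS tau0 tauL gmesh gHB gHW K0 pC qC osc1))//.
  rewrite /Kq; apply: ler_wpM2l => //; rewrite lerD2r; apply: ler_wpM2l => //.
  by apply: lerD; [apply: (le_trans dW)|apply: (le_trans dB)]; rewrite ge_min lexx.
have [-> ->] := expo_truncE W B tauS qvw.
have err_le z : z <= del / 4 ->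
   z + (C * (1 + e^-1) * (\int[mu]_(s in `[0, T]) (step_eval (HWn n) s w - sg * Num.sqrt (Y s w)) ^+ 2
       + \int[mu]_(s in `[0, T]) (step_eval (HBn n) s w - rb * Num.sqrt (Y s w)) ^+ 2)
     + C * (e * (sg ^+ 2 + rb ^+ 2) * (K + 1) + del1) * T) <= del.
  move=> zd.
  have h1 : C * (1 + e^-1) * (\int[mu]_(s in `[0, T]) (step_eval (HWn n) s w - sg * Num.sqrt (Y s w)) ^+ 2
       + \int[mu]_(s in `[0, T]) (step_eval (HBn n) s w - rb * Num.sqrt (Y s w)) ^+ 2) <= del / 4.
    apply: (@le_trans _ _ (C * (1 + e^-1) * (2 * r'))); last by rewrite mulrA.
    apply: ler_wpM2l; first exact: mulr_ge0.
    have : e' <= r' by rewrite ge_min lexx orbT.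
    by move=> er; rewrite mulr_natl mulr2n lerD// ?(le_trans dW)// (le_trans dB).
  have h2 : C * T * del1 <= del / 4.
    by apply: le_trans hr; apply: ler_wpM2l; [rewrite mulr_ge0// ltW|rewrite ge_min lexx orbT].
  rewrite (_ : C * (e * (sg ^+ 2 + rb ^+ 2) * (K + 1) + del1) * T
     = C * s2 * (K + 1) * T * e + C * T * del1); last by rewrite /s2; ring.
  rewrite [leRHS](_ : del = del / 4 + (del / 4 + (del / 4 + del / 4))); last by field.
  by apply: lerD => //; apply: lerD => //; exact: lerD.
have gsI (V' : R -> Omega -> R) H j : is_simple F 0 T H ->
    (forall i, (i <= sp_size H)%N -> grid_point tau (sp_time H i)) -> (j <= m)%N ->
    step_integral V' H (mesh T m j) w = \sum_(k < L) step_eval H (tau k.+1) w *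
    (tau k.+1 <= mesh T m j)%R%:R * (V' (tau k.+1) w - V' (tau k) w).
  move=> sH gH jm; have [_ _ mono _ _] := sH.
  apply: (step_integralE tauS tau0 tauL mono _ gH); [|exact: gmesh|exact: mesh_ge0].
  by move=> i ile; exact: (simple_time_itv sH ile).
have act j s : (j < m)%N -> active T Y m K w j -> mesh T m j < s <= mesh T m j.+1 -> Y s w <= K + 1.
  by move=> jm aj jj; exact: (activeK osc1 jm aj jj).
have cB := step_eval_cell_constant gHB w.
have cW := step_eval_cell_constant gHW w.
have yp0 s : 0 <= s <= T -> 0 <= Y s w by exact: Y_ge0.
have siW' j : (j <= m)%N -> `|\sum_(k < L) step_eval (HWn n) (tau k.+1) w *
    (tau k.+1 <= mesh T m j)%R%:R * (W (tau k.+1) w - W (tau k) w) - IW (mesh T m j) w| <= e1.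
  by move=> jm; rewrite -gsI//; exact: siW.
have siB' j : (j <= m)%N -> `|\sum_(k < L) step_eval (HBn n) (tau k.+1) w *
    (tau k.+1 <= mesh T m j)%R%:R * (B (tau k.+1) w - B (tau k) w) - IB (mesh T m j) w| <= e1.
  by move=> jm; rewrite -gsI//; exact: siB.
have sdeY j : (j <= m)%N -> Y (mesh T m j) w = y + (a0 * mesh T m j - b0 * J (mesh T m j) w) + IW (mesh T m j) w.
  by move=> jm; have [] := sde w j nN jm.
have sdeX j : (j <= m)%N -> X (mesh T m j) w = x + (const_X mdl * mesh T m j + slope_X mdl * J (mesh T m j) w) + IB (mesh T m j) w.
  by move=> jm; have [_ []] := sde w j nN jm.
split => //.
- have := @path_re_close R T m T0 m0 tau L tauS tau0 tauL gmesh sg rb (Y ^~ w)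
    (step_eval (HBn n) ^~ w) (step_eval (HWn n) ^~ w) yp0 (cY (w := w)) cB cW
    (active T Y m K w) (K + 1) del1 C e e0 C0 K1 (ltW del1_gt0) act osc.
  move=> /(_ (W ^~ w) (IW ^~ w) p q A a0 b0 (slope_X mdl) u y e1 sdeY siW').
  have rp j : (j < m)%N -> p j = p j.+1 - T / m%:R * (b0 * p j.+1 - rb ^+ 2 * u ^+ 2 / 2
      + sg ^+ 2 / 2 * (p j.+1 ^+ 2 - q j.+1 ^+ 2)) by case/rec.
  have rA j : (j < m)%N -> A j = A j.+1 - T / m%:R * (a0 * p j.+1) by case/rec.
  move=> /(_ rp rA Cp Cp0 pC qC (lexx _)) /le_trans; apply; apply: err_le.
  apply: le_trans he1; rewrite mulrA; apply: ler_wpM2r; first exact: ltW.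
  by rewrite ler_wpM2l// ler_pM2l// lerDl.
- have := @path_im_close R T m T0 m0 tau L tauS tau0 tauL gmesh sg rb (Y ^~ w)
    (step_eval (HBn n) ^~ w) (step_eval (HWn n) ^~ w) yp0 (cY (w := w)) cB cW
    (active T Y m K w) (K + 1) del1 C e e0 C0 K1 (ltW del1_gt0) act osc.
  move=> /(_ (W ^~ w) (B ^~ w) (IW ^~ w) (IB ^~ w) (X ^~ w) p q b a0 b0 (const_X mdl) (slope_X mdl) u x y e1 sdeY sdeX siW' siB').
  have rq j : (j < m)%N -> q j = q j.+1 - T / m%:R * (u * slope_X mdl + b0 * q j.+1
      + sg ^+ 2 * p j.+1 * q j.+1) by case/rec.
  have rB j : (j < m)%N -> b j = b j.+1 + T / m%:R * (u * const_X mdl - a0 * q j.+1) by case/rec.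
  move=> /(_ rq rB Cp Cp0 pC qC (lexx _)) /le_trans; apply; apply: err_le.
  by apply: le_trans he1; rewrite mulrA.
Qed.

End HestonMartingale.

(** Flags that never switch back on sum only up to a stopping index. That index does not depend on
    [v], so the real and imaginary exponents stop together. *)
Lemma stop_telescope {R : realType} (act : nat -> bool) (m : nat) :
  (forall j, act j.+1 -> act j) ->
  exists2 i, (i <= m)%N & ((forall j, (j < m)%N -> act j) -> i = m) /\
    forall v : nat -> R, \sum_(j < m) (act j)%:R * (v j.+1 - v j) = v i - v 0.
Proof.
move=> actS; have act_le i j : (i <= j)%N -> act j -> act i.
  elim: j => [|j IH]; first by rewrite leqn0 => /eqP ->.
  by rewrite leq_eqVlt => /predU1P[->//|]; rewrite ltnS => ij /actS; exact: IH.
elim: m => [|m [i im [IH1 IH2]]].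
  by exists 0%N => //; split=> // v; rewrite big_ord0 subrr.
have [am|am] := boolP (act m).
  exists m.+1 => //; split=> // v; rewrite big_ord_recr/= am mul1r IH2 IH1; first by ring.
  by move=> j jm; apply: act_le am; exact: ltnW.
exists i; first exact: leqW.
split=> [h|v]; first by rewrite h in am.
by rewrite big_ord_recr/= (negbTE am) mul0r addr0.
Qed.

Section IntegralBounds.
Context {R : realType} {d : measure_display} {Omega : measurableType d}.
Variable P : probability Omega R.
Local Open Scope ereal_scope.

Lemma integral_bound4 (c1 c2 c3 c4 : R) (E1 E2 : set Omega) (f : Omega -> R) :
  (0 <= c1)%R -> (0 <= c2)%R -> (0 <= c3)%R -> (0 <= c4)%R ->
  measurable E1 -> measurable E2 ->
  measurable_fun setT f -> (forall w, (0 <= f w)%R) ->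
  \int[P]_w (c1 + c2 * \1_E1 w + c3 * \1_E2 w + c4 * f w)%:E =
  c1%:E + c2%:E * P E1 + c3%:E * P E2 + c4%:E * \int[P]_w (f w)%:E.
Proof.
move=> c10 c20 c30 c40 mE1 mE2 mf f0.
have mi (E : set Omega) : measurable E -> measurable_fun setT (fun w => (\1_E w : R)%:E).
  by move=> mE; apply/measurable_EFinP; exact: measurable_indic.
have mf' : measurable_fun setT (fun w => (f w)%:E) by apply/measurable_EFinP.
under eq_integral do rewrite !EFinD !EFinM.
have i0 (E : set Omega) w : (0 <= \1_E w :> R)%R by rewrite indicE.
rewrite ge0_integralD//; last 4 first.
- by move=> w _; rewrite !adde_ge0// -?EFinM lee_fin ?mulr_ge0.
- apply: emeasurable_funD; last by apply: measurable_funeM; exact: mi.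
  by apply: emeasurable_funD => //; apply: measurable_funeM; exact: mi.
- by move=> w _; rewrite -EFinM lee_fin mulr_ge0.
- exact: measurable_funeM.
rewrite ge0_integralD//; last 4 first.
- by move=> w _; rewrite !adde_ge0// -?EFinM lee_fin ?mulr_ge0.
- by apply: emeasurable_funD => //; apply: measurable_funeM; exact: mi.
- by move=> w _; rewrite -EFinM lee_fin mulr_ge0.
- by apply: measurable_funeM; exact: mi.
rewrite ge0_integralD//; last 2 first.
- by move=> w _; rewrite -EFinM lee_fin mulr_ge0.
- by apply: measurable_funeM; exact: mi.
rewrite !ge0_integralZl_EFin//; last 3 first.
- by move=> w _; rewrite lee_fin.
- exact: mi.
- exact: mi.
rewrite !integral_indic// !setIT integral_cst//.
by rewrite [X in c1%:E * X]probability_setT mule1.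
Qed.

Lemma integral_dist_le (f g : Omega -> R) (b : Omega -> R) (v : R) :
  P.-integrable setT (EFin \o f) -> P.-integrable setT (EFin \o g) ->
  measurable_fun setT b ->
  \int[P]_w (g w)%:E = v%:E -> (forall w, (`|f w - g w| <= b w)%R) ->
  (`|(\int[P]_w (f w)%:E) - v%:E| <= \int[P]_w (b w)%:E).
Proof.
move=> fi gi mb gv fgb; rewrite -gv -integralB_EFin//.
have mf : measurable_fun setT f by apply/measurable_EFinP; exact: measurable_int fi.
have mg : measurable_fun setT g by apply/measurable_EFinP; exact: measurable_int gi.
apply: (le_trans (le_abse_integral _ _ _)) => //.
  by apply/measurable_EFinP; exact: measurable_funB.
apply: ge0_le_integral => //.
- by apply: measurableT_comp => //; apply: emeasurable_funB; exact/measurable_EFinP.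
- exact/measurable_EFinP.
- by move=> w _; rewrite -EFinB abse_EFin lee_fin.
Qed.

End IntegralBounds.

(** * Transforms and exponential moments of the solution *)

Section HestonTransform.
Context {R : realType} {d : measure_display} {Omega : measurableType d}.
Variables (P : probability Omega R) (mdl : heston R) (F : R -> set (set Omega)).
Variables (W B : R -> Omega -> R) (T x y : R) (X Y : R -> Omega -> R).
Hypotheses (hF : is_filtration F) (hWB : brownian2 P F W B) (T0 : 0 < T) (y0 : 0 <= y).
Hypothesis hsol : heston_solution P mdl F W B T 0 x y X Y.

Let Y_ge0 s w : 0 <= s <= T -> 0 <= Y s w.
Proof. by case: hsol => _ _ h _; exact: h. Qed.

Let cY w : {within `[0, T], continuous (Y ^~ w)}.
Proof. by case: hsol => _ [_ h]. Qed.

Let mY s : 0 <= s <= T -> measurable_fun setT (Y s).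
Proof. exact: (measurable_sol_Y hF hsol). Qed.

Let mX s : 0 <= s <= T -> measurable_fun setT (X s).
Proof. exact: (measurable_sol_X hF hsol). Qed.

Let TT : 0 <= T <= T. Proof. by rewrite lexx ltW. Qed.

Lemma exceed_small (eps : R) : 0 < eps -> exists2 K : R, 0 <= K &
  measurable (exceed_set T Y K) /\ (P (exceed_set T Y K) <= eps%:E)%E.
Proof.
move=> eps0; have [mE vE] := exceed_vanishing P T0 mY cY.
have [n0 /(_ n0 (leqnn _)) h] := vE _ eps0.
by exists n0%:R => //; split => //; exact: (mE n0).
Qed.

Lemma active_stop m K w : (0 < m)%N -> exists2 i, (i <= m)%N &
  (~ exceed_set T Y K w -> i = m) /\ forall v : nat -> R,
    \sum_(j < m) (active T Y m K w j)%:R * (v j.+1 - v j) = v i - v 0.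
Proof.
move=> m0; have [i im [h1 h2]] := @stop_telescope R (active T Y m K w) m (@activeS _ _ _ _ _ _ _ _).
exists i => //; split => // nE; apply: h1 => j jm.
apply/forallP => l; apply: (exceed_setP m0 _ nE).
by rewrite (leq_trans _ jm)// ltnW// ltnS -ltnS ltn_ord.
Qed.

Lemma expR_cos_close (S a c r t del : R) : expR a <= S -> `|r| <= del -> `|t| <= del -> del <= 1 ->
  `|expR a * cos c - expR (a + r) * cos (c + t)| <= S * del * (expR 1 + 1).
Proof.
move=> aS rd td d1.
have S0 : 0 <= S by rewrite (le_trans _ aS)// expR_ge0.
have d0 : 0 <= del by rewrite (le_trans _ rd).
rewrite expRD -mulrA -mulrBr normrM (ger0_norm (expR_ge0 a)) -mulrA.
apply: ler_pM => //.
rewrite (_ : cos c - expR r * cos (c + t) = - ((expR r - 1) * cos (c + t)) - (cos (c + t) - cos c)); last by ring.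
rewrite (le_trans (ler_normB _ _))// mulrDr mulr1 normrN; apply: lerD.
  rewrite normrM (le_trans (_ : _ <= `|expR r - 1|))//.
    by rewrite ler_piMr//; exact: cos_max.
  rewrite (le_trans (expR_taylor0 r))//; apply: ler_pM => //.
  by rewrite ler_expR (le_trans rd).
by rewrite (le_trans (cos_taylor0 _ _)).
Qed.

(** From [(k expR r - 1)^2 >= 0]. On the bad event the martingale is traded for a small multiple of
    its second moment plus a constant, which the small probability of the event then multiplies. *)
Lemma expR_le_sqr (k r : R) : 0 < k -> expR r <= k / 2 * expR (2 * r) + (2 * k)^-1.
Proof.
move=> k0; rewrite (_ : 2 * r = r + r) ?expRD; last by ring.
have := sqr_ge0 (k * expR r - 1); set z := expR r => h.
rewrite -(ler_pM2l (_ : 0 < 2 * k)) ?mulr_gt0// mulrDr divff ?mulf_neq0 ?gt_eqF//.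
by move: h; rewrite sqrrB expr1n mulr1 exprMn; lra.
Qed.

(** The wave at maturity is compared with [expR L0] times the martingale of phase [Th0], whose mean
    is exactly the wave at time 0. Without exceptional event the two differ by a multiple of [del].
    If the path is stopped early, [p >= 0] and [A <= CA] still bound the wave at the stopping time
    by [S]. *)
Lemma affine_limit (u Cp CA : R) (eps : R) : 0 <= Cp -> 0 < eps ->
  exists m1 : nat, forall m, (m1 <= m)%N -> (0 < m)%N -> forall p q A b : nat -> R,
  (forall j, (j < m)%N -> riccati mdl (T / m%:R) u (p j.+1) (q j.+1) (A j.+1) (b j.+1)
     (p j) (q j) (A j) (b j)) ->
  (forall j, (j <= m)%N -> 0 <= p j <= Cp) -> (forall j, (j <= m)%N -> `|q j| <= Cp) ->
  (forall j, (j <= m)%N -> A j <= CA) ->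
  (`|(\int[P]_w (expR (A m - p m * Y T w) * cos (u * X T w + b m - q m * Y T w))%:E)
     - (expR (A 0 - p 0 * y) * cos (u * x + b 0 - q 0 * y))%:E| <= eps%:E)%E.
Proof.
move=> Cp0 eps0; pose S := expR CA.
have S0 : 0 < S := expR_gt0 CA.
have e1 : 0 < expR 1 :> R := expR_gt0 1.
have eps4 : 0 < eps / 4 by rewrite divr_gt0.
have c10 : 0 <= S * (expR 1 + 1) by rewrite mulr_ge0 ?ltW// addr_gt0.
have [del' del'0 hdel'] := small_factor c10 eps4.
pose del := Num.min 1 del'.
have del0 : 0 < del by rewrite lt_min ltr01.
have del1 : del <= 1 by rewrite ge_min lexx.
have hdel : S * del * (expR 1 + 1) <= eps / 4.
  by rewrite (le_trans _ hdel')// mulrAC ler_wpM2l// ge_min lexx orbT.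
pose c2 := S + S * expR 1.
have c20 : 0 <= c2 by rewrite addr_ge0 ?mulr_ge0 ?ltW.
have [e2 e20 he2] := small_factor c20 eps4.
have [K K0 [mE PE]] := exceed_small e20.
have [D hD] := martingale_approx hF hWB T0 hsol u K0 Cp0.
have D'0 : 0 <= S / 2 * `|D| by apply: mulr_ge0 => //; apply: divr_ge0 => //; exact: ltW.
have [k k0 hk] := small_factor D'0 eps4.
pose c3 := S * (1 + (2 * k)^-1).
have c30 : 0 <= c3 by rewrite mulr_ge0 ?ltW// addr_gt0 ?invr_gt0 ?mulr_gt0.
have [e3 e30 he3] := small_factor c30 eps4.
have [m1 hm1] := hD _ _ del0 e30.
exists m1 => m m1m m0 p q A b rec pC qC AC.
have pC' j : (j <= m)%N -> `|p j| <= Cp by move=> /pC /andP[h1 h2]; rewrite ger0_norm.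
have [rho [th [Bad [[mrho mth] int [sm _] [mBad PBad] close]]]] := hm1 m m1m m0 p q A b rec pC' qC.
pose L0 := A 0 - p 0 * y; pose Th0 := u * x + b 0 - q 0 * y.
pose Lm i w := A i - p i * Y (mesh T m i) w.
pose Tm i w := u * X (mesh T m i) w + b i - q i * Y (mesh T m i) w.
have LmS i w : (i <= m)%N -> expR (Lm i w) <= S.
  move=> im; rewrite ler_expR (le_trans _ (AC i im))// lerBlDr lerDl mulr_ge0//.
    by have /andP[] := pC i im.
  by apply: Y_ge0; rewrite mesh_ge0// mesh_leT.
have L0S : expR L0 <= S.
  rewrite ler_expR (le_trans _ (AC 0%N isT))// lerBlDr lerDl mulr_ge0//.
  by have /andP[] := pC 0%N isT.
pose g w := expR (A m - p m * Y T w) * cos (u * X T w + b m - q m * Y T w).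
have gE w : g w = expR (Lm m w) * cos (Tm m w) by rewrite /g /Lm /Tm meshm.
have [i1 E1] := int Th0.
pose Z w := expR L0 * (expR (rho w) * cos (Th0 + th w)).
have iZ : P.-integrable setT (EFin \o Z) by exact: (integrable_EFinZl (expR L0) i1).
have mg : measurable_fun setT g.
  have mYT := mY TT; have mXT := mX TT.
  apply: measurable_funM.
    by apply: measurableT_comp => //; apply: measurable_funB => //; exact: measurable_funM.
  apply: measurableT_comp; first by apply: continuous_measurable_fun; exact: continuous_cos.
  apply: measurable_funB; last exact: measurable_funM.
  by apply: measurable_funD => //; exact: measurable_funM.
have gS w : `|g w| <= S.
  rewrite gE normrM (ger0_norm (expR_ge0 _)) (le_trans _ (LmS m w (leqnn m)))//.
  by rewrite ler_piMr ?expR_ge0//; exact: cos_max.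
have ig : P.-integrable setT (EFin \o g).
  have iS : P.-integrable setT (EFin \o cst S) by exact: finite_measure_integrable_cst.
  apply: le_integrable iS => //.
    exact/measurable_EFinP.
  by move=> w _ /=; rewrite lee_fin (ger0_norm (ltW S0)).
have ZE : (\int[P]_w (Z w)%:E = (expR L0 * cos Th0)%:E)%E.
  rewrite /Z; under eq_integral do rewrite EFinM.
  by rewrite integralZl// E1 -EFinM.
pose E := exceed_set T Y K.
(* One term for each case: no exceptional event, early stopping, bad event; the last one pays for
   the martingale on the bad event. *)
pose bd w := S * del * (expR 1 + 1) + c2 * \1_E w + c3 * \1_Bad w + S * (k / 2) * expR (2 * rho w).
have Sk0 : 0 <= S * (k / 2) by apply: mulr_ge0; [|apply: divr_ge0 => //]; exact: ltW.
have d0' : 0 <= S * del * (expR 1 + 1).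
  by apply: mulr_ge0; [rewrite mulr_ge0 ?ltW|rewrite ltW// addr_gt0].
have mE2 : measurable_fun setT (fun w => expR (2 * rho w)).
  by apply: measurableT_comp => //; exact: measurable_funM.
have gZ w : `|g w - Z w| <= bd w.
  have ZS : `|Z w| <= expR (L0 + rho w).
    rewrite /Z mulrA -expRD normrM (ger0_norm (expR_ge0 _)).
    by rewrite ler_piMr ?expR_ge0//; exact: cos_max.
  have b4 : 0 <= S * (k / 2) * expR (2 * rho w) by rewrite mulr_ge0 ?expR_ge0.
  have b2 : 0 <= c2 * \1_E w by rewrite mulr_ge0.
  have b3 : 0 <= c3 * \1_Bad w by rewrite mulr_ge0.
  have [wB|wB] := pselect (Bad w).
    have -> : bd w = S * del * (expR 1 + 1) + c2 * \1_E w + c3 + S * (k / 2) * expR (2 * rho w).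
      by rewrite /bd [\1_Bad w]indicE mem_set// mulr1.
    have : `|Z w| <= S * (k / 2) * expR (2 * rho w) + S * (2 * k)^-1.
      rewrite (le_trans ZS)// expRD -mulrA -mulrDr; apply: ler_pM => //; rewrite ?expR_ge0//.
      exact: expR_le_sqr.
    move=> h; rewrite (le_trans (ler_normB _ _))//.
    by move: h (gS w); rewrite /c3 mulrDr mulr1; move: b2 d0'; goal_lra.
  have [h1 h2 Y0 X0] := close w wB.
  have [i im [iE tel]] := active_stop K w m0.
  move: h1 h2; rewrite (tel (Lm ^~ w)) (tel (Tm ^~ w)) => h1 h2.
  have Lm0 : Lm 0%N w = L0 by rewrite /Lm mesh0 Y0.
  have Tm0 : Tm 0%N w = Th0 by rewrite /Tm mesh0 Y0 X0.
  have Lr : L0 + rho w = Lm i w + (rho w - (Lm i w - Lm 0%N w)) by rewrite Lm0; ring.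
  have [wE|wE] := pselect (E w).
    have -> : bd w = S * del * (expR 1 + 1) + c2 + c3 * \1_Bad w + S * (k / 2) * expR (2 * rho w).
      by rewrite /bd [\1_E w]indicE mem_set// mulr1.
    have : `|Z w| <= S * expR 1.
      rewrite (le_trans ZS)// Lr expRD; apply: ler_pM (LmS i w im) _; try exact: expR_ge0.
      by rewrite ler_expR (le_trans (ler_norm _))// (le_trans h1).
    move=> h; rewrite (le_trans (ler_normB _ _))//.
    by move: h (gS w); rewrite /c2; move: b3 b4 d0'; goal_lra.
  have ei := iE wE; rewrite ei in Lr h1 h2.
  have : `|g w - Z w| <= S * del * (expR 1 + 1).
    rewrite gE /Z mulrA -expRD Lr.
    rewrite (_ : Th0 + th w = Tm m w + (th w - (Tm m w - Tm 0%N w))); last by rewrite Tm0; ring.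
    by apply: expR_cos_close => //; exact: LmS.
  by rewrite /bd; move: b3 b2 b4; goal_lra.
have mbd : measurable_fun setT bd.
  apply: measurable_funD; last exact: measurable_funM.
  apply: measurable_funD; last by apply: measurable_funM => //; exact: measurable_indic.
  by apply: measurable_funD => //; apply: measurable_funM => //; exact: measurable_indic.
apply: (le_trans (integral_dist_le ig iZ mbd ZE gZ)).
rewrite integral_bound4//.
rewrite (_ : eps = eps / 4 + eps / 4 + eps / 4 + eps / 4); last by goal_lra.
rewrite !EFinD; apply: leeD; [apply: leeD; [apply: leeD|]|].
- by rewrite lee_fin.
- apply: (@le_trans _ _ (c2%:E * e2%:E)%E); last by rewrite -EFinM lee_fin.
  exact: lee_wpmul2l.
- apply: (@le_trans _ _ (c3%:E * e3%:E)%E); last by rewrite -EFinM lee_fin.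
  exact: lee_wpmul2l.
- apply: (@le_trans _ _ ((S * (k / 2))%:E * D%:E)%E); first exact: lee_wpmul2l.
  rewrite -EFinM lee_fin (le_trans _ hk)// (_ : S / 2 * `|D| * k = S * (k / 2) * `|D|); last by ring.
  by rewrite ler_wpM2l// ler_norm.
Qed.

(** Here [p m = - lam] and the wave is unbounded, so [expR (lam Y)] is first cut at a level [M]:
    exceptional events then cost at most [M] times their probability, and elsewhere the martingale,
    of mean 1, dominates. The bound does not involve [M], and monotone convergence removes the cut.
    The 1 added to [CL] is the tolerance [del = 1]. *)
Lemma exp_moment (lam CL Cp : R) : 0 <= Cp ->
  (exists m1 : nat, forall m, (m1 <= m)%N -> (0 < m)%N -> exists p A : nat -> R,
    [/\ forall j, (j < m)%N -> riccati mdl (T / m%:R) 0 (p j.+1) 0 (A j.+1) 0 (p j) 0 (A j) 0,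
      forall j, (j <= m)%N -> `|p j| <= Cp, p m = - lam, A m = 0 & A 0 - p 0 * y <= CL]) ->
  (\int[P]_w (expR (lam * Y T w))%:E < +oo)%E.
Proof.
move=> Cp0 [m1 hm1].
have mYT := mY TT.
have me : measurable_fun setT (fun w => expR (lam * Y T w)).
  by apply: measurableT_comp => //; exact: measurable_funM.
have min_bound (M : nat) : (\int[P]_w (Num.min (expR (lam * Y T w)) M%:R)%:E <= (expR (CL + 1) + 1)%:E)%E.
  have M0 : 0 <= M%:R :> R by [].
  have e2 : 0 < 2^-1 :> R by [].
  have [e e0 he] := small_factor M0 e2.
  have [K K0 [mE PE]] := exceed_small e0.
  have [D hD] := martingale_approx hF hWB T0 hsol 0 K0 Cp0.
  have [m2 hm2] := hD _ _ ltr01 e0.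
  pose m := maxn 1 (maxn m1 m2).
  have m0 : (0 < m)%N by rewrite leq_max.
  have mm1 : (m1 <= m)%N by rewrite leq_max leq_max leqnn orbT.
  have mm2 : (m2 <= m)%N by rewrite leq_max leq_max leqnn !orbT.
  have [p [A [rec pC pm Am L0C]]] := hm1 m mm1 m0.
  have qC j : (j <= m)%N -> `|(fun=> 0 : R) j| <= Cp by rewrite normr0.
  have [rho [th [Bad [[mrho mth] int [sm th0] [mBad PBad] close]]]] := hm2 m mm2 m0 p (fun=> 0) A (fun=> 0) rec pC qC.
  have {}th0 := th0 erefl (fun=> erefl).
  have [_] := int 0.
  under eq_integral do rewrite th0 addr0 cos0 mulr1.
  rewrite cos0 => Erho.
  pose E := exceed_set T Y K.
  have mer : measurable_fun setT (fun w => expR (rho w)) by exact: measurableT_comp.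
  apply: (@le_trans _ _ (\int[P]_w (0 + M%:R * \1_E w + M%:R * \1_Bad w + expR (CL + 1) * expR (rho w))%:E)%E).
    apply: ge0_le_integral => //.
    - by apply/measurable_EFinP; exact: measurable_minr.
    - apply/measurable_EFinP; apply: measurable_funD; last exact: measurable_funM.
      apply: measurable_funD; last by apply: measurable_funM => //; exact: measurable_indic.
      by apply: measurable_funD => //; apply: measurable_funM => //; exact: measurable_indic.
    move=> w _; rewrite lee_fin add0r.
    have b4 : 0 <= expR (CL + 1) * expR (rho w) by rewrite mulr_ge0 ?expR_ge0.
    have b2 : 0 <= M%:R * \1_E w :> R by rewrite mulr_ge0.
    have b3 : 0 <= M%:R * \1_Bad w :> R by rewrite mulr_ge0.
    have [wB|wB] := pselect (Bad w).
      rewrite [\1_Bad w]indicE mem_set// mulr1 ge_min; apply/orP; right; move: b2 b4; goal_lra.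
    have [wE|wE] := pselect (E w).
      rewrite [\1_E w]indicE mem_set// mulr1 ge_min; apply/orP; right; move: b3 b4; goal_lra.
    rewrite ge_min; apply/orP; left; apply: (@le_trans _ _ (expR (CL + 1) * expR (rho w))); last by move: b3 b2; goal_lra.
    have [h1 _ Y0 _] := close w wB.
    have [i im [iE tel]] := active_stop K w m0.
    move: h1; rewrite (tel (fun j => A j - p j * Y (mesh T m j) w)) iE// meshm// mesh0 Y0 pm Am => h1.
    rewrite -expRD ler_expR; move: h1; rewrite ler_norml => /andP[h1 _].
    by move: h1 L0C; goal_lra.
  rewrite (integral_bound4 P (lexx (0 : R)) M0 M0 (expR_ge0 _) mE mBad mer (fun w => expR_ge0 _)).
  rewrite Erho mule1 add0e (_ : expR (CL + 1) + 1 = 2^-1 + 2^-1 + expR (CL + 1)); last by goal_lra.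
  rewrite !EFinD; apply: leeD => //; apply: leeD.
    apply: (@le_trans _ _ (M%:R%:E * e%:E)%E); first exact: lee_wpmul2l.
    by rewrite -EFinM lee_fin.
  apply: (@le_trans _ _ (M%:R%:E * e%:E)%E); first exact: lee_wpmul2l.
  by rewrite -EFinM lee_fin.
pose g (n : nat) w := (Num.min (expR (lam * Y T w)) n%:R)%:E.
have gcvg w : g ^~ w @ \oo --> (expR (lam * Y T w))%:E.
  apply: cvg_near_cst; exists (Num.truncn (expR (lam * Y T w))).+1 => // n /= hn.
  rewrite /g min_l// ltW// (lt_le_trans (truncnS_gt _))// ler_nat//.
have mg n : measurable_fun setT (g n) by apply/measurable_EFinP; exact: measurable_minr.
have g0 n w : (0 <= g n w)%E by rewrite lee_fin le_min expR_ge0 ler0n.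
have ndg w : nondecreasing_seq (g ^~ w).
  by move=> n1 n2 n12; rewrite lee_fin le_min2// ler_nat.
have : (\int[P]_w (expR (lam * Y T w))%:E <= (expR (CL + 1) + 1)%:E)%E.
  rewrite (_ : (fun w => (expR (lam * Y T w))%:E) = (fun w => limn (g ^~ w))); last first.
    by apply/funext => w; apply/esym/cvg_lim => //; exact: gcvg.
  rewrite monotone_convergence//; apply: lime_le.
    apply: ereal_nondecreasing_is_cvgn => n1 n2 n12.
    by apply: ge0_le_integral => // w _; exact: ndg.
  by apply: nearW => n; exact: min_bound.
by move/le_lt_trans; apply; rewrite ltry.
Qed.

End HestonTransform.

Ltac nonneg := repeat first [ done | assumption | apply: sqr_ge0 | apply: normr_ge0
  | apply: expR_ge0 | apply: ler0n | apply: ltW; assumption | apply: addr_ge0 | apply: mulr_ge0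
  | rewrite invr_ge0 ].

(** * Riccati recursion *)

Section Riccati.
Context {R : realType}.
Variable mdl : heston R.
Hypothesis hm : heston_admissible mdl.

Let a0 := drift0 mdl.
Let b0 := reversion mdl.
Let sg := volvol mdl.
Let rb := rho_bar mdl.
Let k0 := slope_X mdl.
Let c0 := const_X mdl.

Let a0_gt0 : 0 < a0. Proof. by case: hm. Qed.
Let b0_gt0 : 0 < b0. Proof. by case: hm. Qed.

Definition riccati_step (h u : R) (z : R * R * R * R) : R * R * R * R :=
  let: (p, q, A, b) := z in
  (p - h * (b0 * p - rb ^+ 2 * u ^+ 2 / 2 + sg ^+ 2 / 2 * (p ^+ 2 - q ^+ 2)),
   q - h * (u * k0 + b0 * q + sg ^+ 2 * p * q),
   A - h * (a0 * p),
   b + h * (u * c0 - a0 * q)).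

(** [k] counts steps back from maturity, where the wave is [expR (- v y) cos (u x + th)]. *)
Definition riccati_iter (h u v th : R) (k : nat) := iter k (riccati_step h u) (v, 0, 0, th).

Definition ric_p h u v th k := (riccati_iter h u v th k).1.1.1.
Definition ric_q h u v th k := (riccati_iter h u v th k).1.1.2.
Definition ric_A h u v th k := (riccati_iter h u v th k).1.2.
Definition ric_b h u v th k := (riccati_iter h u v th k).2.

Lemma riccati_iterS h u v th k :
  riccati mdl h u (ric_p h u v th k) (ric_q h u v th k) (ric_A h u v th k) (ric_b h u v th k)
    (ric_p h u v th k.+1) (ric_q h u v th k.+1) (ric_A h u v th k.+1) (ric_b h u v th k.+1).
Proof.
rewrite /ric_p /ric_q /ric_A /ric_b /riccati_iter iterS.
by case: (iter k _ _) => [[[p q] A] b]; split.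
Qed.

(** In the first order change of [p^2 + q^2] the cubic terms combine into [- h sg^2 p (p^2 + q^2)],
    nonpositive for [p >= 0]: this rules out explosion. Mean reversion also helps, so only the
    inhomogeneity of size [kap] remains; the condition on [h] absorbs the square of the
    increment. *)
Lemma riccati_norm_step (h u p q M p' q' : R) (kap c2 : R) :
  0 <= h -> 0 <= p ->
  kap = rb ^+ 2 * u ^+ 2 / 2 + `|u * k0| ->
  c2 = b0 + kap + sg ^+ 2 ->
  p ^+ 2 + q ^+ 2 <= M -> h * (2 * c2 ^+ 2 * (1 + M)) <= 1 ->
  p' = p - h * (b0 * p - rb ^+ 2 * u ^+ 2 / 2 + sg ^+ 2 / 2 * (p ^+ 2 - q ^+ 2)) ->
  q' = q - h * (u * k0 + b0 * q + sg ^+ 2 * p * q) ->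
  p' ^+ 2 + q' ^+ 2 + 1 + 2 * kap ^+ 2 <= (1 + 2 * h) * (p ^+ 2 + q ^+ 2 + 1 + 2 * kap ^+ 2).
Proof.
move=> h0 p0 kapE c2E GM hM -> ->.
set fp := b0 * p - _ + _; set fq := _ + sg ^+ 2 * p * q.
set G := p ^+ 2 + q ^+ 2 in GM *.
have G0 : 0 <= G by rewrite addr_ge0 ?sqr_ge0.
have k1 : 0 <= rb ^+ 2 * u ^+ 2 / 2 by nonneg.
have kap0 : 0 <= kap by rewrite kapE; nonneg.
have s0 : 0 <= sg ^+ 2 by exact: sqr_ge0.
have pG : `|p| <= 1 + G.
  by rewrite ger0_norm// /G; have := sqr_ge0 (p - 1); have := sqr_ge0 q; have := sqr_ge0 p; lra.
have qG : `|q| <= 1 + G.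
  rewrite /G ler_norml; have := sqr_ge0 (q - 1); have := sqr_ge0 (q + 1).
  by have := sqr_ge0 q; have := sqr_ge0 p; rewrite sqrrB sqrrD; lra.
have pos : 0 <= sg ^+ 2 / 2 * p * G by nonneg.
have inner : p * fp + q * fq >= b0 * G - p * kap - `|q| * kap.
  rewrite (_ : p * fp + q * fq = b0 * G - p * (rb ^+ 2 * u ^+ 2 / 2) + q * (u * k0) + sg ^+ 2 / 2 * p * G); last first.
    by rewrite /fp /fq /G; field.
  have h1 : p * (rb ^+ 2 * u ^+ 2 / 2) <= p * kap by rewrite ler_wpM2l// kapE lerDl.
  have h2 : - (`|q| * kap) <= q * (u * k0).
    rewrite lerNl -mulNr (le_trans (ler_norm _))// normrM normrN ler_wpM2l//.
    by rewrite kapE lerDr.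
  by move: h1 h2 pos; lra.
have fpb : `|fp| <= c2 * (1 + G).
  have e1 : `|b0 * p| <= b0 * (1 + G) by rewrite normrM (gtr0_norm b0_gt0) ler_wpM2l// ltW.
  have e2 : `|sg ^+ 2 / 2 * (p ^+ 2 - q ^+ 2)| <= sg ^+ 2 * (1 + G).
    rewrite normrM ger0_norm; last by rewrite divr_ge0.
    apply: ler_pM => //; rewrite ?divr_ge0//; first by rewrite ler_pdivrMr// ler_peMr// ler1n.
    by rewrite ler_norml /G; have := sqr_ge0 p; have := sqr_ge0 q; goal_lra.
  have e3 : rb ^+ 2 * u ^+ 2 / 2 <= kap * (1 + G).
    by rewrite (le_trans (_ : _ <= kap))// ?kapE ?lerDl// -kapE ler_peMr// lerDl.
  rewrite /fp c2E !mulrDl; move: e1 e2 e3; rewrite !ler_norml.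
  set X1 := b0 * p; set X2 := sg ^+ 2 / 2 * _; set X3 := _ / 2.
  have k1' : 0 <= X3 by exact: k1.
  by move=> /andP[a1 a2] /andP[b1 b2] d1; apply/andP; split; move: a1 a2 b1 b2 d1 k1'; goal_lra.
have fqb : `|fq| <= c2 * (1 + G).
  have e1 : `|b0 * q| <= b0 * (1 + G) by rewrite normrM (gtr0_norm b0_gt0) ler_wpM2l// ltW.
  have e2 : `|sg ^+ 2 * p * q| <= sg ^+ 2 * (1 + G).
    rewrite -mulrA normrM (ger0_norm s0) ler_wpM2l// ler_norml /G.
    have := sqr_ge0 (p - q); have := sqr_ge0 (p + q); have := sqr_ge0 p; have := sqr_ge0 q.
    by rewrite sqrrB sqrrD; goal_lra.
  have e3 : `|u * k0| <= kap * (1 + G).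
    by rewrite (le_trans (_ : _ <= kap))// ?kapE ?lerDr// -kapE ler_peMr// lerDl.
  rewrite /fq c2E !mulrDl; move: e1 e2 e3; rewrite !ler_norml.
  set X1 := b0 * q; set X2 := sg ^+ 2 * p * q; set X3 := u * k0.
  by move=> /andP[a1 a2] /andP[b1 b2] /andP[d1 d2]; apply/andP; split; move: a1 a2 b1 b2 d1 d2; goal_lra.
have sq (r z : R) : `|r| <= z -> r ^+ 2 <= z ^+ 2.
  by move=> rz; rewrite -real_normK ?num_real// lerXn2r// nnegrE// (le_trans _ rz).
have f2 : h ^+ 2 * (fp ^+ 2 + fq ^+ 2) <= h * (1 + G).
  have := sq _ _ fpb; have := sq _ _ fqb => q2 p2.
  have : fp ^+ 2 + fq ^+ 2 <= 2 * c2 ^+ 2 * (1 + G) * (1 + G).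
    by move: p2 q2; rewrite exprMn; goal_lra.
  move=> ff; rewrite expr2 -mulrA; apply: ler_wpM2l => //.
  apply: (le_trans (ler_wpM2l h0 ff)); rewrite mulrA; apply: ler_piMl; first by move: G0; goal_lra.
  apply: le_trans hM; apply: ler_wpM2l => //.
  by apply: ler_wpM2l; [rewrite mulr_ge0// sqr_ge0|rewrite lerD2l].
have e4 : 2 * (p * kap + `|q| * kap) <= G + 2 * kap ^+ 2.
  have := sqr_ge0 (p - kap); have := sqr_ge0 (`|q| - kap).
  by rewrite !sqrrB real_normK ?num_real// /G; goal_lra.
have e5 : 0 <= b0 * G by rewrite mulr_ge0// ltW.
have := ler_wpM2l h0 (_ : - 2 * (p * fp + q * fq) <= G + 2 * kap ^+ 2).
have -> : (p - h * fp) ^+ 2 + (q - h * fq) ^+ 2 = G + h * (- 2 * (p * fp + q * fq)) + h ^+ 2 * (fp ^+ 2 + fq ^+ 2).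
  by rewrite /G; ring.
move=> /(_ _)/wrap[|e6]; first by move: e5 e4 inner; goal_lra.
have k2 : 0 <= h * (2 * kap ^+ 2) by rewrite mulr_ge0// mulr_ge0// sqr_ge0.
set e := p * fp + _ in e6 *; set ff := fp ^+ 2 + _ in f2 *; set K := kap ^+ 2 in e6 k2 *.
by clearbody e ff K G; move: e6 f2 k2 h0; goal_lra.
Qed.

(** The terms [rb^2 u^2 / 2] and [sg^2 q^2 / 2] push [p] upwards, so [p] decays at most
    geometrically and never reaches 0. *)
Lemma riccati_pos_step (h u p q M p' : R) : 0 <= h -> 0 <= p -> p <= M ->
  p' = p - h * (b0 * p - rb ^+ 2 * u ^+ 2 / 2 + sg ^+ 2 / 2 * (p ^+ 2 - q ^+ 2)) ->
  p * (1 - h * (b0 + sg ^+ 2 * M)) <= p'.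
Proof.
move=> h0 p0 pM ->.
have e1 : sg ^+ 2 / 2 * p <= sg ^+ 2 * M.
  by rewrite -mulrA; apply: ler_wpM2l; [exact: sqr_ge0|lra].
have e2 : 0 <= rb ^+ 2 * u ^+ 2 / 2 + sg ^+ 2 / 2 * q ^+ 2 by nonneg.
have e3 := ler_wpM2l p0 e1.
have e4 : b0 * p - rb ^+ 2 * u ^+ 2 / 2 + sg ^+ 2 / 2 * (p ^+ 2 - q ^+ 2) <= p * (b0 + sg ^+ 2 * M).
  by move: e2 e3; lra.
by rewrite mulrBr mulr1 lerD2l lerN2 [X in _ <= X]mulrCA; apply: ler_wpM2l.
Qed.

Lemma bernoulli_le (x : R) n : 0 <= x -> (1 + x) ^+ n <= expR (x * n%:R).
Proof.
move=> x0; rewrite mulrC expRM_natl; apply: lerXn2r; rewrite ?nnegrE ?expR_ge0 ?addr_ge0//.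
exact: expR_ge1Dx.
Qed.

Lemma bernoulli_ge (x : R) n : 0 <= x <= 2^-1 -> expR (- (2 * x * n%:R)) <= (1 - x) ^+ n.
Proof.
move=> /andP[x0 x2].
rewrite (_ : - (2 * x * n%:R) = n%:R * (- (2 * x))) ?expRM_natl; last by ring.
apply: lerXn2r; rewrite ?nnegrE ?expR_ge0//; first by lra.
have := expR_ge1Dx (2 * x); rewrite expRN => h.
rewrite -[X in _ <= X]invrK lef_pV2 ?posrE ?expR_gt0 ?invr_gt0//; last by lra.
apply: le_trans h; rewrite -div1r ler_pdivrMr; last by lra.
by nra.
Qed.

Lemma riccati_bounds (T v u : R) : 0 < T -> 0 < v -> exists C c h0 : R, [/\ 0 < c, 0 < h0 &
  forall h th k, 0 < h < h0 -> h * k%:R <= T ->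
   [/\ c <= ric_p h u v th k <= C, `|ric_q h u v th k| <= C, - C <= ric_A h u v th k <= 0
     & `|ric_b h u v th k - th| <= C]].
Proof.
move=> T0 v0.
pose kap := rb ^+ 2 * u ^+ 2 / 2 + `|u * k0|.
pose c2 := b0 + kap + sg ^+ 2.
pose H0 := v ^+ 2 + 1 + 2 * kap ^+ 2.
(* The bound given by a discrete Gronwall argument up to time [T]. The condition on the step size
   involves [M], and the induction carries the sharper [(1 + 2 h)^k H0], which is at most [M] as
   long as [h k <= T]. *)
pose M := H0 * expR (2 * T).
have kap0 : 0 <= kap by rewrite /kap; nonneg.
have H01 : 1 <= H0 by rewrite /H0; have := sqr_ge0 v; have := sqr_ge0 kap; lra.
have M1 : 1 <= M.
  rewrite -[X in X <= _]mulr1; apply: ler_pM => //.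
  by rewrite -[X in X <= _]expR0 ler_expR mulr_ge0// ltW.
have c20 : 0 < c2 by rewrite !ltr_wpDr ?sqr_ge0.
pose L := b0 + sg ^+ 2 * M.
have L0 : 0 < L by rewrite ltr_wpDr// mulr_ge0 ?sqr_ge0//; lra.
pose c := v * expR (- (2 * L * T)).
pose CC := M + T * (a0 * M) + T * (`|u * c0| + a0 * M).
have M0 : 0 <= M by lra.
have TaM : 0 <= T * (a0 * M) by nonneg.
have Tu : 0 <= T * (`|u * c0| + a0 * M).
  by nonneg.
exists CC, c, (Num.min (2 * L)^-1 (2 * c2 ^+ 2 * (1 + M))^-1); split.
- by rewrite mulr_gt0// expR_gt0.
- rewrite lt_min !invr_gt0 !mulr_gt0 ?exprn_gt0//; lra.
move=> h th k /andP[h0]; rewrite lt_min => /andP[hL hM].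
have hL2 : 0 <= h * L <= 2^-1.
  rewrite mulr_ge0 ?ltW//=; move: hL; rewrite invfM => hL.
  by rewrite -ltr_pdivlMr.
have hM2 : h * (2 * c2 ^+ 2 * (1 + M)) <= 1.
  have : 0 < 2 * c2 ^+ 2 * (1 + M) by rewrite !mulr_gt0 ?exprn_gt0//; move: M1; goal_lra.
  by move=> C2; apply: ltW; rewrite -ltr_pdivlMr// div1r.
suff : h * k%:R <= T -> [/\ v * (1 - h * L) ^+ k <= ric_p h u v th k,
    ric_p h u v th k ^+ 2 + ric_q h u v th k ^+ 2 + 1 + 2 * kap ^+ 2 <= (1 + 2 * h) ^+ k * H0,
    - (h * k%:R * (a0 * M)) <= ric_A h u v th k <= 0
  & `|ric_b h u v th k - th| <= h * k%:R * (`|u * c0| + a0 * M)].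
  move=> bounds hk; have [pk Hk Ak bk] := bounds hk.
  have CM : (1 + 2 * h) ^+ k * H0 <= M.
    rewrite /M mulrC; apply: ler_wpM2l; first by move: H01; goal_lra.
    apply: (le_trans (bernoulli_le _ _)); first by move: h0; goal_lra.
    by rewrite ler_expR -mulrA ler_pM2l.
  set p := ric_p _ _ _ _ _ in pk Hk *; set q := ric_q _ _ _ _ _ in Hk *.
  have k1 : 0 <= a0 * M by nonneg.
  have k2 : 0 <= `|u * c0| + a0 * M by nonneg.
  split.
  - apply/andP; split.
      apply: le_trans pk; apply: ler_wpM2l; first exact: ltW.
      apply: le_trans (bernoulli_ge k hL2); rewrite ler_expR lerN2 -!mulrA ler_pM2l//.
      by rewrite mulrCA ler_pM2l.
    have := sqr_ge0 (p - 1); have := sqr_ge0 q; have := sqr_ge0 kap; move: Hk CM.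
    by rewrite sqrrB /CC; have := sqr_ge0 p; move: Tu TaM; goal_lra.
  - have := sqr_ge0 p; have := sqr_ge0 (`|q| - 1); have := sqr_ge0 kap; move: Hk CM.
    by rewrite sqrrB real_normK ?num_real// /CC; have := sqr_ge0 q; move: Tu TaM; goal_lra.
  - case/andP: Ak => Ak ->; rewrite andbT; apply: le_trans Ak.
    have := ler_wpM2r k1 hk; rewrite /CC; move: Tu M1; goal_lra.
  - apply: le_trans bk _; have := ler_wpM2r k2 hk; rewrite /CC; move: TaM M1; goal_lra.
elim: k => [_|k IH hk].
  rewrite !expr0 mulr1 /ric_p /ric_q /ric_A /ric_b/= !mulr0 !mul0r oppr0 !lexx subrr normr0; split => //.
  by rewrite mul1r /H0 expr0n/= addr0.
have [|pk Hk Ak bk] := IH _.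
  by apply: le_trans hk; apply: ler_wpM2l; [exact: ltW|rewrite ler_nat].
have [] := riccati_iterS h u v th k.
set p := ric_p _ _ _ _ k in pk Hk *; set q := ric_q _ _ _ _ k in Hk *.
set A := ric_A _ _ _ _ k in Ak *; set b := ric_b _ _ _ _ k in bk *.
move=> pS qS AS bS.
have q1L : 0 < 1 - h * L.
  have /andP[_ hL1] := hL2.
  by rewrite subr_gt0; apply: (le_lt_trans hL1); rewrite invf_lt1// ltr1n.
have p0 : 0 <= p by apply: le_trans pk; apply: mulr_ge0; [exact: ltW|apply: exprn_ge0; exact: ltW].
have HM : (1 + 2 * h) ^+ k * H0 <= M.
  rewrite /M mulrC; apply: ler_wpM2l; first by move: H01; goal_lra.
  apply: (le_trans (bernoulli_le _ _)); first by move: h0; goal_lra.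
  rewrite ler_expR -mulrA ler_pM2l//; apply: le_trans hk.
  by apply: ler_wpM2l; [exact: ltW|rewrite ler_nat].
have GM : p ^+ 2 + q ^+ 2 <= M.
  by have := sqr_ge0 kap; move: Hk HM; goal_lra.
have pM : p <= M.
  have := sqr_ge0 (p - 1); have := sqr_ge0 q; have := sqr_ge0 kap; move: Hk HM.
  by rewrite sqrrB; have := sqr_ge0 p; goal_lra.
have qM : `|q| <= M.
  have := sqr_ge0 p; have := sqr_ge0 (`|q| - 1); have := sqr_ge0 kap; move: Hk HM.
  by rewrite sqrrB real_normK ?num_real//; have := sqr_ge0 q; goal_lra.
have apM : a0 * p <= a0 * M by rewrite ler_wpM2l// ltW.
split.
- rewrite exprSr mulrA pS.
  apply: (@le_trans _ _ (p * (1 - h * L))); first by rewrite ler_wpM2r// ltW.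
  exact: riccati_pos_step (ltW h0) p0 pM erefl.
- have := riccati_norm_step (ltW h0) p0 erefl erefl GM hM2 pS qS.
  move=> /le_trans; apply; rewrite [_ ^+ k.+1]exprS -[X in _ <= X]mulrA; apply: ler_wpM2l; last exact: Hk.
  by rewrite addr_ge0// mulr_ge0// ltW.
- rewrite AS -natr1 mulrDr mulr1 mulrDl opprD.
  have := ler_wpM2l (ltW h0) apM; have : 0 <= h * (a0 * p) by nonneg; exact: ltW.
  by case/andP: Ak; rewrite -/a0; set X := h * (a0 * p); set Y := h * (a0 * M); goal_lra.
- rewrite bS (_ : h * k.+1%:R * _ = h * k%:R * (`|u * c0| + a0 * M) + h * (`|u * c0| + a0 * M)); last by rewrite -natr1; ring.
  rewrite addrAC; apply: (le_trans (ler_normD _ _)).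
  apply: lerD => //; rewrite normrM gtr0_norm//; apply: ler_wpM2l; first exact: ltW.
  rewrite (le_trans (ler_normB _ _))// lerD2l normrM gtr0_norm//.
  by apply: ler_wpM2l => //; exact: ltW.
Qed.

(** For [u = 0] the recursion is real and multiplies [p] by [1 - h (b0 + sg^2 p / 2)]. The
    conditions on [lam] and [h] keep this factor in [[0, 1]], so [[- lam, 0]] is invariant. *)
Lemma riccati_neg (T lam : R) : 0 < T -> 0 <= lam -> sg ^+ 2 * lam <= 2 * b0 ->
  forall h k, 0 < h -> h * b0 <= 1 -> h * k%:R <= T ->
   [/\ - lam <= ric_p h 0 (- lam) 0 k <= 0, ric_q h 0 (- lam) 0 k = 0,
     ric_A h 0 (- lam) 0 k <= h * k%:R * (a0 * lam) & ric_b h 0 (- lam) 0 k = 0].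
Proof.
move=> T0 lam0 lamb h k h0 hb; elim: k => [_|k IH hk].
  by rewrite /ric_p /ric_q /ric_A /ric_b/= lexx oppr_le0 lam0 !mulr0 mul0r lexx.
have [] := IH _; first by apply: le_trans hk; apply: ler_wpM2l; [exact: ltW|rewrite ler_nat].
have [] := riccati_iterS h 0 (- lam) 0 k.
set p := ric_p _ _ _ _ k; set q := ric_q _ _ _ _ k; set A := ric_A _ _ _ _ k; set b := ric_b _ _ _ _ k.
move=> -> -> -> -> /andP[p1 p2] -> A1 ->; split.
- have e1 : sg ^+ 2 / 2 * - p <= b0.
    have : sg ^+ 2 * - p <= sg ^+ 2 * lam by rewrite ler_wpM2l ?sqr_ge0//; lra.
    by lra.
  have e2 : 0 <= sg ^+ 2 / 2 * - p by apply: mulr_ge0; [nonneg|lra].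
  rewrite (_ : p - _ = p * (1 - h * (b0 - sg ^+ 2 / 2 * - p))); last by rewrite /b0 /sg; field.
  set z := sg ^+ 2 / 2 * - p in e1 e2 *.
  have e3 : 0 <= h * (b0 - z) by apply: mulr_ge0; [exact: ltW|lra].
  have e4 : h * (b0 - z) <= 1 by apply: le_trans hb; apply: ler_wpM2l; [exact: ltW|lra].
  by set y := h * _ in e3 e4 *; apply/andP; split; move: e3 e4 p1 p2; goal_nra.
- by ring.
- have : a0 * - p <= a0 * lam by rewrite ler_wpM2l ?(ltW a0_gt0)//; lra.
  move=> /(ler_wpM2l (ltW h0)) e; rewrite -natr1 -/a0.
  by move: e A1; set K := k%:R; lra.
- by ring.
Qed.

End Riccati.

(** * Finite differences and comparison *)

Section FiniteDifference.
Context {R : realType}.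
Variables (mdl : heston R) (h dx : R).
Implicit Types (g f : int -> R).

Definition fd_left y : R := fd_beta mdl h dx y + `|fd_alpha mdl h dx y| * (fd_alpha mdl h dx y < 0)%R%:R.
Definition fd_right y : R := fd_beta mdl h dx y + `|fd_alpha mdl h dx y| * (0 < fd_alpha mdl h dx y)%R%:R.

(** The diagonal entry is 1 plus the moduli of the two others, so the operator is the identity plus
    nonnegative multiples of one-sided differences. It fixes constants and obeys a maximum principle
    whatever the ratio of [h] to [dx]. *)
Lemma fd_opE y g i : fd_op mdl h dx y g i =
  g i + fd_left y * (g i - g (i - 1)) + fd_right y * (g i - g (i + 1)).
Proof.
rewrite /fd_op big_cons big_cons big_seq1 /fd_entry.
have e1 : (i == i - 1 + 1 :> int) by lia.
have e2 : (i == i + 1 :> int) = false by lia.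
have e3 : (i == i + 1 + 1 :> int) = false by lia.
have e4 : (i == i + 1 - 1 :> int) by lia.
rewrite e1 e2 eqxx e3 e4 /fd_left /fd_right.
have : fd_alpha mdl h dx y < 0 \/ fd_alpha mdl h dx y = 0 \/ 0 < fd_alpha mdl h dx y.
  by case: (ltgtP (fd_alpha mdl h dx y) 0) => h'; auto.
set al := fd_alpha _ _ _ _ => -[al0|[->|al0]].
- by rewrite al0 [0 < al]lt_gtF//= mulr1n mulr0n; ring.
- by rewrite ltxx normr0; ring.
- by rewrite al0 [al < 0]lt_gtF//= mulr1n mulr0n; ring.
Qed.

Lemma fd_op_linear y (a b : R) g f i :
  fd_op mdl h dx y (fun j => a * g j + b * f j) i = a * fd_op mdl h dx y g i + b * fd_op mdl h dx y f i.
Proof. by rewrite !fd_opE; ring. Qed.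

Lemma fd_op_cst y c i : fd_op mdl h dx y (fun=> c) i = c.
Proof. by rewrite fd_opE !subrr !mulr0 !addr0. Qed.

Hypotheses (h0 : 0 <= h) (dx0 : 0 < dx).

Lemma fd_beta_ge0 y : 0 <= y -> 0 <= fd_beta mdl h dx y.
Proof. by move=> y0; rewrite /fd_beta; have := ltW dx0 => ?; nonneg. Qed.

Lemma fd_left_ge0 y : 0 <= y -> 0 <= fd_left y.
Proof. by move=> /fd_beta_ge0 b0; rewrite /fd_left; nonneg. Qed.

Lemma fd_right_ge0 y : 0 <= y -> 0 <= fd_right y.
Proof. by move=> /fd_beta_ge0 b0; rewrite /fd_right; nonneg. Qed.

Lemma linfD g f : linf g -> linf f -> linf (fun i => g i + f i).
Proof.
move=> [K hK] [L hL]; exists (K + L) => i.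
by rewrite (le_trans (ler_normD _ _))// lerD.
Qed.

Lemma linfZ c g : linf g -> linf (fun i => c * g i).
Proof. by move=> [K hK]; exists (`|c| * K) => i; rewrite normrM ler_wpM2l. Qed.

Lemma linf_cst c : linf (fun=> c : R).
Proof. by exists `|c|. Qed.

(** At a minimum the difference terms are nonpositive. The infimum over the infinite grid need not
    be attained, so a point within [r] of it is used, [r] being small compared with the
    coefficients. *)
Lemma fd_max_principle y g M : 0 <= y -> linf g ->
  (forall i, M <= fd_op mdl h dx y g i) -> forall i, M <= g i.
Proof.
move=> y0 [K hK] hM i.
have cl := fd_left_ge0 y0; have cr := fd_right_ge0 y0.
have hinf : has_inf (range g).
  split; first by exists (g 0), 0.
  by exists (- K) => _ [j _ <-]; have := hK j; rewrite ler_norml => /andP[].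
have gi j : inf (range g) <= g j by apply: ge_inf; [case: hinf|exists j].
apply: le_trans (gi i).
apply/ler_addgt0Pr => e e0.
have c1 : 0 <= 1 + fd_left y + fd_right y by nonneg.
have [r r0 hr] := small_factor c1 e0.
have [_ [j _ <-] gj] := inf_adherent r0 hinf.
have := hM j; rewrite fd_opE => /le_trans; apply.
have d1 k : g j - g k <= r by have := gi k; move: gj; lra.
have e1 := ler_wpM2l cl (d1 (j - 1)); have e2 := ler_wpM2l cr (d1 (j + 1)).
by set I := inf (range g) in gj *; clearbody I; move: gj hr; lra.
Qed.

(** Jacobi iteration from 0: for [f >= 0] the iterates increase and stay below the bound of [f], and
    their pointwise limit is a fixed point because each row has three entries. The general case
    follows by adding a constant. *)
Lemma fd_solvable_ge0 y f : 0 <= y -> linf f -> (forall i, 0 <= f i) ->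
  exists2 g, linf g & fd_op mdl h dx y g = f.
Proof.
move=> y0 [K hK] f0.
have cl := fd_left_ge0 y0; have cr := fd_right_ge0 y0.
set a := fd_left y in cl; set b := fd_right y in cr.
have c1 : 0 < 1 + a + b by rewrite -addrA ltr_pwDl// addr_ge0.
pose Phi (g : int -> R) i := (f i + a * g (i - 1) + b * g (i + 1)) / (1 + a + b).
pose u k := iter k Phi (fun=> 0).
have uS k i : u k.+1 i = Phi (u k) i by [].
have PhiM g1 g2 : (forall i, g1 i <= g2 i) -> forall i, Phi g1 i <= Phi g2 i.
  move=> g12 i; rewrite /Phi ler_pM2r ?invr_gt0//.
  by apply: lerD; [apply: lerD => //|]; exact: ler_wpM2l.
have u_ge0 k i : 0 <= u k i.
  elim: k i => [|k IH] i //; rewrite uS /Phi divr_ge0 ?(ltW c1)//.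
  by rewrite !addr_ge0// mulr_ge0.
have u_inc k i : u k i <= u k.+1 i.
  elim: k i => [|k IH] i; first exact: (u_ge0 1%N).
  by rewrite uS [X in _ <= X]uS; exact: PhiM.
have u_le k i : u k i <= K.
  have fK j : f j <= K by rewrite (le_trans (ler_norm _)).
  have K0 : 0 <= K by rewrite (le_trans (f0 0)).
  elim: k i => [|k IH] i //; rewrite uS /Phi ler_pdivrMr//.
  by have := ler_wpM2l cl (IH (i - 1)); have := ler_wpM2l cr (IH (i + 1)); have := fK i; lra.
have u_cvg i : cvgn (u ^~ i).
  apply: nondecreasing_is_cvgn; first by apply/nondecreasing_seqP => k; exact: u_inc.
  by exists K => _ [k _ <-].
pose g i := limn (u ^~ i).
have ug i : u ^~ i @ \oo --> g i by exact: u_cvg.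
have g0K i : 0 <= g i <= K.
  apply/andP; split; first by apply: limr_ge; [exact: u_cvg|exact: nearW].
  by apply: limr_le; [exact: u_cvg|exact: nearW].
exists g; first by exists K => i; have /andP[g0 gK] := g0K i; rewrite ger0_norm.
apply/funext => i; rewrite fd_opE -/a -/b.
suff : g i = Phi g i.
  by move=> gP; apply: (mulIf (lt0r_neq0 c1)); rewrite /Phi in gP; rewrite {1 2 3}gP; field; exact: lt0r_neq0.
have h1 : (fun k => u k.+1 i) @ \oo --> g i.
  by have := ug i; rewrite -cvg_shiftS.
have h2 : (fun k => u k.+1 i) @ \oo --> Phi g i.
  rewrite /Phi; apply: cvgMl; apply: cvgD; first apply: cvgD; first exact: cvg_cst.
    by apply: cvgMr; exact: ug.
  by apply: cvgMr; exact: ug.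
exact: (cvg_unique _ h1 h2).
Qed.

Lemma fd_solvable y f : 0 <= y -> linf f -> exists2 g, linf g & fd_op mdl h dx y g = f.
Proof.
move=> y0 lf; have [K hK] := lf.
have [||g lg gE] := @fd_solvable_ge0 y (fun i => f i + K) y0.
- by apply: linfD => //; exact: linf_cst.
- by move=> i; have := hK i; rewrite ler_norml => /andP[]; lra.
exists (fun i => 1 * g i + (- K) * 1).
  by apply: linfD; apply: linfZ => //; exact: linf_cst.
apply/funext => i.
by rewrite (fd_op_linear y 1 (- K) g (fun=> 1)) gE fd_op_cst; ring.
Qed.

Lemma fd_invP y f : 0 <= y -> linf f ->
  linf (fd_inv mdl h dx y f) /\ fd_op mdl h dx y (fd_inv mdl h dx y f) = f.
Proof.
move=> y0 lf.
have sur : set_surj linf linf (fd_op mdl h dx y).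
  by move=> f' lf'; have [g lg <-] := fd_solvable y0 lf'; exists g.
split.
  by apply: (surjpinv_image_sub sur); exists f.
by apply: (surjpK (fun=> 0) sur); rewrite inE.
Qed.

End FiniteDifference.

Section HybridComparison.
Context {R : realType}.
Variables (mdl : heston R) (h dx Y_0 X_0 : R) (f : R * R -> R) (N : nat).
Hypotheses (h0 : 0 <= h) (dx0 : 0 < dx).
Local Notation node := (node mdl h Y_0).
Local Notation kup := (k_up mdl h Y_0).
Local Notation kdn := (k_down mdl h Y_0).
Local Notation pu := (p_up mdl h Y_0).
Local Notation pd := (p_down mdl h Y_0).
Local Notation hyb := (hybrid mdl h dx Y_0 X_0 f).

Lemma node_ge0 n k : 0 <= node n k.
Proof. by rewrite /Defs.node mulr_ge0// sqr_ge0. Qed.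

Lemma p_up_itv n k : 0 <= pu n k <= 1.
Proof.
by rewrite /p_up le_max lexx/= ge_max ler01 ge_min lexx orbT.
Qed.

Lemma p_down_ge0 n k : 0 <= pd n k.
Proof. by rewrite /p_down subr_ge0; case/andP: (p_up_itv n k). Qed.

Lemma k_up_le n k : (k <= n)%N -> (k < kup n k <= n.+1)%N.
Proof.
move=> kn; rewrite /k_up big_nat_cond; elim/big_ind: _ => [|i j|i].
- by rewrite ltnS kn/=.
- by move=> /andP[i1 i2] /andP[j1 j2]; rewrite leq_min i1 j1 geq_min i2.
- by rewrite -andbA => /and3P[ki iN _]; rewrite ki.
Qed.

Lemma k_down_le n k : (kdn n k <= k)%N.
Proof.
rewrite /k_down big_nat_cond; elim/big_ind: _ => [//|i j ik jk|i].
  by rewrite geq_max ik.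
by case/andP=> /andP[_].
Qed.

(** Stated through [fd_op] rather than its inverse, so that it can be checked on explicit functions;
    [fd_max_principle] supplies the inversion. *)
Definition supersolution (V : nat -> nat -> int -> R) : Prop :=
  (forall n k, (n <= N)%N -> (k <= n)%N -> linf (V n k)) /\
  forall n k i, (n < N)%N -> (k <= n)%N ->
    pu n k * V n.+1 (kup n k) i + pd n k * V n.+1 (kdn n k) i
      <= fd_op mdl h dx (node n k) (V n k) i.

Hypothesis lf : forall k, (k <= N)%N -> linf (fun i => f (X_0 + i%:~R * dx, node N k)).

Lemma linf_hybrid l n k : (l + n = N)%N -> (k <= n)%N -> linf (hyb l n k).
Proof.
elim: l n k => [n k nN kn|l IH n k lnN kn] /=; first by rewrite add0n in nN; rewrite nN in kn *; exact: lf.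
have /andP[_ ku] := k_up_le kn; have kd := k_down_le n k.
have lnN' : (l + n.+1 = N)%N by rewrite addnS.
apply: linfD; apply: linfZ.
  by have [] := fd_invP mdl h0 dx0 (node_ge0 n k) (IH _ _ lnN' ku).
by have [] := fd_invP mdl h0 dx0 (node_ge0 n k) (IH _ _ lnN' (leq_trans kd (leqW kn))).
Qed.

Lemma scaled_hybrid_le s V : supersolution V ->
  (forall k i, (k <= N)%N -> s * f (X_0 + i%:~R * dx, node N k) <= V N k i) ->
  forall l n k i, (l + n = N)%N -> (k <= n)%N -> s * hyb l n k i <= V n k i.
Proof.
move=> [lV sV] fV; elim=> [n k i /= nN kn|l IH n k i lnN kn].
  by rewrite add0n in nN; rewrite nN in kn *; exact: fV.
have nN : (n < N)%N by rewrite -lnN addSn ltnS leq_addl.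
have lnN' : (l + n.+1 = N)%N by rewrite addnS.
have /andP[_ ku] := k_up_le kn; have kd := leq_trans (k_down_le n k) (leqW kn).
have y0 := node_ge0 n k.
have [l1 E1] := fd_invP mdl h0 dx0 y0 (linf_hybrid lnN' ku).
have [l2 E2] := fd_invP mdl h0 dx0 y0 (linf_hybrid lnN' kd).
rewrite /=; set g1 := fd_inv _ _ _ _ _ in l1 E1 *; set g2 := fd_inv _ _ _ _ _ in l2 E2 *.
have /andP[pu0 _] := p_up_itv n k; have pd0 := p_down_ge0 n k.
have lW : linf (fun j => 1 * V n k j + (- s) * (pu n k * g1 j + pd n k * g2 j)).
  by apply: linfD; apply: linfZ; [apply: lV => //; exact: ltnW|apply: linfD; exact: linfZ].
have := @fd_max_principle R mdl h dx h0 dx0 _ _ 0 y0 lW.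
move=> /(_ _ i); rewrite mul1r mulNr subr_ge0; apply=> j.
rewrite (fd_op_linear mdl h dx _ 1 (- s) (V n k) (fun j0 => pu n k * g1 j0 + pd n k * g2 j0)).
rewrite (fd_op_linear mdl h dx _ (pu n k) (pd n k) g1 g2) E1 E2 mul1r mulNr subr_ge0.
apply: le_trans (sV n k j nN kn).
by rewrite mulrDr !(mulrCA s); apply: lerD; apply: ler_wpM2l => //; exact: IH.
Qed.

End HybridComparison.

(** * One step of the tree *)

Section TreeStep.
Context {R : realType}.
Implicit Types z w : R.

(** Nodes are handled through a signed root [z], in which the lattice is regular: neighbours at one
    level differ by [2 s] and the next level is shifted by [s]. Below, [s = sp rt] with [sp] half of
    [volvol] and [rt] the root of [h], and [e = sqrt (h (1 + eta))] is the natural size of a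
    jump. *)
Definition pos2 z : R := z ^+ 2 * (0 < z)%R%:R.

Lemma pos2_ge0 z : 0 <= pos2 z.
Proof. by rewrite mulr_ge0// sqr_ge0. Qed.

Lemma pos2E z : 0 <= z -> pos2 z = z ^+ 2.
Proof.
rewrite le_eqVlt => /predU1P[<-|z0]; first by rewrite /pos2 expr0n mul0r.
by rewrite /pos2 z0 mulr1.
Qed.

Lemma pos2N z : z <= 0 -> pos2 z = 0.
Proof. by move=> z0; rewrite /pos2 ltNge z0 mulr0. Qed.

Lemma pos2_le z w : z <= w -> pos2 z <= pos2 w.
Proof.
move=> zw; have [z0|z0] := leP z 0; first by rewrite pos2N// pos2_ge0.
by rewrite !pos2E ?(le_trans (ltW z0))// ?lerXn2r// ?nnegrE ?(le_trans (ltW z0))// ltW.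
Qed.

Lemma le_sqr_le (x w : R) : 0 <= w -> x ^+ 2 <= w ^+ 2 -> x <= w.
Proof.
by move=> w0 xw; rewrite leNgt; apply/negP => wx; move: xw; rewrite leNgt ltrXn2r// (le_trans w0)// ltW.
Qed.

Variables (a b sp C1 : R).
Hypotheses (a0 : 0 < a) (b0 : 0 < b) (sp0 : 0 < sp) (C10 : 0 <= C1).
Variables (h rt e z zu zd : R).
Let eta := pos2 z.
Let yu := pos2 zu.
Let yd := pos2 zd.
Let s := sp * rt.
Let dr := eta + (a - b * eta) * h.
Hypotheses (h1 : h <= 1) (rt0 : 0 < rt) (rtE : rt ^+ 2 = h) (e0 : 0 <= e)
  (eE : e ^+ 2 = h * (1 + eta)) (hC1 : h * (1 + eta) <= C1) (bh : b * h <= 2^-1).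
Hypotheses (zsu : z + s <= zu) (zsd : zd <= z - s).
(** Minimality of [k_up], and below maximality of [k_down], in terms of roots: either the nearest
    node is taken, or the previous candidate was on the wrong side of the drifted point [dr]. *)
Hypothesis Hu : zu = z + s \/ (z + s <= zu - 2 * s /\ pos2 (zu - 2 * s) < dr).
Hypothesis Hd : zd = z - s \/ (zd + 2 * s <= z - s /\ dr < pos2 (zd + 2 * s)).
Hypothesis ydr : yd <= dr.

Let eta0 : 0 <= eta. Proof. exact: pos2_ge0. Qed.
Let h0 : 0 < h. Proof. by rewrite -rtE exprn_gt0. Qed.
Let s0 : 0 < s. Proof. exact: mulr_gt0. Qed.
Let rte : rt <= e.
Proof.
apply: le_sqr_le => //; rewrite rtE eE mulrDr mulr1 lerDl mulr_ge0//; exact: ltW.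
Qed.
Let hrt : h <= rt.
Proof.
apply: le_sqr_le; first exact: ltW.
by rewrite rtE expr2 ler_piMr// ltW.
Qed.
Let he : h <= e. Proof. exact: le_trans hrt rte. Qed.
Let e1C : e <= 1 + C1.
Proof. by have := sqr_ge0 (e - 1); rewrite sqrrB; move: eE hC1 (sqr_ge0 e); lra. Qed.
Let e2 : h * eta <= e ^+ 2.
Proof. by rewrite eE mulrDr mulr1 lerDr ltW. Qed.
Let heta1 : h <= e ^+ 2.
Proof. by rewrite eE mulrDr mulr1 lerDl mulr_ge0// ltW. Qed.

Let dr0 : 0 <= dr.
Proof.
have : b * h * eta <= 2^-1 * eta by rewrite ler_wpM2r.
have : 0 <= a * h by nonneg.
by rewrite /dr; move: eta0; lra.
Qed.

Let D := Num.sqrt dr.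
Let D0 : 0 <= D. Proof. exact: sqrtr_ge0. Qed.
Let DE : D ^+ 2 = dr. Proof. exact: sqr_sqrtr. Qed.

Let dr_le : dr <= eta + a * h.
Proof. by rewrite /dr; have : 0 <= b * eta * h; [nonneg|lra]. Qed.

Let sDe : s * D <= sp * (1 + a) * e.
Proof.
rewrite /s -!mulrA; apply: ler_wpM2l; first exact: ltW.
have a1 : 0 <= 1 + a by rewrite addr_ge0// ltW.
apply: le_sqr_le; first exact: mulr_ge0.
rewrite !exprMn rtE DE eE.
have e3 : h * dr <= h * ((1 + a) * (1 + eta)).
  apply: ler_wpM2l; first exact: ltW.
  apply: (le_trans dr_le); rewrite mulrDl mul1r.
  have : a * h <= a * (1 + eta).
    by apply: ler_wpM2l; [exact: ltW|apply: (le_trans h1); rewrite lerDl].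
  by lra.
apply: (le_trans e3); rewrite mulrCA; apply: ler_wpM2r; first by have := ltW h0 => ?; nonneg.
by rewrite expr2 ler_peMl// lerDl ltW.
Qed.

Let rteta : s * Num.sqrt eta <= sp * e.
Proof.
rewrite /s -mulrA; apply: ler_wpM2l; first exact: ltW.
apply: le_sqr_le => //.
by rewrite exprMn rtE sqr_sqrtr.
Qed.

Let etasq : eta <= 0 /\ z <= 0 \/ 0 < z /\ eta = z ^+ 2 /\ Num.sqrt eta = z.
Proof.
have [z0|z0] := leP z 0; [left|right]; first by rewrite /eta pos2N.
by rewrite /eta pos2E ?ltW// sqrtr_sqr ger0_norm ?ltW.
Qed.

Let s2E : s ^+ 2 = sp ^+ 2 * h. Proof. by rewrite /s exprMn rtE. Qed.

Lemma step_up_ge : 0 <= yu - eta.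
Proof. by rewrite subr_ge0; apply: pos2_le; move: zsu s0; lra. Qed.

Lemma step_down_le : yd - eta <= 0.
Proof. by rewrite subr_le0; apply: pos2_le; move: zsd s0; lra. Qed.

(** If the nearest node is not taken, the up node overshoots the drifted point by at most one
    lattice spacing [2 s] in root scale. *)
Lemma step_up_sqrt : yu <= (D + 2 * s) ^+ 2 \/ zu = z + s.
Proof.
case: Hu => [->|[_ h']]; [by right|left].
have : zu - 2 * s <= D.
  rewrite leNgt; apply/negP => Dz; move: h'; rewrite pos2E ?(le_trans D0 (ltW Dz))//.
  by rewrite ltNge -DE lerXn2r ?nnegrE ?(le_trans D0 (ltW Dz))// ltW.
move=> zD; rewrite -pos2E; last by rewrite addr_ge0// mulr_ge0// ltW.
by apply: pos2_le; move: zD; lra.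
Qed.

Lemma step_up_le : yu - eta <= (a + 4 * sp * (1 + a) + 4 * sp ^+ 2 + 2 * sp) * e.
Proof.
have t1 : 0 <= sp * (1 + a) * e by nonneg.
have t2 : 0 <= sp ^+ 2 * e by rewrite mulr_ge0 ?sqr_ge0.
have t3 : 0 <= sp * e by nonneg.
have t4 : a * h <= a * e by rewrite ler_wpM2l// ltW.
have t5 : sp ^+ 2 * h <= sp ^+ 2 * e by rewrite ler_wpM2l// sqr_ge0.
have t6 : 0 <= a * e by nonneg.
case: step_up_sqrt => [|zE].
  have -> : (D + 2 * s) ^+ 2 = dr + 4 * (s * D) + 4 * s ^+ 2 by rewrite -DE; ring.
  by rewrite s2E; move: sDe dr_le; lra.
have : yu <= eta + 2 * (s * Num.sqrt eta) + s ^+ 2.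
  rewrite /yu zE; case: etasq => [[et z0]|[z0 [et sq]]].
    have et0 : eta = 0 by apply: le_anti; rewrite et eta0.
    rewrite et0 sqrtr0 mulr0 mulr0 !add0r -[s ^+ 2]pos2E; last exact: ltW.
    by apply: pos2_le; lra.
  rewrite pos2E; last by rewrite addr_ge0// ltW.
  by rewrite sq et; lra.
by rewrite s2E; move: rteta; lra.
Qed.

Lemma step_down_ge : eta - yd <= (b * (1 + C1) + 4 * sp * (1 + a) + 2 * sp) * e.
Proof.
have t1 : 0 <= sp * (1 + a) * e by nonneg.
have t3 : 0 <= sp * e by nonneg.
have t4 : 0 <= b * (1 + C1) * e by nonneg.
case: Hd => [zE|[_ h']].
  have : eta - yd <= 2 * (s * Num.sqrt eta).
    rewrite /yd zE; case: etasq => [[et z0]|[z0 [et sq]]].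
      have et0 : eta = 0 by apply: le_anti; rewrite et eta0.
      by rewrite et0 sqrtr0 mulr0 mulr0 sub0r oppr_le0 pos2_ge0.
    rewrite sq et; have [zs|zs] := leP s z.
      by rewrite pos2E ?subr_ge0//; have := sqr_ge0 s; lra.
    rewrite pos2N ?subr0; last by lra.
    have : z * z <= s * z by apply: ler_wpM2r; exact: ltW.
    by rewrite expr2; have := mulr_gt0 s0 z0; lra.
  by move: rteta; lra.
have zD : D < zd + 2 * s.
  rewrite ltNge; apply/negP => zD; move: h'; rewrite ltNge -DE -(pos2E D0).
  by rewrite pos2_le.
have yD : D ^+ 2 - 4 * (s * D) <= yd.
  have [Ds|Ds] := leP (2 * s) D.
    apply: (@le_trans _ _ (pos2 (D - 2 * s))); last by apply: pos2_le; lra.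
    by rewrite pos2E ?subr_ge0//; have := sqr_ge0 s; lra.
  apply: (@le_trans _ _ 0); last exact: pos2_ge0.
  have : D * D <= 2 * s * D by apply: ler_wpM2r => //; exact: ltW.
  by rewrite expr2; have := mulr_ge0 (ltW s0) D0; lra.
have : b * (h * eta) <= b * ((1 + C1) * e).
  apply: ler_wpM2l; first exact: ltW.
  by apply: (le_trans e2); rewrite expr2; exact: ler_wpM2r.
have : 0 <= a * h by rewrite mulr_ge0// ltW.
by move: yD sDe; rewrite DE /dr; lra.
Qed.

Let mh := (a - b * eta) * h.

Let mh_le : `|mh| <= (a + b) * e ^+ 2.
Proof.
rewrite /mh normrM (gtr0_norm h0) eE [X in _ <= X](_ : _ = (a + b) * (1 + eta) * h); last by ring.
apply: ler_wpM2r; first exact: ltW.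
have be : 0 <= b * eta by nonneg.
rewrite (le_trans (ler_normB _ _))// (gtr0_norm a0) (ger0_norm be).
have : 0 <= a * eta by rewrite mulr_ge0// ltW.
by move: b0; lra.
Qed.

Variable (pu : R).
Hypothesis pu01 : 0 <= pu <= 1.
Let M1 := pu * (yu - eta) + (1 - pu) * (yd - eta).
Let M2 := pu * (yu - eta) ^+ 2 + (1 - pu) * (yd - eta) ^+ 2.

Lemma convex_le (r x w : R) : x <= r -> w <= r -> pu * x + (1 - pu) * w <= r.
Proof. by case/andP: pu01 => p0 p1 xr wr; nra. Qed.

Lemma second_moment_crude (r : R) : 0 <= r -> `|yu - eta| <= r -> `|yd - eta| <= r ->
  0 <= M2 <= r ^+ 2.
Proof.
move=> r0 ur dr'; have sq (x : R) : `|x| <= r -> x ^+ 2 <= r ^+ 2.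
  by move=> xr; rewrite -real_normK ?num_real// lerXn2r ?nnegrE.
rewrite /M2 convex_le ?sq// andbT.
by case/andP: pu01 => p0 p1; rewrite addr_ge0// mulr_ge0 ?sqr_ge0// subr_ge0.
Qed.

Section Unclipped.
Hypothesis dru : dr <= yu.
Hypothesis puE : pu * (yu - yd) = dr - yd.

Lemma first_moment_unclipped : M1 = mh.
Proof.
rewrite /M1 (_ : _ + _ = pu * (yu - yd) + yd - eta); last by ring.
by rewrite puE /dr /mh; ring.
Qed.

Let M2E : M2 = (yu - dr) * (dr - yd) + mh ^+ 2.
Proof.
rewrite /M2 (_ : _ + _ = pu * (yu - yd) * (yu + yd - 2 * eta) + (yd - eta) ^+ 2); last by ring.
by rewrite puE /mh /dr; ring.
Qed.

(** Threshold beyond which the drift of one step is too small to skip a node: [a h < 2 z s] as soon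
    as [z > cB s], and the up jump goes to the nearest node. *)
Let cB := 1 + a / (2 * sp ^+ 2).
Let cB0 : 0 <= cB. Proof. by rewrite /cB; nonneg. Qed.

(* Near the origin all the quantities at stake are O(h). *)
Let small_case : z <= cB * s ->
  `|M2 - 4 * sp ^+ 2 * eta * h| <= ((2 * (cB ^+ 2 * sp ^+ 2 + a) + 8 * sp ^+ 2 + 2 * (cB + 1) ^+ 2 * sp ^+ 2) ^+ 2
     + 4 * sp ^+ 2 * (cB ^+ 2 * sp ^+ 2)) * e ^+ 4.
Proof.
move=> zs.
have etah : eta <= cB ^+ 2 * sp ^+ 2 * h.
  rewrite -mulrA -s2E -exprMn; case: etasq => [[et _]|[z0 [et _]]].
    by rewrite (le_trans et)// sqr_ge0.
  by rewrite et lerXn2r ?nnegrE ?(ltW z0)// mulr_ge0// ltW.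
set K := 2 * (cB ^+ 2 * sp ^+ 2 + a) + 8 * sp ^+ 2 + 2 * (cB + 1) ^+ 2 * sp ^+ 2.
have yuh : yu <= K * h.
  have t1 : 0 <= (cB + 1) ^+ 2 * sp ^+ 2 * h by nonneg.
  have t2 : 0 <= cB ^+ 2 * sp ^+ 2 * h by nonneg.
  have t3 : 0 <= a * h by nonneg.
  have t4 : 0 <= sp ^+ 2 * h by nonneg.
  case: step_up_sqrt => [|zE].
    have : (D + 2 * s) ^+ 2 <= 2 * D ^+ 2 + 8 * s ^+ 2.
      by have := sqr_ge0 (D - 2 * s); lra.
    by rewrite DE s2E /K; move: dr_le; lra.
  have : yu <= ((cB + 1) * s) ^+ 2.
    rewrite /yu zE -pos2E; last by nonneg.
    by apply: pos2_le; lra.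
  by rewrite exprMn s2E /K; lra.
have K0 : 0 <= K.
  have := pos2_ge0 zu; rewrite -/yu => yu0.
  by rewrite -(pmulr_lge0 _ h0) (le_trans yu0).
have Kh : 0 <= K * h by rewrite mulr_ge0// ltW.
have [||m0 m1] := andP (@second_moment_crude (K * h) Kh _ _).
- by rewrite ger0_norm ?step_up_ge//; move: eta0; lra.
- rewrite ler0_norm ?step_down_le//; have := pos2_ge0 zd; rewrite -/yd.
  by have := step_up_ge; lra.
have t5 : 0 <= 4 * sp ^+ 2 * eta * h by nonneg.
have t6 : 4 * sp ^+ 2 * eta * h <= 4 * sp ^+ 2 * (cB ^+ 2 * sp ^+ 2) * h ^+ 2.
  have -> : 4 * sp ^+ 2 * eta * h = 4 * sp ^+ 2 * h * eta by ring.
  have -> : 4 * sp ^+ 2 * (cB ^+ 2 * sp ^+ 2) * h ^+ 2 = 4 * sp ^+ 2 * h * (cB ^+ 2 * sp ^+ 2 * h) by ring.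
  by apply: ler_wpM2l => //; nonneg.
have h2 : h ^+ 2 <= e ^+ 4.
  by rewrite (exprM e 2 2) lerXn2r ?nnegrE ?sqr_ge0// ltW.
set K2 := 4 * sp ^+ 2 * (cB ^+ 2 * sp ^+ 2) in t6 *.
have K20 : 0 <= K2 by rewrite /K2; nonneg.
have t7 := ler_wpM2l K20 h2; have t8 := ler_wpM2l (sqr_ge0 K) h2.
rewrite exprMn in m1.
by rewrite ler_norml mulrDl; apply/andP; split; lra.
Qed.

Let Ku := a + 4 * sp * (1 + a) + 4 * sp ^+ 2 + 2 * sp.
Let Kd := b * (1 + C1) + 4 * sp * (1 + a) + 2 * sp.

Let KB := (2 * (cB ^+ 2 * sp ^+ 2 + a) + 8 * sp ^+ 2 + 2 * (cB + 1) ^+ 2 * sp ^+ 2) ^+ 2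
     + 4 * sp ^+ 2 * (cB ^+ 2 * sp ^+ 2).
Let KA := sp ^+ 4 + 2 * sp ^+ 2 * (a + b).
Let KC := ((Ku + Kd) ^+ 2 + 4 * sp ^+ 2) * (b ^+ 2 / sp ^+ 2).

(** Three regimes. Near the origin everything is O(h). If both jumps go to the nearest nodes, the
    error is exactly [- s^4 + 2 s^2 mh]. If the down jump skips a node, then [s <= b z h], so [e] is
    bounded below and crude O(e^2) bounds are already O(e^4). *)
Lemma second_moment_unclipped : `|M2 - 4 * sp ^+ 2 * eta * h| <= (KB + KA + KC) * e ^+ 4.
Proof.
have KB0 : 0 <= KB by rewrite /KB; nonneg.
have KA0 : 0 <= KA by rewrite /KA; nonneg; apply: exprn_ge0; exact: ltW.
have Ku0 : 0 <= Ku by rewrite /Ku; nonneg.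
have Kd0 : 0 <= Kd by rewrite /Kd; nonneg.
have KC0 : 0 <= KC by rewrite /KC; nonneg.
have e40 : 0 <= e ^+ 4 by exact: exprn_ge0.
have e4E : e ^+ 4 = e ^+ 2 * e ^+ 2 by rewrite -exprD.
have widen (x k : R) : k <= KB + KA + KC -> x <= k * e ^+ 4 -> x <= (KB + KA + KC) * e ^+ 4.
  by move=> kK /le_trans; apply; apply: ler_wpM2r.
have [zs|zs] := leP z (cB * s).
  by apply: (widen _ KB); [move: KA0 KC0; lra|exact: small_case].
have sz : s <= z.
  by apply: ltW; apply: le_lt_trans zs; rewrite ler_peMl ?(ltW s0)// /cB lerDl; nonneg.
have z0 : 0 < z by exact: lt_le_trans sz.
have etaE : eta = z ^+ 2 by rewrite /eta pos2E// ltW.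
have zuE : zu = z + s.
  case: Hu => // -[zz h']; exfalso.
  have : (z + s) ^+ 2 < dr.
    rewrite -pos2E; last by rewrite addr_ge0// ltW.
    by apply: le_lt_trans h'; exact: pos2_le.
  move=> /lt_le_trans/(_ dr_le); rewrite etaE => h2.
  have : a * h < 2 * z * s.
    have -> : a * h = 2 * (a / (2 * sp ^+ 2) * s) * s.
      rewrite (_ : a * h = a / sp ^+ 2 * s ^+ 2); last by rewrite s2E; field; rewrite gt_eqF.
      by field; rewrite gt_eqF.
    rewrite ltr_pM2r// ltr_pM2l//; apply: le_lt_trans zs.
    have -> : cB * s = s + a / (2 * sp ^+ 2) * s by rewrite /cB mulrDl mul1r.
    by rewrite lerDr ltW.
  by move: h2; have := sqr_ge0 s; rewrite sqrrD; lra.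
have yuE : yu = (z + s) ^+ 2 by rewrite /yu zuE pos2E// addr_ge0// ltW.
case: Hd => [zdE|[zz h']].
  apply: (widen _ KA); first by move: KB0 KC0; lra.
  have ydE : yd = (z - s) ^+ 2 by rewrite /yd zdE pos2E// subr_ge0.
  rewrite M2E yuE ydE (_ : _ - _ = - (s ^+ 2) ^+ 2 + 2 * s ^+ 2 * mh); last first.
    rewrite /dr -/mh etaE (_ : 4 * sp ^+ 2 * z ^+ 2 * h = 4 * (sp ^+ 2 * h) * z ^+ 2); last by ring.
    by rewrite -s2E; ring.
  have -> : KA * e ^+ 4 = sp ^+ 4 * e ^+ 4 + 2 * sp ^+ 2 * (a + b) * e ^+ 4 by rewrite /KA mulrDl.
  apply: (le_trans (ler_normD _ _)); rewrite normrN; apply: lerD.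
    rewrite ger0_norm ?sqr_ge0// s2E exprMn -(exprM sp 2 2).
    apply: ler_wpM2l; first exact: exprn_ge0 (ltW sp0).
    by rewrite (exprM e 2 2) lerXn2r ?nnegrE ?sqr_ge0// ltW.
  rewrite normrM ger0_norm; last by nonneg.
  rewrite s2E e4E (_ : 2 * sp ^+ 2 * (a + b) * _ = 2 * (sp ^+ 2 * e ^+ 2) * ((a + b) * e ^+ 2)); last by ring.
  apply: ler_pM => //; first by nonneg.
  by apply: ler_wpM2l => //; apply: ler_wpM2l => //; exact: sqr_ge0.
apply: (widen _ KC); first by move: KA0 KB0; lra.
have : dr < (z - s) ^+ 2.
  rewrite -pos2E ?subr_ge0//; apply: (lt_le_trans h'); exact: pos2_le.
rewrite /dr etaE => h2.
have sbz : s <= b * z * h.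
  have : 0 <= a * h by nonneg.
  have sz2 : s * s <= s * z by apply: ler_wpM2l => //; exact: ltW.
  move=> ah; rewrite -(ler_pM2r z0).
  by move: h2; rewrite sqrrB expr2 [s ^+ 2]expr2 => h2; lra.
have one : 1 <= b ^+ 2 / sp ^+ 2 * e ^+ 2.
  have : s ^+ 2 <= (b * z * h) ^+ 2.
    by rewrite lerXn2r ?nnegrE ?(ltW s0)// !mulr_ge0 ?ltW.
  rewrite s2E (_ : (b * z * h) ^+ 2 = b ^+ 2 * (h * eta) * h); last by rewrite etaE; ring.
  rewrite ler_pM2r// => h3.
  rewrite mulrAC ler_pdivlMr ?exprn_gt0// mul1r; apply: (le_trans h3).
  by apply: ler_wpM2l => //; exact: sqr_ge0.
have ur : `|yu - eta| <= (Ku + Kd) * e.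
  rewrite ger0_norm ?step_up_ge// (le_trans step_up_le)//.
  by apply: ler_wpM2r => //; rewrite lerDl.
have dd : `|yd - eta| <= (Ku + Kd) * e.
  rewrite ler0_norm ?step_down_le// opprB (le_trans step_down_ge)//.
  by apply: ler_wpM2r => //; rewrite lerDr.
have KK0 : 0 <= (Ku + Kd) * e by nonneg.
have /andP[m0 m1] := second_moment_crude KK0 ur dd.
have s0' : 0 <= 4 * sp ^+ 2 * eta * h by nonneg.
have s1 : 4 * sp ^+ 2 * eta * h <= 4 * sp ^+ 2 * e ^+ 2.
  by rewrite -mulrA (mulrC eta); apply: ler_wpM2l => //; nonneg.
have : `|M2 - 4 * sp ^+ 2 * eta * h| <= ((Ku + Kd) ^+ 2 + 4 * sp ^+ 2) * e ^+ 2.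
  by move: m1; rewrite exprMn => m1; rewrite ler_norml mulrDl; apply/andP; split; lra.
move=> /le_trans h3; rewrite -etaE; apply: h3.
rewrite /KC e4E -mulrA; apply: ler_wpM2l; first by nonneg.
by rewrite mulrA ler_peMl// sqr_ge0.
Qed.

End Unclipped.

Section Clipped.
Variable n : nat.
Hypothesis dru : yu < dr.
Hypothesis zun : s * n.+1%:R <= zu.

Let zu_gt0 : 0 < zu. Proof. by apply: lt_le_trans zun; rewrite mulr_gt0. Qed.

Let szu : s * zu <= a * h.
Proof.
have szu' : s <= zu by apply: le_trans zun; rewrite ler_peMr ?(ltW s0)// ler1n.
have : eta <= (zu - s) ^+ 2.
  by rewrite -pos2E ?subr_ge0//; apply: pos2_le; move: zsu; lra.
have : zu ^+ 2 < dr by rewrite -pos2E// ltW.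
have : s * s <= s * zu by apply: ler_wpM2l => //; exact: ltW.
by rewrite sqrrB [s ^+ 2]expr2; move: dr_le; lra.
Qed.

(** Clipping means that even the top node of the next level lies below the drifted point. A jump up
    gains at least [s zu], which must then be at most [a h], while [zu >= s (n + 1)]: this bounds
    [n] independently of [h]. *)
Lemma clipped_level : sp ^+ 2 * n.+1%:R <= a.
Proof.
rewrite -(ler_pM2r h0); apply: le_trans szu.
rewrite mulrAC -s2E expr2 -mulrA; apply: ler_wpM2l => //; exact: ltW.
Qed.

Let Kc := a ^+ 2 / sp ^+ 2.
Let Kc0 : 0 <= Kc. Proof. by rewrite /Kc; nonneg. Qed.

Let yuh : yu <= Kc * h.
Proof.
rewrite /yu pos2E ?(ltW zu_gt0)//.
have : (s * zu) ^+ 2 <= (a * h) ^+ 2 by rewrite lerXn2r ?nnegrE// mulr_ge0// ltW.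
have -> : (s * zu) ^+ 2 = h * (sp ^+ 2 * zu ^+ 2) by rewrite exprMn s2E; ring.
have -> : (a * h) ^+ 2 = h * (a ^+ 2 * h) by ring.
rewrite ler_pM2l// => h2.
by rewrite /Kc mulrAC ler_pdivlMr ?exprn_gt0// mulrC.
Qed.

Let etah : eta <= Kc * h.
Proof. by apply: le_trans yuh; have := step_up_ge; rewrite subr_ge0. Qed.

Let uh : `|yu - eta| <= Kc * h.
Proof. by rewrite ger0_norm ?step_up_ge//; move: yuh eta0; lra. Qed.

Let dh : `|yd - eta| <= Kc * h.
Proof.
rewrite ler0_norm ?step_down_le//.
by have := pos2_ge0 zd; rewrite -/yd; move: etah; lra.
Qed.

(** Both successors lie below the drifted point, so the mean is never too large; the Lyapunov and
    tail supersolutions use this one-sided bound, free of error. The two-sided bound is O(h),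
    because all nodes involved are O(h). *)
Lemma first_moment_clipped : M1 <= mh /\ `|M1 - mh| <= (2 * Kc + a + b * Kc) * h.
Proof.
have drE : dr - eta = mh by rewrite /dr /mh; ring.
split.
  by apply: convex_le; rewrite -drE lerD2r//; exact: ltW.
have m1 : M1 <= Kc * h.
  by apply: convex_le; apply: (le_trans (ler_norm _)).
have m2 : - (Kc * h) <= M1.
  have := @convex_le (Kc * h) (- (yu - eta)) (- (yd - eta)).
  move=> /(_ _ _)/wrap[||h'].
  - by apply: le_trans uh; rewrite -normrN ler_norm.
  - by apply: le_trans dh; rewrite -normrN ler_norm.
  by rewrite lerNl; apply: le_trans h'; rewrite /M1 !mulrN -opprD.
have t1 : 0 <= b * eta * h by nonneg.
have t2 : b * eta * h <= b * Kc * h.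
  apply: ler_wpM2r; first exact: ltW.
  apply: ler_wpM2l; first exact: ltW.
  by apply: (le_trans etah); rewrite ler_piMr.
have t3 : 0 <= a * h by nonneg.
have t4 : 0 <= Kc * h by nonneg.
by rewrite ler_norml /mh; apply/andP; split; move: m1 m2; lra.
Qed.

Lemma second_moment_clipped :
  `|M2 - 4 * sp ^+ 2 * eta * h| <= (Kc ^+ 2 + 4 * sp ^+ 2 * Kc) * e ^+ 4.
Proof.
have Kh0 : 0 <= Kc * h by nonneg.
have /andP[m0 m1] := second_moment_crude Kh0 uh dh.
have t0 : 0 <= 4 * sp ^+ 2 * eta * h by nonneg.
have t1 : 4 * sp ^+ 2 * eta * h <= 4 * sp ^+ 2 * Kc * h ^+ 2.
  have -> : 4 * sp ^+ 2 * eta * h = 4 * sp ^+ 2 * h * eta by ring.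
  have -> : 4 * sp ^+ 2 * Kc * h ^+ 2 = 4 * sp ^+ 2 * h * (Kc * h) by ring.
  by apply: ler_wpM2l => //; nonneg.
have h2 : h ^+ 2 <= e ^+ 4.
  by rewrite (exprM e 2 2) lerXn2r ?nnegrE ?sqr_ge0// ltW.
have t2 := ler_wpM2l (sqr_ge0 Kc) h2.
have t3 : 4 * sp ^+ 2 * Kc * h ^+ 2 <= 4 * sp ^+ 2 * Kc * e ^+ 4 by apply: ler_wpM2l => //; nonneg.
rewrite exprMn in m1.
by rewrite ler_norml mulrDl; apply/andP; split; lra.
Qed.

End Clipped.

End TreeStep.

Lemma bigmin_mem (s : seq nat) (P : pred nat) (x : nat) :
  \big[minn/x]_(j <- s | P j) j = x \/
  (\big[minn/x]_(j <- s | P j) j \in s /\ P (\big[minn/x]_(j <- s | P j) j)).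
Proof.
elim: s => [|i s IH]; first by rewrite big_nil; left.
rewrite big_cons; case: ifPn => Pi; last first.
  by case: IH => [->|[h1 h2]]; [left|right; rewrite inE h1 orbT].
set m := \big[_/_]_(_ <- s | _) _ in IH *.
rewrite /minn; case: ltnP => im; first by right; rewrite inE eqxx.
by case: IH => [->|[h1 h2]]; [left|right; rewrite inE h1 orbT].
Qed.

Lemma bigmin_le (s : seq nat) (P : pred nat) (x i : nat) : i \in s -> P i ->
  (\big[minn/x]_(j <- s | P j) j <= i)%N.
Proof.
elim: s => [//|l s IH]; rewrite inE big_cons => /predU1P[->|/IH{}IH] Pi.
  by rewrite Pi geq_minl.
by case: ifP => _; [rewrite geq_min IH// orbT|exact: IH].
Qed.

Lemma bigmax_mem (s : seq nat) (P : pred nat) :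
  (\max_(j <- s | P j) j = 0)%N \/
  ((\max_(j <- s | P j) j)%N \in s /\ P (\max_(j <- s | P j) j)%N).
Proof.
elim: s => [|i s IH]; first by rewrite big_nil; left.
rewrite big_cons; case: ifPn => Pi; last first.
  by case: IH => [->|[h1 h2]]; [left|right; rewrite inE h1 orbT].
set m := (\max_(_ <- s | _) _)%N in IH *.
rewrite /maxn; case: ltnP => im; last by right; rewrite inE eqxx.
by case: IH => [->|[h1 h2]]; [left|right; rewrite inE h1 orbT].
Qed.

Lemma bigmax_ge (s : seq nat) (P : pred nat) (i : nat) : i \in s -> P i ->
  (i <= \max_(j <- s | P j) j)%N.
Proof.
elim: s => [//|l s IH]; rewrite inE big_cons => /predU1P[->|/IH{}IH] Pi.
  by rewrite Pi leq_maxl.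
by case: ifP => _; [rewrite leq_max IH// orbT|exact: IH].
Qed.

Section TreeFacts.
Context {R : realType}.
Variables (mdl : heston R) (T Y_0 : R).
Hypotheses (hm : heston_admissible mdl) (T0 : 0 < T) (Y0 : 0 <= Y_0).

Let a := drift0 mdl.
Let b := reversion mdl.
Let sg := volvol mdl.
Let sp := sg / 2.
Let a0 : 0 < a. Proof. by case: hm. Qed.
Let b0 : 0 < b. Proof. by case: hm. Qed.
Let sg0 : 0 < sg. Proof. by case: hm. Qed.
Let sp0 : 0 < sp. Proof. by rewrite divr_gt0. Qed.

Section Node.
Variables (h : R) (n k : nat).
Hypothesis kn : (k <= n)%N.
Local Notation node := (node mdl h Y_0).
Local Notation ku := (k_up mdl h Y_0 n k).
Local Notation kd := (k_down mdl h Y_0 n k).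
Local Notation dr := (node_drifted mdl h Y_0 n k).
Let s := sp * Num.sqrt h.
Let zn (i j : nat) : R := Num.sqrt Y_0 + s * (2 * j%:R - i%:R).

Lemma node_pos2 i j : node i j = pos2 (zn i j).
Proof.
by rewrite /Defs.node /pos2 /zn /s /sp -/sg (_ : sg / 2 * Num.sqrt h * _ = sg / 2 * (2 * j%:R - i%:R) * Num.sqrt h)//; ring.
Qed.

Lemma node_next j : node n.+1 j = pos2 (zn n k + s * (2 * (j%:R - k%:R) - 1)).
Proof. by rewrite node_pos2 /zn -natr1; congr pos2; ring. Qed.

Lemma k_up_facts : (forall j, (k < j < ku)%N -> node n.+1 j < dr) /\
  (dr <= node n.+1 ku \/ ku = n.+1).
Proof.
split=> [j /andP[kj jku]|].
  rewrite ltNge; apply/negP => h'.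
  have jn : (j < n.+2)%N by rewrite (ltn_trans jku)// ltnS; case/andP: (k_up_le mdl h Y_0 kn).
  have : (ku <= j)%N by apply: bigmin_le => //; rewrite mem_index_iota kj.
  by rewrite leqNgt jku.
have [h0|[_ h']] := bigmin_mem (index_iota k.+1 n.+2) (fun j => dr <= node n.+1 j) n.+1.
  by right; exact: h0.
by left; exact: h'.
Qed.

Lemma k_down_facts : (forall j, (kd < j <= k)%N -> dr < node n.+1 j) /\
  (node n.+1 kd <= dr \/ (kd = 0%N /\ dr < node n.+1 0)).
Proof.
split=> [j /andP[kj jku]|].
  rewrite ltNge; apply/negP => h'.
  have : (j <= kd)%N.
    by apply: bigmax_ge => //; rewrite mem_index_iota ltnS.
  by rewrite leqNgt kj.
case: (bigmax_mem (index_iota 0 k.+1) (fun j => node n.+1 j <= dr)) => [h0|[_ h']]; last by left.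
have h0' : kd = 0%N by exact: h0.
by rewrite h0'; case: (leP (node n.+1 0) dr); [left|right].
Qed.

End Node.

Definition step_mean h n k := p_up mdl h Y_0 n k * (node mdl h Y_0 n.+1 (k_up mdl h Y_0 n k) - node mdl h Y_0 n k)
  + (1 - p_up mdl h Y_0 n k) * (node mdl h Y_0 n.+1 (k_down mdl h Y_0 n k) - node mdl h Y_0 n k).

Definition step_square h n k := p_up mdl h Y_0 n k * (node mdl h Y_0 n.+1 (k_up mdl h Y_0 n k) - node mdl h Y_0 n k) ^+ 2
  + (1 - p_up mdl h Y_0 n k) * (node mdl h Y_0 n.+1 (k_down mdl h Y_0 n k) - node mdl h Y_0 n k) ^+ 2.

Lemma tree_step_facts : exists (C h0 : R) (n0 : nat), [/\ 0 < C, 0 < h0 &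
  forall (N n k : nat), (0 < N)%N -> T / N%:R < h0 -> (n < N)%N -> (k <= n)%N ->
  let h := T / N%:R in let eta := node mdl h Y_0 n k in
  let yu := node mdl h Y_0 n.+1 (k_up mdl h Y_0 n k) in
  let yd := node mdl h Y_0 n.+1 (k_down mdl h Y_0 n k) in
  let e := Num.sqrt (h * (1 + eta)) in
  [/\ `|yu - eta| <= C * e /\ `|yd - eta| <= C * e, e <= C,
    step_mean h n k <= mu_Y mdl eta * h,
    `|step_mean h n k - mu_Y mdl eta * h| <= C * h * (n < n0)%N%:R
  & `|step_square h n k - sg ^+ 2 * eta * h| <= C * e ^+ 4]].
Proof.
(* [B1] bounds [h * eta]: roots at levels up to [N] are at most [sqrt Y_0 + s N], and
   [s N sqrt h = sp T]. *)
pose B1 := 2 * (Num.sqrt Y_0 + sp * T) ^+ 2 + 1.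
pose C1 := 1 + B1.
have B10 : 0 <= B1 by rewrite /B1; nonneg.
have C10 : 0 <= C1 by rewrite /C1; nonneg.
pose Ku := a + 4 * sp * (1 + a) + 4 * sp ^+ 2 + 2 * sp.
pose Kd := b * (1 + C1) + 4 * sp * (1 + a) + 2 * sp.
pose cB := 1 + a / (2 * sp ^+ 2).
pose KM := (2 * (cB ^+ 2 * sp ^+ 2 + a) + 8 * sp ^+ 2 + 2 * (cB + 1) ^+ 2 * sp ^+ 2) ^+ 2
     + 4 * sp ^+ 2 * (cB ^+ 2 * sp ^+ 2) + (sp ^+ 4 + 2 * sp ^+ 2 * (a + b))
     + ((Ku + Kd) ^+ 2 + 4 * sp ^+ 2) * (b ^+ 2 / sp ^+ 2).
pose Kc := a ^+ 2 / sp ^+ 2.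
pose Kf := 2 * Kc + a + b * Kc.
pose KN := Kc ^+ 2 + 4 * sp ^+ 2 * Kc.
have Ku0 : 0 <= Ku by rewrite /Ku; nonneg.
have Kd0 : 0 <= Kd by rewrite /Kd; nonneg.
have KM0 : 0 <= KM by rewrite /KM; nonneg; apply: exprn_ge0; exact: ltW.
have Kc0 : 0 <= Kc by rewrite /Kc; nonneg.
have Kf0 : 0 <= Kf by rewrite /Kf; nonneg.
have KN0 : 0 <= KN by rewrite /KN; nonneg.
pose C := (1 + C1) + Ku + Kd + KM + Kf + KN.
have C0 : 0 < C by rewrite /C; lra.
(* [h < hb] excludes that the drifted point lies below the lowest node. That would force
   [z ^+ 2 >= 2 * (Y_0 + 1)]; but the drift removes at most half of [z ^+ 2], and the lowest node is
   at most [Y_0]. *)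
pose hb := sp ^+ 2 / (2 * b ^+ 2 * (Y_0 + 1)).
have hb0 : 0 < hb by rewrite divr_gt0 ?mulr_gt0 ?exprn_gt0// ltr_wpDl.
(* By [clipped_level], clipping occurs only at levels below the third witness. *)
exists C, (Num.min 1 (Num.min (2 * b)^-1 hb)), (Num.truncn (a / sp ^+ 2)).+1.
split=> //; first by rewrite !lt_min ltr01 invr_gt0 mulr_gt0.
move=> N n k N0 + nN kn /=; rewrite !lt_min => /and3P[].
set h := T / N%:R => /ltW h1 hb' hh.
have h0 : 0 < h by rewrite divr_gt0// ltr0n.
set rt := Num.sqrt h.
have rt0 : 0 < rt by rewrite sqrtr_gt0.
have rtE : rt ^+ 2 = h by rewrite sqr_sqrtr// ltW.
set s := sp * rt.
have s0 : 0 < s by exact: mulr_gt0.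
pose z := Num.sqrt Y_0 + s * (2 * k%:R - n%:R).
set eta := node mdl h Y_0 n k.
set yu := node mdl h Y_0 n.+1 _; set yd := node mdl h Y_0 n.+1 _.
have etaE : eta = pos2 z by rewrite /eta node_pos2.
have eta0 : 0 <= eta by rewrite etaE pos2_ge0.
set e := Num.sqrt _.
have eE : e ^+ 2 = h * (1 + eta) by rewrite sqr_sqrtr// mulr_ge0 ?addr_ge0// ltW.
have e0 : 0 <= e by exact: sqrtr_ge0.
pose zu := z + s * (2 * ((k_up mdl h Y_0 n k)%:R - k%:R) - 1).
pose zd := z + s * (2 * ((k_down mdl h Y_0 n k)%:R - k%:R) - 1).
have yuE : yu = pos2 zu by exact: node_next.
have ydE : yd = pos2 zd by exact: node_next.
have sN : s * N%:R * rt = sp * T.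
  rewrite /s (_ : sp * rt * N%:R * rt = sp * (rt ^+ 2 * N%:R)); last by ring.
  by rewrite rtE /h divfK// pnatr_eq0 -lt0n.
have rt1 : rt <= 1 by rewrite -sqrtr1 ler_wsqrtr.
have hC1 : h * (1 + eta) <= C1.
  rewrite mulrDr mulr1 /C1; apply: lerD => //.
  have zN : z <= Num.sqrt Y_0 + s * N%:R.
    rewrite /z lerD2l; apply: ler_wpM2l; first exact: ltW.
    have : (k%:R : R) <= n%:R by rewrite ler_nat.
    have : (n%:R : R) <= N%:R by rewrite ler_nat ltnW.
    by goal_lra.
  have e1 : eta <= (Num.sqrt Y_0 + s * N%:R) ^+ 2.
    by rewrite etaE -pos2E; [exact: pos2_le|nonneg].
  have := ler_wpM2l (ltW h0) e1.
  rewrite (_ : h * (_ + _) ^+ 2 = (Num.sqrt Y_0 * rt + sp * T) ^+ 2); last by rewrite -sN -rtE; ring.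
  have : (Num.sqrt Y_0 * rt + sp * T) ^+ 2 <= (Num.sqrt Y_0 + sp * T) ^+ 2.
    have r1 : Num.sqrt Y_0 * rt <= Num.sqrt Y_0 by rewrite ler_piMr.
    by rewrite lerXn2r ?nnegrE ?lerD2r//; nonneg.
  rewrite /B1; have := sqr_ge0 (Num.sqrt Y_0 + sp * T); goal_lra.
have eC : e <= 1 + C1.
  by have := sqr_ge0 (e - 1); rewrite sqrrB eE; move: hC1; have := sqr_ge0 e; rewrite eE; goal_lra.
have bh : b * h <= 2^-1.
  have : h * (2 * b) < 1 by rewrite -ltr_pdivlMr ?mulr_gt0// div1r.
  by move=> h2b; move: (ltW h2b); goal_lra.
have drE : node_drifted mdl h Y_0 n k = pos2 z + (a - b * pos2 z) * h.
  by rewrite /node_drifted /mu_Y -/eta etaE.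
have dr0 : 0 <= pos2 z + (a - b * pos2 z) * h.
  have : b * h * pos2 z <= 2^-1 * pos2 z by apply: ler_wpM2r => //; exact: pos2_ge0.
  have : 0 <= a * h by nonneg.
  by have := pos2_ge0 z; goal_lra.
have [ku1 ku2] := k_up_facts h kn; have [kd1 kd2] := k_down_facts h n k.
have /andP[kku kun] := k_up_le mdl h Y_0 kn.
have kdk := k_down_le mdl h Y_0 n k.
have kkuR : (k%:R : R) + 1 <= (k_up mdl h Y_0 n k)%:R by rewrite natr1 ler_nat.
have kdkR : ((k_down mdl h Y_0 n k)%:R : R) <= k%:R by rewrite ler_nat.
have zsu : z + s <= zu.
  by rewrite lerD2l -[X in X <= _]mulr1 ler_pM2l//; move: kkuR; goal_lra.
have zsd : zd <= z - s.
  by rewrite lerD2l -[X in _ <= - X]mulr1 -mulrN ler_pM2l//; move: kdkR; goal_lra.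
have Hu : zu = z + s \/ (z + s <= zu - 2 * s /\ pos2 (zu - 2 * s) < pos2 z + (a - b * pos2 z) * h).
  have [ek|nk] := eqVneq (k_up mdl h Y_0 n k) k.+1.
    by left; rewrite /zu ek -natr1; ring.
  have kl : (k.+1 < k_up mdl h Y_0 n k)%N by rewrite ltn_neqAle eq_sym nk.
  have kp : ((k_up mdl h Y_0 n k).-1%:R : R) = (k_up mdl h Y_0 n k)%:R - 1.
    by rewrite -[in RHS](prednK (ltn_trans (ltn0Sn _) kl)) -natr1 addrK.
  have zuE : zu - 2 * s = z + s * (2 * ((k_up mdl h Y_0 n k).-1%:R - k%:R) - 1).
    by rewrite kp /zu; ring.
  right; split.
    rewrite zuE lerD2l -[X in X <= _]mulr1 ler_pM2l// kp.
    have : (k%:R : R) + 2 <= (k_up mdl h Y_0 n k)%:R by rewrite -natrD ler_nat addn2.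
    by goal_lra.
  rewrite -drE zuE -node_next; apply: ku1.
  by move: kl; set kk := k_up _ _ _ _ _; case: kk => // kk' /=; rewrite !ltnS leqnn => ->.
have Hd : zd = z - s \/ (zd + 2 * s <= z - s /\ pos2 z + (a - b * pos2 z) * h < pos2 (zd + 2 * s)).
  have [ek|nk] := eqVneq (k_down mdl h Y_0 n k) k.
    by left; rewrite /zd ek; ring.
  have kl : (k_down mdl h Y_0 n k < k)%N by rewrite ltn_neqAle nk.
  have zdE : zd + 2 * s = z + s * (2 * ((k_down mdl h Y_0 n k).+1%:R - k%:R) - 1).
    by rewrite -natr1 /zd; ring.
  right; split.
    rewrite zdE lerD2l -[X in _ <= - X]mulr1 -mulrN ler_pM2l//.
    have : ((k_down mdl h Y_0 n k).+1%:R : R) <= k%:R by rewrite ler_nat.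
    by goal_lra.
  rewrite -drE zdE -node_next; apply: kd1.
  by rewrite ltnSn.
have ydr : pos2 zd <= pos2 z + (a - b * pos2 z) * h.
  rewrite -drE -ydE; case: kd2 => // -[_ h0n]; exfalso.
  move: h0n; apply/negP; rewrite -leNgt drE.
  have n0E : node mdl h Y_0 n.+1 0 = pos2 (Num.sqrt Y_0 - s * n.+1%:R).
    by rewrite node_pos2; congr pos2; rewrite -/rt -/s; ring.
  have [zs|zs] := leP z s.
    rewrite n0E pos2N//; apply: le_trans (_ : z - s <= 0); last by rewrite subr_le0.
    rewrite /z -natr1; have : 0 <= s * k%:R by nonneg; exact: ltW.
    by goal_lra.
  have [//|h2] := leP (node mdl h Y_0 n.+1 0) (pos2 z + (a - b * pos2 z) * h).
  have z0 : 0 < z by exact: lt_trans zs.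
  have zE : pos2 z = z ^+ 2 by rewrite pos2E// ltW.
  have h3 : z ^+ 2 + (a - b * z ^+ 2) * h < (z - s) ^+ 2.
    rewrite -zE -[(z - s) ^+ 2]pos2E ?subr_ge0 ?(ltW zs)//; apply: (lt_le_trans h2).
    rewrite n0E; apply: pos2_le; rewrite /z -natr1.
    by have : 0 <= s * k%:R; [nonneg; exact: ltW|goal_lra].
  have sbz : s <= b * z * h.
    have : 0 <= a * h by nonneg.
    have sz2 : s * s <= s * z by apply: ler_wpM2l; exact: ltW.
    move=> ah; rewrite -(ler_pM2r z0).
    by move: h3; rewrite sqrrB expr2 [s ^+ 2]expr2; move: ah sz2; goal_lra.
  have : sp ^+ 2 <= b ^+ 2 * (h * z ^+ 2).
    rewrite -(ler_pM2r h0) -{1}rtE -exprMn.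
    rewrite (_ : b ^+ 2 * (h * z ^+ 2) * h = (b * z * h) ^+ 2); last by ring.
    by rewrite lerXn2r ?nnegrE ?(ltW s0)//; nonneg; exact: ltW.
  have : h * (2 * b ^+ 2 * (Y_0 + 1)) <= sp ^+ 2.
    by apply: ltW; rewrite -ltr_pdivlMr// ?mulr_gt0 ?exprn_gt0// ltr_wpDl.
  move=> q1 q2; have : h * (b ^+ 2 * (2 * (Y_0 + 1))) <= h * (b ^+ 2 * z ^+ 2).
    by move: q1 q2; goal_lra.
  rewrite ler_pM2l// ler_pM2l ?exprn_gt0// => z2.
  have n0Y : node mdl h Y_0 n.+1 0 <= Y_0.
    rewrite n0E -[X in _ <= X](sqr_sqrtr Y0) -[X in _ <= X]pos2E ?sqrtr_ge0//.
    by apply: pos2_le; rewrite gerBl; nonneg; exact: ltW.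
  exfalso; move: h2; apply/negP; rewrite -leNgt; apply: (le_trans n0Y); rewrite zE.
  have : b * h * z ^+ 2 <= 2^-1 * z ^+ 2 by apply: ler_wpM2r => //; exact: sqr_ge0.
  have : 0 <= a * h by nonneg.
  by move: z2; goal_lra.
have pu01 := p_up_itv mdl h Y_0 n k.
have eE' : e ^+ 2 = h * (1 + pos2 z) by rewrite eE etaE.
have hC1' : h * (1 + pos2 z) <= C1 by rewrite -etaE.
have U := step_up_le a0 b0 sp0 h1 rt0 rtE e0 eE' bh Hu.
have Dn := step_down_ge a0 b0 sp0 C10 h1 rt0 rtE e0 eE' hC1' bh Hd.
have widen (x c w : R) : 0 <= w -> c <= C -> x <= c * w -> x <= C * w.
  by move=> w0 cC /le_trans; apply; apply: ler_wpM2r.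
have KuC : Ku <= C by rewrite /C; move: C10; move: KN0 Kf0 KM0 Kd0; goal_lra.
have KdC : Kd <= C by rewrite /C; move: C10; move: KN0 Kf0 KM0 Ku0; goal_lra.
have KMC : KM <= C by rewrite /C; move: C10; move: KN0 Kf0 Kd0 Ku0; goal_lra.
have KfC : Kf <= C by rewrite /C; move: C10; move: KN0 KM0 Kd0 Ku0; goal_lra.
have KNC : KN <= C by rewrite /C; move: C10; move: Kf0 KM0 Kd0 Ku0; goal_lra.
have e40 : 0 <= e ^+ 4 by exact: exprn_ge0.
have sgE : sg ^+ 2 = 4 * sp ^+ 2 by rewrite /sp; field.
have b1 : `|yu - eta| <= C * e.
  rewrite yuE etaE ger0_norm; last exact: (step_up_ge sp0 rt0 zsu).
  exact: widen U.
have b2 : `|yd - eta| <= C * e.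
  rewrite ydE etaE ler0_norm; last exact: (step_down_le sp0 rt0 zsd).
  by rewrite opprB; exact: widen Dn.
have b3 : e <= C by apply: (le_trans eC); rewrite /C; move: KN0 Kf0 KM0 Kd0 Ku0; goal_lra.
rewrite /step_mean /step_square -/yu -/yd -/eta yuE ydE etaE /mu_Y -/a -/b sgE.
rewrite yuE etaE in b1; rewrite ydE etaE in b2.
have [dru|dru] := leP (pos2 z + (a - b * pos2 z) * h) (pos2 zu).
  have puE : p_up mdl h Y_0 n k * (pos2 zu - pos2 zd) = pos2 z + (a - b * pos2 z) * h - pos2 zd.
    rewrite /p_up -/yu -/yd yuE ydE -/eta etaE /mu_Y -/a -/b.
    rewrite [(a - b * pos2 z) * h + pos2 z]addrC.
    have [ee|ne] := eqVneq (pos2 zu) (pos2 zd).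
      rewrite ee subrr mulr0; apply/esym/eqP; rewrite subr_eq0 eq_le ydr andbT.
      by rewrite -ee.
    have lt : 0 < pos2 zu - pos2 zd.
      by rewrite subr_gt0 lt_neqAle eq_sym ne/= (le_trans ydr).
    rewrite min_l; last by rewrite ler_pdivrMr// mul1r lerD2r.
    rewrite max_r; first by rewrite divfK// gt_eqF.
    by apply: divr_ge0; [rewrite subr_ge0|exact: ltW].
  have m1 := first_moment_unclipped puE.
  have m2 := second_moment_unclipped a0 b0 sp0 C10 h1 rt0 rtE e0 eE' hC1' bh zsu zsd Hu Hd pu01 puE.
  split=> //; first by rewrite m1.
    by rewrite m1 subrr normr0 mulr_ge0// mulr_ge0// ltW.
  exact: widen m2.
have kun1 : k_up mdl h Y_0 n k = n.+1.
  by case: ku2 => // ku2; move: dru; rewrite ltNge -yuE -drE ku2.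
have zun : sp * rt * n.+1%:R <= zu.
  rewrite /zu kun1 /z -/s (_ : _ + _ + _ = Num.sqrt Y_0 + s * n.+1%:R) ?lerDr ?sqrtr_ge0//.
  by rewrite -natr1; ring.
have [m1 m1'] := first_moment_clipped a0 b0 sp0 h1 rt0 rtE zsu zsd ydr pu01 dru zun.
have m2 := second_moment_clipped a0 b0 sp0 rt0 rtE eE' zsu zsd pu01 dru zun.
have nn0 : (n < (Num.truncn (a / sp ^+ 2)).+1)%N.
  have := clipped_level b0 sp0 rt0 rtE zsu dru zun.
  rewrite mulrC -ler_pdivlMr ?exprn_gt0// => h4.
  rewrite -(ltr_nat R); apply: (@lt_trans _ _ n.+1%:R); first by rewrite ltr_nat.
  exact: le_lt_trans h4 (truncnS_gt _).
split=> //; first by rewrite nn0 mulr1; apply: widen m1' => //; exact: ltW.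
exact: widen m2.
Qed.

End TreeFacts.

Lemma expsin_taylor0 {R : realType} (a b c : R) :
  `|expR a * sin (c + b) - sin c| <= (`|a| + `|b|) * expR `|a|.
Proof.
have sE (t : R) : sin t = cos (t - pi / 2) by rewrite cosB cos_pihalf sin_pihalf mulr0 add0r mulr1.
by rewrite !sE [c + b - _]addrAC; exact: expcos_taylor0.
Qed.

(** * Consistency *)

Section Consistency.
Context {R : realType}.
Variable mdl : heston R.
Hypothesis hm : heston_admissible mdl.
Let a0 := drift0 mdl.
Let b0 := reversion mdl.
Let sg := volvol mdl.
Let rb := rho_bar mdl.
Let k0 := slope_X mdl.
Let c0 := const_X mdl.
Let a0_gt0 : 0 < a0. Proof. by case: hm. Qed.
Let b0_gt0 : 0 < b0. Proof. by case: hm. Qed.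

Definition wave (u p q A b x y : R) : R := expR (A - p * y) * cos (u * x + b - q * y).

Lemma norm_mu_X (eta : R) : 0 <= eta -> `|mu_X mdl eta| <= (`|c0| + `|k0|) * (1 + eta).
Proof.
move=> eta0; rewrite /mu_X -/c0 -/k0 (le_trans (ler_normD _ _))// normrM (ger0_norm eta0).
have : 0 <= `|c0| * eta by nonneg.
by have := normr_ge0 k0; rewrite mulrDr mulr1 mulrDl; lra.
Qed.

(* The two upwind differences together approximate the x-derivatives of the
   generator: the drift part is of first order in [dx]. *)
Lemma fd_wave (h dx eta u A b p q X0 : R) (i : int) : 0 <= h -> 0 < dx <= 1 -> 0 <= eta ->
  `|fd_op mdl h dx eta (fun j => wave u p q A b (X0 + j%:~R * dx) eta) i
    - expR (A - p * eta) *
      (cos (u * (X0 + i%:~R * dx) + b - q * eta)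
       + h * u * mu_X mdl eta * sin (u * (X0 + i%:~R * dx) + b - q * eta)
       + h * rb ^+ 2 * eta * u ^+ 2 / 2 * cos (u * (X0 + i%:~R * dx) + b - q * eta))|
  <= expR (A - p * eta) * (((`|c0| + `|k0|) * u ^+ 2 + rb ^+ 2 * `|u| ^+ 3) * (h * (1 + eta) * dx)).
Proof.
move=> h0 /andP[dx0 dx1] eta0.
rewrite fd_opE /wave.
set E := expR _; set phi := u * _ + b - _.
have E0 : 0 <= E by exact: expR_ge0.
set th := u * dx.
have -> : u * (X0 + (i - 1)%:~R * dx) + b - q * eta = phi + (- th).
  by rewrite rmorphB/= /phi /th; ring.
have -> : u * (X0 + (i + 1)%:~R * dx) + b - q * eta = phi + th.
  by rewrite rmorphD/= /phi /th; ring.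
rewrite /fd_left /fd_right.
set al := fd_alpha _ _ _ _; set be := fd_beta _ _ _ _.
have be0 : 0 <= be by exact: fd_beta_ge0.
pose g1 := cos (phi + th) - cos phi + th * sin phi.
pose g1' := cos (phi - th) - cos phi - th * sin phi.
have hg1 : `|g1| <= th ^+ 2 by rewrite -(real_normK (num_real th)); exact: cos_taylor1.
have hg1' : `|g1'| <= th ^+ 2.
  have := cos_taylor1 (- th) phi; rewrite mulNr normrN.
  by rewrite (real_normK (num_real th)).
pose g2 := cos (phi + th) - cos phi + th * sin phi + th ^+ 2 * cos phi / 2.
pose g2' := cos (phi - th) - cos phi - th * sin phi + th ^+ 2 * cos phi / 2.
have hg2 : `|g2| <= `|th| ^+ 3 by exact: cos_taylor2.
have hg2' : `|g2'| <= `|th| ^+ 3.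
  by have := cos_taylor2 (- th) phi; rewrite mulNr normrN sqrrN.
have alE : al * th = h * u * mu_X mdl eta by rewrite /al /fd_alpha /th; field; rewrite gt_eqF.
have beE : be * th ^+ 2 = h * rb ^+ 2 * eta * u ^+ 2 / 2.
  by rewrite /be /fd_beta /th -/rb; field; rewrite gt_eqF.
pose ap := `|al| * (0 < al)%R%:R; pose an := `|al| * (al < 0)%R%:R.
have apn : ap - an = al.
  rewrite /ap /an; case: (ltgtP al 0) => [l|l|->].
  - by rewrite ltr0_norm//= mulr1n mulr0n; ring.
  - by rewrite gtr0_norm//= mulr1n mulr0n; ring.
  - by rewrite normr0; ring.
have aps : ap + an <= `|al|.
  rewrite /ap /an -mulrDr ler_piMr// -natrD.
  by case: (ltgtP al 0).
have ap0 : 0 <= ap by rewrite /ap; nonneg.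
have an0 : 0 <= an by rewrite /an; nonneg.
rewrite -/ap -/an (_ : _ - _ = - (E * (be * (g2 + g2') + ap * g1 + an * g1'))); last first.
  by rewrite -alE -apn -beE /g1 /g1' /g2 /g2'; field.
rewrite normrN normrM (ger0_norm E0); apply: ler_wpM2l => //.
have t1 : `|be * (g2 + g2')| <= rb ^+ 2 * `|u| ^+ 3 * (h * (1 + eta) * dx).
  rewrite normrM (ger0_norm be0).
  apply: (@le_trans _ _ (be * (2 * `|th| ^+ 3))).
    apply: ler_wpM2l => //; rewrite (le_trans (ler_normD _ _))//.
    by move: hg2 hg2'; goal_lra.
  have -> : be * (2 * `|th| ^+ 3) = rb ^+ 2 * `|u| ^+ 3 * (h * eta * dx).
    rewrite /th normrM (gtr0_norm dx0) /be /fd_beta -/rb; field.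
    by rewrite gt_eqF.
  apply: ler_wpM2l; first by rewrite mulr_ge0 ?sqr_ge0 ?exprn_ge0.
  by apply: ler_wpM2r; [exact: ltW|apply: ler_wpM2l => //; rewrite lerDr].
have t2 : `|ap * g1 + an * g1'| <= (`|c0| + `|k0|) * u ^+ 2 * (h * (1 + eta) * dx).
  apply: (@le_trans _ _ (`|al| * th ^+ 2)).
    rewrite (le_trans (ler_normD _ _))// (normrM ap) (normrM an) (ger0_norm ap0) (ger0_norm an0).
    apply: (@le_trans _ _ ((ap + an) * th ^+ 2)); last by apply: ler_wpM2r => //; exact: sqr_ge0.
    by rewrite mulrDl; apply: lerD; exact: ler_wpM2l.
  have -> : `|al| * th ^+ 2 = `|mu_X mdl eta| * u ^+ 2 * (h * dx).
    rewrite /al /fd_alpha !normrM normfV (gtr0_norm dx0) (ger0_norm h0) /th.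
    by field; rewrite gt_eqF.
  have -> : (`|c0| + `|k0|) * u ^+ 2 * (h * (1 + eta) * dx) = (`|c0| + `|k0|) * (1 + eta) * u ^+ 2 * (h * dx) by ring.
  apply: ler_wpM2r; first by rewrite mulr_ge0// ltW.
  apply: ler_wpM2r; first exact: sqr_ge0.
  exact: norm_mu_X.
by rewrite -addrA (le_trans (ler_normD _ _))// mulrDl [X in _ <= X]addrC; exact: lerD.
Qed.

(** Second order expansion in the jump, averaged over the two successors; the cubic remainder is
    O(e^3) since jumps are O(e) and [e] is bounded. *)
Lemma tree_wave (Cp C e eta yu yd pu M1 M2 p q phi : R) : 0 <= e -> e <= C ->
  0 <= pu <= 1 -> `|p| <= Cp -> `|q| <= Cp ->
  `|yu - eta| <= C * e -> `|yd - eta| <= C * e ->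
  M1 = pu * (yu - eta) + (1 - pu) * (yd - eta) ->
  M2 = pu * (yu - eta) ^+ 2 + (1 - pu) * (yd - eta) ^+ 2 ->
  `|pu * (expR (- p * (yu - eta)) * cos (phi - q * (yu - eta)))
    + (1 - pu) * (expR (- p * (yd - eta)) * cos (phi - q * (yd - eta)))
    - (cos phi + M1 * (- p * cos phi + q * sin phi)
       + M2 / 2 * ((p ^+ 2 - q ^+ 2) * cos phi - 2 * p * q * sin phi))|
  <= (2 * Cp * C) ^+ 3 * expR (Cp * (C * C)) * e ^+ 3.
Proof.
move=> e0 eC /andP[pu0 pu1] pC qC hu hd -> ->.
have C0 : 0 <= C by exact: le_trans eC.
have Cp0 : 0 <= Cp by exact: le_trans pC.
pose rem (D : R) := expR (- p * D) * cos (phi - q * D) - cos phi - ((- p * D) * cos phi - (- q * D) * sin phi)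
  - (((- p * D) ^+ 2 - (- q * D) ^+ 2) * cos phi - 2 * (- p * D) * (- q * D) * sin phi) / 2.
have remC (D : R) : `|D| <= C * e -> `|rem D| <= (2 * Cp * C) ^+ 3 * expR (Cp * (C * C)) * e ^+ 3.
  move=> hD; have := expcos_taylor2 (- p * D) (- q * D) phi; rewrite [- q * D]mulNr -mulNr.
  have pD : `|- p * D| <= Cp * C * e by rewrite normrM normrN -mulrA; apply: ler_pM.
  have qD : `|- q * D| <= Cp * C * e by rewrite normrM normrN -mulrA; apply: ler_pM.
  rewrite /rem mulNr in qD *; rewrite -(mulNr q) in qD *; move=> /le_trans; apply.
  have -> : (2 * Cp * C) ^+ 3 * expR (Cp * (C * C)) * e ^+ 3 = (Cp * C * e + Cp * C * e) ^+ 3 * expR (Cp * (C * C)).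
    by ring.
  apply: ler_pM; rewrite ?exprn_ge0 ?expR_ge0 ?addr_ge0//.
    by apply: lerXn2r; rewrite ?nnegrE ?addr_ge0 ?(le_trans _ pD)//; exact: lerD.
  rewrite ler_expR (le_trans pD)// -mulrA; apply: ler_wpM2l => //; exact: ler_wpM2l.
rewrite (_ : _ - _ = pu * rem (yu - eta) + (1 - pu) * rem (yd - eta)); last by rewrite /rem; field.
rewrite (le_trans (ler_normD _ _))// !normrM (ger0_norm pu0) (ger0_norm (_ : 0 <= 1 - pu)) ?subr_ge0//.
have := ler_wpM2l pu0 (remC _ hu); have := ler_wpM2l (_ : 0 <= 1 - pu) (remC _ hd).
by rewrite subr_ge0 => /(_ pu1); goal_lra.
Qed.

Lemma norm_trig_comb (r s phi Cr : R) : `|r| <= Cr -> `|s| <= Cr -> `|r * cos phi + s * sin phi| <= 2 * Cr.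
Proof.
move=> hr hs; rewrite (le_trans (ler_normD _ _))// !normrM.
have h1 : `|r| * `|cos phi| <= Cr by rewrite (le_trans _ hr)// ler_piMr//; exact: cos_max.
have h2 : `|s| * `|sin phi| <= Cr by rewrite (le_trans _ hs)// ler_piMr//; exact: sin_max.
by lra.
Qed.

(** Bookkeeping for [affine_consistency], where [s1], [s2], [s3] are [e ^+ 3], [e ^+ 2 * dx] and
    [h * ind]. *)
Lemma sum_up (E N n1 n2 n3 n4 n56 n7 KT Ka Kb k1 k2 k3 s1 s2 s3 : R) :
  0 <= E -> 0 <= KT -> 0 <= Ka -> 0 <= Kb -> 0 <= k1 -> 0 <= k2 -> 0 <= k3 -> 0 <= s1 -> 0 <= s2 -> 0 <= s3 ->
  N <= n1 + n2 + n3 + n4 + n56 -> n1 <= KT * s1 -> n2 <= k1 * s3 -> n3 <= k2 * s1 -> n4 <= Ka * s1 ->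
  n56 <= Kb * s1 -> n7 <= E * (k3 * s2) ->
  E * N + n7 <= (k1 + k2 + KT + Ka + Kb + k3) * (E * (s1 + s2 + s3)).
Proof.
move=> E0 KT0 Ka0 Kb0 k10 k20 k30 s10 s20 s30 hN h1 h2 h3 h4 h5 h7.
set Kt := k1 + k2 + KT + Ka + Kb.
have Kt0 : 0 <= Kt by rewrite /Kt; nonneg.
have hN' : N <= Kt * (s1 + s3).
  have w1 : 0 <= (k2 + KT + Ka + Kb) * s3 by nonneg.
  have w2 : 0 <= k1 * s1 by nonneg.
  by rewrite /Kt; move: w1; rewrite !mulrDl !mulrDr; lra.
have := ler_wpM2l E0 hN'.
have : 0 <= E * (Kt * s2) by nonneg.
have : 0 <= E * (k3 * s1) by nonneg.
have : 0 <= E * (k3 * s3) by nonneg.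
move: h7; clearbody Kt; rewrite (_ : (Kt + k3) * _ = E * (Kt * (s1 + s3)) + E * (Kt * s2) + E * (k3 * s1) + E * (k3 * s2) + E * (k3 * s3)); last by ring.
lra.
Qed.

(** The Riccati step is chosen so that the first order terms of the tree average and of the
    difference operator cancel. There remain the tree remainder in [e^3], the spatial error in
    [e^2 dx] and, where the tree is clipped, the drift defect [h ind]. All carry the weight
    [expR (A - p eta)], which later absorbs powers of [eta]. *)
Lemma affine_consistency (u Cp C : R) : 0 <= Cp -> 0 <= C -> exists2 K : R, 0 <= K &
  forall h dx eta yu yd pu e ind p q A b p' q' A' b' X0 (i : int),
  0 <= h -> 0 < dx <= 1 -> 0 <= eta -> 0 <= e -> e <= C -> 0 <= ind -> e ^+ 2 = h * (1 + eta) ->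
  `|p| <= Cp -> `|q| <= Cp -> 0 <= pu <= 1 ->
  `|yu - eta| <= C * e -> `|yd - eta| <= C * e ->
  `|pu * (yu - eta) + (1 - pu) * (yd - eta) - mu_Y mdl eta * h| <= C * h * ind ->
  `|pu * (yu - eta) ^+ 2 + (1 - pu) * (yd - eta) ^+ 2 - sg ^+ 2 * eta * h| <= C * e ^+ 4 ->
  riccati mdl h u p q A b p' q' A' b' ->
  `|pu * wave u p q A b (X0 + i%:~R * dx) yu + (1 - pu) * wave u p q A b (X0 + i%:~R * dx) yd
    - fd_op mdl h dx eta (fun j => wave u p' q' A' b' (X0 + j%:~R * dx) eta) i|
  <= K * (expR (A - p * eta) * (e ^+ 3 + e ^+ 2 * dx + h * ind)).
Proof.
move=> Cp0 C0.
pose K1 := a0 * Cp + b0 * Cp + rb ^+ 2 * u ^+ 2 / 2 + sg ^+ 2 * Cp ^+ 2 + `|u * c0| + `|u * k0|.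
have K10 : 0 <= K1 by rewrite /K1; nonneg.
pose KT := (2 * Cp * C) ^+ 3 * expR (Cp * (C * C)).
have KT0 : 0 <= KT by rewrite /KT; nonneg; apply: exprn_ge0; nonneg.
pose EX := expR (K1 * (C * C)).
have EX0 : 0 <= EX by exact: expR_ge0.
pose K2 := `|u| * (`|c0| + `|k0|).
have K20 : 0 <= K2 by rewrite /K2; nonneg.
pose K3 := (`|c0| + `|k0|) * u ^+ 2 + rb ^+ 2 * `|u| ^+ 3.
have K30 : 0 <= K3 by rewrite /K3; nonneg; apply: exprn_ge0.
pose K4 := rb ^+ 2 * u ^+ 2 / 2.
have K40 : 0 <= K4 by rewrite /K4; nonneg.
pose Ka := (2 * K1) ^+ 2 * EX * C.
pose Kb := (K2 + K4) * (2 * K1) * EX * C.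
have Ka0 : 0 <= Ka by rewrite /Ka; nonneg.
have Kb0 : 0 <= Kb by rewrite /Kb; nonneg.
exists (2 * Cp * C + 2 * Cp ^+ 2 * C * C + KT + Ka + Kb + EX * K3); first by nonneg.
move=> h dx eta yu yd pu e ind p q A b p' q' A' b' X0 i.
move=> h0 dx01 eta0 e0 eC ind0 eE pC qC pu01 hu hd.
set M1 := pu * _ + _; move=> hM1.
set M2 := pu * _ ^+ 2 + _; move=> hM2 [pE qE AE bE].
have ch : `|fd_op mdl h dx eta (fun j => wave u p' q' A' b' (X0 + j%:~R * dx) eta) i
    - expR (A' - p' * eta) *
      (cos (u * (X0 + i%:~R * dx) + b' - q' * eta)
       + h * u * mu_X mdl eta * sin (u * (X0 + i%:~R * dx) + b' - q' * eta)
       + h * rb ^+ 2 * eta * u ^+ 2 / 2 * cos (u * (X0 + i%:~R * dx) + b' - q' * eta))|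
  <= expR (A' - p' * eta) * (K3 * (h * (1 + eta) * dx)) by exact: fd_wave.
move: ch; set FD := fd_op _ _ _ _ _ _; move=> ch.
set x := X0 + _ in ch *.
pose phi := u * x + b - q * eta.
pose E := expR (A - p * eta).
have E0 : 0 <= E by exact: expR_ge0.
(* [al] and [bb] are the changes of the real and imaginary exponents at the node over one Riccati
   step; both are O(e^2). *)
pose al := - h * (a0 * p) + h * eta * (b0 * p - rb ^+ 2 * u ^+ 2 / 2 + sg ^+ 2 / 2 * (p ^+ 2 - q ^+ 2)).
pose bb := h * (u * c0 - a0 * q) + h * eta * (u * k0 + b0 * q + sg ^+ 2 * p * q).
have E'E : expR (A' - p' * eta) = E * expR al.
  by rewrite /E -expRD AE pE; congr expR; rewrite /al /a0 /b0 /sg /rb; ring.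
have phiE : u * x + b' - q' * eta = phi + bb.
  by rewrite bE qE /phi /bb /a0 /b0 /sg /c0 /k0; ring.
rewrite E'E phiE in ch.
have he : h <= e ^+ 2 by rewrite eE mulrDr mulr1 lerDl mulr_ge0.
have hee : h * eta <= e ^+ 2 by rewrite eE mulrDr mulr1 lerDr.
have heta0 : 0 <= h * eta by nonneg.
have p2 : p ^+ 2 <= Cp ^+ 2 by rewrite -real_normK ?num_real// lerXn2r ?nnegrE.
have q2 : q ^+ 2 <= Cp ^+ 2 by rewrite -real_normK ?num_real// lerXn2r ?nnegrE.
have pq : `|p * q| <= Cp ^+ 2 by rewrite normrM expr2; apply: ler_pM.
have pq2 : `|p ^+ 2 - q ^+ 2| <= Cp ^+ 2.
  by rewrite ler_norml; have := sqr_ge0 p; have := sqr_ge0 q; move: p2 q2; goal_lra.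
have e20 : 0 <= e ^+ 2 by exact: sqr_ge0.
have split2 (X Z KX KZ : R) : `|X| <= KX -> `|Z| <= KZ -> KX + KZ <= K1 -> `|h * X + h * eta * Z| <= K1 * e ^+ 2.
  move=> hX hZ hK; rewrite (le_trans (ler_normD _ _))// (normrM h) (normrM (h * eta)) (ger0_norm h0) (ger0_norm heta0).
  have KX0 : 0 <= KX by exact: le_trans hX.
  have KZ0 : 0 <= KZ by exact: le_trans hZ.
  have r1 : h * `|X| <= e ^+ 2 * KX by apply: ler_pM.
  have r2 : h * eta * `|Z| <= e ^+ 2 * KZ by apply: ler_pM.
  have := ler_wpM2l e20 hK; move: r2 r1; goal_lra.
have alC : `|al| <= K1 * e ^+ 2.
  rewrite /al mulNr -mulrN; apply: (split2 _ _ (a0 * Cp) (b0 * Cp + rb ^+ 2 * u ^+ 2 / 2 + sg ^+ 2 * Cp ^+ 2)).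
  - by rewrite normrN normrM (gtr0_norm a0_gt0) ler_wpM2l// ltW.
  - have r1 : `|b0 * p| <= b0 * Cp by rewrite normrM (gtr0_norm b0_gt0) ler_wpM2l// ltW.
    have r2 : `|sg ^+ 2 / 2 * (p ^+ 2 - q ^+ 2)| <= sg ^+ 2 * Cp ^+ 2.
      rewrite normrM ger0_norm; last by nonneg.
      apply: ler_pM => //; first by nonneg.
      by rewrite ler_pdivrMr// ler_peMr ?sqr_ge0// ler1n.
    have r3 : `|rb ^+ 2 * u ^+ 2 / 2| <= rb ^+ 2 * u ^+ 2 / 2 by rewrite ger0_norm.
    by rewrite (le_trans (ler_normD _ _))// lerD// (le_trans (ler_normB _ _))// lerD.
  - by rewrite /K1; have := normr_ge0 (u * c0); have := normr_ge0 (u * k0); goal_lra.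
have bbC : `|bb| <= K1 * e ^+ 2.
  apply: (split2 _ _ (`|u * c0| + a0 * Cp) (`|u * k0| + b0 * Cp + sg ^+ 2 * Cp ^+ 2)).
  - rewrite (le_trans (ler_normB _ _))// lerD2l normrM (gtr0_norm a0_gt0) ler_wpM2l//; exact: ltW.
  - have r1 : `|b0 * q| <= b0 * Cp by rewrite normrM (gtr0_norm b0_gt0) ler_wpM2l// ltW.
    have r2 : `|sg ^+ 2 * p * q| <= sg ^+ 2 * Cp ^+ 2.
      by rewrite -mulrA normrM (ger0_norm (sqr_ge0 _)) ler_wpM2l ?sqr_ge0.
    by rewrite (le_trans (ler_normD _ _))// lerD// (le_trans (ler_normD _ _))// lerD.
  - by rewrite /K1; move: K40; rewrite /K4; goal_lra.
have eX : expR `|al| <= EX.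
  rewrite ler_expR (le_trans alC)//; apply: ler_wpM2l => //.
  by rewrite expr2; apply: ler_pM.
have ab2 : `|al| + `|bb| <= 2 * K1 * e ^+ 2 by move: alC bbC; goal_lra.
have ab0 : 0 <= `|al| + `|bb| by nonneg.
pose c := cos phi; pose sn := sin phi.
pose r3 := expR al * cos (phi + bb) - c - (al * c - bb * sn).
have r3C : `|r3| <= (2 * K1 * e ^+ 2) ^+ 2 * EX.
  rewrite (le_trans (expcos_taylor1 _ _ _))//; apply: ler_pM => //; rewrite ?expR_ge0 ?exprn_ge0//.
  by rewrite lerXn2r ?nnegrE// (le_trans ab0).
pose r4 := expR al * cos (phi + bb) - c.
have r4C : `|r4| <= 2 * K1 * e ^+ 2 * EX.
  by rewrite (le_trans (expcos_taylor0 _ _ _))//; apply: ler_pM => //; rewrite expR_ge0.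
pose r5 := expR al * sin (phi + bb) - sn.
have r5C : `|r5| <= 2 * K1 * e ^+ 2 * EX.
  by rewrite (le_trans (expsin_taylor0 _ _ _))//; apply: ler_pM => //; rewrite expR_ge0.
pose G1 := - p * c + q * sn; pose G2 := (p ^+ 2 - q ^+ 2) * c - 2 * p * q * sn.
have G1C : `|G1| <= 2 * Cp by apply: norm_trig_comb => //; rewrite normrN.
have G2C : `|G2| <= 4 * Cp ^+ 2.
  have -> : G2 = (p ^+ 2 - q ^+ 2) * cos phi + (- (2 * p * q)) * sin phi by rewrite /G2 /c /sn; ring.
  have -> : 4 * Cp ^+ 2 = 2 * (2 * Cp ^+ 2) by ring.
  apply: norm_trig_comb; first by have := sqr_ge0 Cp; move: pq2; goal_lra.
  by rewrite normrN -mulrA normrM ger0_norm// ler_wpM2l.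
have tw := tree_wave phi e0 eC pu01 pC qC hu hd erefl erefl.
rewrite -/M1 -/M2 -/c -/sn -/G1 -/G2 -/KT in tw.
move: tw; set TW := _ + _ * (_ * _); set RT := TW - _; move=> tw.
have wE z : wave u p q A b x z = E * (expR (- p * (z - eta)) * cos (phi - q * (z - eta))).
  by rewrite /wave /E mulrA -expRD; congr (expR _ * cos _); rewrite /phi; ring.
pose RF := FD - E * expR al * (cos (phi + bb) + h * u * mu_X mdl eta * sin (phi + bb)
   + h * rb ^+ 2 * eta * u ^+ 2 / 2 * cos (phi + bb)).
have RFC : `|RF| <= E * (EX * K3 * (e ^+ 2 * dx)).
  rewrite (le_trans ch)// -mulrA; apply: ler_wpM2l => //.
  rewrite -eE -mulrA; apply: ler_wpM2r.
    by case/andP: dx01 => dx0 _; rewrite !mulr_ge0// ltW.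
  by rewrite (le_trans _ eX)// ler_expR ler_norm.
rewrite !wE.
have -> : pu * (E * (expR (- p * (yu - eta)) * cos (phi - q * (yu - eta))))
  + (1 - pu) * (E * (expR (- p * (yd - eta)) * cos (phi - q * (yd - eta)))) - FD
  = E * (RT + (M1 - mu_Y mdl eta * h) * G1 + (M2 - sg ^+ 2 * eta * h) / 2 * G2
      - r3 - h * u * mu_X mdl eta * r5 - h * rb ^+ 2 * eta * u ^+ 2 / 2 * r4) - RF.
  have muXE : mu_X mdl eta = c0 + k0 * eta by [].
  have muYE : mu_Y mdl eta = a0 - b0 * eta by [].
  have bbE : bb = h * (u * c0 - a0 * q) + h * eta * (u * k0 + b0 * q + sg ^+ 2 * p * q) by [].
  have alE : al = - h * (a0 * p) + h * eta * (b0 * p - rb ^+ 2 * u ^+ 2 / 2 + sg ^+ 2 / 2 * (p ^+ 2 - q ^+ 2)) by [].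
  rewrite /RT /TW /RF /r3 /r4 /r5 /G1 /G2 muXE muYE.
  (* With the transcendental factors turned into variables, the cancellation is a polynomial
     identity. *)
  move: (cos (phi + bb)) (sin (phi + bb)) (expR al) (expR (- p * (yu - eta)) * _) (expR (- p * (yd - eta)) * _) => t1 t2 t3 t4 t5.
  rewrite alE bbE; clear; clearbody a0 b0 sg rb k0 c0 c sn E FD M1 M2.
  by field.
have e30 : 0 <= e ^+ 3 by exact: exprn_ge0.
have e43 : e ^+ 4 <= C * e ^+ 3 by rewrite exprS ler_wpM2r.
have b1 : `|(M1 - mu_Y mdl eta * h) * G1| <= 2 * Cp * C * (h * ind).
  rewrite normrM (_ : 2 * Cp * C * (h * ind) = C * h * ind * (2 * Cp)); last by ring.
  exact: ler_pM.
have b2 : `|(M2 - sg ^+ 2 * eta * h) / 2 * G2| <= 2 * Cp ^+ 2 * C * C * e ^+ 3.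
  rewrite 2!normrM [`|2^-1|]ger0_norm//.
  apply: (@le_trans _ _ (C * e ^+ 4 / 2 * (4 * Cp ^+ 2))).
    by apply: ler_pM => //; apply: ler_wpM2r.
  rewrite (_ : _ / 2 * _ = 2 * Cp ^+ 2 * C * e ^+ 4); last by field.
  rewrite (_ : _ * e ^+ 3 = 2 * Cp ^+ 2 * C * (C * e ^+ 3)); last by ring.
  by apply: ler_wpM2l => //; nonneg.
have b3 : `|r3| <= Ka * e ^+ 3.
  apply: (le_trans r3C); rewrite (_ : _ * EX = (2 * K1) ^+ 2 * EX * e ^+ 4); last by ring.
  rewrite (_ : Ka * e ^+ 3 = (2 * K1) ^+ 2 * EX * (C * e ^+ 3)); last by rewrite /Ka; ring.
  by apply: ler_wpM2l => //; nonneg.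
have mX : `|h * u * mu_X mdl eta| <= K2 * e ^+ 2.
  rewrite eE !normrM (ger0_norm h0) /K2 (_ : _ * (h * _) = h * `|u| * ((`|c0| + `|k0|) * (1 + eta))); last by ring.
  apply: ler_wpM2l; first by nonneg.
  exact: norm_mu_X.
have sX : `|h * rb ^+ 2 * eta * u ^+ 2 / 2| <= K4 * e ^+ 2.
  rewrite ger0_norm; last by nonneg.
  have -> : h * rb ^+ 2 * eta * u ^+ 2 / 2 = K4 * (h * eta) by rewrite /K4; ring.
  exact: ler_wpM2l.
have b45 : `|h * u * mu_X mdl eta * r5| + `|h * rb ^+ 2 * eta * u ^+ 2 / 2 * r4| <= Kb * e ^+ 3.
  rewrite (normrM _ r5) (normrM _ r4).
  have t5 := ler_pM (normr_ge0 _) (normr_ge0 _) mX r5C.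
  have t4 := ler_pM (normr_ge0 _) (normr_ge0 _) sX r4C.
  apply: (@le_trans _ _ ((K2 + K4) * (2 * K1) * EX * e ^+ 4)).
    by apply: (le_trans (lerD t5 t4)); rewrite le_eqVlt; apply/orP; left; apply/eqP; ring.
  rewrite (_ : Kb * e ^+ 3 = (K2 + K4) * (2 * K1) * EX * (C * e ^+ 3)); last by rewrite /Kb; ring.
  by apply: ler_wpM2l => //; nonneg.
rewrite (le_trans (ler_normB _ _))// normrM (ger0_norm E0).
have dx0 : 0 <= dx by case/andP: dx01 => /ltW.
move: (h * u * _ * r5) (h * rb ^+ 2 * _ * _ / 2 * r4) b45 => Z5 Z6 b45.
rewrite -/E; clear r3C; clearbody r3 RT RF.
move: (_ * G1) ((M2 - _) / 2 * _) r3 RT RF b1 b2 b3 tw RFC => Z2 Z3 Z4 Z1 Z7 b1 b2 b3 b0' b6.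
have tri : `|Z1 + Z2 + Z3 - Z4 - Z5 - Z6| <= `|Z1| + `|Z2| + `|Z3| + `|Z4| + (`|Z5| + `|Z6|).
  rewrite addrA (le_trans (ler_normB _ _))// lerD2r (le_trans (ler_normB _ _))// lerD2r.
  rewrite (le_trans (ler_normB _ _))// lerD2r (le_trans (ler_normD _ _))// lerD2r.
  exact: ler_normD.
have s1 : 0 <= e ^+ 2 * dx by nonneg.
have s2 : 0 <= h * ind by nonneg.
by apply: (sum_up E0 KT0 Ka0 Kb0 _ _ _ e30 s1 s2 tri b0' b1 b2 b3 b45 b6); nonneg.
Qed.

End Consistency.

Lemma sum_ltn_le (n0 N : nat) : (\sum_(0 <= m < N) (m < n0) <= n0)%N.
Proof.
suff : (\sum_(0 <= m < N) (m < n0) <= minn N n0)%N by move/leq_trans; apply; exact: geq_minr.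
elim: N => [|N IH]; first by rewrite big_geq.
rewrite big_nat_recr//=; case: (ltnP N n0) IH => h IH.
  by rewrite (minn_idPl h) addn1 ltnS (leq_trans IH)// geq_minl.
by rewrite (minn_idPr (leqW h)) addn0 (leq_trans IH)// geq_minr.
Qed.

(** Here the lower bound [c] on [p] is spent: the weight of a wave outweighs the factor
    [(1 + eta) ^+ 2] of the consistency error uniformly over the nodes. *)
Lemma expR_absorb (R : realType) (c : R) : 0 < c -> exists2 K : R, 0 <= K &
  forall z, 0 <= z -> expR (- (c * z)) * (1 + z) ^+ 2 <= K.
Proof.
move=> c0; pose m := Num.min 1 (c / 2).
have m0 : 0 < m by rewrite /m lt_min ltr01/= divr_gt0.
exists (m ^-2); first by rewrite invr_ge0 exprn_ge0// ltW.
move=> z z0.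
have h1 : m * (1 + z) <= expR (c * z / 2).
  apply: le_trans (expR_ge1Dx _); rewrite mulrDr mulr1; apply: lerD; first by rewrite ge_min lexx.
  by rewrite mulrAC; apply: ler_wpM2r => //; rewrite ge_min lexx orbT.
have h2 : (m * (1 + z)) ^+ 2 <= expR (c * z).
  rewrite (_ : c * z = c * z / 2 + c * z / 2); last by field.
  have z1 : 0 <= m * (1 + z) by apply: mulr_ge0; [exact: ltW|exact: addr_ge0].
  by rewrite expRD expr2; apply: ler_pM.
rewrite expRN mulrC ler_pdivrMr ?expR_gt0// mulrC ler_pdivlMr ?exprn_gt0//.
by rewrite mulrC -exprMn.
Qed.

(** * Supersolutions *)

Section Supersolutions.
Context {R : realType}.
Variables (mdl : heston R) (T Y_0 : R).
Hypotheses (hm : heston_admissible mdl) (T0 : 0 < T) (Y0 : 0 <= Y_0).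
Local Notation supersolution h dx N := (supersolution mdl h dx Y_0 N).

Lemma node00 h : node mdl h Y_0 0 0 = Y_0.
Proof.
rewrite /node mulr0 subr0 mulr0 mul0r addr0 sqr_sqrtr//.
case: (ltgtP 0 (Num.sqrt Y_0)) => [_|/lt_geF|/esym/eqP]; rewrite ?sqrtr_ge0 ?mulr1//.
by rewrite sqrtr_eq0 => Y00; have -> : Y_0 = 0; [by apply/le_anti; rewrite Y00 Y0|rewrite mul0r].
Qed.

Lemma ric_shift h u v th k : [/\ ric_p mdl h u v th k = ric_p mdl h u v 0 k,
  ric_q mdl h u v th k = ric_q mdl h u v 0 k, ric_A mdl h u v th k = ric_A mdl h u v 0 k
  & ric_b mdl h u v th k = th + ric_b mdl h u v 0 k].
Proof.
elim: k => [|k [pE qE AE bE]]; first by split=> //; rewrite /ric_b/= addr0.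
have [-> -> -> ->] := riccati_iterS mdl h u v th k.
have [-> -> -> ->] := riccati_iterS mdl h u v 0 k.
by rewrite pE qE AE bE; split=> //; ring.
Qed.

Definition wave0 h u v th N x : R :=
  wave u (ric_p mdl h u v th N) (ric_q mdl h u v th N) (ric_A mdl h u v th N) (ric_b mdl h u v th N) x Y_0.

(** The recursion merely carries the initial phase along, so starting from [x] amounts to adding the
    phase [u x]. This is the source of uniformity in the starting point. *)
Lemma wave0_shift h u v th N x : wave0 h u v th N x = wave0 h u v (u * x + th) N 0.
Proof.
rewrite /wave0; have [-> -> -> ->] := ric_shift h u v th N.
have [-> -> -> ->] := ric_shift h u v (u * x + th) N.
by rewrite /wave; congr (_ * cos _); ring.
Qed.

(** [err n] sums the consistency errors of the remaining levels. As [e^3 <= h sqrt h (1 + eta)^2],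
    and the weight absorbs the powers of [eta], the [N] levels contribute a multiple of
    [T (sqrt h + dx)] and the at most [n0] clipped ones a multiple of [n0 h]. *)
Lemma wave_supersolution u v : 0 < v -> exists (K h0 : R), [/\ 0 <= K, 0 < h0 &
  forall (N : nat) (dx X0 th : R), (0 < N)%N -> T / N%:R < h0 -> 0 < dx <= 1 ->
  exists V, [/\ supersolution (T / N%:R) dx N V,
    forall k i, (k <= N)%N -> V N k i = expR (- (v * node mdl (T / N%:R) Y_0 N k)) * cos (u * (X0 + i%:~R * dx) + th)
  & forall i, V 0 0 i <= wave0 (T / N%:R) u v th N (X0 + i%:~R * dx) + K * (Num.sqrt (T / N%:R) + dx)]].
Proof.
move=> v0.
have [C [h1 [n0 [C0 h10 tree]]]] := tree_step_facts hm T0 Y0.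
have [Cp [c [h2 [c0 h20 ric]]]] := riccati_bounds hm u T0 v0.
have Cp0 : 0 <= Num.max Cp 0 by rewrite le_max lexx orbT.
have [K1 K10 con] := affine_consistency hm u Cp0 (ltW C0).
have [K6 K60 ab] := expR_absorb c0.
exists (K1 * K6 * (T + n0%:R)), (Num.min (Num.min h1 h2) 1); split.
- by rewrite !mulr_ge0// addr_ge0// ltW.
- by rewrite !lt_min h10 h20 ltr01.
move=> N dx X0 th N0; rewrite !lt_min => /andP[/andP[hh1 hh2] hlt1] dx01.
set h := T / N%:R in hh1 hh2 hlt1 *.
have h0 : 0 < h by rewrite divr_gt0// ltr0n.
have hN : h * N%:R = T by rewrite /h divfK// pnatr_eq0 -lt0n.
have dx0 : 0 < dx by case/andP: dx01.
have bnd n : (n <= N)%N -> let k := (N - n)%N in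
   [/\ c <= ric_p mdl h u v th k <= Cp, `|ric_q mdl h u v th k| <= Cp, - Cp <= ric_A mdl h u v th k <= 0
     & `|ric_b mdl h u v th k - th| <= Cp].
  move=> nN k; apply: ric; first by rewrite h0.
  by rewrite -hN ler_pM2l// ler_nat leq_subr.
pose D n := K1 * K6 * (h * Num.sqrt h + h * dx + h * (n < n0)%N%:R).
have D0 n : 0 <= D n by rewrite /D; nonneg; exact: ltW.
pose err n := \sum_(n <= m < N) D m.
pose wv n k i := let j := (N - n)%N in wave u (ric_p mdl h u v th j) (ric_q mdl h u v th j)
  (ric_A mdl h u v th j) (ric_b mdl h u v th j) (X0 + i%:~R * dx) (node mdl h Y_0 n k).
exists (fun n k i => wv n k i + err n); split.
- split.
    move=> n k nN kn; exists (1 + `|err n|) => i.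
    rewrite (le_trans (ler_normD _ _))// lerD2r /wv /wave normrM.
    have [/andP[p0 _] _ /andP[_ A0] _] := bnd _ nN.
    rewrite ger0_norm ?expR_ge0// -[1]mulr1; apply: ler_pM => //; rewrite ?expR_ge0//; last exact: cos_max.
    rewrite -[1]expR0 ler_expR subr_le0 (le_trans A0)// mulr_ge0 ?node_ge0//.
    exact: le_trans (ltW c0) p0.
  move=> n k i nN kn.
  have [[hu hd] eC _ m1 m2] := tree N n k N0 hh1 nN kn.
  rewrite -/h in hu hd eC m1 m2.
  set eta := node mdl h Y_0 n k in hu hd eC m1 m2 *.
  set yu := node mdl h Y_0 n.+1 _ in hu hd *; set yd := node mdl h Y_0 n.+1 _ in hu hd *.
  set e := Num.sqrt _ in hu hd eC m1 m2.
  have eta0 : 0 <= eta by exact: node_ge0.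
  have e0 : 0 <= e by exact: sqrtr_ge0.
  have eE : e ^+ 2 = h * (1 + eta) by rewrite sqr_sqrtr// mulr_ge0 ?addr_ge0// ltW.
  have [pb qb Ab _] := bnd _ nN.
  set p := ric_p _ _ _ _ _ _ in pb *; set q := ric_q _ _ _ _ _ _ in qb *.
  set A := ric_A _ _ _ _ _ _ in Ab *; pose b := ric_b mdl h u v th (N - n.+1).
  case/andP: pb => pb1 pb2; case/andP: Ab => _ Ab.
  have pC : `|p| <= Num.max Cp 0 by rewrite le_max ger0_norm ?pb2// (le_trans (ltW c0)).
  have qC : `|q| <= Num.max Cp 0 by rewrite le_max qb.
  have ricE : riccati mdl h u p q A b (ric_p mdl h u v th (N - n)) (ric_q mdl h u v th (N - n))
     (ric_A mdl h u v th (N - n)) (ric_b mdl h u v th (N - n)).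
    by rewrite -(subnSK nN); exact: riccati_iterS.
  have := con h dx eta yu yd (p_up mdl h Y_0 n k) e (n < n0)%N%:R p q A b _ _ _ _ X0 i
    (ltW h0) dx01 eta0 e0 eC (ler0n _ _) eE pC qC (p_up_itv mdl h Y_0 n k) hu hd m1 m2 ricE.
  rewrite -/yu -/yd; set FD := fd_op _ _ _ _ _ _; set LH := (X in `|X - FD|).
  move=> lF.
  have fdE : fd_op mdl h dx eta (fun j => wv n k j + err n) i = FD + err n.
    transitivity (fd_op mdl h dx eta (fun j => 1 * wv n k j + 1 * err n) i).
      by congr (fd_op _ _ _ _ _ _); apply/funext => j; rewrite !mul1r.
    by rewrite (fd_op_linear mdl h dx eta 1 1 (wv n k) (fun=> err n)) fd_op_cst !mul1r.
  have errE : err n = D n + err n.+1 by rewrite /err big_ltn.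
  rewrite fdE errE.
  have -> : p_up mdl h Y_0 n k * (wv n.+1 (k_up mdl h Y_0 n k) i + err n.+1) +
    p_down mdl h Y_0 n k * (wv n.+1 (k_down mdl h Y_0 n k) i + err n.+1) = LH + err n.+1.
    by rewrite /LH /wv /p_down -/p -/q -/A -/b -/yu -/yd; ring.
  rewrite addrA lerD2r -lerBlDl; apply: (le_trans (ler_norm _)); apply: (le_trans lF).
  rewrite /D -mulrA; apply: ler_wpM2l => //.
  have E1 : expR (A - p * eta) <= expR (- (c * eta)).
    by rewrite ler_expR; have := ler_wpM2r eta0 pb1; move: Ab; goal_lra.
  have z1 : 1 <= 1 + eta by move: eta0; goal_lra.
  have z2 : 0 <= 1 + eta by move: eta0; goal_lra.
  have E2 : expR (A - p * eta) * (1 + eta) ^+ 2 <= K6.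
    by rewrite (le_trans _ (ab _ eta0))// ler_wpM2r// exprn_ge0.
  have z12 : 1 + eta <= (1 + eta) ^+ 2 by rewrite expr2 ler_peMr.
  have z02 : 1 <= (1 + eta) ^+ 2 by exact: (le_trans z1).
  have hs0 : 0 <= h * Num.sqrt h by nonneg; exact: ltW.
  have e3 : e ^+ 3 <= h * Num.sqrt h * (1 + eta) ^+ 2.
    rewrite exprS eE /e sqrtrM; last exact: ltW.
    rewrite (_ : _ * _ * (h * _) = h * Num.sqrt h * (Num.sqrt (1 + eta) * (1 + eta))); last by ring.
    apply: ler_wpM2l => //; rewrite expr2; apply: ler_wpM2r => //.
    by rewrite -[X in _ <= X](ger0_norm z2) -sqrtr_sqr ler_wsqrtr.
  have e2 : e ^+ 2 * dx <= h * dx * (1 + eta) ^+ 2.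
    rewrite eE mulrAC; apply: ler_wpM2l => //; apply: mulr_ge0; exact: ltW.
  have e1 : h * (n < n0)%N%:R <= h * (n < n0)%N%:R * (1 + eta) ^+ 2.
    by rewrite ler_peMr// mulr_ge0// ltW.
  set S := h * Num.sqrt h + h * dx + h * (n < n0)%N%:R.
  apply: (@le_trans _ _ (expR (A - p * eta) * (S * (1 + eta) ^+ 2))).
    by apply: ler_wpM2l; rewrite ?expR_ge0// /S !mulrDl; do 2?apply: lerD.
  rewrite [S * _]mulrC mulrA; apply: ler_wpM2r => //.
  by rewrite /S; nonneg; exact: ltW.
- move=> k i kN; rewrite /wv /err big_geq// addr0 subnn /wave /ric_p /ric_q /ric_A /ric_b /=.
  by rewrite sub0r mul0r subr0.
- move=> i; rewrite /wv subn0 node00 -/(wave0 _ _ _ _ _ _) lerD2l /err.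
  rewrite -[X in _ <= X]mulrA /D -mulr_sumr; apply: ler_wpM2l; first by nonneg.
  rewrite big_split/= big_split/= !sumr_const_nat subn0 -mulr_sumr -natr_sum.
  have hs : h <= Num.sqrt h.
    rewrite -[X in X <= _](sqr_sqrtr (ltW h0)) expr2 ger_pMr ?sqrtr_gt0//.
    by rewrite -[1]sqrtr1 ler_wsqrtr// ltW.
  have s1 : h * Num.sqrt h *+ N = T * Num.sqrt h by rewrite -mulr_natr -hN; ring.
  have s2 : h * dx *+ N = T * dx by rewrite -mulr_natr -hN; ring.
  rewrite s1 s2.
  have s3 : h * (\sum_(0 <= m < N) (m < n0))%:R <= n0%:R * Num.sqrt h.
    rewrite mulrC; apply: ler_pM => //; first exact: ltW.
    by rewrite ler_nat sum_ltn_le.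
  have s4 : 0 <= n0%:R * dx by nonneg; exact: ltW.
  by rewrite mulrDl !mulrDr; move: s3 s4; goal_lra.
Qed.
End Supersolutions.

(** * A rational substitute for the indicator of large displacements *)

Section TailFunction.
Context {R : realType}.
Implicit Types w d : R.

(** Chosen rational so that its differences are explicit. It vanishes only at 0, is at least 1/2 for
    [|w| >= 1], has first and second differences of orders [d] and [d^2] for the scheme, and is at
    most twice [1 - expR (- w^2 / 2)], which the expectation side can handle. *)
Definition bump w : R := w ^+ 2 / (1 + w ^+ 2).

Let D w : R := 1 + w ^+ 2.
Let D0 w : 0 < D w. Proof. by rewrite /D ltr_pwDl// sqr_ge0. Qed.

Lemma bump_itv w : 0 <= bump w <= 1.
Proof.
rewrite /bump divr_ge0 ?sqr_ge0//=; last exact: (ltW (D0 w)).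
by rewrite ler_pdivrMr ?(D0 w)// mul1r lerDr.
Qed.

Lemma bump0 : bump 0 = 0. Proof. by rewrite /bump expr0n/= mul0r. Qed.

Lemma bump_le_exp w : bump w <= 2 * (1 - expR (- (w ^+ 2 / 2))).
Proof.
set s := w ^+ 2 / 2; have s0 : 0 <= s by rewrite /s divr_ge0 ?sqr_ge0.
have wE : w ^+ 2 = 2 * s by rewrite /s; field.
rewrite /bump wE expRN; apply: (@le_trans _ _ (2 * (1 - (1 + s)^-1))).
  rewrite -subr_ge0 (_ : _ - _ = 2 * s ^+ 2 / ((1 + s) * (1 + 2 * s))).
    by apply: divr_ge0; apply: mulr_ge0; rewrite ?sqr_ge0//; lra.
  by field; apply/andP; split; apply: lt0r_neq0; lra.
apply: ler_wpM2l => //; rewrite lerD2l lerN2 lef_pV2 ?posrE ?expR_gt0//; last by lra.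
exact: expR_ge1Dx.
Qed.

Lemma bump_diff1 w d : `|bump w - bump (w + d)| <= `|d|.
Proof.
set z := w + d.
have -> : bump w - bump z = (w - z) * ((w + z) / (D w * D z)).
  by rewrite /bump; have := D0 w; have := D0 z; rewrite /D => h1 h2; field; rewrite !gt_eqF.
rewrite normrM distrC {1}/z addrAC subrr add0r ler_piMr//.
rewrite normf_div [`|D w * _|]gtr0_norm ?mulr_gt0// ler_pdivrMr ?mulr_gt0// mul1r.
have := sqr_ge0 (w * z); rewrite ler_norml /D => h1.
have := sqr_ge0 (1 - w); have := sqr_ge0 (1 - z).
have := sqr_ge0 (1 + w); have := sqr_ge0 (1 + z).
by move: h1; rewrite exprMn !expr2; nra.
Qed.

Lemma bump_diff2 w d : `|bump (w + d) + bump (w - d) - 2 * bump w| <= 8 * d ^+ 2.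
Proof.
have -> : bump (w + d) + bump (w - d) - 2 * bump w =
   2 * d ^+ 2 * ((1 + d ^+ 2 - 3 * w ^+ 2) / (D w * (D (w + d) * D (w - d)))).
  rewrite /bump; have := D0 w; have := D0 (w + d); have := D0 (w - d); rewrite /D => h1 h2 h3.
  by field; rewrite !gt_eqF.
have n2 : 0 <= 2 * d ^+ 2 by apply: mulr_ge0 => //; exact: sqr_ge0.
rewrite normrM (ger0_norm n2).
have -> : 8 * d ^+ 2 = 2 * d ^+ 2 * 4 by ring.
apply: ler_wpM2l => //.
rewrite normf_div [`|D w * _|]gtr0_norm ?mulr_gt0// ler_pdivrMr ?mulr_gt0//.
have w0 := sqr_ge0 w; have d0 := sqr_ge0 d.
have P1 : 1 + 2 * w ^+ 2 + 2 * d ^+ 2 <= D (w + d) * D (w - d).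
  rewrite /D -subr_ge0 (_ : _ - _ = ((w + d) * (w - d)) ^+ 2) ?sqr_ge0//; ring.
have P2 : 1 + 2 * w ^+ 2 + 2 * d ^+ 2 <= D w * (D (w + d) * D (w - d)).
  rewrite (le_trans P1)// ler_peMl//; first by rewrite mulr_ge0// ltW.
  by rewrite /D lerDl.
by rewrite (@le_trans _ _ (1 + d ^+ 2 + 3 * w ^+ 2))//; [rewrite ler_norml; lra|lra].
Qed.

End TailFunction.

Section MoreSupersolutions.
Context {R : realType}.
Variables (mdl : heston R) (T Y_0 : R).
Hypotheses (hm : heston_admissible mdl) (T0 : 0 < T) (Y0 : 0 <= Y_0).
Let a0 := drift0 mdl.
Let b0 := reversion mdl.
Let a0_gt0 : 0 < a0. Proof. by case: hm. Qed.
Let b0_gt0 : 0 < b0. Proof. by case: hm. Qed.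

Lemma fd_opD h dx y (g1 g2 : int -> R) i : fd_op mdl h dx y (fun j => g1 j + g2 j) i =
  fd_op mdl h dx y g1 i + fd_op mdl h dx y g2 i.
Proof.
transitivity (fd_op mdl h dx y (fun j => 1 * g1 j + 1 * g2 j) i).
  by congr (fd_op _ _ _ _ _ _); apply/funext => j; rewrite !mul1r.
by rewrite (fd_op_linear mdl h dx y 1 1 g1 g2) !mul1r.
Qed.

Lemma supersolutionD h dx N V1 V2 : supersolution mdl h dx Y_0 N V1 -> supersolution mdl h dx Y_0 N V2 ->
  supersolution mdl h dx Y_0 N (fun n k i => V1 n k i + V2 n k i).
Proof.
move=> [l1 s1] [l2 s2]; split=> [n k nN kn|n k i nN kn].
  by apply: linfD; [exact: l1|exact: l2].
rewrite (fd_opD h dx _ (V1 n k) (V2 n k)).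
by have := lerD (s1 n k i nN kn) (s2 n k i nN kn); rewrite !mulrDr; lra.
Qed.

Lemma supersolutionZ h dx N c V : 0 <= c -> supersolution mdl h dx Y_0 N V ->
  supersolution mdl h dx Y_0 N (fun n k i => c * V n k i).
Proof.
move=> c0 [l1 s1]; split=> [n k nN kn|n k i nN kn].
  by apply: linfZ; exact: l1.
have -> : fd_op mdl h dx (node mdl h Y_0 n k) (fun j => c * V n k j) i =
   c * fd_op mdl h dx (node mdl h Y_0 n k) (V n k) i.
  rewrite -[RHS]addr0 -[in RHS](mul0r (fd_op mdl h dx (node mdl h Y_0 n k) (V n k) i)).
  rewrite -(fd_op_linear mdl h dx _ c 0 (V n k) (V n k)).
  by congr (fd_op _ _ _ _ _ _); apply/funext => j; rewrite mul0r addr0.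
by have := ler_wpM2l c0 (s1 n k i nN kn); rewrite mulrDr !mulrA !(mulrC c).
Qed.

Lemma cst_supersolution h dx N c : supersolution mdl h dx Y_0 N (fun _ _ _ => c).
Proof.
split=> [n k _ _|n k i _ _]; first by exists `|c|.
by rewrite fd_op_cst /p_down -mulrDl addrC subrK mul1r.
Qed.

(** The second order term is of size [lam^2 h (1 + eta)]. For small [lam] its part in [eta] is
    dominated by the mean reversion [lam b0 h eta], and the rest is a constant rate [K]. The bound
    [lam (C C) <= 1] keeps [lam] times a jump below 1. *)
Lemma lyapunov_supersolution : exists2 lam0 : R, 0 < lam0 & forall lam, 0 < lam <= lam0 ->
  exists K h0 : R, 0 < h0 /\ forall (N : nat) (dx : R), (0 < N)%N -> T / N%:R < h0 -> 
  exists V, [/\ supersolution mdl (T / N%:R) dx Y_0 N V,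
    forall k i, (k <= N)%N -> V N k i = expR (lam * node mdl (T / N%:R) Y_0 N k)
  & forall i, V 0 0 i <= K].
Proof.
have [C [h1 [n0 [C0 h10 tree]]]] := tree_step_facts hm T0 Y0.
pose E := expR 1 : R; have E0 : 0 < E by exact: expR_gt0.
exists (Num.min (C * C)^-1 (b0 / (E * C ^+ 2))).
  by rewrite lt_min invr_gt0 mulr_gt0// divr_gt0// mulr_gt0// exprn_gt0.
move=> lam; rewrite le_min => /and3P[lam0 lam1 lam2].
have lC : lam * (C * C) <= 1 by rewrite -ler_pdivlMr ?mulr_gt0// mul1r.
have lb : lam * (E * C ^+ 2) <= b0 by rewrite -ler_pdivlMr// mulr_gt0// exprn_gt0.
pose K := lam * a0 + lam ^+ 2 * E * C ^+ 2.
have K0 : 0 <= K by rewrite /K; nonneg; exact: ltW.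
exists (expR (lam * Y_0) * expR (K * T)), h1; split=> // N dx N0 hh1.
set h := T / N%:R in hh1 *.
have h0 : 0 < h by rewrite divr_gt0// ltr0n.
have hN : h * N%:R = T by rewrite /h divfK// pnatr_eq0 -lt0n.
exists (fun n k i => expR (lam * node mdl h Y_0 n k) * expR (K * (h * (N - n)%N%:R))); split.
- split; first by move=> n k _ _; eexists => i; exact: lexx.
  move=> n k i nN kn; rewrite fd_op_cst.
  have [[hu hd] eC m0 _ _] := tree N n k N0 hh1 nN kn.
  rewrite -/h in hu hd eC m0.
  move: m0; rewrite /step_mean /p_down.
  have := p_up_itv mdl h Y_0 n k; set pu := p_up _ _ _ _ _ => /andP[pu0 pu1].
  have eta0 : 0 <= node mdl h Y_0 n k by exact: node_ge0.
  set eta := node mdl h Y_0 n k in hu hd eC eta0 *.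
  set yu := node mdl h Y_0 n.+1 _ in hu hd *; set yd := node mdl h Y_0 n.+1 _ in hu hd *.
  set e := Num.sqrt _ in hu hd eC.
  have e0 : 0 <= e by exact: sqrtr_ge0.
  have eE : e ^+ 2 = h * (1 + eta) by rewrite sqr_sqrtr// mulr_ge0 ?addr_ge0// ltW.
  rewrite -(subnSK nN) => m0.
  have key z : `|z - eta| <= C * e -> expR (lam * z) <= expR (lam * eta) * (1 + lam * (z - eta) + lam ^+ 2 * E * C ^+ 2 * e ^+ 2).
    move=> hz; have -> : lam * z = lam * eta + lam * (z - eta) by ring.
    rewrite expRD; apply: ler_wpM2l; first exact: expR_ge0.
    set D := lam * (z - eta).
    have D1 : `|D| <= lam * (C * e) by rewrite normrM (gtr0_norm lam0) ler_wpM2l// ltW.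
    have D2 : `|D| <= 1.
      rewrite (le_trans D1)// (le_trans _ lC)//.
      by apply: ler_wpM2l; [exact: ltW|apply: ler_wpM2l => //; exact: ltW].
    have D3 : D ^+ 2 <= lam ^+ 2 * C ^+ 2 * e ^+ 2.
      rewrite -!exprMn -(real_normK (num_real D)) lerXn2r ?nnegrE//; first by nonneg; exact: ltW.
      by rewrite -mulrA.
    have D4 : expR `|D| <= E by rewrite ler_expR.
    have := expR_taylor1 D; rewrite (real_normK (num_real D)) => /(le_trans (ler_norm _)).
    have : D ^+ 2 * expR `|D| <= lam ^+ 2 * C ^+ 2 * e ^+ 2 * E by apply: ler_pM; rewrite ?sqr_ge0 ?expR_ge0.
    by rewrite !mulrA; goal_lra.
  set X := expR (K * _); set X' := expR (K * _).
  have X'E : X' = X * expR (K * h) by rewrite /X /X' -expRD -natr1; congr expR; ring.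
  have X0 : 0 <= X by exact: expR_ge0.
  rewrite X'E.
  have e1 : 1 + K * h <= expR (K * h) by exact: expR_ge1Dx.
  have ku := ler_wpM2l pu0 (key _ hu).
  have pd0 : 0 <= 1 - pu by rewrite subr_ge0.
  have kd := ler_wpM2l pd0 (key _ hd).
  have F0 : 0 <= expR (lam * eta) by exact: expR_ge0.
  suff le1 : pu * expR (lam * yu) + (1 - pu) * expR (lam * yd) <= expR (lam * eta) * expR (K * h).
    by have := ler_wpM2r X0 le1; goal_lra.
  apply: (le_trans (lerD ku kd)).
  set ex := expR (K * h) in e1 *; set F := expR (lam * eta) in F0 *.
  have -> : pu * (F * (1 + lam * (yu - eta) + lam ^+ 2 * E * C ^+ 2 * e ^+ 2)) +
    (1 - pu) * (F * (1 + lam * (yd - eta) + lam ^+ 2 * E * C ^+ 2 * e ^+ 2)) =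
    F * (1 + lam * (pu * (yu - eta) + (1 - pu) * (yd - eta)) + lam * (lam * (E * C ^+ 2)) * e ^+ 2) by ring.
  apply: ler_wpM2l => //; apply: le_trans e1; rewrite -addrA lerD2l.
  have m1 := ler_wpM2l (ltW lam0) m0.
  have m2 : lam * (lam * (E * C ^+ 2)) * e ^+ 2 <= lam ^+ 2 * E * C ^+ 2 * h + lam * b0 * (h * eta).
    rewrite eE mulrDr mulr1 mulrDr; apply: lerD; first by rewrite le_eqVlt; apply/orP; left; apply/eqP; ring.
    by apply: ler_wpM2r; [nonneg; exact: ltW|apply: ler_wpM2l => //; exact: ltW].
  apply: (le_trans (lerD m1 m2)); rewrite /K /mu_Y -/a0 -/b0.
  by rewrite le_eqVlt; apply/orP; left; apply/eqP; ring.
- by move=> k i _; rewrite subnn mulr0 mulr0 expR0 mulr1.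
- by move=> i; rewrite subn0 hN node00.
Qed.

(** The symmetric part needs the second difference only; the upwind part picks one of the two first
    differences. *)
Lemma fd_op_ge h dx eta (g : int -> R) D1 D2 i : 0 <= h -> 0 < dx -> 0 <= eta -> 
  `|g i - g (i - 1)| <= D1 -> `|g i - g (i + 1)| <= D1 -> `|g (i + 1) + g (i - 1) - 2 * g i| <= D2 ->
  g i - (fd_beta mdl h dx eta * D2 + `|fd_alpha mdl h dx eta| * D1) <= fd_op mdl h dx eta g i.
Proof.
move=> h0 dx0 eta0 d1 d2 d3; rewrite fd_opE /fd_left /fd_right.
have be0 := fd_beta_ge0 mdl h0 dx0 eta0.
set al := fd_alpha _ _ _ _; set be := fd_beta _ _ _ _ in be0 *.
have D10 : 0 <= D1 by exact: le_trans d1.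
have hb : - (be * D2) <= be * (2 * g i - g (i + 1) - g (i - 1)).
  rewrite -mulrN; apply: ler_wpM2l => //.
  by move: d3; rewrite ler_norml => /andP[]; lra.
suff : - (`|al| * D1) <= `|al| * (al < 0)%R%:R * (g i - g (i + 1)) + `|al| * (0 < al)%R%:R * (g i - g (i - 1)) /\
    - (`|al| * D1) <= `|al| * (al < 0)%R%:R * (g i - g (i - 1)) + `|al| * (0 < al)%R%:R * (g i - g (i + 1)).
  by move=> []; lra.
have n0 := normr_ge0 al.
have w1 : - (`|al| * D1) <= `|al| * (g i - g (i + 1)).
  by rewrite -mulrN ler_wpM2l//; move: d2; rewrite ler_norml => /andP[].
have w2 : - (`|al| * D1) <= `|al| * (g i - g (i - 1)).
  by rewrite -mulrN ler_wpM2l//; move: d1; rewrite ler_norml => /andP[].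
have w3 : 0 <= `|al| * D1 by nonneg.
by case: (ltgtP al 0) => _; rewrite /= ?mulr1n ?mulr0n ?mulr1 ?mulr0; split; move: w1 w2 w3; goal_lra.
Qed.

(** The operator lowers the rescaled [bump] by at most a multiple of [h (1 + eta) / A], where
    [A >= 1] bounds [1 / A^2] by [1 / A]. The mean of [1 + Y] grows at rate at most [a0]; the
    corrector [ga], null at maturity, satisfies the resulting inequality
    [(1 + a0 h) ga (n + 1) + h <= ga n]. *)
Lemma tail_supersolution : exists K h0 : R, [/\ 0 <= K, 0 < h0 & forall (A : R) (N : nat) (dx X0 xc : R), 1 <= A ->
  (0 < N)%N -> T / N%:R < h0 -> 0 < dx ->
  exists V, [/\ supersolution mdl (T / N%:R) dx Y_0 N V,
    forall k i, (k <= N)%N -> V N k i = bump ((X0 + i%:~R * dx - xc) / A)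
  & forall i, V 0 0 i = bump ((X0 + i%:~R * dx - xc) / A) + K / A]].
Proof.
have [C [h1 [n0 [C0 h10 tree]]]] := tree_step_facts hm T0 Y0.
pose c1 := `|const_X mdl| + `|slope_X mdl|.
pose K1 := rho_bar mdl ^+ 2 * 4 + c1.
have K10 : 0 <= K1 by rewrite /K1 /c1; nonneg.
exists (K1 * (1 + Y_0) * (expR (a0 * T) * T)), h1; split=> //.
  apply: mulr_ge0; first by apply: mulr_ge0 => //; exact: addr_ge0.
  by apply: mulr_ge0; [exact: expR_ge0|exact: ltW].
move=> A N dx X0 xc A1 N0 hh1 dx0.
set h := T / N%:R in hh1 *.
have h0 : 0 < h by rewrite divr_gt0// ltr0n.
have hN : h * N%:R = T by rewrite /h divfK// pnatr_eq0 -lt0n.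
have A0 : 0 < A by exact: lt_le_trans A1.
pose g j := bump ((X0 + j%:~R * dx - xc) / A).
pose ga n := expR (a0 * (h * (N - n)%N%:R)) * (h * (N - n)%N%:R).
have ga0 n : 0 <= ga n by rewrite /ga mulr_ge0 ?expR_ge0// mulr_ge0// ltW.
exists (fun n k i => g i + K1 / A * (1 + node mdl h Y_0 n k) * ga n); split.
- split.
    move=> n k _ _; exists (1 + `|K1 / A * (1 + node mdl h Y_0 n k) * ga n|) => i.
    rewrite (le_trans (ler_normD _ _))// lerD2r.
    by have /andP[b1 b2] := bump_itv ((X0 + i%:~R * dx - xc) / A); rewrite ger0_norm.
  move=> n k i nN kn.
  have [_ _ m0 _ _] := tree N n k N0 hh1 nN kn.
  rewrite -/h in m0; move: m0; rewrite /step_mean /p_down.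
  have := p_up_itv mdl h Y_0 n k; set pu := p_up _ _ _ _ _ => /andP[pu0 pu1].
  have eta0 : 0 <= node mdl h Y_0 n k by exact: node_ge0.
  set eta := node mdl h Y_0 n k in eta0 *.
  set yu := node mdl h Y_0 n.+1 _; set yd := node mdl h Y_0 n.+1 _ => m0.
  have fdE : fd_op mdl h dx eta (fun j => g j + K1 / A * (1 + eta) * ga n) i =
     fd_op mdl h dx eta g i + K1 / A * (1 + eta) * ga n.
    by rewrite (fd_opD h dx eta g (fun=> K1 / A * (1 + eta) * ga n)) fd_op_cst.
  rewrite fdE.
  pose d := dx / A.
  have gS : g (i + 1) = bump ((X0 + i%:~R * dx - xc) / A + d).
    by rewrite /g /d rmorphD/=; congr bump; field; rewrite gt_eqF.
  have gP : g (i - 1) = bump ((X0 + i%:~R * dx - xc) / A - d).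
    by rewrite /g /d rmorphB/=; congr bump; field; rewrite gt_eqF.
  have d0 : 0 <= d by rewrite /d divr_ge0// ltW.
  have := @fd_op_ge h dx eta g d (8 * d ^+ 2) i (ltW h0) dx0 eta0.
  rewrite gS gP.
  move=> /(_ _ _ (bump_diff2 _ _)) hfd.
  have {}hfd : g i - (fd_beta mdl h dx eta * (8 * d ^+ 2) + `|fd_alpha mdl h dx eta| * d) <= fd_op mdl h dx eta g i.
    apply: hfd; last by rewrite (le_trans (bump_diff1 _ _))// ger0_norm.
    by rewrite (le_trans (bump_diff1 _ (- d)))// normrN ger0_norm.
  have e1 : fd_beta mdl h dx eta * (8 * d ^+ 2) + `|fd_alpha mdl h dx eta| * d <= K1 / A * (h * (1 + eta)).
    have t1 : fd_beta mdl h dx eta * (8 * d ^+ 2) <= rho_bar mdl ^+ 2 * 4 / A * (h * (1 + eta)).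
      have -> : fd_beta mdl h dx eta * (8 * d ^+ 2) = rho_bar mdl ^+ 2 * 4 * (h * eta) * A^-1 * A^-1.
        by rewrite /fd_beta /d; field; rewrite !gt_eqF.
      apply: (@le_trans _ _ (rho_bar mdl ^+ 2 * 4 * (h * eta) * A^-1)).
        rewrite ler_piMr ?invf_le1//; nonneg; exact: ltW.
      rewrite mulrAC; apply: ler_wpM2l; first by nonneg; exact: ltW.
      by apply: ler_wpM2l; [exact: ltW|rewrite lerDr].
    have t2 : `|fd_alpha mdl h dx eta| * d <= c1 / A * (h * (1 + eta)).
      have -> : `|fd_alpha mdl h dx eta| * d = `|mu_X mdl eta| * (h / A).
        have hd0 : 0 <= h / dx by apply: divr_ge0; exact: ltW.
        rewrite /fd_alpha /d (normrM (h / dx) (mu_X mdl eta)) (ger0_norm hd0).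
        by field; rewrite !gt_eqF.
      rewrite (_ : c1 / A * _ = c1 * (1 + eta) * (h / A)); last by field; rewrite gt_eqF.
      by apply: ler_wpM2r; [rewrite divr_ge0// ltW|exact: norm_mu_X].
    by move: t1 t2; rewrite /K1 !mulrDl; goal_lra.
  have gaE : (1 + a0 * h) * ga n.+1 + h <= ga n.
    rewrite /ga -(subnSK nN) -natr1; set r := (N - n.+1)%N%:R.
    have r0 : 0 <= r by rewrite /r ler0n.
    have E1 : 1 + a0 * h <= expR (a0 * h) by exact: expR_ge1Dx.
    have E2 : 1 <= expR (a0 * (h * r)).
      by rewrite -[1]expR0 ler_expR mulr_ge0 ?mulr_ge0// ltW.
    have -> : a0 * (h * (r + 1)) = a0 * h + a0 * (h * r) by ring.
    rewrite expRD; set x1 := expR (a0 * h) in E1 *; set x2 := expR (a0 * (h * r)) in E2 *.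
    have w1 : (1 + a0 * h) * (x2 * (h * r)) <= x1 * (x2 * (h * r)).
      by apply: ler_wpM2r => //; apply: mulr_ge0; [exact: (le_trans ler01)|apply: mulr_ge0 => //; exact: ltW].
    have w2 : 1 <= x1 * x2.
      rewrite -[1]mulr1; apply: ler_pM => //; apply: le_trans E1.
      by rewrite lerDl mulr_ge0// ltW.
    have := ler_wpM2r (ltW h0) w2; rewrite mul1r => w3.
    rewrite (_ : x1 * x2 * _ = x1 * (x2 * (h * r)) + x1 * x2 * h); first exact: lerD.
    by ring.
  have mm : pu * (1 + yu) + (1 - pu) * (1 + yd) <= (1 + eta) * (1 + a0 * h).
    apply: (@le_trans _ _ (1 + eta + mu_Y mdl eta * h)); first by move: m0; goal_lra.
    rewrite /mu_Y -/a0 -/b0.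
    have : 0 <= b0 * eta * h by nonneg; exact: ltW.
    have : 0 <= a0 * eta * h by nonneg; exact: ltW.
    goal_lra.
  have KA0 : 0 <= K1 / A by rewrite divr_ge0// ltW.
  have s1 := ler_wpM2r (ga0 n.+1) mm.
  have s2 := ler_wpM2l (_ : 0 <= 1 + eta) gaE.
  have s3 : (pu * (1 + yu) + (1 - pu) * (1 + yd)) * ga n.+1 + (1 + eta) * h <= (1 + eta) * ga n.
    by apply: le_trans (s2 _); [rewrite mulrDr; move: s1|move: eta0]; goal_lra.
  have s4 := ler_wpM2l KA0 s3.
  move: s4 e1 hfd; rewrite -/(g i); goal_lra.
- by move=> k i _; rewrite /ga subnn mulr0 !mulr0 addr0.
- move=> i; rewrite /ga subn0 hN (node00 mdl Y0).
  have zE z : K1 / A * (1 + Y_0) * z = K1 * (1 + Y_0) * z / A by field; rewrite gt_eqF.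
  by rewrite zE.
Qed.

End MoreSupersolutions.

(** * Approximation of the payoff by waves *)

Section BinomialMean.
Context {R : realType}.
Implicit Types (s : R) (g : nat -> R).

(* The mean of [g (k + S)], with [S] binomial of parameters [n] and [s]:
   for [k = 0] it is the Bernstein polynomial with node values [g]. *)
Fixpoint bern (n : nat) s g (k : nat) : R :=
  if n is n'.+1 then s * bern n' s g k.+1 + (1 - s) * bern n' s g k else g k.

Lemma bern_cst n s v k : bern n s (fun=> v) k = v.
Proof. by elim: n k => //= n IH k; rewrite !IH; ring. Qed.

Lemma bern_lin n s a g1 g2 k : bern n s (fun j => a * g1 j + g2 j) k = a * bern n s g1 k + bern n s g2 k.
Proof. by elim: n k => //= n IH k; rewrite !IH; ring. Qed.

Lemma bern_sqr n s a k : bern n s (fun j => (j%:R - a) ^+ 2) k = (k%:R + n%:R * s - a) ^+ 2 + n%:R * (s * (1 - s)).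
Proof.
elim: n k => [|n IH] k /=; first by rewrite mul0r addr0 mul0r addr0.
by rewrite !IH -!natr1; ring.
Qed.

Lemma bern_le n s g1 g2 k : 0 <= s <= 1 -> (forall j, (k <= j <= k + n)%N -> g1 j <= g2 j) ->
  bern n s g1 k <= bern n s g2 k.
Proof.
move=> /andP[s0 s1]; elim: n k => [|n IH] k hg /=; first by apply: hg; rewrite addn0 leqnn.
apply: lerD; apply: ler_wpM2l; rewrite ?subr_ge0//; apply: IH => j /andP[j1 j2]; apply: hg.
  by rewrite (ltnW j1) -addSnnS.
by rewrite j1 (leq_trans j2)// leq_add2l.
Qed.

Lemma bern_dist n s g v k : 0 <= s <= 1 -> `|bern n s g k - v| <= bern n s (fun j => `|g j - v|) k.
Proof.
move=> /andP[s0 s1]; elim: n k => [|n IH] k //=.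
have -> : s * bern n s g k.+1 + (1 - s) * bern n s g k - v =
   s * (bern n s g k.+1 - v) + (1 - s) * (bern n s g k - v) by ring.
have s1' : 0 <= 1 - s by rewrite subr_ge0.
rewrite (le_trans (ler_normD _ _))// !normrM (ger0_norm s0) (ger0_norm s1').
by apply: lerD; apply: ler_wpM2l.
Qed.

(** Chebyshev's argument in two variables: the quadratic penalties average to binomial variances. *)
Lemma bern2_dist n s t (F : nat -> nat -> R) v (e a b : R) : 0 <= s <= 1 -> 0 <= t <= 1 ->
  (forall j l, (j <= n)%N -> (l <= n)%N ->
    `|F j l - v| <= e + a * (j%:R - n%:R * s) ^+ 2 + b * (l%:R - n%:R * t) ^+ 2) ->
  `|bern n s (fun j => bern n t (F j) 0) 0 - v| <= e + a * (n%:R * (s * (1 - s))) + b * (n%:R * (t * (1 - t))).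
Proof.
move=> s01 t01 hF; apply: (le_trans (bern_dist _ _ _ _ s01)).
have sq u : bern n u (fun l => (l%:R - n%:R * u) ^+ 2) 0 = n%:R * (u * (1 - u)).
  by rewrite bern_sqr add0r subrr expr0n/= add0r.
apply: (@le_trans _ _ (bern n s (fun j => a * (j%:R - n%:R * s) ^+ 2 + (e + b * (n%:R * (t * (1 - t))))) 0)).
  apply: bern_le => // j; rewrite add0n => /andP[_ jn].
  apply: (le_trans (bern_dist _ _ _ _ t01)).
  apply: (@le_trans _ _ (bern n t (fun l => b * (l%:R - n%:R * t) ^+ 2 + (e + a * (j%:R - n%:R * s) ^+ 2)) 0)).
    by apply: bern_le => // l; rewrite add0n => /andP[_ ln]; rewrite [X in _ <= X]addrC; exact: hF.
  by rewrite (bern_lin n t b (fun l => (l%:R - n%:R * t) ^+ 2) (fun=> _)) sq bern_cst; lra.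
by rewrite (bern_lin n s a (fun l => (l%:R - n%:R * s) ^+ 2) (fun=> _)) sq bern_cst; lra.
Qed.

End BinomialMean.

Section TrigSpan.
Context {R : realType}.

(* Families indexed by a centre [c], with amplitudes bounded uniformly in [c]. *)
Inductive tspan (b : bool) : (R -> R -> R -> R) -> Prop :=
| tspan_gen u v a th K : 0 <= v -> (b -> 0 < v) -> (forall c, 0 <= a c <= K) ->
    tspan b (fun c x y => a c * (expR (- (v * y)) * cos (u * x + th c)))
| tspan_add phi psi : tspan b phi -> tspan b psi -> tspan b (fun c x y => phi c x y + psi c x y).

Lemma tspan_ext b phi psi : tspan b phi -> (forall c x y, psi c x y = phi c x y) -> tspan b psi.
Proof. by move=> h e; suff -> : psi = phi by []; apply/funext => c; apply/funext => x; apply/funext => y. Qed.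

(** Amplitudes are nonnegative, so a negative [w c] is turned into a phase shift by [pi]. *)
Lemma tspanZ b w K phi : (forall c, `|w c| <= K) -> tspan b phi -> tspan b (fun c x y => w c * phi c x y).
Proof.
move=> wK; elim=> [u v a th K' v0 bv aK|phi1 phi2 _ h1 _ h2].
- have gen := @tspan_gen b u v (fun c => `|w c| * a c) (fun c => th c + (w c < 0)%R%:R * pi) (K * K') v0 bv.
  apply: tspan_ext (gen _) _.
    by move=> c; have /andP[a0 a1] := aK c; rewrite mulr_ge0//=; apply: ler_pM.
  move=> c x y /=; case: (ltrP (w c) 0) => w0 /=.
    by rewrite mul1r addrA cosDpi ltr0_norm//; ring.
  by rewrite mul0r addr0 ger0_norm//; ring.
- by apply: tspan_ext (tspan_add h1 h2) _ => c x y; rewrite mulrDr.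
Qed.

Lemma tspan_scale b k phi : tspan b phi -> tspan b (fun c x y => k * phi c x y).
Proof. by apply: (@tspanZ b (fun=> k) `|k|). Qed.

Lemma tspan_cst w K : (forall c, `|w c| <= K) -> tspan false (fun c _ _ => w c).
Proof.
move=> wK; have gen := @tspan_gen false 0 0 (fun=> 1) (fun=> 0) 1 (lexx _) (fun e => False_ind _ (notF e)).
apply: tspan_ext (tspanZ wK (gen _)) _; first by move=> c; rewrite lexx ler01.
by move=> c x y; rewrite !mul0r addr0 oppr0 expR0 cos0 !mulr1.
Qed.

Lemma tspan0 b : tspan b (fun _ _ _ => 0).
Proof.
have gen := @tspan_gen b 0 1 (fun=> 0) (fun=> 0) 0 (ler01) (fun=> ltr01).
by apply: tspan_ext (gen _) _ => [c|c x y]; rewrite ?lexx// mul0r.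
Qed.

(** Every rate [v >= 0] becomes [v + 1 > 0], so the product satisfies the stricter flag. *)
Lemma tspan_exp b b' phi : tspan b phi -> tspan b' (fun c x y => expR (- y) * phi c x y).
Proof.
elim=> [u v a th K v0 _ aK|phi1 phi2 _ h1 _ h2].
- have gen := @tspan_gen b' u (v + 1) a th K.
  apply: tspan_ext (gen _ _ aK) _; [by rewrite addr_ge0|by rewrite ltr_wpDl|].
  by move=> c x y; rewrite mulrDl mul1r opprD expRD; ring.
- by apply: tspan_ext (tspan_add h1 h2) _ => c x y; rewrite mulrDr.
Qed.

Lemma tspan_cos b k tau phi : tspan b phi -> tspan b (fun c x y => cos (k * x + tau c) * phi c x y).
Proof.
elim=> [u v a th K v0 bv aK|phi1 phi2 _ h1 _ h2].
- have gen1 := @tspan_gen b (u + k) v (fun c => a c / 2) (fun c => th c + tau c) (K / 2) v0 bv.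
  have gen2 := @tspan_gen b (u - k) v (fun c => a c / 2) (fun c => th c - tau c) (K / 2) v0 bv.
  have aK' c : 0 <= a c / 2 <= K / 2 by have := aK c; lra.
  apply: tspan_ext (tspan_add (gen1 aK') (gen2 aK')) _ => c x y.
  have -> : (u + k) * x + (th c + tau c) = (u * x + th c) + (k * x + tau c) by ring.
  have -> : (u - k) * x + (th c - tau c) = (u * x + th c) - (k * x + tau c) by ring.
  by move: (u * x + th c) (k * x + tau c) => z1 z2; rewrite cosB cosD; field.
- by apply: tspan_ext (tspan_add h1 h2) _ => c x y; rewrite mulrDr.
Qed.

(** The variable of the Bernstein polynomials in [x]: it lies in [[0, 1]], multiplication by it
    preserves the span, and it determines [x] as long as [|x - c| <= A pi / 2]. *)
Definition phase (A c x : R) : R := (1 + sin ((x - c) / A)) / 2.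

Lemma tspan_phase b A phi : tspan b phi -> tspan b (fun c x y => phase A c x * phi c x y).
Proof.
move=> h; have h1 := tspan_cos A^-1 (fun c => - c / A - pi / 2) h.
apply: tspan_ext (tspan_scale 2^-1 (tspan_add h h1)) _ => c x y.
have -> : A^-1 * x + (- c / A - pi / 2) = (x - c) / A - pi / 2 by ring.
by rewrite cosB cos_pihalf sin_pihalf /phase; field.
Qed.

Lemma tspan_sub b phi psi : tspan b phi -> tspan b psi -> tspan b (fun c x y => phi c x y - psi c x y).
Proof.
move=> h1 h2.
by apply: tspan_ext (tspan_add h1 (tspan_scale (- 1) h2)) _ => c x y; rewrite mulN1r.
Qed.

Lemma tspan_bern_phase b A n phi k : (forall j, tspan b (phi j)) ->
  tspan b (fun c x y => bern n (phase A c x) (fun j => phi j c x y) k).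
Proof.
move=> h; elim: n k => [|n IH] k /=; first exact: tspan_ext (h k) _.
apply: tspan_ext (tspan_add (tspan_phase A (IH k.+1)) (tspan_sub (IH k) (tspan_phase A (IH k)))) _.
by move=> c x y; ring.
Qed.

Lemma tspan_bern_exp b n phi k : (forall j, tspan b (phi j)) ->
  tspan b (fun c x y => bern n (expR (- y)) (fun j => phi j c x y) k).
Proof.
move=> h; elim: n k => [|n IH] k /=; first exact: tspan_ext (h k) _.
apply: tspan_ext (tspan_add (tspan_exp b (IH k.+1)) (tspan_sub (IH k) (tspan_exp b (IH k)))) _.
by move=> c x y; ring.
Qed.

(* Without its node of index 0, a Bernstein polynomial in [expR (- y)] is divisible by [expR (- y)]. *)
Lemma tspan_bern_exp0 n phi : (forall j, tspan false (phi j)) -> (forall c x y, phi 0 c x y = 0) ->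
  tspan true (fun c x y => bern n (expR (- y)) (fun j => phi j c x y) 0).
Proof.
move=> h h0; elim: n => [|n IH] /=; first by apply: tspan_ext (tspan0 true) _.
apply: tspan_ext (tspan_add (tspan_exp true (tspan_bern_exp n 1 h)) (tspan_sub IH (tspan_exp true IH))) _.
by move=> c x y; ring.
Qed.

Lemma phase_itv A c x : 0 <= phase A c x <= 1.
Proof. by rewrite /phase; have := sin_le1 ((x - c) / A); have := sin_geN1 ((x - c) / A); lra. Qed.

End TrigSpan.

Section Gaps.
Context {R : realType}.
Implicit Types al be del : R.

(** Sum to product, with [d'] the half difference and [m] the half sum: [|m| + d' <= pi / 2] gives
    [cos m >= sin d' >= sin (del / 2)]. It makes the injectivity of the phase quantitative. *)
Lemma sin_gap al be del : - (pi / 2) <= al <= pi / 2 -> - (pi / 2) <= be <= pi / 2 -> 0 < del <= `|al - be| ->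
  2 * sin (del / 2) ^+ 2 <= `|sin al - sin be|.
Proof.
wlog ab : al be / be <= al => [H ha hb hd|].
  case: (leP be al) => ab; first exact: H.
  by rewrite distrC; apply: H => //; [exact: ltW|rewrite distrC].
move=> /andP[a1 a2] /andP[b1 b2] /andP[d0]; rewrite ger0_norm ?subr_ge0// => dab.
pose d' := (al - be) / 2; pose m := (al + be) / 2.
have -> : sin al - sin be = 2 * cos m * sin d'.
  have -> : al = m + d' by rewrite /m /d'; field.
  have -> : be = m - d' by rewrite /m /d'; field.
  rewrite sinB sinD.
  by ring.
have p0 := @pi_gt0 R.
have h1 : del / 2 <= d' by rewrite /d'; lra.
have h2 : d' <= pi / 2 by rewrite /d'; lra.
have s1 : sin (del / 2) <= sin d'.
  by rewrite leNgt ltr_sin ?in_itv/= -?leNgt//; lra.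
have s0 : 0 <= sin (del / 2) by apply: sin_ge0_pi; lra.
have s2 : sin d' <= cos m.
  have -> : cos m = cos `|m| by have [m0|m0] := leP 0 m; [rewrite ger0_norm|rewrite ltr0_norm// cosN].
  have -> : sin d' = cos (pi / 2 - d') by rewrite cosB cos_pihalf sin_pihalf; ring.
  have hm : `|m| <= pi / 2 - d' by rewrite ler_norml /m /d'; lra.
  have m0 := normr_ge0 m.
  by rewrite leNgt ltr_cos ?in_itv/= -?leNgt//; lra.
have sd0 : 0 <= sin d' by exact: le_trans s1.
apply: le_trans (ler_norm _); rewrite -mulrA; apply: ler_wpM2l => //; rewrite expr2.
by apply: ler_pM => //; exact: le_trans s2.
Qed.

Lemma expR_gap M y1 y2 del : 0 <= del -> y1 <= M -> del <= y2 - y1 -> expR (- M) * (1 - expR (- del)) <= expR (- y1) - expR (- y2).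
Proof.
move=> d0 yM d.
have -> : expR (- y1) - expR (- y2) = expR (- y1) * (1 - expR (- (y2 - y1))).
  by rewrite mulrBr mulr1 -expRD; congr (_ - expR _); ring.
apply: ler_pM; rewrite ?expR_ge0 ?subr_ge0//.
- by rewrite -[X in _ <= X]expR0 ler_expR oppr_le0.
- by rewrite ler_expR lerN2.
- by rewrite lerD2l lerN2 ler_expR lerN2.
Qed.

Lemma powR_le_expR (lam c C eps : R) : 0 < lam -> 0 < c -> 0 < C -> 0 < eps -> exists2 M : R, 0 < M &
  forall y, M <= y -> C * (1 + y `^ c) <= eps * expR (lam * y).
Proof.
move=> lam0 c0 C0 eps0.
have [k ck] : exists k : nat, c <= k%:R by exists (Num.truncn c).+1; apply: ltW; exact: truncnS_gt.
pose m := Num.min 1 (lam / k.+1%:R).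
have m0 : 0 < m by rewrite /m lt_min ltr01/= divr_gt0.
have mk0 : 0 < m ^+ k.+1 by rewrite exprn_gt0.
exists (2 * C / (eps * m ^+ k.+1)); first by apply: divr_gt0; apply: mulr_gt0.
have emk0 : 0 < eps * m ^+ k.+1 by exact: mulr_gt0.
move=> y; rewrite (ler_pdivrMr _ _ emk0) => hy.
have y0 : 0 <= y.
  rewrite leNgt; apply/negP => yn.
  have : y * (eps * m ^+ k.+1) < 0 by rewrite pmulr_llt0.
  by move: hy; lra.
have z0 : 0 <= 1 + y by lra.
have z1 : 1 <= 1 + y by lra.
have zk : 1 <= (1 + y) ^+ k by exact: exprn_ege1.
have h1 : y `^ c <= (1 + y) ^+ k.
  apply: (@le_trans _ _ ((1 + y) `^ c)).
    by apply: ge0_ler_powR; rewrite ?nnegrE//; [exact: ltW|lra].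
  by rewrite -powR_mulrn//; exact: ler_powR.
have h2 : m ^+ k.+1 * (1 + y) ^+ k.+1 <= expR (lam * y).
  rewrite -exprMn (_ : lam * y = k.+1%:R * (lam * y / k.+1%:R)); last by rewrite [RHS]mulrC divfK// pnatr_eq0.
  rewrite expRM_natl; apply: lerXn2r; rewrite ?nnegrE ?expR_ge0//; first by rewrite mulr_ge0// ltW.
  apply: le_trans (expR_ge1Dx _); rewrite mulrDr mulr1; apply: lerD; first by rewrite ge_min lexx.
  by rewrite mulrAC; apply: ler_wpM2r => //; rewrite ge_min lexx orbT.
have h3 : C * (1 + y `^ c) <= 2 * C * (1 + y) ^+ k.
  by have := ler_wpM2l (ltW C0) (lerD zk h1); lra.
apply: (le_trans h3); apply: le_trans (ler_wpM2l (ltW eps0) h2).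
set mk := m ^+ k.+1 in mk0 emk0 hy h2 *; clearbody mk.
rewrite exprS; set Z := (1 + y) ^+ k in zk *; clearbody Z.
have -> : eps * (mk * ((1 + y) * Z)) = y * (eps * mk) * Z + eps * mk * Z by ring.
have := ler_wpM2r (le_trans ler01 zk) hy.
have : 0 <= eps * mk * Z by apply: mulr_ge0; [exact: ltW|exact: le_trans zk].
lra.
Qed.

End Gaps.

Section BernsteinApproximation.
Context {R : realType}.

Lemma bump_ge_half (w : R) : 1 <= `|w| -> 2^-1 <= bump w.
Proof.
move=> w1; have : 1 <= w ^+ 2 by rewrite -(real_normK (num_real w)); exact: exprn_ege1.
move=> w2; rewrite /bump ler_pdivlMr ?ltr_pwDl ?sqr_ge0//; lra.
Qed.

Lemma clamp_lip (a y z : R) :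
  `|Num.max 0 (Num.min 1 (a - y)) - Num.max 0 (Num.min 1 (a - z))| <= `|y - z|.
Proof.
have := ler_norm (y - z); have := ler_norm (z - y); rewrite [`|z - y|]distrC; move: `|y - z| => n n1 n2.
have b (w : R) : 0 <= Num.max 0 (Num.min 1 w) <= 1 by rewrite le_max lexx/= ge_max ler01 ge_min lexx.
have m (w : R) : Num.max 0 (Num.min 1 w) = w \/ w <= 0 /\ Num.max 0 (Num.min 1 w) = 0 \/ 1 <= w /\ Num.max 0 (Num.min 1 w) = 1.
  have [w1|w1] := leP 1 w; first by right; right; split=> //; apply/max_idPr.
  by have [w0|w0] := leP w 0; [right; left|left].
move: (b (a - y)) (b (a - z)) (m (a - y)) (m (a - z)); clear b m.
move: (Num.max _ _) (Num.max _ _) => u v /andP[b1 b1'] /andP[b2 b2'] m1 m2.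
by rewrite ler_norml; case: m1 => [e1|[[f1 e1]|[f1 e1]]]; case: m2 => [e2|[[f2 e2]|[f2 e2]]]; lra.
Qed.

Lemma sqr_dist_ge (K m n z u : R) : 0 <= K -> 0 < m -> 0 < n -> m <= `|z / n - u| ->
  2 * K <= 2 * K / (n ^+ 2 * m ^+ 2) * (z - n * u) ^+ 2.
Proof.
move=> K0 m0 n0 hm.
have -> : 2 * K / (n ^+ 2 * m ^+ 2) * (z - n * u) ^+ 2 = 2 * K * ((z / n - u) ^+ 2 / m ^+ 2).
  by field; rewrite !gt_eqF.
rewrite ler_peMr//; first by rewrite mulr_ge0.
rewrite ler_pdivlMr ?exprn_gt0// mul1r -(real_normK (num_real (z / n - u))).
by rewrite lerXn2r ?nnegrE// ltW.
Qed.

(** Bernstein polynomials in the coordinates [phase] and [expR (- y)]. The latter compactifies the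
    half-line of [y], and the point at infinity is harmless because [g] vanishes for large [y]. The
    phase is injective only on an interval around [c]; outside it the crude bound [2 K] is paid by
    [4 K bump]. *)
Lemma bernstein_approx (g : R * R -> R) (K M eps A : R) : 0 < eps -> 1 <= A -> 0 <= K ->
  (forall x y, 0 <= y -> `|g (x, y)| <= K) -> (forall x y, M <= y -> g (x, y) = 0) ->
  (forall e, 0 < e -> exists2 d, 0 < d & forall x x' y y', 0 <= y -> 0 <= y' ->
     `|x - x'| < d -> `|y - y'| < d -> `|g (x, y) - g (x', y')| <= e) ->
  exists2 phi, tspan true phi & forall c x y, 0 <= y ->
    `|phi c x y - g (x, y)| <= eps + 4 * K * bump ((x - c) / A).
Proof.
move=> eps0 A1 K0 gK gM guc.
have A0 : 0 < A by exact: lt_le_trans A1.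
have e20 : 0 < eps / 2 by rewrite divr_gt0.
have [d d0 hd] := guc _ e20.
pose del := Num.min (d / A) 1.
have del0 : 0 < del by rewrite /del lt_min ltr01 andbT divr_gt0.
have delA : A * del <= d by rewrite mulrC -ler_pdivlMr// /del ge_min lexx.
(* [m1] and [m2] are gaps in the two coordinates: values of [phase], respectively of [expR (- y)],
   closer than these come from points closer than [d], or from heights where [g] vanishes. *)
pose m1 := sin (del / 2) ^+ 2.
have m10 : 0 < m1.
  rewrite /m1 exprn_gt0// sin_gt0_pihalf//; have := @pihalf_ge1 R.
  have : del <= 1 by rewrite /del ge_min lexx orbT.
  move: del0; goal_lra.
pose m2 := expR (- M) * (1 - expR (- d)).
have m20 : 0 < m2 by rewrite /m2 mulr_gt0 ?expR_gt0// subr_gt0 -[X in _ < X]expR0 ltr_expR oppr_lt0.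
have m2M : m2 <= expR (- M) by rewrite /m2 ler_piMr ?expR_ge0// lerBlDr lerDl expR_ge0.
pose Q := K / m1 ^+ 2 + K / m2 ^+ 2.
have Q0 : 0 <= Q by rewrite /Q addr_ge0// divr_ge0// exprn_ge0// ltW.
have [n [n0 hn]] : exists n : nat, (0 < n)%N /\ Q <= eps * n%:R.
  exists (Num.truncn (Q / eps)).+1; split=> //.
  by rewrite mulrC -ler_pdivrMr// ltW// truncnS_gt.
have nR0 : 0 < n%:R :> R by rewrite ltr0n.
(* Nodes obtained by inverting the two coordinates. The index [l = 0] stands for infinite [y] and
   gets the value 0, as [tspan_bern_exp0] requires. *)
pose al j : R := asin (2 * (j%:R / n%:R) - 1).
pose yl l : R := Num.max 0 (- ln (l%:R / n%:R)).
have yl0 l : 0 <= yl l by rewrite /yl le_max lexx.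
pose F c j l : R := if l == 0%N then 0 else g (c + A * al j, yl l).
have FK c j l : `|F c j l| <= K by rewrite /F; case: ifP => _; rewrite ?normr0// gK.
exists (fun c x y => bern n (phase A c x) (fun j => bern n (expR (- y)) (F c j) 0) 0).
  apply: (tspan_bern_phase A n 0 (phi := fun j c x y => bern n (expR (- y)) (F c j) 0)) => j.
  apply: (tspan_bern_exp0 n (phi := fun l c _ _ => F c j l)) => [l|c x y].
    exact: (@tspan_cst R (fun c => F c j l) K).
  by rewrite /F eqxx.
move=> c x y y0.
set s := phase A c x; set t := expR (- y).
have s01 : 0 <= s <= 1 by exact: phase_itv.
have t01 : 0 <= t <= 1 by rewrite expR_ge0/= -[X in _ <= X]expR0 ler_expR oppr_le0.
have /andP[bu0 _] := bump_itv ((x - c) / A).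
have Fv j l : `|F c j l - g (x, y)| <= 2 * K.
  by rewrite (le_trans (ler_normB _ _))//; have := FK c j l; have := gK x y y0; goal_lra.
have [big|small] := ltP (pi / 2) `|(x - c) / A|.
  have := @bern2_dist R n s t (F c) (g (x, y)) (2 * K) 0 0 s01 t01.
  rewrite !mul0r !addr0 => /(_ _)/le_trans; apply.
    by move=> j l _ _; rewrite !mul0r !addr0.
  have := @bump_ge_half ((x - c) / A) (le_trans (@pihalf_ge1 R) (ltW big)).
  move/(ler_wpM2l (mulr_ge0 (ler0n R 4) K0)); move: eps0; goal_lra.
pose a := 2 * K / (n%:R ^+ 2 * m1 ^+ 2); pose b := 2 * K / (n%:R ^+ 2 * m2 ^+ 2).
have n20 : 0 < n%:R ^+ 2 :> R by rewrite exprn_gt0.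
have a0 : 0 <= a by apply: divr_ge0; [exact: mulr_ge0|apply: mulr_ge0; exact: sqr_ge0].
have b0 : 0 <= b by apply: divr_ge0; [exact: mulr_ge0|apply: mulr_ge0; exact: sqr_ge0].
apply: (@le_trans _ _ (eps / 2 + a * (n%:R * (s * (1 - s))) + b * (n%:R * (t * (1 - t))))).
  apply: bern2_dist => // j l jn len.
  have aq : 0 <= a * (j%:R - n%:R * s) ^+ 2 by apply: mulr_ge0 => //; exact: sqr_ge0.
  have bq : 0 <= b * (l%:R - n%:R * t) ^+ 2 by apply: mulr_ge0 => //; exact: sqr_ge0.
  have [j1|j1] := leP m1 `|j%:R / n%:R - s|.
    by have := sqr_dist_ge K0 m10 nR0 j1; have := Fv j l; rewrite -/a; move: bq eps0; goal_lra.
  have [l1|l1] := leP m2 `|l%:R / n%:R - t|.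
    by have := sqr_dist_ge K0 m20 nR0 l1; have := Fv j l; rewrite -/b; move: aq eps0; goal_lra.
  suff : `|F c j l - g (x, y)| <= eps / 2 by move: bq aq; goal_lra.
  have jn1 : -1 <= 2 * (j%:R / n%:R : R) - 1 <= 1.
    have : 0 <= j%:R / n%:R :> R by rewrite divr_ge0.
    have : j%:R / n%:R <= 1 :> R by rewrite ler_pdivrMr// mul1r ler_nat.
    goal_lra.
  have sal : sin (al j) = 2 * (j%:R / n%:R) - 1 by apply: asinK; rewrite in_itv.
  have alj : - (pi / 2) <= al j <= pi / 2 by rewrite asin_geNpi2// asin_lepi2.
  have dx : `|al j - (x - c) / A| < del.
    rewrite ltNge; apply/negP => dx.
    have := @sin_gap R (al j) ((x - c) / A) del alj; rewrite -ler_norml => /(_ small).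
    rewrite del0 dx => /(_ isT); rewrite sal -/m1.
    have -> : 2 * (j%:R / n%:R) - 1 - sin ((x - c) / A) = 2 * (j%:R / n%:R - s).
      by rewrite /s /phase; field; rewrite gt_eqF.
    by rewrite normrM ger0_norm// ler_pM2l// leNgt j1.
  have dx' : `|c + A * al j - x| < d.
    apply: lt_le_trans delA; have -> : c + A * al j - x = A * (al j - (x - c) / A).
      by field; rewrite gt_eqF.
    by rewrite normrM (gtr0_norm A0) ltr_pM2l.
  rewrite /F; case: eqP => l0.
    rewrite l0 mul0r sub0r normrN ger0_norm ?expR_ge0// in l1.
    have yM : M <= y by have := lt_le_trans l1 m2M; rewrite ltr_expR; goal_lra.
    by rewrite gM// subrr normr0 ltW.
  have lpos : 0 < l%:R / n%:R :> R by rewrite divr_gt0// ltr0n lt0n; apply/eqP.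
  have ylE : yl l = - ln (l%:R / n%:R).
    by rewrite /yl; apply/max_idPr; rewrite oppr_ge0 ln_le0// ler_pdivrMr// mul1r ler_nat.
  have eyl : expR (- yl l) = l%:R / n%:R by rewrite ylE opprK lnK// posrE.
  rewrite -eyl in l1.
  have [dy|dy] := ltP `|yl l - y| d; first exact: hd.
  have [y1|y1] := leP M (yl l); have [y2|y2] := leP M y.
  - by rewrite (gM _ _ y1) (gM _ _ y2) subrr normr0 ltW.
  - have yy : y <= yl l by rewrite (le_trans (ltW y2)).
    rewrite ger0_norm ?subr_ge0// in dy.
    have := expR_gap (ltW d0) (ltW y2) dy; rewrite -/m2 -/t => h.
    by rewrite distrC in l1; have := le_lt_trans (le_trans h (ler_norm _)) l1; rewrite ltxx.
  - have yy : yl l <= y by rewrite (le_trans (ltW y1)).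
    rewrite distrC ger0_norm ?subr_ge0// in dy.
    have := expR_gap (ltW d0) (ltW y1) dy; rewrite -/m2 -/t => h.
    by have := le_lt_trans (le_trans h (ler_norm _)) l1; rewrite ltxx.
  - have [yy|yy] := leP y (yl l).
    + rewrite ger0_norm ?subr_ge0// in dy.
      have := expR_gap (ltW d0) (ltW y2) dy; rewrite -/m2 -/t => h.
      by rewrite distrC in l1; have := le_lt_trans (le_trans h (ler_norm _)) l1; rewrite ltxx.
    + rewrite distrC ger0_norm ?subr_ge0 ?(ltW yy)// in dy.
      have := expR_gap (ltW d0) (ltW y1) dy; rewrite -/m2 -/t => h.
      by have := le_lt_trans (le_trans h (ler_norm _)) l1; rewrite ltxx.
have quart (z : R) : z * (1 - z) <= 1 / 4 by have := sqr_ge0 (z - 1 / 2); rewrite expr2; goal_lra.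
have h1 : a * (n%:R * (s * (1 - s))) <= K / m1 ^+ 2 / n%:R / 2.
  have -> : K / m1 ^+ 2 / n%:R / 2 = a * (n%:R * (1 / 4)) by rewrite /a; field; rewrite !gt_eqF.
  by apply: ler_wpM2l => //; apply: ler_wpM2l => //; exact: ltW.
have h2 : b * (n%:R * (t * (1 - t))) <= K / m2 ^+ 2 / n%:R / 2.
  have -> : K / m2 ^+ 2 / n%:R / 2 = b * (n%:R * (1 / 4)) by rewrite /b; field; rewrite !gt_eqF.
  by apply: ler_wpM2l => //; apply: ler_wpM2l => //; exact: ltW.
have h3 : K / m1 ^+ 2 / n%:R + K / m2 ^+ 2 / n%:R <= eps by rewrite -mulrDl ler_pdivrMr.
have : 0 <= 4 * K * bump ((x - c) / A) by rewrite mulr_ge0// mulr_ge0.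
move: h3 h2 h1; goal_lra.
Qed.

(** Above [M] the growth of [f] is below [eps * expR (lam * y)], so [f] can be cut off there by
    [chi] at that cost. The constant [K] precedes [A]: the width can then be enlarged until the tail
    term is negligible. *)
Lemma payoff_approx (f : R * R -> R) (lam eps : R) : C_inf0_pol f ->
  (forall M : R, 0 < M -> unif_continuous_on f [set p : R * R | 0 <= p.2 <= M]) -> 0 < lam -> 0 < eps ->
  exists2 K, 0 <= K & forall A, 1 <= A -> exists2 phi, tspan true phi & forall c x y, 0 <= y ->
    `|phi c x y - f (x, y)| <= eps + K * bump ((x - c) / A) + eps * expR (lam * y).
Proof.
move=> [_ [C [_ [c [C0 _ c0 _ fC]]]]] fuc lam0 eps0.
have {}fC x y : 0 <= y -> `|f (x, y)| <= C * (1 + y `^ c).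
  move=> y0; have := fC y y0; rewrite -lee_fin; apply: le_trans.
  by apply: ereal_sup_ubound; exists x.
have [M M0 hM] := powR_le_expR lam0 c0 C0 eps0.
pose K := C * (1 + (M + 1) `^ c).
have K0 : 0 <= K by rewrite /K mulr_ge0 ?addr_ge0 ?powR_ge0// ltW.
have fK x y : 0 <= y -> y <= M + 1 -> `|f (x, y)| <= K.
  move=> y0 yM; rewrite (le_trans (fC x y y0))//; apply: ler_wpM2l; first exact: ltW.
  by rewrite lerD2l; apply: ge0_ler_powR; rewrite ?nnegrE// ?ltW//; lra.
pose chi (y : R) := Num.max 0 (Num.min 1 (M + 1 - y)).
have chi01 y : 0 <= chi y <= 1 by rewrite /chi le_max lexx/= ge_max ler01 ge_min lexx.
have chi1 y : y <= M -> chi y = 1.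
  move=> yM; rewrite /chi (min_idPl _); last by lra.
  by apply/max_idPr.
have chi0 y : M + 1 <= y -> chi y = 0.
  by move=> yM; rewrite /chi; apply/max_idPl; rewrite ge_min; apply/orP; right; lra.
have chi_lip y y' : `|chi y - chi y'| <= `|y - y'| by exact: clamp_lip.
pose g (p : R * R) := f p * chi p.2.
have gK x y : 0 <= y -> `|g (x, y)| <= K.
  move=> y0; have /andP[p1 p2] := chi01 y; rewrite /g /= normrM (ger0_norm p1).
  have [yM|yM] := leP y (M + 1); last by rewrite chi0 ?mulr0// ltW.
  by rewrite -[K]mulr1; apply: ler_pM => //; exact: fK.
have gM x y : M + 1 <= y -> g (x, y) = 0 by move=> yM; rewrite /g /= chi0// mulr0.
have fg x y : 0 <= y -> `|g (x, y) - f (x, y)| <= eps * expR (lam * y).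
  move=> y0; have /andP[p1 p2] := chi01 y.
  have E0 : 0 <= eps * expR (lam * y) by rewrite mulr_ge0 ?expR_ge0// ltW.
  rewrite /g /=; have [yM|yM] := leP y M; first by rewrite chi1// mulr1 subrr normr0.
  have -> : f (x, y) * chi y - f (x, y) = - (f (x, y) * (1 - chi y)) by ring.
  have p1' : 0 <= 1 - chi y by rewrite subr_ge0.
  rewrite normrN normrM (ger0_norm p1').
  apply: (@le_trans _ _ `|f (x, y)|); first by rewrite ler_piMr// lerBlDr lerDl.
  exact: le_trans (fC x y y0) (hM y (ltW yM)).
have guc e : 0 < e -> exists2 d, 0 < d & forall x x' y y', 0 <= y -> 0 <= y' ->
     `|x - x'| < d -> `|y - y'| < d -> `|g (x, y) - g (x', y')| <= e.
  move=> e0; have M1 : 0 < M + 1 by lra.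
  have e2 : 0 < e / 2 by move: e0; goal_lra.
  have [d1 d10 hd1] := fuc _ M1 _ e2.
  have [d2 d20 hd2] := small_factor K0 e2.
  exists (Num.min d1 d2); first by rewrite lt_min d10.
  move=> x x' y y' y0 y'0; rewrite !lt_min => /andP[x1 _] /andP[y1 y2].
  have kd : K * `|y - y'| <= e / 2 by rewrite (le_trans _ hd2)// ler_wpM2l// ltW.
  (* Meant for [z'] above [M + 1], where [chi] vanishes: the value of [g] at [z] is then at most [K]
     times the variation of [chi]. *)
  have cd z z' : z <= M + 1 -> `|z - z'| = `|y - y'| -> 0 <= z -> forall v, `|g (v, z)| <= K * `|chi z - chi z'| + `|K * chi z'|.
    move=> zM _ z0 v; rewrite /g /= normrM.
    have h1 : `|f (v, z)| * `|chi z| <= K * `|chi z| by rewrite ler_wpM2r// fK.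
    rewrite (le_trans h1)// normrM (ger0_norm K0) -mulrDr ler_wpM2l//.
    by rewrite -lerBlDr (le_trans (lerB_dist _ _)).
  have [yM|yM] := leP y (M + 1); have [y'M|y'M] := leP y' (M + 1).
  - have /andP[p1 p2] := chi01 y.
    rewrite /g /= (_ : _ - _ = (f (x, y) - f (x', y')) * chi y + f (x', y') * (chi y - chi y')); last by ring.
    rewrite (le_trans (ler_normD _ _))// !normrM (ger0_norm p1).
    have w1 : `|f (x, y) - f (x', y')| <= e / 2.
      by apply: ltW; apply: hd1 => //=; rewrite ?y0 ?y'0.
    have w2 : `|f (x, y) - f (x', y')| * chi y <= e / 2 by rewrite (le_trans _ w1)// ler_piMr.
    have w3 : `|f (x', y')| * `|chi y - chi y'| <= K * `|y - y'| by apply: ler_pM => //; exact: fK.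
    move: w3 w2 kd; goal_lra.
  - have y'M' := ltW y'M; rewrite [g (x', y')](gM _ _ y'M') subr0; have := cd y y' yM erefl y0 x.
    rewrite (chi0 _ y'M') mulr0 normr0 addr0 => /le_trans; apply.
    by have := ler_wpM2l K0 (chi_lip y y'); rewrite (chi0 _ y'M'); move: kd e0; goal_lra.
  - have yM' := ltW yM; rewrite [g (x, y)](gM _ _ yM') sub0r normrN; have := cd y' y y'M (distrC _ _) y'0 x'.
    rewrite (chi0 _ yM') mulr0 normr0 addr0 => /le_trans; apply.
    have := ler_wpM2l K0 (chi_lip y' y); rewrite (chi0 _ yM') [`|y' - y|]distrC; move: kd e0; goal_lra.
  - by rewrite (gM _ _ (ltW yM)) (gM _ _ (ltW y'M)) subrr normr0 ltW.
exists (4 * K); first by rewrite mulr_ge0.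
move=> A A1; have [phi phiS hphi] := bernstein_approx eps0 A1 K0 gK gM guc.
exists phi => // c' x y y0.
have -> : phi c' x y - f (x, y) = (phi c' x y - g (x, y)) + (g (x, y) - f (x, y)) by ring.
by rewrite (le_trans (ler_normD _ _))// lerD// ?fg// hphi.
Qed.

End BernsteinApproximation.

Lemma continuous_bump {R : realType} : continuous (@bump R).
Proof.
move=> w; apply: cvgM; first exact: exprn_continuous.
apply: cvgV; first by rewrite gt_eqF// ltr_pwDl// sqr_ge0.
by apply: cvgD; [exact: cvg_cst|exact: exprn_continuous].
Qed.

Section RealExpectation.
Context {R : realType} {d : measure_display} {Omega : measurableType d} (P : probability Omega R).

Lemma bounded_integrable (f : Omega -> R) K : measurable_fun setT f -> (forall w, `|f w| <= K) ->
  P.-integrable setT (EFin \o f).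
Proof.
move=> mf fK; apply: measurable_bounded_integrable => //.
  by rewrite (le_lt_trans (probability_le1 P measurableT))// ltry.
by exists K; split; [exact: num_real|move=> M /ltW rM s _; exact: le_trans rM].
Qed.

Lemma EFin_Rintegral (f : Omega -> R) : P.-integrable setT (EFin \o f) ->
  (\int[P]_w (f w)%:E)%E = (\int[P]_w f w)%:E.
Proof. by move=> fi; rewrite /Rintegral fineK//; exact: integrable_fin_num. Qed.

Lemma Rintegral_prob_cst r : \int[P]_w (cst r w) = r.
Proof. by rewrite Rintegral_cst//= probability_setT/= mulr1. Qed.

End RealExpectation.

(** * Expectations of the approximants *)

Section ExpectationSide.
Context {R : realType} {d : measure_display} {Omega : measurableType d}.
Variables (P : probability Omega R) (mdl : heston R) (F : R -> set (set Omega)).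
Variables (W B : R -> Omega -> R) (T y : R) (Xp : R -> R -> Omega -> R) (Yp : R -> Omega -> R).
Hypotheses (hm : heston_admissible mdl) (hF : is_filtration F) (hWB : brownian2 P F W B) (T0 : 0 < T) (y0 : 0 <= y).
Hypothesis hsol : forall x, heston_solution P mdl F W B T 0 x y (Xp x) Yp.
Let XT x w := Xp x T w.
Let YT w := Yp T w.

Let mX x : measurable_fun setT (XT x).
Proof. by apply: (measurable_sol_X hF (hsol x)); rewrite lexx ltW. Qed.

Let mY : measurable_fun setT YT.
Proof. by apply: (measurable_sol_Y hF (hsol 0)); rewrite lexx ltW. Qed.

Let Y0 w : 0 <= YT w.
Proof. by have [_ _ h _] := hsol 0; apply: h; rewrite lexx ltW. Qed.

Let tr u v th x w : R := expR (- (v * YT w)) * cos (u * XT x w + th).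

Let mexp v : measurable_fun setT (fun w => expR (- (v * YT w)) : R).
Proof.
by apply: (measurableT_comp (@measurable_expR R)); apply: measurableT_comp => //; exact: measurable_funM.
Qed.

Let mcos (Z : Omega -> R) : measurable_fun setT Z -> measurable_fun setT (fun w => cos (Z w) : R).
Proof. by move=> mZ; apply: measurableT_comp => //; apply: continuous_measurable_fun; exact: continuous_cos. Qed.

Let exp_le1 v w : 0 <= v -> 0 <= expR (- (v * YT w)) <= 1.
Proof. by move=> v0; rewrite expR_ge0 -[X in _ <= X]expR0 ler_expR oppr_le0 mulr_ge0. Qed.

Lemma measurable_tr u v th x : measurable_fun setT (tr u v th x).
Proof.
apply: measurable_funM; first exact: mexp.
by apply: mcos; apply: measurable_funD => //; exact: measurable_funM.
Qed.

Lemma norm_tr_le u v th x w : 0 <= v -> `|tr u v th x w| <= 1.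
Proof.
move=> v0; have /andP[e0 e1] := exp_le1 w v0.
by rewrite /tr normrM (ger0_norm e0) -[1]mulr1; apply: ler_pM => //; exact: cos_max.
Qed.

Lemma integrable_tr u v th x : 0 <= v -> P.-integrable setT (EFin \o tr u v th x).
Proof.
by move=> v0; apply: (@bounded_integrable _ _ _ P _ 1); [exact: measurable_tr|move=> w; exact: norm_tr_le].
Qed.

(** Uniform in [th] but not yet in [x]: the threshold of [affine_limit] depends on the processes
    started at [x]. *)
Let transform1 u v x eps : 0 < v -> 0 < eps -> exists m1 : nat, forall m, (m1 <= m)%N -> (0 < m)%N -> forall th,
  `|(\int[P]_w tr u v th x w) - wave0 mdl y (T / m%:R) u v th m x| <= eps.
Proof.
move=> v0 eps0.
have [Cp [c [h0 [c0 h00 ric]]]] := riccati_bounds hm u T0 v0.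
have Cp0 : 0 <= Num.max Cp 0 by rewrite le_max lexx orbT.
have [m1 hm1] := affine_limit hF hWB T0 y0 (hsol x) u 0 Cp0 eps0.
have [m2 hm2] : exists m2 : nat, forall m, (m2 <= m)%N -> (0 < m)%N -> T / m%:R < h0.
  exists (Num.truncn (T / h0)).+1 => m hm' m0; rewrite ltr_pdivrMr ?ltr0n// mulrC -ltr_pdivrMr//.
  by apply: lt_le_trans (truncnS_gt _) _; rewrite ler_nat.
exists (maxn m1 m2) => m; rewrite geq_max => /andP[mm1 mm2] m0 th.
set h := T / m%:R.
have h_gt0 : 0 < h by rewrite divr_gt0// ltr0n.
have hk k : (k <= m)%N -> h * k%:R <= T by move=> km; rewrite /h mulrAC ler_pdivrMr ?ltr0n// ler_pM2l// ler_nat.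
have hh : 0 < h < h0 by rewrite h_gt0 hm2.
have E1 : (\int[P]_w (expR (ric_A mdl h u v th 0 - ric_p mdl h u v th 0 * Yp T w) *
   cos (u * Xp x T w + ric_b mdl h u v th 0 - ric_q mdl h u v th 0 * Yp T w))%:E)%E = (\int[P]_w (tr u v th x w))%:E.
  rewrite -EFin_Rintegral; last exact/integrable_tr/ltW.
  by apply: eq_integral => w _; rewrite /tr /ric_A /ric_p /ric_b /ric_q/= sub0r mul0r subr0.
have := hm1 m mm1 m0 (fun j => ric_p mdl h u v th (m - j)) (fun j => ric_q mdl h u v th (m - j))
  (fun j => ric_A mdl h u v th (m - j)) (fun j => ric_b mdl h u v th (m - j)).
rewrite -lee_fin -abse_EFin EFinB -E1 /= subnn subn0; apply.
- by move=> j jm; rewrite -(subnSK jm); exact: riccati_iterS.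
- move=> j jm; have [/andP[p1 p2] _ _ _] := ric h th (m - j)%N hh (hk _ (leq_subr _ _)).
  by rewrite (le_trans (ltW c0) p1) le_max p2.
- move=> j jm; have [_ q1 _ _] := ric h th (m - j)%N hh (hk _ (leq_subr _ _)).
  by rewrite le_max q1.
- by move=> j jm; have [_ _ /andP[_ A1] _] := ric h th (m - j)%N hh (hk _ (leq_subr _ _)).
Qed.

(** Both sides are limits of the same numbers, by [wave0_shift]. This stands in for the relation
    [X^x = x + X^0], that is, for a uniqueness statement about the equation. *)
Lemma transform_shift u v th x : 0 < v -> \int[P]_w tr u v th x w = \int[P]_w tr u v (u * x + th) 0 w.
Proof.
move=> v0; apply/eqP; rewrite -subr_eq0 -normr_le0; apply/ler_addgt0Pr => e e0; rewrite add0r.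
have e2 : 0 < e / 2 by rewrite divr_gt0.
have [m1 h1] := transform1 u x v0 e2; have [m2 h2] := transform1 u 0 v0 e2.
have k1 := h1 (maxn m1 m2).+1 (leqW (leq_maxl _ _)) (ltn0Sn _) th.
have k2 := h2 (maxn m1 m2).+1 (leqW (leq_maxr _ _)) (ltn0Sn _) (u * x + th).
rewrite wave0_shift in k1.
by move: k1 k2; set w0 := wave0 _ _ _ _ _ _ _ _; rewrite !ler_norml => /andP[k1 k1'] /andP[k2 k2']; lra.
Qed.

Lemma transform_limit u v eps : 0 < v -> 0 < eps -> exists m1 : nat, forall m, (m1 <= m)%N -> (0 < m)%N -> forall th x,
  `|(\int[P]_w tr u v th x w) - wave0 mdl y (T / m%:R) u v th m x| <= eps.
Proof.
move=> v0 eps0; have [m1 h1] := transform1 u 0 v0 eps0.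
by exists m1 => m mm m0 th x; rewrite transform_shift// wave0_shift; exact: h1.
Qed.

Lemma integrable_exp lam : 0 <= lam -> volvol mdl ^+ 2 * lam <= 2 * reversion mdl ->
  P.-integrable setT (EFin \o (fun w => expR (lam * YT w))).
Proof.
move=> lam0 laml; apply/integrableP; split.
  by apply/measurable_EFinP; apply: (measurableT_comp (@measurable_expR R)); exact: measurable_funM.
under eq_integral do rewrite /= ger0_norm ?expR_ge0//.
have [_ a0 b0 _ _] := hm.
apply: (exp_moment hF hWB T0 (hsol 0) (CL := T * (drift0 mdl * lam) + lam * y) lam0).
exists (Num.truncn (T * reversion mdl)).+1 => m mm m0.
set h := T / m%:R.
have h_gt0 : 0 < h by rewrite divr_gt0// ltr0n.
have hb : h * reversion mdl <= 1.
  rewrite /h mulrAC ler_pdivrMr ?ltr0n// mul1r; apply: ltW; apply: lt_le_trans (truncnS_gt _) _.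
  by rewrite ler_nat.
have hk k : (k <= m)%N -> h * k%:R <= T by move=> km; rewrite /h mulrAC ler_pdivrMr ?ltr0n// ler_pM2l// ler_nat.
have neg k : (k <= m)%N -> [/\ - lam <= ric_p mdl h 0 (- lam) 0 k <= 0, ric_q mdl h 0 (- lam) 0 k = 0,
     ric_A mdl h 0 (- lam) 0 k <= h * k%:R * (drift0 mdl * lam) & ric_b mdl h 0 (- lam) 0 k = 0].
  by move=> km; apply: (riccati_neg hm T0 lam0 laml) => //; exact: hk.
exists (fun j => ric_p mdl h 0 (- lam) 0 (m - j)), (fun j => ric_A mdl h 0 (- lam) 0 (m - j)).
split=> [j jm|j jm|||].
- have [_ q1 _ b1] := neg (m - j.+1)%N (leq_subr _ _); have [_ q2 _ b2] := neg (m - j)%N (leq_subr _ _).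
  have := riccati_iterS mdl h 0 (- lam) 0 (m - j.+1); rewrite (subnSK jm).
  by rewrite q1 q2 b1 b2.
- have [p1 _ _ _] := neg (m - j)%N (leq_subr _ _).
  by rewrite ler_norml; lra.
- by rewrite subnn.
- by rewrite subnn.
- rewrite subn0; have [/andP[p1 _] _ A1 _] := neg m (leqnn _).
  rewrite -mulNr; apply: lerD.
    apply: (le_trans A1); apply: ler_wpM2r; last exact: hk.
    by rewrite mulr_ge0// ltW.
  by rewrite ler_wpM2r// lerNl.
Qed.

(** [1 - expR (- v Y) <= v Y <= (v / lam) expR (lam Y)], and the exponential moment is finite. *)
Lemma small_v eps : 0 < eps -> exists2 v : R, 0 < v & \int[P]_w (1 - expR (- (v * YT w))) <= eps.
Proof.
move=> eps0; have [_ a0 b0 s0 _] := hm.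
pose lam := 2 * reversion mdl / volvol mdl ^+ 2.
have s20 : 0 < volvol mdl ^+ 2 by rewrite exprn_gt0.
have lam0 : 0 < lam by rewrite divr_gt0// mulr_gt0.
have il := @integrable_exp lam (ltW lam0).
rewrite {1}/lam mulrC divfK ?gt_eqF// in il; have {}il := il (lexx _).
set I := \int[P]_w expR (lam * YT w) => //.
have I0 : 0 <= I by apply: Rintegral_ge0 => w _; exact: expR_ge0.
have [v v0 hv] := small_factor (divr_ge0 I0 (ltW lam0)) eps0.
exists v => //; apply: (le_trans _ hv).
have -> : I / lam * v = v / lam * I by ring.
rewrite /I -RintegralZl//; apply: le_Rintegral => //.
- apply: (@bounded_integrable _ _ _ P _ 1); first by apply: measurable_funB => //; exact: mexp.
  by move=> w; have /andP[e0 e1] := exp_le1 w (ltW v0); rewrite ler_norml; lra.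
- exact: integrable_EFinZl.
move=> w _; have h1 := expR_ge1Dx (- (v * YT w)); have h2 := expR_ge1Dx (lam * YT w).
have h3 : v * YT w = v / lam * (lam * YT w) by field; rewrite gt_eqF.
have vl : 0 <= v / lam by rewrite divr_ge0// ltW.
have := ler_wpM2l vl (le_trans (_ : lam * YT w <= 1 + lam * YT w) h2).
by rewrite lerDr ler01 => /(_ isT); lra.
Qed.

Let Z x w := XT x w - x.
Let mZ x : measurable_fun setT (Z x).
Proof. by apply: measurable_funB. Qed.

Let G A x w : R := expR (- ((Z x w / A) ^+ 2 / 2)).
Let mG A x : measurable_fun setT (G A x).
Proof.
apply: (measurableT_comp (@measurable_expR R)); apply: measurableT_comp => //.
by apply: measurable_funM => //; apply: measurable_funX; exact: measurable_funM.
Qed.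
Let G01 A x w : 0 <= G A x w <= 1.
Proof. by rewrite expR_ge0 -[X in _ <= X]expR0 ler_expR oppr_le0 divr_ge0// sqr_ge0. Qed.

(* [1 + G] is a Gaussian mixture of functions [1 + cos (q Z)]. *)
Lemma gauss_mixture A v x : 0 < A -> 0 < v ->
  \int[P]_w (expR (- (v * YT w)) * (1 + G A x w)) = \int[P]_w (expR (- (v * YT w)) * (1 + G A 0 w)).
Proof.
move=> A0 v0; have iA0 : 0 < A^-1 by rewrite invr_gt0.
pose gam := normal_prob 0 (A^-1).
pose f x' (p : Omega * measurableTypeR R) : \bar R := (expR (- (v * YT p.1)) * (1 + cos (p.2 * Z x' p.1)))%:E.
have mf x' : measurable_fun setT (f x').
  apply/measurable_EFinP; apply: measurable_funM.
    by apply: (measurableT_comp (mexp v)).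
  apply: measurable_funD => //; apply: measurableT_comp.
    by apply: continuous_measurable_fun; exact: continuous_cos.
  by apply: measurable_funM => //; apply: (measurableT_comp (mZ x')).
have f0 x' p : (0 <= f x' p)%E.
  by rewrite lee_fin mulr_ge0 ?expR_ge0// -lerBlDl sub0r cos_geN1.
have inner x' w : (\int[gam]_q f x' (w, q) = (expR (- (v * YT w)) * (1 + G A x' w))%:E)%E.
  transitivity ((expR (- (v * YT w)))%:E * \int[gam]_q (expR (0 * q) * (1 + cos (Z x' w * q + 0)))%:E)%E.
    rewrite -ge0_integralZl_EFin//.
    - by apply: eq_integral => q _; rewrite /f /= -EFinM mul0r expR0 mul1r addr0 [q * _]mulrC.
    - apply/measurable_EFinP; apply: continuous_measurable_fun => q; apply: cvgM.
        by apply: (continuous_comp (@mulrl_continuous _ 0 q)); exact: continuous_expR.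
      apply: cvgD; first exact: cvg_cst.
      apply: continuous_comp; last exact: continuous_cos.
      by apply: cvgD; [exact: mulrl_continuous|exact: cvg_cst].
  rewrite (ge0_integral_exp_cos iA0) (gauss_cosE iA0) -EFinM; congr (_ * _)%:E.
  rewrite mulr0 mul0r addr0 cos0 mulr1 expr0n/= !mul0r expR0 mul1r /G exprVn exprMn exprVn.
  by congr (1 + expR _); field; rewrite gt_eqF.
have integrable_exp1 : P.-integrable setT (EFin \o (fun w => expR (- (v * YT w)))).
  apply: (@bounded_integrable _ _ _ P _ 1); first exact: mexp.
  by move=> w; have /andP[e0 e1] := exp_le1 w (ltW v0); rewrite ger0_norm.
have outer x' q : (\int[P]_w f x' (w, q) = \int[P]_w f 0%R (w, q))%E.
  have fE x'' : (\int[P]_w f x'' (w, q))%E = (\int[P]_w expR (- (v * YT w)) + \int[P]_w tr q v 0 0 w)%:E.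
    have -> : \int[P]_w tr q v 0 0 w = \int[P]_w tr q v (- (q * x'')) x'' w.
      by rewrite [RHS]transform_shift// subrr.
    have itr := integrable_tr q (- (q * x'')) x'' (ltW v0).
    rewrite -(RintegralD measurableT integrable_exp1 itr).
    rewrite -EFin_Rintegral; last exact: integrable_EFinD.
    apply: eq_integral => w _; rewrite /f /tr /= /Z mulrDr mulr1; congr (_ + _ * cos _)%:E; ring.
  by rewrite !fE.
have key x' : (\int[P]_w (expR (- (v * YT w)) * (1 + G A x' w))%:E)%E = (\int[gam]_q \int[P]_w f x' (w, q))%E.
  rewrite -(@fubini_tonelli _ _ _ _ R P gam (f x') (mf x') (f0 x')).
  by apply: eq_integral => w _; rewrite inner.
by rewrite /Rintegral (key x) (key 0); congr fine; apply: eq_integral => q _; exact: outer.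
Qed.

(** Under the weight [expR (- v Y)] the mean of [1 + G] does not depend on [x], by [gauss_mixture],
    so dominated convergence is needed at [x = 0] only. Removing the weight costs the small mean of
    [1 - expR (- v Y)]. *)
Lemma tail_limit eps A0 : 0 < eps -> exists A : R, [/\ 1 <= A, A0 <= A & forall x, \int[P]_w bump (Z x w / A) <= eps].
Proof.
move=> eps0.
have e4 : 0 < eps / 4 by rewrite divr_gt0.
have [v v0 hv] := small_v e4.
have h1 A x w : 0 <= 1 - G A x w <= 1 by have := G01 A x w; lra.
have m1 A x : measurable_fun setT (fun w => 1 - G A x w) by apply: measurable_funB.
have i1 A x : P.-integrable setT (EFin \o (fun w => 1 - G A x w)).
  apply: (@bounded_integrable _ _ _ P _ 1) => // w.
  by have /andP[e0 e1] := h1 A x w; rewrite ger0_norm.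
have [n nA hn] : exists2 n : nat, A0 <= n.+1%:R & \int[P]_w (1 - G n.+1%:R 0 w) <= eps / 4.
  have mfn n : measurable_fun setT (fun w => (1 - G n.+1%:R 0 w)%:E) by apply/measurable_EFinP.
  have cv : {ae P, forall w, setT w -> (1 - G n.+1%:R 0 w)%:E @[n --> \oo] --> 0%E}.
    apply: aeW => w _; apply: cvg_EFin; first exact: nearW.
    have bnd : \forall n \near \oo, cst 0 n <= 1 - G n.+1%:R 0 w <= (Z 0 w ^+ 2 / 2) * harmonic n.
      apply: nearW => n; have /andP[-> _] := h1 n.+1%:R 0 w; rewrite /=.
      have := expR_ge1Dx (- ((Z 0 w / n.+1%:R) ^+ 2 / 2)); rewrite -/(G _ _ _).
      move=> hG; apply: (@le_trans _ _ ((Z 0 w / n.+1%:R) ^+ 2 / 2)); first by rewrite lerBlDr -lerBlDl.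
      rewrite exprMn mulrAC; apply: ler_wpM2l; first by rewrite divr_ge0 ?sqr_ge0.
      by rewrite expr2 ler_piMr// invf_le1// ler1n.
    apply: (squeeze_cvgr bnd); first exact: cvg_cst.
    rewrite -[X in _ --> X](mulr0 (Z 0 w ^+ 2 / 2)); apply: cvgM; first exact: cvg_cst.
    exact: cvg_harmonic.
  have dom : {ae P, forall w n, setT w -> (`|(1 - G n.+1%:R 0 w)%:E| <= cst 1 w)%E}.
    apply: aeW => w n _; have /andP[e0 e1] := h1 n.+1%:R 0 w.
    by rewrite abse_EFin lee_fin ger0_norm.
  have ig1 : P.-integrable setT (EFin \o cst 1) by exact: finite_measure_integrable_cst.
  have [_ _] := dominated_convergence measurableT mfn (measurable_cst 0%E) cv ig1 dom.
  rewrite integral0 => /fine_cvgP[_ /cvgrPdist_le/(_ _ e4)[n _ /(_ _ (leq_maxl n (Num.truncn A0)))]].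
  rewrite /= sub0r normrN => hn; exists (maxn n (Num.truncn A0)).
    by apply: ltW; apply: lt_le_trans (truncnS_gt _) _; rewrite ler_nat ltnS leq_maxr.
  exact: le_trans (ler_norm _) hn.
exists n.+1%:R; split=> [|//|x]; first by rewrite ler1n.
set A : R := n.+1%:R in nA hn *.
have A_gt0 : 0 < A by rewrite /A ltr0n.
have ie : P.-integrable setT (EFin \o (fun w => expR (- (v * YT w)))).
  apply: (@bounded_integrable _ _ _ P _ 1); first exact: mexp.
  by move=> w; have /andP[e0 e1] := exp_le1 w (ltW v0); rewrite ger0_norm.
have ieG x' : P.-integrable setT (EFin \o (fun w => expR (- (v * YT w)) * (1 + G A x' w))).
  apply: (@bounded_integrable _ _ _ P _ 2).
    by apply: measurable_funM; [exact: mexp|apply: measurable_funD].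
  move=> w; have /andP[e0 e1] := exp_le1 w (ltW v0); have /andP[g0 g1] := G01 A x' w.
  rewrite normrM (ger0_norm e0) ger0_norm ?addr_ge0//.
  rewrite -[2]mul1r; apply: ler_pM => //; first by rewrite addr_ge0.
  by rewrite -[2]/(1 + 1) lerD2l.
have ie' : P.-integrable setT (EFin \o (fun w => 1 - expR (- (v * YT w)))).
  apply: (@bounded_integrable _ _ _ P _ 1); first by apply: measurable_funB => //; exact: mexp.
  by move=> w; have /andP[e0 e1] := exp_le1 w (ltW v0); rewrite ger0_norm ?subr_ge0// gerBl.
have i2e := integrable_EFinZl 2 ie.
have wE x' : \int[P]_w (2 * expR (- (v * YT w)) - expR (- (v * YT w)) * (1 + G A x' w)) =
   2 * \int[P]_w expR (- (v * YT w)) - \int[P]_w (expR (- (v * YT w)) * (1 + G A x' w)).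
  by rewrite RintegralB// RintegralZl.
have ib : P.-integrable setT (EFin \o (fun w => bump (Z x w / A))).
  apply: (@bounded_integrable _ _ _ P _ 1).
    by apply: (measurableT_comp (continuous_measurable_fun continuous_bump)); exact: measurable_funM.
  by move=> w; have /andP[b0 b1] := bump_itv (Z x w / A); rewrite ger0_norm.
have iW x' : P.-integrable setT (EFin \o (fun w => 2 * expR (- (v * YT w)) - expR (- (v * YT w)) * (1 + G A x' w))).
  exact: integrable_EFinB.
have s1 : \int[P]_w bump (Z x w / A) <= \int[P]_w (2 * ((2 * expR (- (v * YT w)) - expR (- (v * YT w)) * (1 + G A x w)) + (1 - expR (- (v * YT w))))).
  apply: le_Rintegral => //.
    by apply: integrable_EFinZl; exact: integrable_EFinD.
  move=> w _; have := bump_le_exp (Z x w / A); rewrite -/(G A x w).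
  have /andP[e0 e1] := exp_le1 w (ltW v0); have /andP[g0 g1] := G01 A x w => /le_trans; apply.
  apply: ler_wpM2l => //; rewrite -subr_ge0.
  (* The weighted expression exceeds [1 - G] by exactly this product of nonnegative factors. *)
  rewrite [leRHS](_ : _ = (1 - expR (- (v * YT w))) * G A x w); last by ring.
  by rewrite mulr_ge0// subr_ge0.
apply: (le_trans s1).
rewrite RintegralZl//; last exact: integrable_EFinD.
rewrite RintegralD// wE gauss_mixture// -wE.
have : \int[P]_w (2 * expR (- (v * YT w)) - expR (- (v * YT w)) * (1 + G A 0 w)) <= \int[P]_w (1 - G A 0 w).
  apply: le_Rintegral => // w _.
  have /andP[e0 e1] := exp_le1 w (ltW v0); have /andP[g0 g1] := G01 A 0 w.
  rewrite [leLHS](_ : _ = expR (- (v * YT w)) * (1 - G A 0 w)); last by ring.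
  by rewrite ler_piMl// subr_ge0.
move=> /le_trans/(_ hn) h2.
rewrite [leRHS](_ : eps = 2 * (eps / 4 + eps / 4)); last by field.
by rewrite ler_pM2l// lerD.
Qed.

End ExpectationSide.

(** * Convergence *)

Section Glue.
Context {R : realType} {d : measure_display} {Omega : measurableType d}.
Variables (P : probability Omega R) (mdl : heston R) (F : R -> set (set Omega)).
Variables (W B : R -> Omega -> R) (T y : R) (Xp : R -> R -> Omega -> R) (Yp : R -> Omega -> R).
Hypotheses (hm : heston_admissible mdl) (hF : is_filtration F) (hWB : brownian2 P F W B) (T0 : 0 < T) (y0 : 0 <= y).
Hypothesis hsol : forall x, heston_solution P mdl F W B T 0 x y (Xp x) Yp.

Lemma tspan_integrable phi x : tspan true phi -> P.-integrable setT (EFin \o (fun w => phi x (Xp x T w) (Yp T w))).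
Proof.
elim=> [u v a th K v0 _ aK|phi1 phi2 _ h1 _ h2].
  by apply: integrable_EFinZl; exact: (integrable_tr hF T0 hsol u (th x) x v0).
exact: integrable_EFinD.
Qed.

(** The amplitude at [x0] is at most [K] for every centre, and the thresholds for a wave do not
    depend on its phase; hence [h0] serves all [X_0] and [i0]. *)
Lemma tspan_supersolution phi eps : tspan true phi -> 0 < eps -> exists2 h0 : R, 0 < h0 &
  forall (N : nat) (dx X_0 : R) (i0 : int), (0 < N)%N -> T / N%:R < h0 -> 0 < dx < h0 ->
  let x0 := X_0 + i0%:~R * dx in
  exists V, [/\ supersolution mdl (T / N%:R) dx y N V,
    forall k i, (k <= N)%N -> phi x0 (X_0 + i%:~R * dx) (node mdl (T / N%:R) y N k) <= V N k i
  & V 0 0 i0 <= (\int[P]_w phi x0 (Xp x0 T w) (Yp T w)) + eps].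
Proof.
move=> hphi; elim: hphi eps => [u v a th K v0 /(_ isT) v1 aK|phi1 phi2 t1 h1 t2 h2] eps eps0; last first.
  have e2 : 0 < eps / 2 by rewrite divr_gt0.
  have [r1 r10 {}h1] := h1 _ e2; have [r2 r20 {}h2] := h2 _ e2.
  exists (Num.min r1 r2); first by rewrite lt_min r10.
  move=> N dx X_0 i0 N0; rewrite !lt_min => /andP[hN1 hN2] /and3P[dx0 dx1 dx2] x0.
  have dx01 : 0 < dx < r1 by rewrite dx0.
  have dx02 : 0 < dx < r2 by rewrite dx0.
  have [V1 [s1 f1 b1]] := h1 N dx X_0 i0 N0 hN1 dx01; have [V2 [s2 f2 b2]] := h2 N dx X_0 i0 N0 hN2 dx02.
  exists (fun n k i => V1 n k i + V2 n k i); split; first exact: supersolutionD.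
    by move=> k i kN; apply: lerD; [exact: f1|exact: f2].
  rewrite RintegralD//; [|exact: tspan_integrable|exact: tspan_integrable].
  by move: b1 b2; rewrite -/x0; lra.
have K0 : 0 <= K by have /andP[a0 aK0] := aK 0; exact: le_trans aK0.
have e2 : 0 < eps / 2 by rewrite divr_gt0.
have [e1 e10 he1] := small_factor K0 e2.
have [m1 hm1] := transform_limit hm hF hWB T0 y0 hsol u v1 e10.
have [K1 [h1 [K10 h10 hw]]] := wave_supersolution hm T0 y0 u v1.
have KK0 : 0 <= K * K1 by exact: mulr_ge0.
have e4 : 0 < eps / 4 by rewrite divr_gt0.
have [r r0 hr] := small_factor KK0 e4.
(* [T / m1.+1%:R] forces [N] beyond the threshold of [transform_limit], and [r ^+ 2] makes the root
   of the time step at most [r]. *)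
exists (Num.min (Num.min h1 (T / m1.+1%:R)) (Num.min (r ^+ 2) (Num.min r 1))).
  by rewrite !lt_min h10 divr_gt0//= exprn_gt0// r0 ltr01.
move=> N dx X_0 i0 N0; rewrite !lt_min => /andP[/andP[hN1 hN2] /and3P[hN3 _ _]] /and3P[dx0 _ /and3P[_ dx2 dx3]] x0.
have mN : (m1 <= N)%N.
  apply: ltnW; move: hN2; rewrite ltr_pM2l// ltf_pV2 ?posrE ?ltr0n// ltr_nat => /ltnW.
  by [].
have dx01 : 0 < dx <= 1 by rewrite dx0 ltW.
have [V [s1 f1 b1]] := hw N dx X_0 (th x0) N0 hN1 dx01.
have /andP[a0 aK0] := aK x0.
exists (fun n k i => a x0 * V n k i); split; first exact: supersolutionZ.
  by move=> k i kN; rewrite f1.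
rewrite RintegralZl//; last exact: (integrable_tr hF T0 hsol u (th x0) x0 v0).
have := hm1 N mN N0 (th x0) x0; rewrite ler_norml => /andP[k1 k2].
have b2 := b1 i0; rewrite -/x0 in b2.
set I := \int[P]_w _ in k1 k2 *; set w0 := wave0 _ _ _ _ _ _ _ _ in k1 k2 b2.
have sr : Num.sqrt (T / N%:R) <= r.
  have rE : Num.sqrt (r ^+ 2) = r by rewrite sqrtr_sqr gtr0_norm.
  by rewrite -[X in _ <= X]rE ler_wsqrtr// ltW.
have t1 : K1 * (Num.sqrt (T / N%:R) + dx) <= K1 * (r + r) by apply: ler_wpM2l => //; apply: lerD => //; exact: ltW.
have t2 : V 0 0 i0 - I <= e1 + K1 * (r + r) by move: k1 k2 b2 t1; goal_lra.
have t3 : 0 <= e1 + K1 * (r + r) by rewrite addr_ge0 ?mulr_ge0 ?addr_ge0// ltW.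
have t4 := le_trans (ler_wpM2l a0 t2) (ler_wpM2r t3 aK0).
rewrite -lerBlDl -mulrBr; apply: (le_trans t4); rewrite mulrDr.
have -> : K * (K1 * (r + r)) = 2 * (K * K1 * r) by ring.
by move: he1 hr; goal_lra.
Qed.

Variable f : R * R -> R.
Hypotheses (hf : C_inf0_pol f)
  (hfu : forall M : R, 0 < M -> unif_continuous_on f [set p : R * R | 0 <= p.2 <= M]).

Let mX x : measurable_fun setT (Xp x T).
Proof. by apply: (measurable_sol_X hF (hsol x)); rewrite lexx ltW. Qed.

Let mY : measurable_fun setT (Yp T).
Proof. by apply: (measurable_sol_Y hF (hsol 0)); rewrite lexx ltW. Qed.

Let Y0 w : 0 <= Yp T w.
Proof. by have [_ _ h _] := hsol 0; apply: h; rewrite lexx ltW. Qed.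

(** Continuity of [f] is known only within the closed half-plane; measurability comes from pointwise
    approximation by families in the span. *)
Lemma measurable_payoff x : measurable_fun setT (fun w => f (Xp x T w, Yp T w)).
Proof.
have app n : exists phi, tspan true phi /\ forall c x y, 0 <= y ->
    `|phi c x y - f (x, y)| <= (1 + (x - c) ^+ 2 + expR y) * harmonic n.
  have e0 : 0 < n.+1%:R^-1 :> R by rewrite invr_gt0 ltr0n.
  have [K K0 hK] := payoff_approx hf hfu ltr01 e0.
  (* With this width [K / A <= 1 / (n + 1)], so the tail term is at most [(x - c)^2 / (n + 1)]. *)
  pose A := 1 + K * n.+1%:R.
  have A1 : 1 <= A by rewrite /A lerDl mulr_ge0.
  have [phi tphi hphi] := hK A A1; exists phi; split=> // c x' y' y'0.
  apply: (le_trans (hphi c x' y' y'0)); rewrite mul1r.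
  have A0 : 0 < A by exact: lt_le_trans A1.
  rewrite (_ : (_ + _ + _) * _ = n.+1%:R^-1 + (x' - c) ^+ 2 * harmonic n + n.+1%:R^-1 * expR y'); last first.
    by rewrite -[harmonic n]/(n.+1%:R^-1); move: (n.+1%:R^-1) (expR y') => ? ?; ring.
  rewrite lerD2r lerD2l.
  apply: (@le_trans _ _ (K * ((x' - c) ^+ 2 / A))).
    apply: ler_wpM2l => //; rewrite /bump ler_pdivrMr ?ltr_pwDl ?sqr_ge0//.
    apply: (@le_trans _ _ ((x' - c) ^+ 2 / A * 1)).
      rewrite mulr1 exprMn expr2 mulrA; apply: ler_piMr; last by rewrite invf_le1.
      by rewrite mulr_ge0 ?invr_ge0// ?sqr_ge0// ltW.
    by apply: ler_wpM2l; [rewrite divr_ge0 ?sqr_ge0// ltW|rewrite lerDl sqr_ge0].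
  rewrite mulrCA; apply: ler_wpM2l; first exact: sqr_ge0.
  by rewrite /harmonic ler_pdivrMr// mulrC ler_pdivlMr ?ltr0n// /A lerDr.
have [phi hphi] := choice app.
apply: (measurable_fun_cvg (h := fun n w => phi n x (Xp x T w) (Yp T w))).
  move=> n; have [t _] := hphi n.
  exact/measurable_EFinP/(measurable_int P)/tspan_integrable.
move=> w _; apply/cvgrPdist_le => e e0.
have c0 : (1 + (Xp x T w - x) ^+ 2 + expR (Yp T w)) * harmonic n @[n --> \oo] --> (0 : R).
  rewrite -[X in _ --> X](mulr0 (1 + (Xp x T w - x) ^+ 2 + expR (Yp T w))).
  by apply: cvgM; [exact: cvg_cst|exact: cvg_harmonic].
have /cvgrPdist_le/(_ e e0)[n0 _ hn0] := c0.
exists n0 => // n /hn0 /=; rewrite sub0r normrN => h; rewrite distrC.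
have [_ b] := hphi n; apply: (le_trans (b x (Xp x T w) (Yp T w) (Y0 w))).
exact: le_trans (ler_norm _) h.
Qed.

Lemma linf_payoff dx X_0 z : 0 <= z -> linf (fun i => f (X_0 + i%:~R * dx, z)).
Proof.
move=> z0; have [_ [C [_ [c [_ _ _ _ fC]]]]] := hf; exists (C * (1 + z `^ c)) => i.
by rewrite -lee_fin; apply: le_trans (fC z z0); apply: ereal_sup_ubound; exists (X_0 + i%:~R * dx).
Qed.

(** The constants are chosen in the order [lam], [eps1], [A], [phi], step thresholds, each depending
    on the previous ones only. The same error function separates the payoff from [phi] twice: in the
    scheme, through supersolutions, and under the expectation. *)
Lemma hybrid_converges e : 0 < e -> exists2 eta : R, 0 < eta & forall (N : nat) (dx X_0 : R) (i : int),
  (0 < N)%N -> T / N%:R < eta -> 0 < dx < eta ->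
  let x0 := X_0 + i%:~R * dx in
  P.-integrable setT (EFin \o (fun w => f (Xp x0 T w, Yp T w))) /\
  `|(\int[P]_w f (Xp x0 T w, Yp T w)) - hybrid0 mdl T X_0 f N dx y i| <= e.
Proof.
move=> e0; have [_ a0 b0 s0 _] := hm.
have [lam1 lam10 lya] := lyapunov_supersolution hm T0 y0.
have s20 : 0 < volvol mdl ^+ 2 by rewrite exprn_gt0.
(* The Lyapunov supersolution needs the first bound, the exponential moment of [Y] the second. *)
pose lam := Num.min lam1 (2 * reversion mdl / volvol mdl ^+ 2).
have lam0 : 0 < lam by rewrite /lam lt_min lam10 divr_gt0// mulr_gt0.
have lam01 : 0 < lam <= lam1 by rewrite lam0 /lam ge_min lexx.
have laml : volvol mdl ^+ 2 * lam <= 2 * reversion mdl by rewrite mulrC -ler_pdivlMr// /lam ge_min lexx orbT.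
have [KL [h1 [h10 {}lya]]] := lya lam lam01.
have ilam := integrable_exp hm hF hWB T0 y0 hsol (ltW lam0) laml.
set J := \int[P]_w expR (lam * Yp T w).
have J0 : 0 <= J by apply: Rintegral_ge0 => w _; exact: expR_ge0.
(* [eps1] enters four times: as a constant on each side, times the Lyapunov bound [KL] in the
   scheme, and times the moment [J] under the expectation. *)
pose Q := 2 + `|KL| + J.
have Q0 : 0 <= Q by rewrite /Q; have := normr_ge0 KL; lra.
have e4 : 0 < e / 4 by rewrite divr_gt0.
have [eps1 eps10 heps1] := small_factor Q0 e4.
have [C1 C10 app] := payoff_approx hf hfu lam0 eps10.
have [K2 [h2 [K20 h20 tail]]] := tail_supersolution hm T0 y0.
have [e5 e50 he5] := small_factor C10 e4.
(* [A >= K2 / e5] makes the tail term [K2 / A] of the scheme at most [e5], the bound that [tl] gives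
   for the expectation. *)
have [A [A1 A2 tl]] := tail_limit hm hF hWB T0 y0 hsol (K2 / e5) e50.
have [phi tphi hphi] := app A A1.
have tspan_s s := tspan_scale s tphi.
have [h3 h30 sup3] := tspan_supersolution (tspan_s 1) e4.
have [h4 h40 sup4] := tspan_supersolution (tspan_s (- 1)) e4.
have [h0 h00 /andP[h01 /andP[h02 /andP[h03 h04]]]] : exists2 h0 : R, 0 < h0 & [&& h0 <= h1, h0 <= h2, h0 <= h3 & h0 <= h4].
  exists (Num.min (Num.min h1 h2) (Num.min h3 h4)); first by rewrite !lt_min h10 h20 h30.
  by rewrite !ge_min !lexx !orbT.
exists h0 => // N dx X_0 i N0 hN dx0h x0.
have /andP[dx0 dxh] := dx0h.
have hge0 : 0 <= T / N%:R by apply: divr_ge0 => //; exact: ltW.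
have [VL [sL fL bL]] := lya N dx N0 (lt_le_trans hN h01).
have A0 : 0 < A by exact: lt_le_trans A1.
have [VT [sT fT bT]] := tail A N dx X_0 x0 A1 N0 (lt_le_trans hN h02) dx0.
have iphi s := tspan_integrable x0 (tspan_s s).
have ibump : P.-integrable setT (EFin \o (fun w => bump ((Xp x0 T w - x0) / A))).
  apply: (@bounded_integrable _ _ _ P _ 1).
    apply: (measurableT_comp (continuous_measurable_fun continuous_bump)).
    by apply: measurable_funM => //; exact: measurable_funB.
  by move=> w; have /andP[b1 b2] := bump_itv ((Xp x0 T w - x0) / A); rewrite ger0_norm.
have ierr : P.-integrable setT (EFin \o (fun w => (eps1 + C1 * bump ((Xp x0 T w - x0) / A)) + eps1 * expR (lam * Yp T w))).
  apply: integrable_EFinD; last exact: integrable_EFinZl.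
  by apply: integrable_EFinD; [exact: finite_measure_integrable_cst|exact: integrable_EFinZl].
have if_ : P.-integrable setT (EFin \o (fun w => f (Xp x0 T w, Yp T w))).
  have i1 : P.-integrable setT (EFin \o (fun w => `|1 * phi x0 (Xp x0 T w) (Yp T w)| + ((eps1 + C1 * bump ((Xp x0 T w - x0) / A)) + eps1 * expR (lam * Yp T w)))).
    by apply: integrable_EFinD => //; exact: (integrable_abse (iphi 1)).
  apply: le_integrable i1 => //; first exact/measurable_EFinP/measurable_payoff.
  move=> w _; rewrite /= lee_fin; have := hphi x0 (Xp x0 T w) (Yp T w) (Y0 w).
  set p := phi _ _ _; set g := f _; set r := _ + eps1 * _ => h.
  rewrite mul1r (le_trans _ (ler_norm _))//.
  have -> : g = p - (p - g) by ring.
  by rewrite (le_trans (ler_normB _ _))// lerD2l.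
split=> //.
have EE : \int[P]_w ((eps1 + C1 * bump ((Xp x0 T w - x0) / A)) + eps1 * expR (lam * Yp T w)) <= eps1 + e / 4 + eps1 * J.
  rewrite RintegralD//; last 2 first.
  - by apply: integrable_EFinD; [exact: finite_measure_integrable_cst|exact: integrable_EFinZl].
  - exact: integrable_EFinZl.
  rewrite RintegralD//; last 2 first.
  - exact: finite_measure_integrable_cst.
  - exact: integrable_EFinZl.
  rewrite !RintegralZl// -/J (Rintegral_prob_cst P eps1) lerD2r lerD2l.
  by rewrite (le_trans _ he5)// ler_wpM2l.
have main s : s = 1 \/ s = - 1 ->
    s * hybrid0 mdl T X_0 f N dx y i <= s * (\int[P]_w f (Xp x0 T w, Yp T w)) + e.
  move=> hs.
  have [V [sV fV bV]] : exists V, [/\ supersolution mdl (T / N%:R) dx y N V,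
      forall k i', (k <= N)%N -> s * phi x0 (X_0 + i'%:~R * dx) (node mdl (T / N%:R) y N k) <= V N k i'
    & V 0 0 i <= (\int[P]_w (s * phi x0 (Xp x0 T w) (Yp T w))) + e / 4].
    case: hs => ->.
    - by apply: sup3 => //; [exact: lt_le_trans h03|rewrite dx0 (lt_le_trans dxh)].
    - by apply: sup4 => //; [exact: lt_le_trans h04|rewrite dx0 (lt_le_trans dxh)].
  have sabs z : s * z <= `|z| by case: hs => ->; rewrite ?mul1r ?mulN1r ?ler_norm// -normrN ler_norm.
  pose U n k j := V n k j + ((eps1 + C1 * VT n k j) + eps1 * VL n k j).
  have sU : supersolution mdl (T / N%:R) dx y N U.
    apply: supersolutionD => //; apply: supersolutionD; last by apply: supersolutionZ => //; exact: ltW.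
    by apply: supersolutionD; [exact: cst_supersolution|exact: supersolutionZ].
  have lf k : (k <= N)%N -> linf (fun i' => f (X_0 + i'%:~R * dx, node mdl (T / N%:R) y N k)).
    by move=> _; apply: linf_payoff; exact: node_ge0.
  have fU k i' : (k <= N)%N -> s * f (X_0 + i'%:~R * dx, node mdl (T / N%:R) y N k) <= U N k i'.
    move=> kN; rewrite /U fT// fL//.
    set X := X_0 + i'%:~R * dx; set eta := node _ _ _ _ _.
    have := hphi x0 X eta (node_ge0 _ _ _ _ _); rewrite distrC => h.
    have := sabs (f (X, eta) - phi x0 X eta); have := fV k i' kN; rewrite -/X -/eta.
    move: h; set z1 := `|_|; goal_lra.
  have := scaled_hybrid_le hge0 dx0 lf sU fU i (addn0 N) (leqnn 0).
  rewrite -[hybrid _ _ _ _ _ _ _ _ _ i]/(hybrid0 mdl T X_0 f N dx y i) => hU.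
  apply: (le_trans hU); rewrite /U bT subrr mul0r bump0 add0r.
  have t1 : \int[P]_w (s * phi x0 (Xp x0 T w) (Yp T w)) <= s * (\int[P]_w f (Xp x0 T w, Yp T w)) + (eps1 + e / 4 + eps1 * J).
    apply: (@le_trans _ _ (\int[P]_w (s * f (Xp x0 T w, Yp T w) + ((eps1 + C1 * bump ((Xp x0 T w - x0) / A)) + eps1 * expR (lam * Yp T w))))).
      apply: le_Rintegral => //; first by apply: integrable_EFinD => //; exact: integrable_EFinZl.
      move=> w _; have := hphi x0 (Xp x0 T w) (Yp T w) (Y0 w).
      by have := sabs (phi x0 (Xp x0 T w) (Yp T w) - f (Xp x0 T w, Yp T w)); set z1 := `|_|; goal_lra.
    rewrite RintegralD//; last exact: integrable_EFinZl.
    by rewrite RintegralZl// lerD2l.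
  have t2 : C1 * (K2 / A) <= e / 4.
    rewrite (le_trans _ he5)// ler_wpM2l// ler_pdivrMr// mulrC -ler_pdivrMr//.
  have t3 : eps1 * VL 0 0 i <= eps1 * `|KL|.
    by apply: ler_wpM2l; [exact: ltW|rewrite (le_trans (bL i))// ler_norm].
  move: heps1; rewrite /Q !mulrDl [_ * eps1]mulrC [J * _]mulrC; move: bV t1 t2 t3; goal_lra.
have := main 1 (or_introl erefl); have := main (- 1) (or_intror erefl).
by rewrite ler_norml !mul1r !mulN1r; goal_lra.
Qed.

End Glue.

Theorem theorem4p4 (R : realType) (m : heston R) (T X_0 : R)
    (hm : heston_admissible m) (hT : 0 < T)
    (d : measure_display) (Omega : measurableType d)
    (P : probability Omega R)
    (F : R -> set (set Omega)) (W B : R -> Omega -> R)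
    (hF : is_filtration F) (hWB : brownian2 P F W B)
    (X : R -> R -> R -> R -> Omega -> R) (Y : R -> R -> R -> Omega -> R)
    (hXY : forall t x y : R, 0 <= t <= T -> 0 <= y ->
       heston_solution P m F W B T t x y (X t x y) (Y t y))
    (f : R * R -> R) (hf : C_inf0_pol f)
    (hfu : forall M : R, 0 < M ->
       unif_continuous_on f [set p : R * R | 0 <= p.2 <= M])
    (u : R -> R -> R -> \bar R)
    (hu : forall t x y : R, 0 <= t <= T -> 0 <= y ->
       u t x y = 'E_P[fun w => f (X t x y T w, Y t y T w)]%E) :
  forall y : R, 0 <= y ->
  forall e : R, 0 < e -> exists2 eta : R, 0 < eta &
    forall (N : nat) (dx : R),
      (0 < N)%N -> T / N%:R < eta -> 0 < dx < eta ->
      (ereal_sup [set `|u 0%R (X_0 + i%:~R * dx)%R y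
                        - (hybrid0 m T X_0 f N dx y i)%:E| | i in [set: int]]
       < e%:E)%E.
Proof.
move=> y y0 e e0.
have hsol x : heston_solution P m F W B T 0 x y (X 0 x y) (Y 0 y) by apply: hXY => //; rewrite lexx ltW.
have e2 : 0 < e / 2 by rewrite divr_gt0.
have [eta eta0 heta] := hybrid_converges hm hF hWB hT y0 hsol hf hfu e2.
exists eta => // N dx N0 hN dx0.
(* The supremum over the grid preserves only weak inequalities, hence the estimate with [e / 2]. *)
apply: (@le_lt_trans _ _ (e / 2)%:E); last by rewrite lte_fin; lra.
apply: ge_ereal_sup => _ [i _ <-].
have [if_ hi] := heta N dx X_0 i N0 hN dx0.
have T00 : 0 <= (0 : R) <= T by rewrite lexx ltW.
rewrite (hu _ _ _ T00 y0) unlock.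
by rewrite EFin_Rintegral// -EFinB abse_EFin lee_fin.
Qed.
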